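(* Let $S$ be a union of finitely many points and non-intersecting smooth curve segments in $\mathbb P^1\setminus\{0\}$. Let $\phi\in C^\infty(\mathbb P^1)$ be a Kähler potential (i.e. $\omega+dd^c\phi>0$, where $\omega$ is the Fubini-Study form) and suppose that the Hele-Shaw flow for $\omega+dd^c\phi$ develops tangency along $S$. Then the weak solution $$\Phi := \sup\left\{\psi:\mathbb P^1\times\overline{\mathbb D}\to\mathbb R\cup\{-\infty\}\ :\ \psi\text{ is usc},\ \pi_{\mathbb P^1}^*\omega+dd^c\psi\ge 0,\ \psi(z,\tau)\le\phi(\tau z)\text{ for }(z,\tau)\in\mathbb P^1\times\partial\mathbb D\right\}$$ to the Dirichlet problem for the homogeneous complex Monge-Ampère equation on $\mathbb P^1\times\overline{\mathbb D}$ with boundary data $(z,\tau)\mapsto\phi(\tau z)$ is not twice differentiable at the points $(\tau^{-1}z,\tau)$ with $z\in S$, $|\tau|=1$.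
   Context: $\mathbb D\subset\mathbb C$ is the open unit disc. Fix a point $0\in\mathbb P^1$ and a chart $0\in\mathbb C\subset\mathbb P^1$ with coordinate $z$; $\tau z$ denotes multiplication by $\tau$ extended to $\mathbb P^1$ (fixing $\infty$). $dd^c$ is normalized so that $dd^c\log|z|^2=\delta_0$ in one variable, i.e. $dd^c=\frac{i}{2\pi}\partial\overline\partial$, and $\omega=\omega_{FS}$ equals $dd^c\log(1+|z|^2)$ on $\mathbb C$, so that $\mathbb P^1$ has area $1$. $\pi_{\mathbb P^1}:\mathbb P^1\times\overline{\mathbb D}\to\mathbb P^1$ is the projection. Hele-Shaw flow: a function $\psi:\mathbb P^1\to\mathbb R\cup\{-\infty\}$ is $\omega$-psh if $\psi+u$ is (pluri)subharmonic whenever locally $dd^cu=\omega$. The Lelong number at $0$ is $\nu_0(\psi)=\sup\{t:\psi\le t\ln|z|^2+O(1)\text{ near }z=0\}$. For $t\in(0,1)$ put $\psi_t:=\sup\{\psi:\psi\ \omega\text{-psh},\ \psi\le\phi,\ \nu_0(\psi)\ge t\}$ and $\Omega_t:=\{z\in\mathbb P^1:\psi_t(z)<\phi(z)\}$. The family $\{\Omega_t\}_{t\in(0,1)}$ is the Hele-Shaw flow for $\omega+dd^c\phi$. The Hele-Shaw flow for $\omega+dd^c\phi$ develops tangency along $S$ if there exists $T\in(0,1)$ such that (1) $\Omega_t$ is smoothly bounded, simply connected and varies smoothly for $t<T$ (locally $\partial\Omega_t$ is the graph of a smooth function varying smoothly with $t$), and (2) $\Omega_T$ is simply connected and $\partial\Omega_T$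 is the image of a smooth locally embedded curve intersecting itself tangentially precisely along $S$. *)

(* Defs.v *)
From HB Require Import structures.
From mathcomp Require Import all_boot all_order all_algebra.
From mathcomp Require Import complex.
From mathcomp Require Import all_classical all_reals all_analysis.

Set Implicit Arguments.
Unset Strict Implicit.
Unset Printing Implicit Defensive.

Import Order.TTheory GRing.Theory Num.Theory.
Import numFieldNormedType.Exports.

Local Open Scope classical_set_scope.
Local Open Scope ring_scope.

(** * Calculus *)

(* [U] is meant to be open: all derivatives are two-sided. *)
Fixpoint Ck_on (R : realType) (V W : normedModType R) (k : nat) (U : set V)
    (f : V -> W) : Prop :=
  if k is k'.+1 then
    (forall x, U x -> differentiable f x) /\
    (forall v, Ck_on k' U (fun x => 'D_v f x))
  else forall x, U x -> {for x, continuous f}.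

Definition smooth_on (R : realType) (V W : normedModType R) (U : set V)
  (f : V -> W) : Prop := forall k, Ck_on k U f.

Definition has_diff_within (R : realType) (V : normedModType R) (D : set V)
    (f : V -> R) (x : V) (L : {linear V -> R}) : Prop :=
  forall e : R, 0 < e ->
    \forall y \near x, D y -> `|f y - f x - L (y - x)| <= e * `|y - x|.

(* Twice differentiability at [x] relative to [D]: the differential [df] exists
   at all points of [D] near [x] and is itself differentiable at [x].  The
   latter is tested on each vector [v], which is enough in finite dimension.
   Below, [D] is a product with a closed disc, where differentials at points of
   [D] are unique, and [x] is a boundary point of [D]. *)
Definition twice_differentiable_within (R : realType) (V : normedModType R)
    (D : set V) (f : V -> R) (x : V) : Prop :=
  exists df : V -> {linear V -> R},
    (\forall y \near x, D y -> has_diff_within D f y (df y)) /\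
    (forall v, exists L, has_diff_within D (fun y => df y v) x L).

(** * Topology *)

Definition bd (T : topologicalType) (A : set T) : set T :=
  closure A `\` interior A.

Definition simply_connected (R : realType) (T : topologicalType) (A : set T) :
    Prop :=
  (forall x y, A x -> A y -> exists g : R -> T,
     [/\ {within `[0, 1]%classic, continuous g}, g 0 = x, g 1 = y &
         forall s, 0 <= s <= 1 -> A (g s)]) /\
  (forall g : R -> T, {within `[0, 1]%classic, continuous g} -> g 0 = g 1 ->
     (forall s, 0 <= s <= 1 -> A (g s)) ->
     exists H : R * R -> T,
       [/\ {within `[0, 1]%classic `*` `[0, 1]%classic, continuous H},
           forall s r, 0 <= s <= 1 -> 0 <= r <= 1 -> A (H (s, r)),
           forall s, 0 <= s <= 1 -> H (s, 0) = g s,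
           forall r, 0 <= r <= 1 -> H (0, r) = g 0 /\ H (1, r) = g 0 &
           forall s, 0 <= s <= 1 -> H (s, 1) = g 0]).

(** * The complex plane and the projective line *)

(* The complex numbers as a normed space over [R], so that differentiability
   means real differentiability; complex arithmetic is that of [R[i]]. *)
Notation plane R := (R * R)%type.

Definition toC (R : realType) (x : plane R) : R[i] := Complex x.1 x.2.
Definition ofC (R : realType) (c : R[i]) : plane R :=
  (complex.Re c, complex.Im c).
Definition cmul (R : realType) (x y : plane R) : plane R :=
  ofC (toC x * toC y).
Definition cinv (R : realType) (x : plane R) : plane R := ofC (toC x)^-1.

(* The squared modulus (the library norm on [R * R] is the sup norm). *)
Definition sqmod (R : realType) (x : plane R) : R := x.1 ^+ 2 + x.2 ^+ 2.

(* [None] is the point at infinity. *)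
Notation P1 R := (one_point_compactification (plane R)).

(* The two affine charts: z |-> z, and w |-> 1 / w. *)
Definition chart (R : realType) (c : bool) (x : plane R) : P1 R :=
  if c then Some x else if x == 0 then None else Some (cinv x).

Definition P1zero (R : realType) : P1 R := Some (0 : plane R).

(* [P1mul tau z] is [tau z], for [tau != 0]. *)
Definition P1mul (R : realType) (tau : plane R) (z : P1 R) : P1 R :=
  if z is Some x then Some (cmul tau x) else None.

Definition smooth_P1 (R : realType) (f : P1 R -> R) : Prop :=
  forall c, smooth_on [set: plane R] (fun x => f (chart c x)).

(** * Plurisubharmonic functions *)

(* For [V] a complex vector space in which [rot theta v] is [exp(i theta) v],
   and [U] open in [V]: [f] is upper semicontinuous with values in
   [-oo, +oo[ and satisfies the sub-mean value inequality on every disc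
   contained in [U] of every complex line.  The function -oo is allowed. *)
Definition psh_on (R : realType) (V : normedModType R) (rot : R -> V -> V)
    (U : set V) (f : V -> \bar R) : Prop :=
  [/\ forall x, U x -> (f x < +oo)%E,
      forall x r, U x -> (f x < r%:E)%E -> \forall y \near x, (f y < r%:E)%E &
      forall a b,
        (forall s theta : R, 0 <= s <= 1 -> U (a + s *: rot theta b)) ->
        (f a <= ((2 * pi)^-1)%:E *
           \int[@lebesgue_measure R]_(theta in `[0%R, (2 * pi)%R]%classic)
             f (a + rot theta b)%R)%E].

Definition rot1 (R : realType) (theta : R) (x : plane R) : plane R :=
  cmul (cos theta, sin theta) x.

Definition rot2 (R : realType) (theta : R) (p : plane R * plane R) :
  plane R * plane R := (rot1 theta p.1, rot1 theta p.2).

(* Density of dd^c u = (i / 2 pi) ddbar u with respect to dx /\ dy: since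
   ddbar u = (1/4) (Laplacian u) dz /\ dzbar and dz /\ dzbar = -2i dx /\ dy, it
   is (Laplacian u) / (4 pi). *)
Definition ddc (R : realType) (u : plane R -> R) (x : plane R) : R :=
  let d (v : plane R) (f : plane R -> R) := fun y => 'D_v f y in
  (d (1, 0) (d (1, 0) u) x + d (0, 1) (d (0, 1) u) x) / (4 * pi).

(* Density of the Fubini-Study form in the chart z.  It has the same expression
   in the chart w = 1/z, because log(1 + |z|^2) = log(1 + |w|^2) - log|w|^2. *)
Definition omegaFS (R : realType) : plane R -> R :=
  ddc (fun x => ln (1 + sqmod x)).

Definition FS_potential (R : realType) (U : set (plane R)) (u : plane R -> R) :
  Prop := smooth_on U u /\ (forall x, U x -> ddc u x = omegaFS x).

Definition omega_psh (R : realType) (psi : P1 R -> \bar R) : Prop :=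
  (forall z, (psi z < +oo)%E) /\
  (forall c U u, open U -> FS_potential U u ->
     psh_on (@rot1 R) U (fun x => psi (chart c x) + (u x)%:E)%E).

Definition kahler_potential (R : realType) (phi : P1 R -> R) : Prop :=
  smooth_P1 phi /\
  (forall c x, 0 < omegaFS x + ddc (fun y => phi (chart c y)) x).

(** * The Hele-Shaw flow *)

(* [lne 0 = -oo]. *)
Definition lelong0 (R : realType) (psi : P1 R -> \bar R) : \bar R :=
  ereal_sup [set t%:E | t in [set t : R | exists C : R,
    \forall x \near (0 : plane R),
      (psi (chart true x) <= t%:E * lne (sqmod x)%:E + C%:E)%E]].

Definition HS_envelope (R : realType) (phi : P1 R -> R) (t : R) (z : P1 R) :
    \bar R :=
  ereal_sup [set psi z | psi in [set psi : P1 R -> \bar R |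
    [/\ omega_psh psi, forall y, (psi y <= (phi y)%:E)%E &
        (t%:E <= lelong0 psi)%E]]].

Definition HS_flow (R : realType) (phi : P1 R -> R) (t : R) : set (P1 R) :=
  [set z | (HS_envelope phi t z < (phi z)%:E)%E].

(** * Smoothly bounded domains and curves *)

(* Coordinates centred at [chart c a], rotated by the unit complex number [e]. *)
Definition frame (R : realType) (c : bool) (a e : plane R) (x : plane R) :
  P1 R := chart c (a + cmul e x).

(* Locally, [A] is the region below the graph of a smooth function. *)
Definition smoothly_bounded (R : realType) (A : set (P1 R)) : Prop :=
  forall p, bd A p ->
  exists c a e (r rho : R) (g : R -> R),
    [/\ chart c a = p, sqmod e = 1, 0 < r, 0 < rho &
        smooth_on [set x | `|x| < r] g /\
        forall x y, `|x| < r -> `|y| < rho ->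
          (bd A (frame c a e (x, y)) <-> y = g x) /\
          (A (frame c a e (x, y)) <-> y < g x)].

Definition varies_smoothly (R : realType) (A : R -> set (P1 R)) (T : R) : Prop :=
  forall t0 p, 0 < t0 < T -> bd (A t0) p ->
  exists c a e (r rho eps : R) (g : R * R -> R),
    [/\ chart c a = p, sqmod e = 1, 0 < r, 0 < rho & 0 < eps] /\
    smooth_on [set q | `|q.1| < r /\ `|q.2 - t0| < eps] g /\
    (forall x y t, `|x| < r -> `|y| < rho -> `|t - t0| < eps ->
       (bd (A t) (frame c a e (x, y)) <-> y = g (x, t))).

(* [g] expresses the curve [gam] near the parameter [s] in the chart [c]. *)
Definition smooth_lift (R : realType) (gam : R -> P1 R) (s : R) (c : bool)
    (g : R -> plane R) : Prop :=
  exists2 r : R, 0 < r &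
    smooth_on [set x | `|x - s| < r] g /\
    (forall x, `|x - s| < r -> chart c (g x) = gam x).

Definition immersed_at (R : realType) (gam : R -> P1 R) (s : R) : Prop :=
  exists c g, smooth_lift gam s c g /\ derive1 g s != 0.

(* [gam] is a closed curve of period 1; an immersion of the circle is locally
   an embedding.  [S] is exactly the set of multiple points of [gam], and any
   two branches through such a point have parallel tangents. *)
Definition self_tangent_curve (R : realType) (gam : R -> P1 R)
    (S : set (P1 R)) : Prop :=
  let distinct s s' := forall k : int, s - s' <> k%:~R in
  [/\ forall s, gam (s + 1) = gam s,
      forall s, immersed_at gam s,
      forall p, S p <->
        exists s s', [/\ distinct s s', gam s = p & gam s' = p] &
      forall s s', distinct s s' -> gam s = gam s' ->
        forall c g g', smooth_lift gam s c g -> smooth_lift gam s' c g' ->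
          exists k : R, derive1 g' s' = k *: derive1 g s].

Definition develops_tangency (R : realType) (phi : P1 R -> R)
    (S : set (P1 R)) : Prop :=
  exists2 T : R, 0 < T < 1 &
    [/\ forall t, 0 < t < T ->
          smoothly_bounded (HS_flow phi t) /\
          simply_connected R (HS_flow phi t),
        varies_smoothly (HS_flow phi) T,
        simply_connected R (HS_flow phi T) &
        exists2 gam : R -> P1 R,
          range gam = bd (HS_flow phi T) & self_tangent_curve gam S].

(* Finitely many points together with finitely many pairwise disjoint, closed,
   embedded smooth arcs. *)
Definition points_and_segments (R : realType) (S : set (P1 R)) : Prop :=
  exists (F : set (P1 R)) (m : nat) (sigma : 'I_m -> R -> P1 R),
    [/\ finite_set F,
        forall i s, 0 <= s <= 1 -> immersed_at (sigma i) s,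
        forall i j s s', 0 <= s <= 1 -> 0 <= s' <= 1 ->
          sigma i s = sigma j s' -> i = j /\ s = s' &
        S = F `|` \bigcup_i (sigma i @` `[0, 1]%classic)].

(** * The Dirichlet problem *)

(* For functions on P^1 x closed disc; values outside are irrelevant.
   pi^* omega + dd^c psi >= 0 is a condition on the interior P^1 x disc, where
   it means that psi + u is plurisubharmonic for local potentials u of omega. *)
Definition HMAE_candidate (R : realType) (phi : P1 R -> R)
    (psi : P1 R * plane R -> \bar R) : Prop :=
  [/\ forall z tau, sqmod tau <= 1 -> (psi (z, tau) < +oo)%E,
      forall p r, sqmod p.2 <= 1 -> (psi p < r%:E)%E ->
        \forall q \near p, sqmod q.2 <= 1 -> (psi q < r%:E)%E,
      forall c U u, open U -> FS_potential U u ->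
        psh_on (@rot2 R) [set p | U p.1 /\ sqmod p.2 < 1]
          (fun p => psi (chart c p.1, p.2) + (u p.1)%:E)%E &
      forall z tau, sqmod tau = 1 ->
        (psi (z, tau) <= (phi (P1mul tau z))%:E)%E].

Definition weak_solution (R : realType) (phi : P1 R -> R)
    (p : P1 R * plane R) : \bar R :=
  ereal_sup [set psi p | psi in HMAE_candidate phi].

(* Twice differentiability, relative to P^1 x closed disc, of a function on
   that manifold with boundary, read in an affine chart of P^1 around [z]. *)
Definition twice_differentiable_at (R : realType)
    (Phi : P1 R * plane R -> \bar R) (z : P1 R) (tau : plane R) : Prop :=
  exists c a (F : plane R * plane R -> R),
    let D := [set p : plane R * plane R | sqmod p.2 <= 1] in
    [/\ chart c a = z,
        \forall p \near (a, tau), D p -> Phi (chart c p.1, p.2) = (F p)%:E &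
        twice_differentiable_within D F (a, tau)].

(* Main.v *)
(* In the coordinate 1 / z, where the point 0 is at infinity, the weak solution
   along the orbit tau |-> (tau^-1 z, tau) is, by the minimum principle for
   subharmonic functions invariant under rotations (Kiselev), the Legendre
   transform in t of the Hele-Shaw envelopes psi_t at z.  If it is twice
   differentiable at the points over p, then near p the largest t for which
   psi_t = phi agrees with a function D that is differentiable at p.

   Let p be a double point of the boundary of Omega_T.  Two branches of the
   boundary through p are tangent, so each is the graph of a function of size
   O(x^2) in suitable coordinates, and D = T on it forces the differential of D
   at p to be vertical.  Choose the vertical direction in which it is
   nonnegative.  A comparison with the explicit harmonic function
   y + 2 K (x^2 - y^2) above the graph gives psi_T >= psi_t - O((T - t) eps) on
   a circle of radius eps / 2 around (0, eps), and psi_t = phi there already for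
   T - t an arbitrarily small multiple of eps.  Since phi is strictly
   subharmonic, psi_T = phi at (0, eps): there is no fluid on that side of p.

   It remains to see that fluid occurs on both sides of a double point.  Between
   two tangent contact graphs there is no fluid, because the gap phi - psi_T
   would vanish there to a higher order than strict subharmonicity of phi
   allows.  Hence a double point with fluid on one side only, or a triple point,
   has such points on every vertical line near it.  Such points would therefore
   be continued beyond the end of the arc of S on which they lie. *)

Require Import Defs.
From HB Require Import structures.
From mathcomp Require Import all_boot all_order all_algebra.
From mathcomp Require Import complex.
From mathcomp Require Import all_classical all_reals all_analysis.
From mathcomp Require Import measurable_realfun ring lra zify.

Set Implicit Arguments.
Unset Strict Implicit.
Unset Printing Implicit Defensive.

Import Order.TTheory GRing.Theory Num.Theory.
Import numFieldNormedType.Exports.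
Local Open Scope classical_set_scope.
Local Open Scope ring_scope.

(** Integral means, by which [psh_on] is defined, behave badly under the operations needed here:
    suprema of families, gluing, holomorphic substitution and partial infima. All of them are
    carried out with the viscosity notion [touched], for which the maximum principle costs one
    perturbation by [e |x|^2]. Averaging a test function over a small circle leads from means to
    test functions. The way back solves the Dirichlet problem on the disc approximately, with Fejer
    kernels at equidistant nodes; the same kernels later interpolate radii in Kiselev's principle.

    Every stage of the flow contains [z = 0], so its boundary lies in the chart [w = 1/z]. There a
    Lelong number [t] at [z = 0] becomes growth [(1 - t) ln |w|^2] at infinity.

    On the orbit of [w] the term [hs t w + (1 - t) ln |tau|^2] decreases like [2 (1 - t) s] when
    [|tau| = 1 - s]. A slope [d] of the solution at the boundary circle therefore corresponds to the
    contact time [1 + d / 2]. This is the function [D], and so a second derivative of the solution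
    enters as a first derivative of [D]. *)

Section PlaneAlgebra.
Variable R : realType.
Implicit Types x y z h : plane R.

Lemma cmulE x y : cmul x y = (x.1*y.1-x.2*y.2, x.1*y.2+x.2*y.1).
Proof. by case: x y => [a b] [c d]. Qed.

Lemma cinvE x : cinv x = (x.1/sqmod x, - x.2/sqmod x).
Proof. by case: x => [a b]; rewrite /cinv /toC /ofC /sqmod /= mulNr. Qed.

Lemma sqmodM x y : sqmod (cmul x y) = sqmod x * sqmod y.
Proof. by rewrite cmulE /sqmod /=; ring. Qed.

Lemma sqmod_ge0 x : 0 <= sqmod x.
Proof. by rewrite addr_ge0 // sqr_ge0. Qed.

Lemma sqmod_eq0 x : (sqmod x == 0) = (x == 0).
Proof.
rewrite /sqmod paddr_eq0 ?sqr_ge0// !sqrf_eq0.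
by case: x => a b /=; apply/idP/idP => [/andP[/eqP-> /eqP->]//|/eqP[-> ->]]; rewrite !eqxx.
Qed.

Lemma sqmod_gt0 x : (0 < sqmod x) = (x != 0).
Proof. by rewrite lt_neqAle sqmod_ge0 andbT eq_sym sqmod_eq0. Qed.

Lemma sqmod0 : sqmod (0 : plane R) = 0.
Proof. by rewrite /sqmod /= expr0n addr0. Qed.

Lemma sqmodN x : sqmod (- x) = sqmod x.
Proof. by rewrite /sqmod /= !sqrrN. Qed.

Lemma sqmodD_le x y : sqmod (x + y) <= 2 * sqmod x + 2 * sqmod y.
Proof.
case: x y => [a b] [c d]; rewrite /sqmod /=.
have := sqr_ge0 (a - c); have := sqr_ge0 (b - d); nra.
Qed.

Lemma sqmod_le_norm x : sqmod x <= 2 * `|x| ^+ 2.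
Proof.
rewrite /sqmod prod_normE.
have h1 : `|x.1| <= Num.max `|x.1| `|x.2| by rewrite le_max lexx.
have h2 : `|x.2| <= Num.max `|x.1| `|x.2| by rewrite le_max lexx orbT.
rewrite -(real_normK (num_real x.1)) -(real_normK (num_real x.2)).
have := normr_ge0 x.1; have := normr_ge0 x.2; nra.
Qed.

Lemma norm_le_sqmod x : `|x| ^+ 2 <= sqmod x.
Proof.
rewrite /sqmod prod_normE.
rewrite -(real_normK (num_real x.1)) -(real_normK (num_real x.2)).
have := normr_ge0 x.1; have := normr_ge0 x.2.
by rewrite /Num.max; case: ifP => _; nra.
Qed.

Lemma near_sqmod (x0 : plane R) (Q : plane R -> Prop) :
  (\forall y \near x0, Q y) <->
  exists2 r : R, 0 < r & forall h, sqmod h < r -> Q (x0 + h).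
Proof.
split.
  move=> /nbhs_normP[r /= r0 rQ]; exists (r ^+ 2); first by rewrite exprn_gt0.
  move=> h hr; apply: rQ => /=; rewrite opprD addNKr normrN.
  have := norm_le_sqmod h => /le_lt_trans/(_ hr).
  by rewrite ltr_pXn2r ?nnegrE// ltW.
move=> [r r0 rQ]; apply/nbhs_normP; exists (Num.min 1 (r / 2)) => /=.
  by rewrite lt_min ltr01/= divr_gt0.
move=> y /= yr; have -> : y = x0 + (y - x0) by rewrite addrC subrK.
apply: rQ; rewrite -sqmodN opprB.
move: yr; rewrite lt_min => /andP[h1 h2].
apply: (le_lt_trans (sqmod_le_norm _)).
have := normr_ge0 (x0 - y); nra.
Qed.

Lemma near0_sqmod (Q : plane R -> Prop) :
  (\forall y \near (0 : plane R), Q y) <->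
  exists2 r : R, 0 < r & forall h, sqmod h < r -> Q h.
Proof.
split => [/near_sqmod|] [r r0 rQ].
  by exists r => // h /rQ; rewrite add0r.
by apply/near_sqmod; exists r => // h /rQ; rewrite add0r.
Qed.

Lemma nearD0 (x0 : plane R) (Q : plane R -> Prop) :
  (\forall y \near x0, Q y) <-> (\forall h \near (0 : plane R), Q (x0 + h)).
Proof. by split => [/near_sqmod|/near0_sqmod] H; [apply/near0_sqmod|apply/near_sqmod]. Qed.

Lemma continuous_sqmod : continuous (@sqmod R).
Proof.
move=> x; apply: (@continuousD _ _ _ (fun x : plane R => x.1 ^+ 2) (fun x => x.2 ^+ 2)).
  by apply: continuousM; exact: cvg_fst.
by apply: continuousM; exact: cvg_snd.
Qed.

End PlaneAlgebra.

(** * Subharmonicity by test functions *)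

Section Usc.
Variable R : realType.

Definition usc_in (T : topologicalType) (K : set T) (F : T -> \bar R) :=
  forall x, K x -> forall r : R, (F x < r%:E)%E ->
    \forall y \near x, K y -> (F y < r%:E)%E.

Lemma ereal_between (x : \bar R) (r : R) : (x < r%:E)%E ->
  exists2 r' : R, (x < r'%:E)%E & r' < r.
Proof.
case: x => [x||] //.
  by rewrite lte_fin => xr; exists ((x + r) / 2); rewrite ?lte_fin; lra.
by move=> _; exists (r - 1); rewrite ?ltNyr//; lra.
Qed.

Lemma ereal_between2 (x y : \bar R) : (x < y)%E ->
  exists2 r : R, (x < r%:E)%E & (r%:E <= y)%E.
Proof.
case: y => [y||].
- by move=> /ereal_between[r' h1 h2]; exists r' => //; rewrite lee_fin ltW.
- case: x => [x||] // _; first by exists (x + 1); rewrite ?leey// lte_fin; lra.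
  by exists 0; rewrite ?ltNyr ?leey.
- by case: x.
Qed.

(** If no value were maximal, every point of [K] would lie strictly below some value taken on [K].
    Compactness, with the superlevel sets [F i >= F y] as index filter, would then give a value
    strictly above all values on [K], itself included. *)
Lemma usc_EVT (T : topologicalType) (K : set T) (F : T -> \bar R) :
  compact K -> K !=set0 -> usc_in K F ->
  exists2 x, K x & forall y, K y -> (F y <= F x)%E.
Proof.
move=> cK [k0 Kk0] uF; apply: contrapT => nmax.
have step x : K x -> exists2 y, K y & (F x < F y)%E.
  move=> Kx; apply: contrapT => ny; apply: nmax; exists x => // y Ky.
  by rewrite leNgt; apply/negP => xy; apply: ny; exists y.
pose G := filter_from K (fun y => [set i | K i /\ (F y <= F i)%E]).
have FG : Filter G.
  apply: filter_from_filter; first by exists k0.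
  move=> i j Ki Kj; have [ij|/ltW ji] := leP (F i) (F j).
    by exists j => // z [Kz jz]; split; split => //; exact: le_trans jz.
  by exists i => // z [Kz iz]; split; split => //; exact: le_trans iz.
have /compact_near_coveringP/(_ _ G (fun i x => K x -> (F x < F i)%E) FG) := cK.
case=> [x Kx|y Ky yP].
  have [y Ky /ereal_between2[r xr ry]] := step x Kx.
  exists ([set z | K z -> (F z < r%:E)%E], [set i | K i /\ (F y <= F i)%E]).
    by split; [exact: uF|exists y].
  move=> [z i] /= [zr [Ki yi]] Kz.
  by apply: lt_le_trans (zr Kz) _; exact: le_trans ry yi.
by have := yP y (conj Ky (lexx _)) y Ky Ky; rewrite ltxx.
Qed.

Lemma usc_addr (T : topologicalType) (K : set T) (F : T -> \bar R) (g : T -> R) :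
  usc_in K F -> {in K, continuous g} -> usc_in K (fun x => F x + (g x)%:E)%E.
Proof.
move=> uF cg x Kx r; rewrite -lteBrDr// => /ereal_between[s Fs sr].
have := uF x Kx s Fs.
have e0 : 0 < r - g x - s by lra.
have := cg x (mem_set Kx) => /cvgrPdist_lt/(_ _ e0) gx.
apply: filterS2 gx => y gy Fy Ky; rewrite -lteBrDr//.
apply: lt_trans (Fy Ky) _; rewrite lte_fin.
by move: gy; rewrite ltr_distl => /andP[]; lra.
Qed.

End Usc.

Section Touching.
Variable R : realType.
Implicit Types (x y h : plane R) (F : plane R -> \bar R).

(* The real parts of the complex polynomials [A h + B h^2]. *)
Definition hquad (c : plane R * plane R) (h : plane R) : R :=
  c.1.1 * h.1 + c.1.2 * h.2 + c.2.1 * (h.1 ^+ 2 - h.2 ^+ 2) + c.2.2 * (h.1 * h.2).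

(* A strictly superharmonic quadratic function touches [F] from above at [x];
   "no touching" is subharmonicity in the viscosity sense. *)
Definition touched F x := exists (r : R) c e,
  [/\ F x = r%:E, 0 < e &
      \forall h \near (0 : plane R), (F (x + h)%R <= (r + hquad c h - e * sqmod h)%:E)%E].

Lemma hquad0 c : hquad c 0 = 0.
Proof. by rewrite /hquad /=; ring. Qed.

Lemma continuous_hquad c : continuous (hquad c).
Proof.
move=> x.
have c1 : (fun x : plane R => x.1) @ x --> x.1 by exact: cvg_fst.
have c2 : (fun x : plane R => x.2) @ x --> x.2 by exact: cvg_snd.
apply: cvgD; last by apply: cvgM; [exact: cvg_cst|exact: cvgM].
apply: cvgD; last by apply: cvgM; [exact: cvg_cst|apply: cvgB; exact: cvgM].
by apply: cvgD; apply: cvgM => //; exact: cvg_cst.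
Qed.

(** Adding a small multiple of [|x|^2] turns an interior maximum into a point where an affine
    function minus [e |h|^2] touches [F] from above. *)
Lemma max_principle (K U : set (plane R)) F (c : R) :
  compact K -> open U -> U `<=` K -> usc_in K F ->
  (forall x, K x -> (F x < +oo)%E) ->
  (forall x, U x -> ~ touched F x) ->
  (forall x, K x -> ~ U x -> (F x <= c%:E)%E) ->
  forall x, K x -> (F x <= c%:E)%E.
Proof.
move=> cK oU UK uF Ffin nt bd x1 Kx1; rewrite leNgt; apply/negP => cx1.
have [B B0 KB] : exists2 B, 0 < B & forall x, K x -> sqmod x <= B.
  have [|x Kx xB] := @compact_EVT_max _ _ (@sqmod R) K (ex_intro _ x1 Kx1) cK.
    by apply: continuous_subspaceT => y; exact: continuous_sqmod.
  exists (1 + sqmod x); first by have := sqmod_ge0 x; lra.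
  by move=> y Ky; have := xB y (mem_set Ky); lra.
have [v cv Fv] : exists2 v, c < v & (v%:E <= F x1)%E.
  have [v h1 h2] := ereal_between2 cx1.
  by exists v; rewrite -?lte_fin.
(* On [K] the perturbation is then at most [(v - c) / 2], half of the assumed excess over [c], so
   the maximum cannot lie off [U]. *)
pose e := (v - c) / (2 * B).
have e0 : 0 < e by rewrite divr_gt0// ?subr_gt0// mulr_gt0.
pose G x := (F x + (e * sqmod x)%:E)%E.
have uG : usc_in K G.
  apply: usc_addr => // x _.
  by apply: cvgM; [exact: cvg_cst|exact: continuous_sqmod].
have [x0 Kx0 mx0] := usc_EVT cK (ex_intro _ x1 Kx1) uG.
have vG : (v%:E <= G x0)%E.
  apply: le_trans (mx0 _ Kx1); rewrite /G.
  rewrite -[leLHS]adde0; apply: leeD => //; rewrite lee_fin.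
  by rewrite mulr_ge0 ?sqmod_ge0// ltW.
have Ux0 : U x0.
  apply: contrapT => nU; have := bd _ Kx0 nU => Fc.
  have : (v%:E <= c%:E + (e * B)%:E)%E.
    apply: le_trans vG _; apply: leeD => //; rewrite lee_fin.
    by rewrite ler_pM2l// KB.
  rewrite -EFinD lee_fin /e.
  have -> : (v - c) / (2 * B) * B = (v - c) / 2 by field; rewrite gt_eqF.
  lra.
have [r0 Fr0] : exists r0, F x0 = r0%:E.
  have := Ffin _ Kx0; move: vG; rewrite /G.
  by case: (F x0) => [r||] //; exists r.
apply: (nt _ Ux0); exists r0, ((- 2 * e * x0.1, - 2 * e * x0.2), (0, 0)), e; split => //.
have : \forall y \near x0, U y by exact: open_nbhs_nbhs.
move=> /nearD0; apply: filterS => h /UK /mx0; rewrite /G Fr0.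
rewrite -EFinD -leeBrDr// -EFinB => /le_trans; apply.
rewrite lee_fin /hquad /sqmod /=; lra.
Qed.

(** The remainder of [k] beyond its harmonic quadratic part is absorbed by half of the strictness
    [e] of the test function. *)
Lemma touched_addharm F x (k : plane R -> R) c :
  (forall e, 0 < e -> \forall h \near (0 : plane R),
     `|k (x + h) - k x - hquad c h| <= e * sqmod h) ->
  touched (fun y => F y + (k y)%:E)%E x -> touched F x.
Proof.
move=> kc [r [d [e [Fr e0 He]]]].
have [s Fs] : exists s, F x = s%:E.
  by move: Fr; case: (F x) => [s||] //; exists s.
exists s, (d - c), (e / 2); split => //; first by rewrite divr_gt0.
have := kc _ (divr_gt0 e0 (ltr0Sn _ 1)); apply: filterS2 He => h.
rewrite -leeBrDr// => /le_trans Hh kh; apply: Hh; rewrite -EFinB lee_fin.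
move: Fr; rewrite Fs -EFinD => -[<-].
move: kh; rewrite ler_norml => /andP[h1 h2].
rewrite /hquad /=; move: h1 h2; rewrite /hquad; lra.
Qed.

End Touching.

(** * Euclidean norm and second-order holomorphic jets *)

Section ComplexNorm.
Variable R : realType.
Implicit Types x y z h : plane R.

Lemma plane_eq x y : x.1 = y.1 -> x.2 = y.2 -> x = y.
Proof. by case: x y => [a b] [c d] /= -> ->. Qed.

Definition cnorm x : R := Num.sqrt (sqmod x).

Lemma cnorm_ge0 x : 0 <= cnorm x. Proof. exact: sqrtr_ge0. Qed.

Lemma sqr_cnorm x : cnorm x ^+ 2 = sqmod x.
Proof. by rewrite sqr_sqrtr// sqmod_ge0. Qed.

Lemma cnormM x y : cnorm (cmul x y) = cnorm x * cnorm y.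
Proof. by rewrite /cnorm sqmodM sqrtrM// sqmod_ge0. Qed.

Lemma cnormN x : cnorm (- x) = cnorm x.
Proof. by rewrite /cnorm sqmodN. Qed.

Lemma cnorm0 : cnorm 0 = 0. Proof. by rewrite /cnorm sqmod0 sqrtr0. Qed.

Lemma cnorm_eq0 x : (cnorm x == 0) = (x == 0).
Proof. by rewrite -sqmod_eq0 -sqr_cnorm sqrf_eq0. Qed.

Definition cdot x y : R := x.1 * y.1 + x.2 * y.2.

Lemma cdot_le x y : `|cdot x y| <= cnorm x * cnorm y.
Proof.
rewrite -(@ler_pXn2r _ 2)// ?nnegrE ?mulr_ge0 ?cnorm_ge0//.
rewrite exprMn !sqr_cnorm real_normK ?num_real// /cdot /sqmod.
by have := sqr_ge0 (x.1 * y.2 - x.2 * y.1); nra.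
Qed.

Lemma cnormD x y : cnorm (x + y) <= cnorm x + cnorm y.
Proof.
rewrite -(@ler_pXn2r _ 2)// ?nnegrE ?addr_ge0 ?cnorm_ge0//.
rewrite sqrrD !sqr_cnorm.
have := cdot_le x y; rewrite ler_norml => /andP[_].
rewrite /cdot /sqmod /=; lra.
Qed.

Lemma near0_cnorm (Q : plane R -> Prop) :
  (\forall y \near (0 : plane R), Q y) <->
  exists2 r : R, 0 < r & forall h, cnorm h < r -> Q h.
Proof.
split => [/near0_sqmod[r r0 rQ]|[r r0 rQ]].
  exists (Num.sqrt r); first by rewrite sqrtr_gt0.
  by move=> h; rewrite /cnorm ltr_sqrt// => /rQ.
apply/near0_sqmod; exists (r ^+ 2); first exact: exprn_gt0.
move=> h hr; apply: rQ; rewrite -(@ltr_pXn2r _ 2)// ?nnegrE ?cnorm_ge0 ?ltW//.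
by rewrite sqr_cnorm.
Qed.

Lemma near_cnorm (x0 : plane R) (Q : plane R -> Prop) :
  (\forall y \near x0, Q y) <->
  exists2 r : R, 0 < r & forall h, cnorm h < r -> Q (x0 + h).
Proof. by rewrite nearD0; exact: near0_cnorm. Qed.

Definition bigOn (k : nat) (f : plane R -> plane R) :=
  exists2 C : R, 0 <= C &
  \forall h \near (0 : plane R), cnorm (f h) <= C * cnorm h ^+ k.

Lemma near0_cnorm_lt (r : R) : 0 < r -> \forall h \near (0 : plane R), cnorm h < r.
Proof. by move=> r0; apply/near0_cnorm; exists r. Qed.

Lemma bigOnD k f g : bigOn k f -> bigOn k g -> bigOn k (fun h => f h + g h).
Proof.
move=> [C C0 Cf] [D D0 Dg]; exists (C + D); first exact: addr_ge0.
apply: filterS2 Cf Dg => h hC hD; apply: le_trans (cnormD _ _) _.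
by rewrite mulrDl lerD.
Qed.

Lemma bigOnM k l f g : bigOn k f -> bigOn l g ->
  bigOn (k + l) (fun h => cmul (f h) (g h)).
Proof.
move=> [C C0 Cf] [D D0 Dg]; exists (C * D); first exact: mulr_ge0.
apply: filterS2 Cf Dg => h hC hD; rewrite cnormM exprD mulrACA.
by apply: ler_pM; rewrite ?cnorm_ge0.
Qed.

Lemma bigOn_cst c : bigOn 0 (fun=> c).
Proof.
exists (cnorm c); first exact: cnorm_ge0.
by near=> h; rewrite expr0 mulr1.
Unshelve. all: by end_near. Qed.

Lemma bigOn_id : bigOn 1 id.
Proof. by exists 1 => //; near=> h; rewrite expr1 mul1r. Unshelve. all: by end_near. Qed.

Lemma bigOn_weak k l f : (l <= k)%N -> bigOn k f -> bigOn l f.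
Proof.
move=> lk [C C0 Cf]; exists C => //; near=> h.
apply: le_trans (near Cf h _) _; first by [].
rewrite ler_wpM2l// ler_wiXn2l ?cnorm_ge0//.
by apply: ltW; near: h; exact: near0_cnorm_lt.
Unshelve. all: by end_near. Qed.

Lemma bigOn_comp k f g : bigOn k f -> bigOn 1 g -> bigOn k (fun h => f (g h)).
Proof.
move=> [C C0 /near0_cnorm[r r0 Cf]] [D D0 Dg].
exists (C * D ^+ k); first by rewrite mulr_ge0// exprn_ge0.
near=> h.
have hg : cnorm (g h) <= D * cnorm h.
  by have := near Dg h; rewrite expr1; apply.
apply: le_trans (Cf _ _) _.
  apply: le_lt_trans hg _; apply: (@le_lt_trans _ _ ((D + 1) * cnorm h)).
    by rewrite ler_wpM2r ?cnorm_ge0// lerDl.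
  rewrite mulrC -ltr_pdivlMr ?ltr_wpDl//.
  by near: h; apply: near0_cnorm_lt; rewrite divr_gt0// ltr_wpDl.
rewrite -mulrA ler_wpM2l// -exprMn.
by rewrite lerXn2r ?nnegrE ?mulr_ge0 ?cnorm_ge0.
Unshelve. all: by end_near. Qed.

Lemma eq_bigOn k f g : f =1 g -> bigOn k f -> bigOn k g.
Proof. by move=> fg [C C0 Cf]; exists C => //; apply: filterS Cf => h; rewrite fg. Qed.

(* Holomorphic up to second order at [x]. *)
Definition hol2 (f : plane R -> plane R) x :=
  exists g1 g2, bigOn 3 (fun h =>
    f (x + h)%R - (f x + cmul g1 h + cmul g2 (cmul h h))).

Lemma hol2_cst c x : hol2 (fun=> c) x.
Proof.
exists 0, 0; exists 0 => //; near=> h.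
rewrite (_ : _ - _ = 0) ?cnorm0 ?mul0r//.
by apply: plane_eq; rewrite !cmulE /=; ring.
Unshelve. all: by end_near. Qed.

Lemma hol2_id x : hol2 id x.
Proof.
exists (1, 0), 0; exists 0 => //; near=> h.
rewrite (_ : _ - _ = 0) ?cnorm0 ?mul0r//.
by apply: plane_eq; rewrite !cmulE /=; ring.
Unshelve. all: by end_near. Qed.

Lemma hol2D f g x : hol2 f x -> hol2 g x -> hol2 (fun y => f y + g y) x.
Proof.
move=> [a [b Of]] [c [d Og]]; exists (a + c), (b + d).
apply: eq_bigOn (bigOnD Of Og) => h.
by apply: plane_eq; rewrite !cmulE /=; ring.
Qed.

Lemma hol2M f g x : hol2 f x -> hol2 g x -> hol2 (fun y => cmul (f y) (g y)) x.
Proof.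
move=> [a [b Of]] [c [d Og]].
exists (cmul a (g x) + cmul (f x) c), (cmul b (g x) + cmul a c + cmul (f x) d).
pose r h : plane R := f (x + h) - (f x + cmul a h + cmul b (cmul h h)).
pose s h : plane R := g (x + h) - (g x + cmul c h + cmul d (cmul h h)).
have O1 := bigOn_id; have O2 := bigOnM O1 O1; have O3 := bigOnM O1 O2.
have O4 := bigOnM O1 O3.
have Oa := bigOnM (bigOn_cst (cmul a d + cmul b c)) O3.
have Ob := bigOn_weak (isT : (3 <= 4)%N) (bigOnM (bigOn_cst (cmul b d)) O4).
have wk (u v w : plane R) : bigOn 0 (fun h => u + cmul v h + cmul w (cmul h h)).
  apply: bigOnD; last first.
    by apply: (@bigOn_weak 2) => //; apply: (bigOnM (bigOn_cst w) O2).
  by apply: bigOnD; [exact: bigOn_cst|apply: (@bigOn_weak 1) => //; exact: (bigOnM (bigOn_cst v) O1)].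
have Oc := bigOnM (wk (f x) a b) Og.
have Od := bigOnM (bigOnD (wk (g x) c d) (bigOn_weak (isT : (0 <= 3)%N) Og)) Of.
apply: eq_bigOn (bigOnD (bigOnD Oa Ob) (bigOnD Oc Od)) => h.
by apply: plane_eq; rewrite !cmulE /=; ring.
Qed.

Lemma hol2_bigO1 f x : hol2 f x -> bigOn 1 (fun h => f (x + h)%R - f x).
Proof.
move=> [a [b Of]].
have O1 := bigOn_id; have O2 := bigOnM O1 O1.
have Oa := bigOnM (bigOn_cst a) O1.
have Ob := bigOn_weak (isT : (1 <= 2)%N) (bigOnM (bigOn_cst b) O2).
apply: eq_bigOn (bigOnD (bigOn_weak (isT : (1 <= 3)%N) Of) (bigOnD Oa Ob)) => h.
by apply: plane_eq; rewrite !cmulE /=; ring.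
Qed.

Lemma hol2_comp f g x : hol2 g x -> hol2 f (g x) -> hol2 (f \o g) x.
Proof.
move=> hg; have Ok := hol2_bigO1 hg; move: hg => [c [d Og]] [a [b Of]].
exists (cmul a c), (cmul a d + cmul b (cmul c c)).
have O1 := bigOn_id; have O2 := bigOnM O1 O1.
pose k h : plane R := g (x + h) - g x.
have Of' := bigOn_comp Of Ok.
have Oa := bigOnM (bigOn_cst a) Og.
(* k^2 - (c h)^2 = (k - c h) (k + c h) *)
have Oc := bigOnM (bigOn_cst c) O1.
have Om : bigOn 2 (fun h => k h - cmul c h).
  have Od := bigOnM (bigOn_cst d) O2.
  apply: eq_bigOn (bigOnD (bigOn_weak (isT : (2 <= 3)%N) Og) Od) => h.
  by apply: plane_eq; rewrite /k !cmulE /=; ring.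
have Ob := bigOnM (bigOn_cst b) (bigOnM Om (bigOnD Ok Oc)).
apply: eq_bigOn (bigOnD Of' (bigOnD Oa Ob)) => h.
by rewrite /= /k (addrC (g (x + h))) addNKr; apply: plane_eq; rewrite !cmulE /=; ring.
Qed.

Lemma hol2_continuous f x : hol2 f x -> {for x, continuous f}.
Proof.
move=> /hol2_bigO1[C C0 Cf]; apply/cvgrPdist_lt => e e0.
apply/nearD0; near=> h.
rewrite distrC -(@ltr_pXn2r _ 2) ?nnegrE// ?ltW//.
apply: (le_lt_trans (norm_le_sqmod _)); rewrite -sqr_cnorm.
rewrite ltr_pXn2r ?nnegrE ?cnorm_ge0 ?(ltW e0)//.
apply: (@le_lt_trans _ _ ((C + 1) * cnorm h)).
  apply: le_trans (near Cf h _) _; first by [].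
  by rewrite expr1 ler_wpM2r ?cnorm_ge0// lerDl.
rewrite mulrC -ltr_pdivlMr ?ltr_wpDl//.
by near: h; apply: near0_cnorm_lt; rewrite divr_gt0// ltr_wpDl.
Unshelve. all: by end_near. Qed.

Lemma cinv_mulV x : x != 0 -> cmul x (cinv x) = (1, 0).
Proof.
rewrite -sqmod_gt0 => x0; apply: plane_eq; rewrite cmulE cinvE /=; last first.
  by field; rewrite gt_eqF.
rewrite /sqmod in x0 *; field; by rewrite gt_eqF.
Qed.

Lemma cinv_neq0 x : x != 0 -> cinv x != 0.
Proof.
move=> x0; apply/eqP => i0; have := cinv_mulV x0.
by rewrite i0 cmulE /= !mulr0 subr0 => -[/eqP]; rewrite eq_sym oner_eq0.
Qed.

Lemma cinv0 : cinv (0 : plane R) = 0.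
Proof. by rewrite cinvE /= oppr0 !mul0r. Qed.

Lemma sqmod_cinv x : sqmod (cinv x) = (sqmod x)^-1.
Proof.
have [->|x0] := eqVneq x 0; first by rewrite cinv0 sqmod0 invr0.
have sx : sqmod x != 0 by rewrite sqmod_eq0.
apply: (mulfI sx); rewrite -sqmodM cinv_mulV// divff//.
by rewrite /sqmod /= expr1n expr0n addr0.
Qed.

Lemma cinvK : involutive (@cinv R).
Proof.
move=> x; have [->|x0] := eqVneq x 0; first by rewrite !cinv0.
have s0 : sqmod x != 0 by rewrite sqmod_eq0.
apply: plane_eq; rewrite (cinvE (cinv x)) sqmod_cinv (cinvE x) /=.
  by field.
by field.
Qed.

(** Here [i = 1/x] and [j = 1/(x + h)], so that [j = i - i h j]; substituting this identity into
    itself twice leaves the cubic remainder. *)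
Lemma cinv_expand x h i j : cmul x i = (1, 0) -> cmul (x + h) j = (1, 0) ->
  j - (i + cmul (- cmul i i) h + cmul (cmul i (cmul i i)) (cmul h h)) =
  cmul (cmul (- cmul i (cmul i i)) (cmul h (cmul h h))) j.
Proof.
move=> e1 e2.
have step u : cmul u j = cmul u i - cmul u (cmul i (cmul h j)).
  have H1 : cmul (cmul u i) (cmul (x + h) j) = cmul u i.
    by rewrite e2; apply: plane_eq; rewrite cmulE /=; ring.
  have H2 : cmul (cmul u i) (cmul (x + h) j) =
      cmul (cmul x i) (cmul u j) + cmul u (cmul i (cmul h j)).
    by apply: plane_eq; rewrite !cmulE /=; ring.
  rewrite -[X in X - _]H1 H2 e1; apply: plane_eq; rewrite !cmulE /=; ring.
have one (u : plane R) : cmul (1, 0) u = u by apply: plane_eq; rewrite cmulE /=; ring.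
have s1 := step (1, 0); have s2 := step (cmul i h).
have s3 := step (cmul (cmul i h) (cmul i h)).
rewrite !one in s1.
have {}s1 : j = i - cmul (cmul i h) j.
  by rewrite [LHS]s1; apply: plane_eq; rewrite !cmulE /=; ring.
rewrite {1}s1 s2.
have -> : cmul (cmul i h) (cmul i (cmul h j)) = cmul (cmul (cmul i h) (cmul i h)) j.
  by apply: plane_eq; rewrite !cmulE /=; ring.
by rewrite s3; apply: plane_eq; rewrite !cmulE /=; ring.
Qed.

Lemma hol2_cinv x : x != 0 -> hol2 (@cinv R) x.
Proof.
move=> x0; have sx : 0 < cnorm x by rewrite lt_neqAle cnorm_ge0 andbT eq_sym cnorm_eq0.
(* 1/(x+h) - 1/x + h/x^2 - h^2/x^3 = - h^3 / (x^3 (x+h)) *)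
pose i := cinv x.
exists (- cmul i i), (cmul i (cmul i i)).
have Oi : bigOn 0 (fun h => cinv (x + h)).
  exists (2 / cnorm x); first by rewrite divr_ge0// ltW.
  near=> h; rewrite expr0 mulr1 /cnorm sqmod_cinv sqrtrV ?sqmod_ge0//.
  have hx : cnorm h < cnorm x / 2 by near: h; apply: near0_cnorm_lt; rewrite divr_gt0.
  have hxx : cnorm x / 2 <= cnorm (x + h).
    have := cnormD (x + h) (- h); rewrite addrK cnormN; lra.
  rewrite -/(cnorm (x + h)) -[leRHS]invf_div lef_pV2 ?posrE ?divr_gt0//.
  by apply: lt_le_trans hxx; rewrite divr_gt0.
have O1 := bigOn_id; have O3 := bigOnM O1 (bigOnM O1 O1).
have [C C0 CO] := bigOnM (bigOnM (bigOn_cst (- cmul i (cmul i i))) O3) Oi.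
exists C => //; near=> h.
rewrite (_ : _ - _ = cmul (cmul (- cmul i (cmul i i)) (cmul h (cmul h h))) (cinv (x + h))).
  by rewrite -[3%N]/(0 + (1 + (1 + 1)) + 0)%N; near: h.
have xh0 : x + h != 0.
  apply/eqP => /eqP; rewrite addr_eq0 => /eqP xh.
  have : cnorm h < cnorm x by near: h; exact: near0_cnorm_lt.
  by rewrite xh cnormN ltxx.
exact: cinv_expand (cinv_mulV x0) (cinv_mulV xh0).
Unshelve. all: by end_near. Qed.

End ComplexNorm.

Section ProductNear.
Variables T U V : topologicalType.

Lemma near_fst (t : T * U) (Q : T -> Prop) :
  (\forall x \near t.1, Q x) -> \forall t' \near t, Q t'.1.
Proof. by move=> nQ; exists (Q, setT) => /=; [split=> //; exact: filterT|move=> ? []]. Qed.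

Lemma near_snd (t : T * U) (Q : U -> Prop) :
  (\forall x \near t.2, Q x) -> \forall t' \near t, Q t'.2.
Proof. by move=> nQ; exists (setT, Q) => /=; [split=> //; exact: filterT|move=> ? []]. Qed.

Lemma cvg_comp_fst (k : T -> V) (t : T * U) :
  {for t.1, continuous k} -> (fun t' => k t'.1) @ t --> k t.1.
Proof. by move=> ck B /ck kB; exact: (near_fst (Q := k @^-1` B)). Qed.

Lemma cvg_comp_snd (k : U -> V) (t : T * U) :
  {for t.2, continuous k} -> (fun t' => k t'.2) @ t --> k t.2.
Proof. by move=> ck B /ck kB; exact: (near_snd (Q := k @^-1` B)). Qed.

End ProductNear.

(** * Compact discs and second-order harmonic jets *)

Section Discs.
Variable R : realType.
Implicit Types x y z h : plane R.

Definition cdisc x (r : R) : set (plane R) := [set y | sqmod (y - x) <= r].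

Lemma continuous_sqmodB x : continuous (fun y => sqmod (y - x)).
Proof.
move=> y; apply: (@continuous_comp _ _ _ (fun y => y - x) (@sqmod R)).
  by apply: cvgB; [exact: cvg_id|exact: cvg_cst].
exact: continuous_sqmod.
Qed.

Lemma closed_cdisc x r : closed (cdisc x r).
Proof.
apply: (@closed_comp _ _ (fun y => sqmod (y - x)) [set t | t <= r]).
  by move=> y _; exact: continuous_sqmodB.
exact: closed_le.
Qed.

Lemma open_disc x r : open [set y | sqmod (y - x) < r].
Proof.
apply: (@open_comp _ _ (fun y => sqmod (y - x)) [set t | t < r]).
  by move=> y _; exact: continuous_sqmodB.
exact: open_lt.
Qed.

Lemma compact_cdisc x r : compact (cdisc x r).
Proof.
pose s := 1 + `|r|.
pose B : set (plane R) := `[x.1 - s, x.1 + s] `*` `[x.2 - s, x.2 + s].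
apply: (@subclosed_compact _ _ B); first exact: closed_cdisc.
  by apply: compact_setX; exact: segment_compact.
move=> y; rewrite /cdisc /B /= => yr.
have h : sqmod (y - x) <= s ^+ 2.
  apply: (le_trans yr); apply: (le_trans (ler_norm r)).
  by rewrite /s; have := normr_ge0 r; nra.
have s0 : 0 <= s by rewrite /s; have := normr_ge0 r; lra.
move: h; rewrite /sqmod /= => h; rewrite !in_itv /=.
have := sqr_ge0 (y.1 - x.1); have := sqr_ge0 (y.2 - x.2) => h1 h2.
have : `|y.1 - x.1| <= s.
  by rewrite -(@ler_pXn2r _ 2) ?nnegrE// real_normK ?num_real//; lra.
have : `|y.2 - x.2| <= s.
  by rewrite -(@ler_pXn2r _ 2) ?nnegrE// real_normK ?num_real//; lra.
rewrite !ler_norml => /andP[? ?] /andP[? ?]; split; apply/andP; split; lra.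
Qed.

Lemma near0_cube (C e : R) : 0 < e ->
  \forall h \near (0 : plane R), C * cnorm h ^+ 3 <= e * sqmod h.
Proof.
move=> e0.
have n1 : \forall h \near (0 : plane R), cnorm h < e / (`|C| + 1).
  by apply: near0_cnorm_lt; rewrite divr_gt0// ltr_wpDl.
apply: filterS n1 => h hh; rewrite -sqr_cnorm exprS mulrA.
apply: ler_wpM2r; first exact: sqr_ge0.
apply: (@le_trans _ _ ((`|C| + 1) * cnorm h)).
  by apply: ler_wpM2r; [exact: cnorm_ge0|have := ler_norm C; lra].
by rewrite mulrC -ler_pdivlMr ?ltr_wpDl// ltW.
Qed.

(** Second-order contact with a harmonic quadratic is all that [touched] can see of harmonicity. It
    is stable under sums, scaling and, later, holomorphic substitution. *)
Definition hjet (k : plane R -> R) x := exists c, forall e, 0 < e ->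
  \forall h \near (0 : plane R), `|k (x + h) - k x - hquad c h| <= e * sqmod h.

Lemma hjet_touched F k x : hjet k x ->
  touched (fun y => F y + (k y)%:E)%E x -> touched F x.
Proof. by move=> [c kc]; exact: (touched_addharm kc). Qed.

Lemma norm_fst_le x : `|x.1| <= cnorm x.
Proof.
rewrite -(@ler_pXn2r _ 2) ?nnegrE ?cnorm_ge0// real_normK ?num_real// sqr_cnorm.
by rewrite /sqmod lerDl sqr_ge0.
Qed.

Lemma norm_snd_le x : `|x.2| <= cnorm x.
Proof.
rewrite -(@ler_pXn2r _ 2) ?nnegrE ?cnorm_ge0// real_normK ?num_real// sqr_cnorm.
by rewrite /sqmod lerDr sqr_ge0.
Qed.

Lemma hol2_hjet f x : hol2 f x -> hjet (fun y => (f y).1) x.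
Proof.
move=> [a [b [C C0 Cf]]].
exists ((a.1, - a.2), (b.1, - 2 * b.2)) => e e0; near=> h.
apply: le_trans (near (near0_cube C e0) h _); last by [].
apply: le_trans (near Cf h _); last by [].
apply: le_trans (norm_fst_le _); rewrite le_eqVlt; apply/orP; left; apply/eqP.
by congr (`|_|); rewrite !cmulE /hquad /=; ring.
Unshelve. all: by end_near. Qed.

Lemma hjetD k l x : hjet k x -> hjet l x -> hjet (fun y => k y + l y) x.
Proof.
move=> [c kc] [d ld]; exists (c + d) => e e0.
have e2 : 0 < e / 2 by rewrite divr_gt0.
apply: filterS2 (kc _ e2) (ld _ e2) => h h1 h2.
have -> : k (x + h) + l (x + h) - (k x + l x) - hquad (c + d) h =
  (k (x + h) - k x - hquad c h) + (l (x + h) - l x - hquad d h).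
  by rewrite /hquad /=; ring.
by apply: le_trans (ler_normD _ _) _; lra.
Qed.

Lemma hjetZ (a : R) k x : hjet k x -> hjet (fun y => a * k y) x.
Proof.
move=> [c kc]; exists ((a * c.1.1, a * c.1.2), (a * c.2.1, a * c.2.2)) => e e0.
have a1 : 0 < `|a| + 1 by have := normr_ge0 a; lra.
have e2 : 0 < e / (`|a| + 1) by rewrite divr_gt0.
apply: filterS (kc _ e2) => h h1.
have -> : a * k (x + h) - a * k x -
    hquad ((a * c.1.1, a * c.1.2), (a * c.2.1, a * c.2.2)) h =
  a * (k (x + h) - k x - hquad c h) by rewrite /hquad /=; ring.
rewrite normrM; apply: (@le_trans _ _ ((`|a| + 1) * (e / (`|a| + 1) * sqmod h))).
  by apply: ler_pM => //; lra.
by rewrite mulrA mulrCA divff ?gt_eqF// mulr1.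
Qed.

Lemma hjet_cst (a : R) x : hjet (fun=> a) x.
Proof.
exists 0 => e e0; near=> h.
have -> : a - a - hquad 0 h = 0 by rewrite /hquad /=; ring.
by rewrite normr0 mulr_ge0 ?sqmod_ge0// ltW.
Unshelve. all: by end_near. Qed.

Lemma hjet_hquad c x : hjet (hquad c) x.
Proof.
pose d : plane R * plane R := ((c.1.1 + 2 * c.2.1 * x.1 + c.2.2 * x.2,
  c.1.2 - 2 * c.2.1 * x.2 + c.2.2 * x.1), c.2).
exists d => e e0; near=> h.
rewrite (_ : _ - _ = 0); last by rewrite /hquad /d /=; ring.
by rewrite normr0 mulr_ge0 ?sqmod_ge0// ltW.
Unshelve. all: by end_near. Qed.

Lemma eq_hjet k l x : k =1 l -> hjet k x -> hjet l x.
Proof. by move=> /funext ->. Qed.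

Lemma near_hjet k l x : (\forall y \near x, k y = l y) -> hjet k x -> hjet l x.
Proof.
move=> /[dup] /nbhs_singleton kx /nearD0 kl [c kc]; exists c => e e0.
by apply: filterS2 kl (kc e e0) => h; rewrite kx => ->.
Qed.

Lemma near_touched F G x : (\forall y \near x, F y = G y) -> touched F x -> touched G x.
Proof.
move=> /[dup] /nbhs_singleton Fx /nearD0 FG [r [c [e [Fr e0 He]]]].
exists r, c, e; split => //; first by rewrite -Fx.
by apply: filterS2 FG He => h ->.
Qed.

End Discs.

(** * Holomorphic substitution in functions that no test function touches *)

Section Composition.
Variable R : realType.
Local Notation P := (plane R).

Let d2 (p q : P * P) := sqmod (p.1 - q.1) + sqmod (p.2 - q.2).

Let sqmod_expand (E g r k : P) : cnorm k <= 1 ->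
  sqmod (E - (cmul g (cmul k k) + r)) <= sqmod E -
    2 * cdot E (cmul g (cmul k k)) + 2 * cnorm E * cnorm r +
    (2 * cnorm g ^+ 2 * cnorm k ^+ 4 + 2 * cnorm r ^+ 2).
Proof.
move=> k1; have := cdot_le E r; rewrite ler_norml => /andP[h1 _].
have h2 := sqmodD_le (cmul g (cmul k k)) r.
have -> : 2 * cnorm g ^+ 2 * cnorm k ^+ 4 = 2 * sqmod (cmul g (cmul k k)).
  by rewrite -(sqr_cnorm (cmul _ _)) !cnormM; ring.
rewrite [in 2 * cnorm r ^+ 2]sqr_cnorm.
suff -> : sqmod (E - (cmul g (cmul k k) + r)) = sqmod E -
   2 * cdot E (cmul g (cmul k k)) - 2 * cdot E r + sqmod (cmul g (cmul k k) + r).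
  by move: h1 h2; rewrite /cdot /sqmod /=; lra.
by rewrite /sqmod /cdot /=; ring.
Qed.

(* Moving along the tangent line of a holomorphic curve changes the squared
   distance to it by a harmonic quadratic form and a cubic error. *)
Lemma hol2_dist (g : P -> P) x (p : P) : hol2 g x -> exists a c C,
  \forall k \near (0 : P),
   sqmod (p + cmul k a - g (x + k)) <= sqmod (p - g x) + hquad c k + C * cnorm k ^+ 3.
Proof.
move=> [a [b [C C0 Cg]]]; pose E := p - g x.
exists a, ((0, 0), (- 2 * (E.1 * b.1 + E.2 * b.2), - 4 * (E.2 * b.1 - E.1 * b.2))).
exists (2 * cnorm E * C + (2 * cnorm b ^+ 2 + 2 * C ^+ 2)).
near=> k.
have k1 : cnorm k <= 1 by apply: ltW; near: k; exact: near0_cnorm_lt.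
have k0 := cnorm_ge0 k.
have := near Cg k; move/(_ ltac:(by [])).
set r := (X in cnorm X) => hr.
have -> : p + cmul k a - g (x + k) = E - (cmul b (cmul k k) + r).
  by apply: plane_eq; rewrite /r /E !cmulE /=; ring.
apply: le_trans (sqmod_expand _ _ _ k1) _.
have -> : - (2 * cdot E (cmul b (cmul k k))) = hquad ((0, 0), (- 2 * (E.1 * b.1 + E.2 * b.2), - 4 * (E.2 * b.1 - E.1 * b.2))) k.
  by rewrite /hquad /cdot !cmulE /=; ring.
rewrite -/E -!addrA lerD2l lerD2l.
have hE := cnorm_ge0 E; have hb := sqr_ge0 (cnorm b).
have h3 : 2 * cnorm E * cnorm r <= 2 * cnorm E * (C * cnorm k ^+ 3).
  by apply: ler_wpM2l => //; apply: mulr_ge0.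
have k34 : cnorm k ^+ 4 <= cnorm k ^+ 3 by apply: ler_wiXn2l.
have k36 : cnorm k ^+ 6 <= cnorm k ^+ 3 by apply: ler_wiXn2l.
have h4 : 2 * cnorm b ^+ 2 * cnorm k ^+ 4 <= 2 * cnorm b ^+ 2 * cnorm k ^+ 3.
  by apply: ler_wpM2l => //; apply: mulr_ge0.
have h5 : cnorm r ^+ 2 <= C ^+ 2 * cnorm k ^+ 3.
  apply: (@le_trans _ _ ((C * cnorm k ^+ 3) ^+ 2)).
    by rewrite lerXn2r ?nnegrE ?cnorm_ge0 ?mulr_ge0 ?exprn_ge0.
  by rewrite exprMn -exprM ler_wpM2l ?sqr_ge0.
by lra.
Unshelve. all: by end_near. Qed.

(* The penalty method: a test function touching [f \o g] yields, after maximizing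
   [f p - Q x - N |p - g x|^2], one touching [f] on a line parallel to [g' x]. *)
Lemma touched_comp (f : P * P -> \bar R) (g : P -> P * P) (x0 : P) (W : set (P * P)) :
  open W -> W (g x0) -> usc_in W f -> (forall p, W p -> (f p < +oo)%E) ->
  (forall p b, W p ->
     ~ touched (fun h => f (p.1 + cmul h b.1, p.2 + cmul h b.2)) 0) ->
  (\forall x \near x0, hol2 (fun x => (g x).1) x /\ hol2 (fun x => (g x).2) x) ->
  ~ touched (f \o g) x0.
Proof.
move=> oW Wg uf ff nt hg [r0 [c [e [fr e0 /near0_sqmod[rho rho0 Hrho]]]]].
have [r2 r20 Wr2] : exists2 r, 0 < r & forall p : P * P,
    sqmod (p.1 - (g x0).1) <= r -> sqmod (p.2 - (g x0).2) <= r -> W p.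
  have : nbhs (g x0) W by exact: open_nbhs_nbhs.
  case=> -[A B] /= [/near_sqmod[a a0 Aa] /near_sqmod[b b0 Bb]] AB.
  exists (Num.min a b / 2); first by rewrite divr_gt0// lt_min a0.
  have m0 : 0 < Num.min a b by rewrite lt_min a0.
  move=> p pa pb; apply: AB; split => /=.
    rewrite -[p.1](subrK (g x0).1) addrC; apply: Aa.
    have : Num.min a b <= a by rewrite ge_min lexx.
    lra.
  rewrite -[p.2](subrK (g x0).2) addrC; apply: Bb.
  have : Num.min a b <= b by rewrite ge_min lexx orbT.
  lra.
have [r1 r10 Hr1] : exists2 r1, 0 < r1 & forall h, sqmod h <= r1 ->
    [/\ sqmod h < rho, hol2 (fun x => (g x).1) (x0 + h) /\ hol2 (fun x => (g x).2) (x0 + h),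
        sqmod ((g (x0 + h)).1 - (g x0).1) < r2 & sqmod ((g (x0 + h)).2 - (g x0).2) < r2].
  have [hg1 hg2] := nbhs_singleton hg.
  have n1 : \forall x \near x0, sqmod ((g x).1 - (g x0).1) < r2.
    have N : nbhs (g x0).1 [set y | sqmod (y - (g x0).1) < r2].
      by apply: open_nbhs_nbhs; split; [exact: open_disc|rewrite /= subrr sqmod0].
    exact: (hol2_continuous hg1 N).
  have n2 : \forall x \near x0, sqmod ((g x).2 - (g x0).2) < r2.
    have N : nbhs (g x0).2 [set y | sqmod (y - (g x0).2) < r2].
      by apply: open_nbhs_nbhs; split; [exact: open_disc|rewrite /= subrr sqmod0].
    exact: (hol2_continuous hg2 N).
  have /near_sqmod[s s0 Hs] : \forall x \near x0,
      (hol2 (fun x => (g x).1) x /\ hol2 (fun x => (g x).2) x) /\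
      (sqmod ((g x).1 - (g x0).1) < r2 /\ sqmod ((g x).2 - (g x0).2) < r2).
    by apply: filterI => //; exact: filterI.
  exists (Num.min rho s / 2); first by rewrite divr_gt0// lt_min rho0.
  have m0 : 0 < Num.min rho s by rewrite lt_min rho0.
  move=> h hr.
  have m1 : Num.min rho s <= rho by rewrite ge_min lexx.
  have m2 : Num.min rho s <= s by rewrite ge_min lexx orbT.
  have h1 : sqmod h < rho by lra.
  have h2 : sqmod h < s by lra.
  by have [? []] := Hs h h2; split.
pose D1 := cdisc (0 : P) r1; pose D2 := cdisc (g x0).1 r2; pose D3 := cdisc (g x0).2 r2.
pose K := D1 `*` (D2 `*` D3).
have cK : compact K by do 2 ?[apply: compact_setX]; exact: compact_cdisc.
(* Half of the strictness is given up: [f \o g - Q] is then at most [- (e / 2) |h|^2], hence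
   negative on the circle [|h|^2 = r1]. *)
pose Q (h : P) := r0 + hquad c h - e / 2 * sqmod h.
have cQ : continuous Q.
  move=> h; apply: cvgB; last by apply: cvgM; [exact: cvg_cst|exact: continuous_sqmod].
  by apply: cvgD; [exact: cvg_cst|exact: continuous_hquad].
pose dd (t : P * (P * P)) := d2 t.2 (g (x0 + t.1)).
have KW t : K t -> W t.2 by move=> [_ [/= h1 h2]]; exact: Wr2.
have D1E h : D1 h <-> sqmod h <= r1 by rewrite /D1 /cdisc /= subr0.
have cdd : {in K, continuous dd}.
  move=> t /set_mem[/D1E /Hr1[_ [/hol2_continuous c1 /hol2_continuous c2] _ _] _].
  have cx (k : P -> P) : {for x0 + t.1, continuous k} -> (fun t : P * (P * P) => k (x0 + t.1)) @ t --> k (x0 + t.1).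
    move=> ck; apply: (cvg_comp_fst (k := fun h => k (x0 + h))).
    move=> B /ck /nearD0 Bk; apply/nearD0.
    have : \forall h \near (0 : P), B (k (x0 + t.1 + h)) by [].
    by apply: filterS => h /=; rewrite addrA.
  have c21 : (fun t : P * (P * P) => t.2.1) @ t --> t.2.1.
    by apply: (cvg_comp_snd (k := fst)); exact: cvg_fst.
  have c22 : (fun t : P * (P * P) => t.2.2) @ t --> t.2.2.
    by apply: (cvg_comp_snd (k := snd)); exact: cvg_snd.
  have sq (k : P * (P * P) -> P) : k @ t --> k t -> (fun t => sqmod (k t)) @ t --> sqmod (k t).
    by move=> ck B /continuous_sqmod /ck.
  apply: cvgD.
    by apply: (sq (fun t => t.2.1 - (g (x0 + t.1)).1)); apply: cvgB => //; exact: (cx (fun x => (g x).1)).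
  by apply: (sq (fun t => t.2.2 - (g (x0 + t.1)).2)); apply: cvgB => //; exact: (cx (fun x => (g x).2)).
have uf2 : usc_in K (fun t => f t.2).
  move=> t Kt r fr2; have Wt := KW _ Kt.
  have : \forall p \near t.2, W p -> (f p < r%:E)%E by exact: uf.
  by move=> /near_snd; apply: filterS => t' h Kt'; apply: h; exact: KW.
have cQ1 : continuous (fun t : P * (P * P) => - Q t.1).
  by move=> t; apply: cvgN; apply: cvg_comp_fst; exact: cQ.
have ufQ : usc_in K (fun t => f t.2 + (- Q t.1)%:E)%E.
  by apply: usc_addr => // t _; exact: cQ1.
pose t0 : P * (P * P) := (0, g x0).
have Kt0 : K t0.
  split; first by apply/D1E; rewrite sqmod0 ltW.
  by split; rewrite /= /D2 /D3 /cdisc /= subrr sqmod0 ltW.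
have dd_ge0 t : 0 <= dd t by rewrite /dd /d2 addr_ge0 ?sqmod_ge0.
have [B fB] : exists B, forall t, K t -> (f t.2 + (- Q t.1)%:E <= B%:E)%E.
  have [t Kt tm] := usc_EVT cK (ex_intro _ t0 Kt0) ufQ.
  have : (f t.2 + (- Q t.1)%:E < +oo)%E by rewrite lte_add_pinfty ?ltry// ff//; exact: KW.
  have := tm; case: (f t.2 + _)%E => [B||] // H _; first by exists B.
  by exists 0 => t' /H; rewrite leeNy_eq => /eqP ->; rewrite leNye.
pose H N t := (f t.2 + (- Q t.1)%:E + (- (N * dd t))%:E)%E.
pose inn (t : P * (P * P)) := [/\ sqmod t.1 < r1, sqmod (t.2.1 - (g x0).1) < r2 & sqmod (t.2.2 - (g x0).2) < r2].
(* For a large penalty [N] nothing outside the interior of [K] competes with the value [0] at [t0].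
   At zero distance from the curve such a point sits over [|h|^2 = r1], where [Q] wins; at positive
   distance [N] wins. *)
have Hneg : \forall N \near +oo, K `<=` (fun t => K t -> ~ inn t -> (H N t < 0)%E).
  move/compact_near_coveringP : cK => /(_ R +oo (fun N t => K t -> ~ inn t -> (H N t < 0)%E) _).
  apply=> t Kt.
  have [it|nit] := pselect (inn t).
    have inear : \forall t' \near t, inn t'.
      case: it => i1 i2 i3.
      have n1 : \forall t' \near t, sqmod t'.1 < r1.
        have : \forall h \near t.1, sqmod (h - 0) < r1.
          by apply: open_nbhs_nbhs; split; [exact: open_disc|rewrite /= subr0].
        by move=> /near_fst; apply: filterS => t' /=; rewrite subr0.
      have n2 : \forall t' \near t, sqmod (t'.2.1 - (g x0).1) < r2.
        have : \forall h \near t.2.1, sqmod (h - (g x0).1) < r2.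
          by apply: open_nbhs_nbhs; split; [exact: open_disc|].
        by move=> /(near_fst (t := t.2)) /near_snd.
      have n3 : \forall t' \near t, sqmod (t'.2.2 - (g x0).2) < r2.
        have : \forall h \near t.2.2, sqmod (h - (g x0).2) < r2.
          by apply: open_nbhs_nbhs; split; [exact: open_disc|].
        by move=> /(near_snd (t := t.2)) /near_snd.
      by apply: filterS3 n1 n2 n3 => t' *; split.
    by near_simpl; near=> t' N => Kt'; case; near: t'.
  have [d0|dn0] := eqVneq (dd t) 0.
    have tE : t.2 = g (x0 + t.1).
      move/eqP: d0; rewrite /dd /d2 paddr_eq0 ?sqmod_ge0// !sqmod_eq0 !subr_eq0.
      case/andP => /eqP h1 /eqP h2.
      by rewrite [LHS]surjective_pairing h1 h2 -surjective_pairing.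
    have [tK1 tK2] := Kt; have t1 : sqmod t.1 <= r1 by apply/D1E.
    have [q1 _ q3 q4] := Hr1 _ t1.
    have er1 : sqmod t.1 = r1.
      apply/eqP; rewrite eq_le t1 leNgt; apply/negP => lt; apply: nit.
      by rewrite /inn tE.
    have : (f t.2 + (- Q t.1)%:E < (0 : R)%:E)%E.
      rewrite tE; have := Hrho _ q1 => /= Hq.
      apply: (@le_lt_trans _ _ ((r0 + hquad c t.1 - e * sqmod t.1)%:E + (- Q t.1)%:E)%E).
        exact: leeD2r.
      rewrite -EFinD lte_fin /Q er1; nra.
    move=> /(ufQ t Kt) nf.
    near_simpl; near=> t' N => Kt' _.
    have hnf : K t' -> (f t'.2 + (- Q t'.1)%:E < (0 : R)%:E)%E by near: t'.
    have N0 : 0 <= N by near: N; apply: nbhs_pinfty_ge; rewrite num_real.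
    rewrite /H; apply: le_lt_trans (hnf Kt').
    rewrite -[leRHS]adde0; apply: leeD => //; rewrite lee_fin oppr_le0 mulr_ge0//.
  have dp : 0 < dd t by rewrite lt_neqAle eq_sym dn0 dd_ge0.
  have nd : \forall t' \near t, dd t / 2 < dd t'.
    have := cdd t (mem_set Kt) => /cvgrPdist_lt/(_ _ (divr_gt0 dp (ltr0Sn _ 1))).
    by apply: filterS => t'; rewrite ltr_distl => /andP[]; lra.
  near_simpl; near=> t' N => Kt' _.
  rewrite /H; apply: (@le_lt_trans _ _ (B%:E + (- (N * dd t'))%:E)%E).
    by apply: leeD2r; exact: fB.
  rewrite -EFinD lte_fin subr_lt0.
  have hd : dd t / 2 < dd t' by near: t'.
  have hN : (`|B| + 1) / (dd t / 2) <= N.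
    by near: N; apply: nbhs_pinfty_ge; rewrite num_real.
  have : `|B| + 1 <= N * (dd t / 2) by rewrite -ler_pdivrMr// divr_gt0.
  have N0 : 0 <= N.
    by apply: le_trans hN; rewrite divr_ge0 ?addr_ge0// ltW// divr_gt0.
  have : N * (dd t / 2) <= N * dd t' by rewrite ler_wpM2l// ltW.
  by have := ler_norm B; lra.
have [N [N0 HN]] : exists N, 0 <= N /\ forall t, K t -> ~ inn t -> (H N t < 0)%E.
  have : \forall N \near +oo, 0 <= N /\ forall t, K t -> ~ inn t -> (H N t < 0)%E.
    apply: filterS2 (nbhs_pinfty_ge (num_real 0)) Hneg => N N0 KN; split => // t Kt.
    exact: KN.
  by move/filter_ex.
have uH : usc_in K (H N).
  apply: usc_addr => // t Kt; apply: cvgN.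
  by apply: cvgM; [exact: cvg_cst|exact: cdd].
have [t1 Kt1 mt1] := usc_EVT cK (ex_intro _ t0 Kt0) uH.
have H0 : (0 <= H N t1)%E.
  apply: le_trans (mt1 _ Kt0).
  have dd0 : dd t0 = 0 by rewrite /dd /d2 /t0 /= addr0 !subrr !sqmod0 addr0.
  have Q0 : Q 0 = r0 by rewrite /Q hquad0 sqmod0; ring.
  by rewrite /H dd0 [t0.2]/= [t0.1]/= Q0 -[f _]/((f \o g) x0) fr -!EFinD lee_fin; lra.
have i1 : inn t1.
  by apply: contrapT => ni; have := HN _ Kt1 ni; rewrite ltNge H0.
have [s fs] : exists s, f t1.2 = s%:E.
  have := ff _ (KW _ Kt1); move: H0; rewrite /H.
  by case: (f t1.2) => [s||] // _ _; exists s.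
have [j1 j2 j3] := i1.
have [_ [g1 g2] _ _] := Hr1 _ (ltW j1).
have [a1 [c1 [C1 n1]]] := hol2_dist t1.2.1 g1.
have [a2 [c2 [C2 n2]]] := hol2_dist t1.2.2 g2.
(* [a1] and [a2] are the derivatives of the components of [g] at the maximum. Moving the parameter
   by [k] and the point by [k a] changes the penalty by a harmonic form and a cubic error; of the
   strictness [e / 2] of [Q], [e / 4] survives. *)
apply: (nt t1.2 (a1, a2) (KW _ Kt1)).
pose cl : P * P := ((c.1.1 + 2 * c.2.1 * t1.1.1 + c.2.2 * t1.1.2 - e * t1.1.1,
  c.1.2 - 2 * c.2.1 * t1.1.2 + c.2.2 * t1.1.1 - e * t1.1.2), c.2).
pose cc : P * P := ((cl.1.1 + N * (c1.1.1 + c2.1.1), cl.1.2 + N * (c1.1.2 + c2.1.2)),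
  (cl.2.1 + N * (c1.2.1 + c2.2.1), cl.2.2 + N * (c1.2.2 + c2.2.2))).
have cmc (a x : P) (r : R) (y : P) : sqmod (x - y) < r -> \forall k \near (0 : P), sqmod (x + cmul k a - y) < r.
    move=> xy; have hc : hol2 (fun k => x + cmul k a) 0.
      apply: hol2D; first exact: hol2_cst.
      by apply: hol2M; [exact: hol2_id|exact: hol2_cst].
    have nb : nbhs (x + cmul 0 a) [set z | sqmod (z - y) < r].
      apply: open_nbhs_nbhs; split; first exact: open_disc.
      by rewrite /= (_ : cmul 0 a = 0) ?addr0//; apply: plane_eq; rewrite cmulE /=; ring.
    exact: (hol2_continuous hc nb).
exists s, cc, (e / 4); split; first 2 last.
- near=> k => /=; rewrite !add0r.
  pose t' : P * (P * P) := (t1.1 + k, (t1.2.1 + cmul k a1, t1.2.2 + cmul k a2)).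
  have Kt' : K t'.
    split; [|split] => /=; rewrite /D1 /D2 /D3 /cdisc /=; apply: ltW; last 2 first.
    + by near: k; exact: cmc.
    + by near: k; exact: cmc.
    rewrite subr0; have : sqmod (t1.1 + cmul k (1, 0) - 0) < r1.
      by near: k; apply: cmc; rewrite subr0.
    by rewrite subr0 (_ : cmul k (1, 0) = k)//; apply: plane_eq; rewrite cmulE /=; ring.
  have := mt1 _ Kt'; rewrite /H fs /= -!EFinD -leeBrDr// -leeBrDr// -!EFinB.
  move/le_trans; apply; rewrite lee_fin.
  have e1 : sqmod (t1.2.1 + cmul k a1 - (g (x0 + t1.1 + k)).1) <= sqmod (t1.2.1 - (g (x0 + t1.1)).1) + hquad c1 k + C1 * cnorm k ^+ 3.
    by near: k.
  have e2 : sqmod (t1.2.2 + cmul k a2 - (g (x0 + t1.1 + k)).2) <= sqmod (t1.2.2 - (g (x0 + t1.1)).2) + hquad c2 k + C2 * cnorm k ^+ 3.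
    by near: k.
  have e3 : N * (C1 + C2) * cnorm k ^+ 3 <= e / 4 * sqmod k.
    by near: k; apply: near0_cube; rewrite divr_gt0.
  have ed : dd t' - dd t1 <= hquad c1 k + hquad c2 k + (C1 + C2) * cnorm k ^+ 3.
    rewrite /dd /d2 /= [x0 + (_ + _)]addrA; apply: le_trans (lerB (lerD e1 e2) (lexx _)) _.
    rewrite le_eqVlt; apply/orP; left; apply/eqP; ring.
  have e4 : N * dd t' - N * dd t1 <= N * (hquad c1 k + hquad c2 k) + e / 4 * sqmod k.
    rewrite -mulrBr; apply: le_trans (ler_wpM2l N0 ed) _.
    by rewrite mulrDr lerD2l mulrA.
  have -> : hquad cc k = hquad cl k + N * (hquad c1 k + hquad c2 k).
    by rewrite /hquad /cc /=; ring.
  have -> : Q (t1.1 + k) = Q t1.1 + hquad cl k - e / 2 * sqmod k.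
    by rewrite /Q /hquad /cl /sqmod /=; field.
  rewrite -/t'; move: e4; clear; move: (N * dd t') (N * dd t1) (N * _) (Q t1.1) (hquad cl k) (sqmod k).
  by move=> *; lra.
- have c0 (a : P) : cmul 0 a = 0 by apply: plane_eq; rewrite cmulE /=; ring.
  by rewrite !c0 !addr0 -fs; case: (t1.2).
- by rewrite divr_gt0.
Unshelve. all: by end_near. Qed.

End Composition.

(** * Circle means *)

Section Fejer.
Variable R : realType.
Local Notation P := (plane R).
Implicit Types (x y : P) (t u : R).

Definition cis t : P := (cos t, sin t).

Definition cpow x k : P := iter k (cmul x) (1, 0).

Lemma cis0 : cis 0 = (1, 0). Proof. by rewrite /cis cos0 sin0. Qed.

Lemma cmul_cis t u : cmul (cis t) (cis u) = cis (t + u).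
Proof. by apply: plane_eq; rewrite cmulE /cis /= ?cosD ?sinD; ring. Qed.

Lemma sqmod_cis t : sqmod (cis t) = 1.
Proof. by rewrite /sqmod /= cos2Dsin2. Qed.

Lemma cpow_cis t k : cpow (cis t) k = cis (k%:R * t).
Proof.
elim: k => [|k IH]; first by rewrite mul0r cis0.
by rewrite /cpow /= -/(cpow _ k) IH cmul_cis; congr cis; rewrite -addn1 natrD; ring.
Qed.

Lemma cpow0 k : cpow 0 k = ((k == 0%N)%:R, 0).
Proof.
case: k => [|k] //; rewrite /cpow /=.
by apply: plane_eq; rewrite cmulE /=; ring.
Qed.

Lemma hol2_cpow k x : hol2 (fun y => cpow y k) x.
Proof.
elim: k => [|k IH]; first exact: hol2_cst.
by apply: (hol2M (hol2_id x) IH).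
Qed.

Lemma hol2_sum (I : Type) (r : seq I) (f : I -> P -> P) x :
  (forall i, hol2 (f i) x) -> hol2 (fun y => \sum_(i <- r) f i y) x.
Proof.
move=> hf; elim: r => [|i r IH].
  rewrite (_ : (fun y => _) = fun=> 0); first exact: hol2_cst.
  by apply/funext => y; rewrite big_nil.
rewrite (_ : (fun y => _) = fun y => f i y + \sum_(j <- r) f j y); first exact: hol2D.
by apply/funext => y; rewrite big_cons.
Qed.

Lemma fst_sum (I : Type) (r : seq I) (f : I -> P) :
  (\sum_(i <- r) f i).1 = \sum_(i <- r) (f i).1.
Proof. by elim: r => [|i r IH]; rewrite ?big_nil// !big_cons -IH. Qed.

Definition node (n j : nat) : R := j%:R * (2 * pi) / n%:R.

(** On the circle the real part is [|sum_(a < N) e^(i a u)|^2 / (N (N + 1))] with [u] the angle from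
    the node. Truncated subtraction makes the exponent [|a - b|], so the kernel is the real part of
    a polynomial and is harmonic in the disc. With [N + 1] nodes even the frequency [N] averages
    out. *)
Definition fejer (N j : nat) x : P :=
  \sum_(a < N) \sum_(b < N)
    cmul ((N.+1 * N)%:R^-1, 0) (cpow (cmul x (cis (- node N.+1 j))) ((a - b) + (b - a))).

Lemma hol2_fejer N j x : hol2 (fejer N j) x.
Proof.
apply: hol2_sum => a; apply: hol2_sum => b.
apply: hol2M; first exact: hol2_cst.
apply: (hol2_comp (f := fun y => cpow y ((a - b) + (b - a))) (g := fun y => cmul y (cis (- node N.+1 j)))); last exact: hol2_cpow.
by apply: hol2M; [exact: hol2_id|exact: hol2_cst].
Qed.

Let cos_dist (a b : nat) t :
  cos (((a - b) + (b - a))%N%:R * t) = cos (a%:R * t - b%:R * t).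
Proof.
have [ab|/ltnW ba] := leqP a b.
  have -> : ((a - b) + (b - a) = b - a)%N by lia.
  by rewrite natrB// -cosN; congr cos; ring.
have -> : ((a - b) + (b - a) = a - b)%N by lia.
by rewrite natrB//; congr cos; ring.
Qed.

Lemma fejerE N j t : (fejer N j (cis t)).1 =
  (N.+1 * N)%:R^-1 * \sum_(a < N) \sum_(b < N)
    cos (a%:R * (t - node N.+1 j) - b%:R * (t - node N.+1 j)).
Proof.
rewrite /fejer fst_sum mulr_sumr; apply: eq_bigr => a _.
rewrite fst_sum mulr_sumr; apply: eq_bigr => b _.
by rewrite cmul_cis cpow_cis cmulE /= mul0r subr0 cos_dist.
Qed.

(** The double sum is the squared modulus of a trigonometric sum, split into its cosine and sine
    parts. *)
Lemma fejer_ge0 N j t : 0 <= (fejer N j (cis t)).1.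
Proof.
rewrite fejerE mulr_ge0// ?invr_ge0//; set u := t - _.
have -> : \sum_(a < N) \sum_(b < N) cos (a%:R * u - b%:R * u) =
   (\sum_(a < N) cos (a%:R * u)) ^+ 2 + (\sum_(a < N) sin (a%:R * u)) ^+ 2.
  rewrite !expr2 !mulr_suml -big_split /=; apply: eq_bigr => a _.
  by rewrite !mulr_sumr -big_split /=; apply: eq_bigr => b _; rewrite cosB.
by rewrite addr_ge0 ?sqr_ge0.
Qed.

(** At the origin only the [N] diagonal terms survive. *)
Lemma fejer0 N j : (0 < N)%N -> (fejer N j 0).1 = N.+1%:R^-1.
Proof.
move=> N0; rewrite /fejer fst_sum.
have -> : cmul 0 (cis (- node N.+1 j)) = 0.
  by apply: plane_eq; rewrite cmulE /=; ring.
rewrite (eq_bigr (fun=> (N.+1 * N)%:R^-1)); last first.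
  move=> a _; rewrite fst_sum (bigD1 a)// big1 ?addr0.
    by rewrite cpow0 cmulE /= subnn /=; ring.
  move=> b ba; rewrite cpow0 cmulE (_ : (_ == 0)%N = false) /=; last first.
    by apply/negP => /eqP E; case/negP: ba; apply/eqP/val_inj => /=; lia.
  by ring.
by rewrite sumr_const card_ord natrM invfM -[LHS]mulr_natr -mulrA mulVf ?mulr1// pnatr_eq0 -lt0n.
Qed.

Let telescope_nodes (v : nat -> R) n : \sum_(j < n) (v j - v j.+1) = v 0%N - v n.
Proof.
elim: n => [|n IH]; first by rewrite big_ord0 subrr.
by rewrite big_ord_recr /= IH; ring.
Qed.

(* Telescoping after multiplication by [2 sin (pi m / n)]. *)
Lemma sum_cos_nodes (n m : nat) t : (0 < m < n)%N ->
  \sum_(j < n) cos (m%:R * (t - node n j)) = 0.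
Proof.
move=> /andP[m0 mn]; pose al : R := m%:R * pi / n%:R.
have n0 : (n%:R : R) != 0 by rewrite pnatr_eq0 -lt0n; apply: leq_ltn_trans mn.
have npos : (0 : R) < n%:R by rewrite lt_neqAle eq_sym n0 ler0n.
have s0 : sin al != 0.
  rewrite gt_eqF//; apply: sin_gt0_pi; rewrite /al; apply/andP; split.
    by apply: divr_gt0 => //; apply: mulr_gt0; [rewrite ltr0n|exact: pi_gt0].
  by rewrite ltr_pdivrMr// mulrC ltr_pM2l ?pi_gt0// ltr_nat.
apply: (mulfI (mulf_neq0 (_ : (2 : R) != 0) s0)); first by rewrite pnatr_eq0.
rewrite mulr0 mulr_sumr.
pose u (j : nat) := sin (m%:R * t - (2 * j%:R - 1) * al).
have uE (j : nat) : 2 * sin al * cos (m%:R * (t - node n j)) = u j - u j.+1.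
  have -> : m%:R * (t - node n j) = m%:R * t - 2 * j%:R * al.
    by rewrite /node /al; field.
  rewrite /u.
  have -> : m%:R * t - (2 * j%:R - 1) * al = (m%:R * t - 2 * j%:R * al) + al by ring.
  have -> : m%:R * t - (2 * j.+1%:R - 1) * al = (m%:R * t - 2 * j%:R * al) - al.
    by rewrite -(@natr1 _ j); ring.
  by set X := m%:R * t - 2 * _ * al; rewrite (sinD X al) (sinB X al); ring.
rewrite (eq_bigr (fun j : 'I_n => u j - u j.+1)); last by move=> j _; exact: uE.
rewrite telescope_nodes.
rewrite /u; apply/eqP; rewrite subr_eq0; apply/eqP.
have -> : m%:R * t - (2 * n%:R - 1) * al = (m%:R * t - (2 * 0%:R - 1) * al) - (pi *+ 2) *+ m.
  by rewrite -(mulr_natr (pi *+ 2) m) -(mulr_natr pi 2) /al; field.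
set z := m%:R * t - _; have := periodicn (@sinD2pi R) m (z - (pi *+ 2) *+ m).
by rewrite subrK => ->.
Qed.

(** Off the diagonal the frequency [|a - b|] is nonzero and below [N.+1], so it sums to zero over
    the nodes. *)
Lemma fejer_sum1 N t : (0 < N)%N -> \sum_(j < N.+1) (fejer N j (cis t)).1 = 1.
Proof.
move=> N0; under eq_bigr do rewrite fejerE.
rewrite -mulr_sumr exchange_big /=.
have e (a : 'I_N) : \sum_(j < N.+1) \sum_(b < N)
    cos (a%:R * (t - node N.+1 j) - b%:R * (t - node N.+1 j)) = N.+1%:R.
  rewrite exchange_big /= (bigD1 a)//= [X in _ + X]big1 ?addr0.
    rewrite (eq_bigr (fun=> 1)) ?sumr_const ?card_ord// => j _.
    by rewrite subrr cos0.
  move=> b ba; under eq_bigr do rewrite -cos_dist.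
  apply: sum_cos_nodes; move: ba; rewrite -val_eqE /= => ba.
  by have := ltn_ord a; have := ltn_ord b; lia.
under eq_bigr do rewrite e.
rewrite sumr_const card_ord -[N.+1%:R *+ N]mulr_natr -natrM mulVf// pnatr_eq0.
by rewrite muln_eq0 negb_or /= -lt0n.
Qed.

Lemma sqmod_cisB t u : sqmod (cis t - cis u) = 2 - 2 * cos (t - u).
Proof.
rewrite cosB /sqmod /=; have := cos2Dsin2 t; have := cos2Dsin2 u; lra.
Qed.

(** The squared chord is [2 - 2 cos (t - u)]. Multiplication by the cosine shifts frequencies by
    one, and only the [N - 1] pairs on each neighbouring diagonal survive the sum over the nodes.
    The rate [2 / N] makes the kernels concentrate at their nodes. *)
Lemma fejer_conc N t : (0 < N)%N ->
  \sum_(j < N.+1) (fejer N j (cis t)).1 * sqmod (cis t - cis (node N.+1 j)) = 2 / N%:R.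
Proof.
move=> N0; under eq_bigr do rewrite sqmod_cisB mulrBr.
rewrite sumrB -mulr_suml fejer_sum1// mul1r.
suff -> : \sum_(j < N.+1) (fejer N j (cis t)).1 * (2 * cos (t - node N.+1 j)) = 2 * (N%:R - 1) / N%:R.
  have n2 : (N%:R : R) != 0 by rewrite pnatr_eq0 -lt0n.
  by rewrite mulrBr mulr1 mulrBl mulfK// opprB addrC subrK.
pose c (m : nat) (j : nat) := cos (m%:R * (t - node N.+1 j)) : R.
have cs (m : nat) : (m <= N)%N -> \sum_(j < N.+1) c m j = (m == 0%N)%:R * N.+1%:R.
  case: m => [|m] mN.
    by rewrite mul1r /c; under eq_bigr do rewrite mul0r cos0; rewrite sumr_const card_ord.
  by rewrite mul0r; apply: sum_cos_nodes.
have cc (a b j : nat) : cos (a%:R * (t - node N.+1 j) - b%:R * (t - node N.+1 j)) * (2 * cos (t - node N.+1 j)) =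
    c ((a.+1 - b) + (b - a.+1))%N j + c ((a - b.+1) + (b.+1 - a))%N j.
  rewrite /c !cos_dist; set u := t - _.
  have -> : a.+1%:R * u - b%:R * u = (a%:R * u - b%:R * u) + u by rewrite -(@natr1 _ a); ring.
  have -> : a%:R * u - b.+1%:R * u = (a%:R * u - b%:R * u) - u by rewrite -(@natr1 _ b); ring.
  by set X := a%:R * u - b%:R * u; rewrite (cosD X u) (cosB X u); ring.
under eq_bigr do rewrite fejerE -mulrA mulr_suml.
rewrite -mulr_sumr exchange_big /=.
have ind (a : 'I_N) : \sum_(j < N.+1) (\sum_(b < N) cos (a%:R * (t - node N.+1 j) - b%:R * (t - node N.+1 j))) *
     (2 * cos (t - node N.+1 j)) = ((a.+1 < N)%N%:R + (0 < a)%N%:R) * N.+1%:R.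
  under eq_bigr do rewrite mulr_suml.
  rewrite exchange_big /=.
  transitivity (\sum_(b < N) (((a.+1 == b :> nat)%:R + (a == b.+1 :> nat)%:R) * N.+1%:R : R)).
    apply: eq_bigr => b _; under eq_bigr do rewrite cc.
    have ha := ltn_ord a; have hb := ltn_ord b.
    rewrite big_split /= !cs; [|lia|lia]; rewrite mulrDl.
    by congr (_%:R * _ + _%:R * _); congr nat_of_bool; apply/idP/idP; lia.
  rewrite -mulr_suml big_split /=; congr ((_ + _) * _).
    have [aN|aN] := ltnP a.+1 N.
      rewrite (bigD1 (Ordinal aN))//= eqxx big1 ?addr0// => b /negP nb.
      by rewrite (_ : _ == _ = false)//; apply/negP => /eqP ab; apply: nb; apply/eqP/val_inj.
    rewrite big1// => b _; rewrite (_ : _ == _ = false)//.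
    by apply/negP => /eqP ab; have := ltn_ord b; lia.
  case: a => -[|a] aN /=.
    by rewrite big1// => b _.
  have aN' : (a < N)%N by lia.
  rewrite (bigD1 (Ordinal aN'))//= eqxx big1 ?addr0// => b /negP nb.
  by rewrite (_ : _ == _ = false)//; apply/negP => /eqP ab; apply: nb; apply/eqP/val_inj; move: ab => /= [].
under eq_bigr do rewrite ind.
rewrite -mulr_suml big_split /=.
have -> : \sum_(i < N) (i.+1 < N)%N%:R = N%:R - 1 :> R.
  case: N N0 {cs cc ind c} => // N _; rewrite big_ord_recr /= ltnn addr0.
  rewrite (eq_bigr (fun=> 1)); last by move=> i _; rewrite ltnS ltn_ord.
  by rewrite sumr_const card_ord -addn1 natrD addrK.
have -> : \sum_(i < N) (0 < i)%N%:R = N%:R - 1 :> R.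
  case: N N0 {cs cc ind c} => // N _; rewrite big_ord_recl /= add0r.
  rewrite (eq_bigr (fun=> 1)); last by move=> i _.
  by rewrite sumr_const card_ord -addn1 natrD addrK.
have n1 : (N.+1%:R : R) != 0 by rewrite pnatr_eq0.
have n2 : (N%:R : R) != 0 by rewrite pnatr_eq0 -lt0n.
rewrite natrM; move: n1 n2; move: (N.+1%:R : R) (N%:R : R) => u v u0 v0; field.
by rewrite u0 v0.
Qed.

End Fejer.

Section CircleMeans.
Variable R : realType.
Local Notation P := (plane R).
Local Notation mu := (@lebesgue_measure R).
Local Notation I2pi := (`[0%R, (2 * pi)%R]%classic : set R).

Lemma circle_param (x : P) : sqmod x = 1 -> exists t, x = cis t.
Proof.
case: x => a b; rewrite /sqmod /= => ab.
have a1 : -1 <= a <= 1 by rewrite -ler_norml -(@ler_pXn2r _ 2) ?nnegrE// real_normK ?num_real// expr1n; have := sqr_ge0 b; lra.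
have ca : cos (acos a) = a by apply: acosK; rewrite in_itv.
have sa : sin (acos a) = `|b|.
  rewrite sin_acos// -sqrtr_sqr; congr Num.sqrt; lra.
have [b0|b0] := leP 0 b.
  by exists (acos a); rewrite /cis ca sa ger0_norm.
by exists (- acos a); rewrite /cis cosN sinN ca sa ltr0_norm// opprK.
Qed.

Lemma continuous_cis : continuous (@cis R).
Proof. by move=> t; exact: (cvg_pair (@continuous_cos R t) (@continuous_sin R t)). Qed.

Lemma usc_measurable (F : R -> \bar R) (D : set R) : measurable D ->
  usc_in setT F -> measurable_fun D F.
Proof.
move=> mD uF; suff m : measurable_fun [set: R] F by exact: measurable_funS m.
have -> : F = (fun x => - (- F x))%E by apply/funext => x; rewrite oppeK.
apply: measurableT_comp => //.
apply: measurable_realfun.lower_semicontinuous_measurable.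
apply/lower_semicontinuousP => a.
rewrite openE => x /= aFx.
have Fx : (F x < (- a)%:E)%E by rewrite EFinN lteNr.
have H : \forall y \near x, (a%:E < - F y)%E.
  by apply: filterS (uF x I (- a) Fx) => y /(_ I); rewrite EFinN lteNr.
exact: H.
Qed.

Lemma usc_cont (T : topologicalType) (g : T -> R) : continuous g ->
  usc_in setT (fun t => (g t)%:E).
Proof.
move=> cg t _ s; rewrite lte_fin => gs.
have H : \forall y \near t, g y < s := cvgr_lt _ (cg t) _ gs.
by near=> y => _; rewrite lte_fin; near: y; exact: H.
Unshelve. all: by end_near.
Qed.

(** Positive and negative parts are compared separately, so that integrals equal to [-oo] are
    allowed. *)
Lemma le_integral_meas (D : set R) (f g : R -> \bar R) : measurable D ->
  measurable_fun D f -> measurable_fun D g -> (forall x, D x -> (f x <= g x)%E) ->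
  (\int[mu]_(x in D) f x <= \int[mu]_(x in D) g x)%E.
Proof.
move=> mD mf mg fg; rewrite integralE [leRHS]integralE; apply: leeB.
  apply: ge0_le_integral => //; [exact: measurable_funepos|exact: measurable_funepos|].
  by move=> x Dx; apply: (@funepos_le _ _ D) => [y /set_mem /fg|]//; rewrite inE.
apply: ge0_le_integral => //; [exact: measurable_funeneg|exact: measurable_funeneg|].
by move=> x Dx; apply: (@funeneg_le _ _ D) => [y /set_mem /fg|]//; rewrite inE.
Qed.

Lemma twopi_gt0 : 0 < 2 * pi :> R.
Proof. by rewrite mulr_gt0// pi_gt0. Qed.

Lemma integral_hquad (c : P * P) (rho r e : R) :
  (\int[mu]_(t in I2pi)
    (r + hquad c (cmul (rho, 0) (cis t)) - e * rho ^+ 2)%:E = (2 * pi * (r - e * rho ^+ 2))%:E)%E.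
Proof.
pose f (t : R) := r + hquad c (cmul (rho, 0) (cis t)) - e * rho ^+ 2.
pose F (t : R) : R := (r - e * rho ^+ 2) * t + rho * c.1.1 * sin t - rho * c.1.2 * cos t +
  rho ^+ 2 * c.2.1 * (sin t * cos t) + rho ^+ 2 * c.2.2 / 2 * (sin t * sin t).
have dF (t : R) : is_derive t 1 F (f t).
  have di : is_derive t (1 : R^o) (id : R -> R) 1 := is_derive_id t (1 : R^o).
  have ds := is_derive_sin t; have dc := is_derive_cos t.
  have := is_deriveD (is_deriveD (is_deriveB (is_deriveD (is_deriveZ (r - e * rho ^+ 2) di)
    (is_deriveZ (rho * c.1.1) ds)) (is_deriveZ (rho * c.1.2) dc))
    (is_deriveZ (rho ^+ 2 * c.2.1) (is_deriveM ds dc)))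
    (is_deriveZ (rho ^+ 2 * c.2.2 / 2) (is_deriveM ds ds)).
  set g := (X in is_derive _ _ X _); set v := (X in is_derive _ _ _ X).
  have -> : g = F by apply/funext.
  suff -> : v = f t by [].
  rewrite /v /f /hquad cmulE /GRing.scale /=; have := cos2Dsin2 t.
  move: (cos t) (sin t) => C S _; by field.
rewrite (@continuous_FTC2 _ f F); first last.
- by move=> t _; rewrite derive1E; apply: derive_val.
- have cF (t : R) : {for t, continuous F}.
    by apply: differentiable_continuous; apply/derivable1_diffP; have [] := dF t.
  split.
  + by move=> t _; have [] := dF t.
  + by apply: cvg_at_right_filter; exact: cF.
  + by apply: cvg_at_left_filter; exact: cF.
- apply: continuous_subspaceT => t; apply: cvgB; last exact: cvg_cst.
  apply: cvgD; first exact: cvg_cst.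
  apply: (@continuous_comp _ _ _ (fun t => cmul (rho, 0) (cis t)) (hquad c)); last exact: continuous_hquad.
  have ch : hol2 (fun x : P => cmul (rho, 0) x) (cis t).
    by apply: hol2M; [exact: hol2_cst|exact: hol2_id].
  apply: (@continuous_comp _ _ _ (@cis R) (fun x => cmul (rho, 0) x)); first exact: continuous_cis.
  exact: hol2_continuous.
- exact: twopi_gt0.
have s2 : sin (2 * pi) = 0 :> R by rewrite mulr_natl sin2pi.
have c2 : cos (2 * pi) = 1 :> R by rewrite mulr_natl cos2pi.
rewrite -EFinB; congr (_%:E); rewrite /F s2 c2 sin0 cos0.
by move: (pi : R) => q; ring.
Qed.

(** A touching test function has mean [r - e rho^2] over a small circle, strictly less than its
    value [r] at the centre. *)
Lemma mean_not_touched (F : P -> \bar R) (r0 : R) : 0 < r0 ->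
  (forall h, sqmod h < r0 -> forall r : R, (F h < r%:E)%E -> \forall y \near h, (F y < r%:E)%E) ->
  (forall rho : R, 0 < rho -> rho ^+ 2 < r0 ->
     (F (0 : plane R)%R <= ((2 * pi)^-1)%:E * \int[mu]_(t in I2pi) F (cmul (rho, 0) (cis t))%R)%E) ->
  ~ touched F 0.
Proof.
move=> r00 uF mF [r [c [e [Fr e0 /near0_sqmod[d d0 Hd]]]]].
pose m := Num.min r0 d; have m0 : 0 < m by rewrite lt_min r00.
pose rho := Num.sqrt (m / 2).
have rho0 : 0 < rho by rewrite sqrtr_gt0 divr_gt0.
have rho2 : rho ^+ 2 = m / 2 by rewrite sqr_sqrtr// ltW// divr_gt0.
have mr0 : m <= r0 by rewrite /m ge_min lexx.
have md : m <= d by rewrite /m ge_min lexx orbT.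
have sq t : sqmod (cmul (rho, 0) (cis t)) = m / 2.
  by rewrite sqmodM sqmod_cis mulr1 /sqmod /= expr0n addr0.
have := mF rho rho0; rewrite rho2 => /(_ ltac:(lra)).
rewrite Fr leNgt => /negP; apply.
have uFc : usc_in setT (fun t => F (cmul (rho, 0) (cis t))).
  move=> t _ s Fs; have := uF _ _ s Fs; rewrite sq => /(_ ltac:(lra)) H.
  have cc : {for t, continuous (fun t => cmul (rho, 0) (cis t))}.
    have ch : hol2 (fun x : P => cmul (rho, 0) x) (cis t).
      by apply: hol2M; [exact: hol2_cst|exact: hol2_id].
    apply: (@continuous_comp _ _ _ (@cis R) (fun x => cmul (rho, 0) x)); first exact: continuous_cis.
    exact: hol2_continuous.
  have H' : \forall t' \near t, (F (cmul (rho, 0) (cis t'))%R < s%:E)%E := cc _ H.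
  by apply: filterS H' => t' h _; exact: h.
have H : (\int[mu]_(t in I2pi) F (cmul (rho, 0) (cis t))%R <= (2 * pi * (r - e * rho ^+ 2))%:E)%E.
  rewrite -(integral_hquad c); apply: le_integral_meas => //.
  - exact: usc_measurable.
  - apply: usc_measurable => //; apply: usc_cont => t.
    apply: cvgB; last exact: cvg_cst.
    apply: cvgD; first exact: cvg_cst.
    apply: (@continuous_comp _ _ _ (fun t => cmul (rho, 0) (cis t)) (hquad c)); last exact: continuous_hquad.
    have ch : hol2 (fun x : P => cmul (rho, 0) x) (cis t).
      by apply: hol2M; [exact: hol2_cst|exact: hol2_id].
    apply: (@continuous_comp _ _ _ (@cis R) (fun x => cmul (rho, 0) x)); first exact: continuous_cis.
    exact: hol2_continuous.
  move=> t _; have := Hd (cmul (rho, 0) (cis t)); rewrite add0r sq rho2.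
  by apply; lra.
apply: (@le_lt_trans _ _ (((2 * pi)^-1)%:E * (2 * pi * (r - e * rho ^+ 2))%:E)%E).
  by apply: lee_wpmul2l => //; rewrite lee_fin invr_ge0 ltW// twopi_gt0.
rewrite -EFinM mulKf ?gt_eqF ?twopi_gt0// lte_fin.
by rewrite ltrBlDr ltrDl mulr_gt0// exprn_gt0.
Qed.

(** The arcs are closed, so the values of neighbouring arcs add up at a common node; for nonnegative
    [h], as in the application, this only raises the function there. *)
Definition arc_step (n : nat) (h : nat -> R) (t : R) : R :=
  \sum_(j < n) h j * \1_(`[node R n j, node R n j.+1]%classic) t.

Lemma arc_step_mean n h : (0 < n)%N ->
  (\int[mu]_(t in I2pi) (arc_step n h t)%:E = (2 * pi / n%:R * \sum_(j < n) h j)%:E)%E.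
Proof.
move=> n0; have n0' : 0 < n%:R :> R by rewrite ltr0n.
transitivity (\int[mu]_(t in I2pi)
    (\sum_(j < n) ((h j)%:E * (\1_(`[node R n j, node R n j.+1]%classic) t)%:E))%E)%E.
  apply: eq_integral => t _; rewrite /arc_step -sumEFin.
  by apply: eq_bigr => j _; rewrite EFinM.
have ii (j : 'I_n) : mu.-integrable I2pi (fun t => (\1_(`[node R n j, node R n j.+1]%classic) t)%:E).
  by apply: (@integrableS _ _ _ _ setT) => //; exact: integrable_indic_itv.
rewrite integral_sum//; last by move=> j; apply: integrableZl.
rewrite mulr_sumr -sumEFin; apply: eq_bigr => j _.
rewrite integralZl// integral_indic//.
have nj : node R n j <= node R n j.+1.
  by rewrite /node ler_pM2r ?invr_gt0// ler_pM2r ?twopi_gt0// ler_nat.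
have -> : `[node R n j, node R n j.+1]%classic `&` I2pi = `[node R n j, node R n j.+1]%classic.
  apply/seteqP; split => [t []//|t tj]; split => //.
  move: tj; rewrite /= !in_itv /= => /andP[t1 t2]; apply/andP; split.
    by apply: le_trans t1; rewrite /node !mulr_ge0// ?invr_ge0 ?ltW// pi_gt0.
  apply: (le_trans t2); rewrite /node ler_pdivrMr// mulrC ler_pM2l ?twopi_gt0//.
  by rewrite ler_nat ltn_ord.
have nd : node R n j.+1 - node R n j = 2 * pi / n%:R.
  rewrite /node -(@natr1 _ j); move: n0'; move: (n%:R : R) (pi : R) => m q m0; field.
  by rewrite gt_eqF.
have lt : node R n j < node R n j.+1.
  by rewrite -subr_gt0 nd divr_gt0// twopi_gt0.
have mj : mu `[node R n j, node R n j.+1]%classic = (2 * pi / n%:R)%:E.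
  by rewrite lebesgue_measure_itv /= lte_fin lt -EFinD nd.
by transitivity ((h j)%:E * (2 * pi / n%:R)%:E)%E; [congr (_ * _)%E|rewrite -EFinM mulrC].
Qed.

Lemma hjet_continuous (k : P -> R) x : hjet k x -> {for x, continuous k}.
Proof.
move=> [c kc]; apply/cvgrPdist_lt => e e0; apply/nearD0.
have e2 : 0 < e / 2 by rewrite divr_gt0.
have n1 : \forall h \near (0 : P), `|hquad c h| < e / 2.
  have := @continuous_hquad R c 0 => /cvgrPdist_lt/(_ _ e2).
  by rewrite hquad0; apply: filterS => h; rewrite sub0r normrN.
have n2 : \forall h \near (0 : P), sqmod h < e / 2 by apply/near0_sqmod; exists (e / 2).
apply: filterS3 n1 n2 (kc 1 ltr01) => h h1 h2 h3.
rewrite distrC; have -> : k (x + h) - k x = (k (x + h) - k x - hquad c h) + hquad c h by rewrite subrK.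
by apply: le_lt_trans (ler_normD _ _) _; rewrite mul1r in h3; lra.
Qed.

Lemma hjet_sum (J : Type) (r : seq J) (k : J -> P -> R) x :
  (forall i, hjet (k i) x) -> hjet (fun y => \sum_(i <- r) k i y) x.
Proof.
move=> hk; elim: r => [|i r IH].
  by apply: (eq_hjet (k := fun=> 0)); [move=> y; rewrite big_nil|exact: hjet_cst].
apply: (eq_hjet (k := fun y => k i y + \sum_(j <- r) k j y)); last exact: hjetD.
by move=> y; rewrite big_cons.
Qed.

(* The largest value of [F] near each of [n] equidistant points of the circle
   gives harmonic polynomials (via the Fejer kernel) dominating [F] on the circle
   up to an arbitrarily small error; Fatou's lemma lets the mesh go to zero. *)
Lemma mean_ge_step (F : P -> \bar R) (C v eps : R) (M : R) :
  usc_in (cdisc 0 1) F -> (forall x, sqmod x <= 1 -> (F x <= C%:E)%E) ->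
  (forall x, sqmod x < 1 -> ~ touched F x) -> 0 < eps -> - M <= C -> F 0 = v%:E ->
  exists n (h : nat -> R), [/\ (0 < n)%N, 2 * pi / n%:R <= eps,
    v <= n%:R^-1 * \sum_(j < n) h j + eps,
    forall j, h j <= C &
    forall j, h j = - M \/ exists2 x, sqmod x = 1 /\ sqmod (x - cis (node R n j)) <= eps & F x = (h j)%:E].
Proof.
move=> uF FC nt eps0 MC Fv.
have F1 (x : P) : sqmod x <= 1 <-> cdisc 0 1 x by rewrite /cdisc /= subr0.
(* Large enough for two purposes: arcs of length at most [eps], and a Fejer error
   [2 (C + M) / (eps N)] of at most [eps]. *)
pose N := (Num.Def.trunc ((2 * `|C + M| / eps + 2 * pi) / eps)).+1.
have hN : (2 * `|C + M| / eps + 2 * pi) / eps < N%:R by exact: truncnS_gt.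
have N0 : (0 < N)%N by [].
have hN' : 2 * `|C + M| / eps + 2 * pi < N%:R * eps by rewrite -ltr_pdivrMr.
have ab : 0 <= 2 * `|C + M| / eps by rewrite divr_ge0 ?mulr_ge0// ltW.
pose Kj j := cdisc (0 : P) 1 `&` [set x | sqmod x = 1 /\ sqmod (x - cis (node R N.+1 j)) <= eps].
have Kne j : Kj j !=set0.
  exists (cis (node R N.+1 j)); split; first by rewrite /cdisc /= subr0 sqmod_cis.
  by split; [exact: sqmod_cis|rewrite subrr sqmod0 ltW].
have Kc j : compact (Kj j).
  apply: (@subclosed_compact _ _ (cdisc 0 1)); [|exact: compact_cdisc|by move=> x []].
  apply: closedI; first exact: closed_cdisc.
  apply: closedI; last exact: closed_cdisc.
  apply: (@closed_comp _ _ (@sqmod R) [set t | t = 1]); first by move=> x _; exact: continuous_sqmod.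
  exact: closed_eq.
have Ku j : usc_in (Kj j) F.
  move=> x [Kx _] r /(uF x Kx r); by apply: filterS => y h [Ky _]; exact: h.
(* [h j] is the maximum of [F] near the node, cut off at [- M] because [F] may be [-oo] there. *)
have ex j : exists h : R, [/\ h <= C, - M <= h, forall x, Kj j x -> (F x <= h%:E)%E &
    h = - M \/ exists2 x, sqmod x = 1 /\ sqmod (x - cis (node R N.+1 j)) <= eps & F x = h%:E].
  have [x [Kx Px] mx] := usc_EVT (Kc j) (Kne j) (Ku j).
  have [FM|MF] := leP (F x) (- M)%:E.
    exists (- M); split => //; [|by left].
    by move=> y Ky; apply: le_trans FM; exact: mx.
  have FxC := FC x (proj2 (F1 x) Kx).
  have [h Fh] : exists h, F x = h%:E.
    by move: FxC MF; case: (F x) => [h||] //; exists h.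
  exists h; split; [by rewrite -lee_fin -Fh|by rewrite -lee_fin -Fh ltW|by move=> y /mx; rewrite Fh|].
  by right; exists x.
have [h hP] := choice ex.
exists N.+1, h; split => //.
- have e : N.+1%:R = N%:R + 1 :> R by rewrite natr1.
  rewrite ler_pdivrMr// e; move: hN' ab; move: (_ / eps) (N%:R : R) (2 * pi : R) => a b c *.
  by rewrite mulrDr mulr1 (mulrC eps); lra.
- pose u x := \sum_(j < N.+1) h j * (fejer N j x).1.
  have ju x : hjet u x.
    by apply: hjet_sum => j; apply: hjetZ; apply: hol2_hjet; exact: hol2_fejer.
  have cu : continuous u.
    by move=> x; exact: hjet_continuous (ju x).
  have bd x : sqmod x = 1 -> (F x + (- u x)%:E <= eps%:E)%E.
    move=> x1; have FxC : (F x <= C%:E)%E by apply: FC; rewrite x1.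
    have [t xt] := circle_param x1.
    case Fx : (F x) => [f||]; last by rewrite addNye leNye.
      rewrite -EFinD lee_fin /u.
      have fC : f <= C by rewrite -lee_fin -Fx.
      have -> : f - \sum_(j < N.+1) h j * (fejer N j x).1 = \sum_(j < N.+1) (fejer N j x).1 * (f - h j).
        rewrite -[f in LHS]mul1r -(fejer_sum1 t N0) -xt mulr_suml -sumrB.
        by apply: eq_bigr => j _; ring.
      (* Near a node [f <= h j]. Far from it [f - h j <= C + M], and the squared distance to the
         node divided by [eps] exceeds [1]. Both cases are covered by the second moment of the
         kernel. *)
      apply: (@le_trans _ _ (\sum_(j < N.+1) (C + M) / eps * ((fejer N j x).1 * sqmod (x - cis (node R N.+1 j))))).
        apply: ler_sum => j _; have k0 : 0 <= (fejer N j x).1 by rewrite xt fejer_ge0.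
        have [h1 h2 h3 _] := hP j.
        rewrite mulrCA ler_wpM2l//.
        have [near|far] := leP (sqmod (x - cis (node R N.+1 j))) eps.
          have : (F x <= (h j)%:E)%E by apply: h3; split => //; apply: (F1 _).1; rewrite x1.
          rewrite Fx lee_fin => fh; apply: (@le_trans _ _ 0); first lra.
          by apply: mulr_ge0; [apply: divr_ge0; [lra|exact: ltW]|exact: sqmod_ge0].
        apply: (@le_trans _ _ (C + M)); first lra.
        rewrite -mulrA ler_peMr//; first lra.
        by rewrite mulrC ler_pdivlMr// mul1r ltW.
      rewrite -mulr_sumr xt fejer_conc//.
      have Np : 0 < N%:R :> R by rewrite ltr0n.
      rewrite mulrA ler_pdivrMr// (mulrC eps); apply: (le_trans _ (ltW hN')).
      have -> : (C + M) / eps * 2 = 2 * (C + M) / eps by move: (eps^-1) => q; ring.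
      have CM : 0 <= C + M by lra.
      by rewrite (ger0_norm CM) lerDl ltW// twopi_gt0.
    by move: FxC; rewrite Fx.
  have := @max_principle R (cdisc 0 1) [set x | sqmod (x - 0) < 1] (fun x => F x + (- u x)%:E)%E eps
    (@compact_cdisc _ _ _) (@open_disc _ _ _).
  move=> /(_ _ _ _ _ _ (0 : P)) H.
  have : (F (0 : P)%R + (- u (0 : P)%R)%:E <= eps%:E)%E.
    apply: H.
    - by move=> x /= xx; rewrite /cdisc /= ltW.
    - by apply: usc_addr => // x _; apply: cvgN; exact: cu.
    - move=> x /(F1 x).2 x1; rewrite lte_add_pinfty ?ltry//.
      by apply: le_lt_trans (FC x x1) _; rewrite ltry.
    - move=> x /=; rewrite subr0 => x1 tx; apply: (nt x x1); apply: hjet_touched tx.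
      by apply: (eq_hjet (k := fun y => (-1) * u y)); [move=> y; rewrite mulN1r|exact: hjetZ].
    - move=> x /(F1 x).2 x1 nx; apply: bd; apply/eqP; rewrite eq_le x1 /= leNgt.
      by apply/negP => lt; apply: nx; rewrite /= subr0.
    - by apply: (F1 _).1; rewrite sqmod0.
  rewrite Fv -EFinD lee_fin /u.
  under eq_bigr do rewrite fejer0//.
  rewrite -mulr_suml [X in v - X]mulrC => h1; rewrite -lerBlDl; exact: h1.
- by move=> j; have [] := hP j.
- by move=> j; have [] := hP j.
Qed.


Lemma norm_sin_le (x : R) : `|sin x| <= `|x|.
Proof.
wlog x0 : x / 0 <= x.
  move=> H; have [/H//|/ltW x0] := leP 0 x.
  by rewrite -normrN -[`|x|]normrN -sinN; apply: H; rewrite oppr_ge0.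
move: x0; rewrite le_eqVlt => /orP[/eqP <-|x0]; first by rewrite sin0.
have [|c _] := @MVT R sin cos 0 x x0 (fun y _ => is_derive_sin y).
  by apply: continuous_subspaceT => y; exact: continuous_sin.
rewrite sin0 !subr0 => ->; rewrite normrM ler_piMl// ler_norml.
by rewrite cos_geN1 cos_le1.
Qed.

Lemma sqmod_cisB_le (t u : R) : sqmod (cis t - cis u) <= (t - u) ^+ 2.
Proof.
rewrite sqmod_cisB; pose x := (t - u) / 2.
have -> : t - u = x + x by rewrite /x; field.
have s2 : sin x ^+ 2 <= x ^+ 2.
  rewrite -(real_normK (num_real (sin x))) -(real_normK (num_real x)).
  by rewrite lerXn2r ?nnegrE// norm_sin_le.
rewrite cosD; have := cos2Dsin2 x; move: s2; move: (sin x) (cos x) => S C h1 h2.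
have -> : C * C = 1 - S ^+ 2 by rewrite -h2; ring.
lra.
Qed.

Lemma arc_cover (n : nat) (t : R) : (0 < n)%N -> 0 <= t <= 2 * pi ->
  exists j : 'I_n, node R n j <= t <= node R n j.+1.
Proof.
move=> n0 /andP[t0 t1]; have n0' : 0 < n%:R :> R by rewrite ltr0n.
have tp := twopi_gt0.
pose x := t * n%:R / (2 * pi).
have x0 : 0 <= x by rewrite /x !mulr_ge0// ?invr_ge0 ltW.
have tx : t = x * (2 * pi) / n%:R.
  by rewrite /x divfK ?gt_eqF// mulfK ?gt_eqF.
have nodele (j : nat) : (node R n j <= t) = (j%:R <= x).
  by rewrite /node tx ler_pM2r ?invr_gt0// ler_pM2r.
have nodege (j : nat) : (t <= node R n j) = (x <= j%:R).
  by rewrite /node tx ler_pM2r ?invr_gt0// ler_pM2r.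
have /andP[m1 m2] := truncn_itv x0.
have [mn|nm] := ltnP (Num.Def.trunc x) n.
  by exists (Ordinal mn); rewrite nodele nodege /= m1 ltW.
have xn : x <= n%:R by rewrite /x ler_pdivrMr// mulrC ler_pM2l.
have ln : (n.-1 < n)%N by rewrite ltn_predL.
exists (Ordinal ln); rewrite nodele nodege /= prednK// xn andbT.
apply: le_trans m1; rewrite ler_nat; apply: leq_trans nm; exact: leq_pred.
Qed.

Lemma limn_einfE (u : (\bar R)^nat) : limn_einf u = ereal_sup (range (einfs u)).
Proof. by rewrite limn_einf_lim; apply: cvg_lim => //; exact: cvg_einfs_sup. Qed.

Lemma limn_einf_ge (u : (\bar R)^nat) a n0 : (forall k, (n0 <= k)%N -> (a <= u k)%E) ->
  (a <= limn_einf u)%E.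
Proof.
move=> au; rewrite limn_einfE; apply: ereal_sup_ge; exists (einfs u n0); first by exists n0.
by apply: le_ereal_inf_tmp => _ [k /= nk <-]; exact: au.
Qed.

Lemma limn_einf_le (u : (\bar R)^nat) a (w : nat -> R) :
  (forall k, (u k <= (a + w k)%:E)%E) ->
  (forall (e : R), 0 < e -> forall n0, exists2 k, (n0 <= k)%N & w k <= e) ->
  (limn_einf u <= a%:E)%E.
Proof.
move=> uw w0; rewrite limn_einfE; apply: ge_ereal_sup => _ [n _ <-].
apply/lee_addgt0Pr => e e0; have [k nk wk] := w0 e e0 n.
apply: (@le_trans _ _ (u k)); first by apply: ereal_inf_lbound; exists k.
by apply: le_trans (uw k) _; rewrite -EFinD lee_fin lerD2l.
Qed.

(** Step [k] uses mesh [1 / (k + 1)] and cut-off [- k]. The nonnegative functions [C - h] have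
    integrals at most [2 pi (C - F 0 + 1 / (k + 1))], while upper semicontinuity puts [C - F]
    pointwise below their lower limit. *)
Lemma circle_mean_ge (F : P -> \bar R) :
  (forall x, sqmod x <= 1 -> forall r : R, (F x < r%:E)%E -> \forall y \near x, (F y < r%:E)%E) ->
  (forall x, sqmod x <= 1 -> (F x < +oo)%E) ->
  (forall x, sqmod x < 1 -> ~ touched F x) ->
  (F (0 : P)%R <= ((2 * pi)^-1)%:E * \int[mu]_(t in I2pi) F (cis t))%E.
Proof.
move=> uF Ffin nt.
have F1 (x : P) : sqmod x <= 1 <-> cdisc 0 1 x by rewrite /cdisc /= subr0.
have uK : usc_in (cdisc 0 1) F by move=> x /(F1 x).2 /uF H r /H; apply: filterS.
case Fv : (F 0) => [v||]; last by rewrite leNye.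
  2: by have := Ffin 0; rewrite sqmod0 Fv => /(_ ler01).
have [C0 C0P] : exists C : R, forall x, sqmod x <= 1 -> (F x <= C%:E)%E.
  have [x Kx mx] := usc_EVT (@compact_cdisc _ _ _) (ex_intro _ 0 ((F1 0).1 ltac:(by rewrite sqmod0))) uK.
  exists (fine (F x)) => y /(F1 y).1 /mx; move: (mx 0 ((F1 0).1 ltac:(by rewrite sqmod0))).
  rewrite Fv; have := Ffin x ((F1 x).2 Kx); by case: (F x).
pose C := Num.max C0 0.
have FC x : sqmod x <= 1 -> (F x <= C%:E)%E.
  by move=> /C0P /le_trans; apply; rewrite lee_fin le_max lexx.
have C0' : 0 <= C by rewrite le_max lexx orbT.
have st (k : nat) : exists n, exists h : nat -> R, [/\ (0 < n)%N, 2 * pi / n%:R <= k.+1%:R^-1 :> R,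
    v <= n%:R^-1 * \sum_(j < n) h j + k.+1%:R^-1,
    forall j, h j <= C &
    forall j, h j = - k%:R \/ exists2 x, sqmod x = 1 /\ sqmod (x - cis (node R n j)) <= k.+1%:R^-1 & F x = (h j)%:E].
  have e0 : 0 < k.+1%:R^-1 :> R by rewrite invr_gt0.
  have m0 : - k%:R <= C by apply: (@le_trans _ _ 0); rewrite ?oppr_le0.
  have [n [h [h1 h2 h3 h4 h5]]] := @mean_ge_step F C v k.+1%:R^-1 k%:R uK FC nt e0 m0 Fv.
  by exists n; exists h; split.
have [nn st'] := choice st; have [hh nhP] := choice st'.
pose G (k : nat) (t : R) := arc_step (nn k) (fun j => C - (hh k) j) t.
have G0 k t : 0 <= G k t.
  rewrite /G /arc_step; apply: sumr_ge0 => j _; apply: mulr_ge0; last by rewrite indicE.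
  by have [_ _ _ H _] := nhP k; rewrite subr_ge0.
have mG k : measurable_fun I2pi (fun t => (G k t)%:E).
  apply/measurable_EFinP; apply: measurable_sum => j.
  by apply: measurable_funM => //; exact: measurable_indic.
have fG := fatou mu (measurable_itv `[0, 2 * pi]) mG (fun k t _ => ltac:(by rewrite lee_fin; exact: G0)).
have tp := twopi_gt0.
have intG k : (\int[mu]_(t in I2pi) (G k t)%:E <= (2 * pi * (C - v + k.+1%:R^-1))%:E)%E.
  have [n0 _ vh _ _] := nhP k; rewrite arc_step_mean// lee_fin -mulrA ler_pM2l//.
  have -> : (nn k)%:R^-1 * \sum_(j < nn k) (C - hh k j) = C - (nn k)%:R^-1 * \sum_(j < nn k) hh k j.
    rewrite sumrB sumr_const card_ord mulrBr -[C *+ _]mulr_natr (mulrC C) mulKf//.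
    by rewrite pnatr_eq0 -lt0n.
  move: vh; move: (_ * \sum_(j < nn k) hh k j) (k.+1%:R^-1 : R) => S q.
  by lra.
have lim1 : (limn_einf (fun k => \int[mu]_(t in I2pi) (G k t)%:E) <= (2 * pi * (C - v))%:E)%E.
  apply: (@limn_einf_le _ _ (fun k => 2 * pi * k.+1%:R^-1)).
    by move=> k; rewrite -mulrDr; exact: intG.
  move=> e e0 n0; pose m := maxn n0 (Num.Def.trunc (2 * pi / e)).
  exists m; first by rewrite leq_maxl.
  rewrite ler_pdivrMr// -ler_pdivrMl// [e^-1 * _]mulrC; apply: (le_trans (ltW (truncnS_gt _))).
  by rewrite ler_nat ltnS leq_maxr.
have lim2 t : I2pi t -> (C%:E - F (cis t) <= limn_einf (fun k => (G k t)%:E))%E.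
  move=> tI; rewrite leNgt; apply/negP => /ereal_between2[s0 /ereal_between[s sL ss0] s0C].
  move: sL; rewrite ltNge => /negP; apply.
  have Fr : (F (cis t) < (C - s)%:E)%E.
    have : (F (cis t) < +oo)%E by apply: Ffin; rewrite sqmod_cis.
    move: s0C; case: (F (cis t)) => [f||] //; last by rewrite ltNyr.
    by rewrite -EFinB lee_fin lte_fin => ? _; lra.
  have /near_sqmod[d d0 Hd] := uF (cis t) ltac:(by rewrite sqmod_cis) _ Fr.
  (* The first bound brings the point where step [k] takes its value within [sqrt d] of [cis t]; the
     second makes the cut-off value [- k] smaller than [C - s]. *)
  pose K := maxn (Num.Def.trunc (4 / d)) (Num.Def.trunc `|C - s|).+1.
  apply: (@limn_einf_ge _ _ K) => k Kk; rewrite lee_fin.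
  have [n0 nk _ hC hj] := nhP k.
  have [j /andP[tj1 tj2]] := arc_cover n0 tI.
  have Gj : C - (hh k) j <= G k t.
    rewrite /G /arc_step (bigD1 j)//= indicE mem_set ?mulr1; last by rewrite /= in_itv /= tj1.
    rewrite lerDl; apply: sumr_ge0 => i _; apply: mulr_ge0; last by rewrite indicE.
    by rewrite subr_ge0.
  apply: le_trans Gj.
  have k1 : (0 : R) < k.+1%:R by rewrite ltr0n.
  have hk1 : 4 / d < k.+1%:R.
    apply: lt_le_trans (truncnS_gt _) _; rewrite ler_nat ltnS.
    by apply: leq_trans Kk; rewrite leq_maxl.
  have hk2 : `|C - s| < k%:R.
    apply: lt_le_trans (truncnS_gt _) _; rewrite ler_nat.
    by apply: leq_trans Kk; rewrite leq_maxr.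
  have [->|[x [x1 xw] Fx]] := hj j.
    by have := ler_norm (- (C - s)); rewrite normrN; lra.
  have xt : sqmod (x - cis t) < d.
    have q0 : 0 < k.+1%:R^-1 :> R by rewrite invr_gt0.
    have q1 : k.+1%:R^-1 <= 1 :> R by rewrite invf_le1// ler1n.
    have q4 : 4 * k.+1%:R^-1 < d by rewrite ltr_pdivrMr// mulrC -ltr_pdivrMr.
    have wt : sqmod (cis (node R (nn k) j) - cis t) <= k.+1%:R^-1.
      apply: (le_trans (sqmod_cisB_le _ _)).
      have n0' : 0 < (nn k)%:R :> R by rewrite ltr0n.
      have nd : node R (nn k) j.+1 - node R (nn k) j = 2 * pi / (nn k)%:R.
        rewrite /node -(@natr1 _ j); move: n0'; move: ((nn k)%:R : R) (pi : R) => m q m0; field.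
        by rewrite gt_eqF.
      have b : `|node R (nn k) j - t| <= k.+1%:R^-1.
        move: tj1 tj2 nd nk q0; move: (node R _ j) (node R _ j.+1) (2 * pi / _) (k.+1%:R^-1) => x1' x2' x3' x4' *.
        by rewrite ler_norml; apply/andP; split; lra.
      rewrite -(real_normK (num_real _)); have := normr_ge0 (node R (nn k) j - t).
      move: b q0 q1; move: (`|_|) (_^-1) => a b; nra.
    have := sqmodD_le (x - cis (node R (nn k) j)) (cis (node R (nn k) j) - cis t).
    rewrite addrA subrK => /le_lt_trans; apply; move: xw wt q4.
    by move: (sqmod _) (sqmod _) (k.+1%:R^-1) => a b c *; lra.
  have := Hd (x - cis t) xt; rewrite addrC subrK Fx lte_fin; lra.
have mF : measurable_fun I2pi (fun t => F (cis t)).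
  apply: usc_measurable => // t _ r /uF; rewrite sqmod_cis => /(_ (lexx _)) H.
  by have H' : \forall t' \near t, (F (cis t') < r%:E)%E := @continuous_cis t _ H; apply: filterS H'.
have mCF : measurable_fun I2pi (fun t => C%:E - F (cis t))%E.
  by apply: emeasurable_funB => //; exact: measurable_cst.
have bound : (\int[mu]_(t in I2pi) (C%:E - F (cis t)) <= (2 * pi * (C - v))%:E)%E.
  apply: le_trans lim1; apply: le_trans fG.
  apply: le_integral_meas => //.
  rewrite (_ : (fun x => _) = fun t => - limn_esup (fun k => - (G k t)%:E))%E; last first.
    by apply/funext => t; rewrite -[X in limn_esup X]/(-%E \o (fun k => (G k t)%:E)) limn_esupN oppeK.
  apply: measurableT_comp => //; apply: measurable_fun_limn_esup => k.
  by apply: measurableT_comp => //; exact: mG.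
have posCF t : I2pi t -> (0 <= C%:E - F (cis t))%E.
  move=> _; have h : (F (cis t) <= C%:E)%E by apply: FC; rewrite sqmod_cis.
  case: (F (cis t)) h => [f||] //= h; last by rewrite leey.
  by rewrite -EFinB lee_fin subr_ge0 -lee_fin.
have iCF : mu.-integrable I2pi (fun t => C%:E - F (cis t))%E.
  apply/integrableP; split => //.
  have -> : (\int[mu]_(t in I2pi) `|C%:E - F (cis t)| = \int[mu]_(t in I2pi) (C%:E - F (cis t)))%E.
    by apply: eq_integral => t; rewrite inE => tI; rewrite gee0_abs// posCF.
  by apply: le_lt_trans bound _; rewrite ltry.
have muI : mu I2pi = (2 * pi)%:E by rewrite lebesgue_measure_itv /= lte_fin twopi_gt0 -EFinD subr0.
have iC : mu.-integrable I2pi (cst C%:E).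
  apply/integrableP; split; first exact: measurable_cst.
  rewrite (_ : (fun x => _) = cst `|C%:E|%E)// integral_cst//.
  set z := (X in (_ * X < _)%E); have -> : z = (2 * pi)%:E := muI.
  by rewrite -EFinM ltry.
have -> : (\int[mu]_(t in I2pi) F (cis t) = \int[mu]_(t in I2pi) (cst C%:E t - (C%:E - F (cis t))))%E.
  apply: eq_integral => t _ /=.
  have : (F (cis t) < +oo)%E by apply: Ffin; rewrite sqmod_cis.
  case: (F (cis t)) => [f||] // _.
  by rewrite -!EFinB; congr (_%:E); ring.
rewrite integralB//= integral_cst//.
set z := (X in (_ * X - _)%E); have -> : z = (2 * pi)%:E := muI.
have H : ((2 * pi * v)%:E <= C%:E * (2 * pi)%:E - \int[mu]_(t in I2pi) (C%:E - F (cis t)))%E.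
  apply: (@le_trans _ _ (C%:E * (2 * pi)%:E - (2 * pi * (C - v))%:E)%E); last exact: leeB.
  by rewrite -EFinM -EFinB lee_fin; move: (2 * pi : R) => q; lra.
rewrite (_ : v%:E = ((2 * pi)^-1)%:E * (2 * pi * v)%:E)%E.
  by apply: lee_wpmul2l => //; rewrite lee_fin invr_ge0 ltW.
by rewrite -EFinM mulKf// gt_eqF.
Qed.

End CircleMeans.

(** * Calculus of smooth functions and second-order Taylor expansions *)

Section DiffEps.
Variables (R : realType) (V W : normedModType R).

Lemma diff_eps (f : V -> W) x : differentiable f x -> forall e : R, 0 < e ->
  \forall h \near (0 : V), `|f (x + h) - f x - 'd f x h| <= e * `|h|.
Proof.
move=> /diff_locally /eqaddoP df e e0; apply: filterS (df e e0) => h /=.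
rewrite /= -![(_ + _ : _ -> _) _]/(_ + _) -![(- _ : _ -> _) _]/(- _) /cst /= opprD addrA.
by rewrite [h + x]addrC.
Qed.

Lemma diff_intro (f : V -> W) x (L : {linear V -> W}) : continuous L ->
  (forall e : R, 0 < e -> \forall h \near (0 : V), `|f (x + h) - f x - L h| <= e * `|h|) ->
  differentiable f x /\ 'd f x = L :> (V -> W).
Proof.
move=> cL H.
have E : f \o shift x = cst (f x) + L +o_ 0 id.
  apply/eqaddoP => e e0; apply: filterS (H e e0) => h.
  by rewrite /= -![(_ + _ : _ -> _) _]/(_ + _) -![(- _ : _ -> _) _]/(- _) /cst /= opprD addrA [h + x]addrC.
have dE := diff_unique cL E; split => //.
by apply/diff_locallyP; rewrite dE.
Qed.

Lemma near_eq_differentiable (f g : V -> W) x :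
  (\forall y \near x, f y = g y) -> differentiable f x -> differentiable g x.
Proof.
move=> fg df; have [] // := @diff_intro g x ('d f x).
  exact: diff_continuous.
move=> e e0; have := diff_eps df e0.
have fgx := nbhs_singleton fg; move: fg; rewrite (near_shift 0 x) /= => fg.
by apply: filterS2 fg => h /=; rewrite subr0 -fgx addrC => <-.
Qed.

End DiffEps.

Section SmoothOn.
Variables (R : realType) (V : normedModType R).
Implicit Types (U : set V).

Lemma Ck_onS (W : normedModType R) k U (f : V -> W) : Ck_on k.+1 U f -> Ck_on k U f.
Proof.
elim: k f => [|k IH] f /= [df Df].
  by move=> x Ux; apply: differentiable_continuous; exact: df.
by split => // v; apply: IH; exact: Df.
Qed.

Lemma sub_Ck_on (W : normedModType R) k U U' (f : V -> W) : U `<=` U' ->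
  Ck_on k U' f -> Ck_on k U f.
Proof.
move=> UU; elim: k f => [|k IH] f /=; first by move=> cf x /UU; exact: cf.
by move=> [df Df]; split => [x /UU|v]; [exact: df|exact: IH].
Qed.

Lemma open_near U (Q : V -> Prop) x : open U -> U x -> (forall x, U x -> Q x) ->
  \forall y \near x, Q y.
Proof. by move=> oU Ux UQ; apply: filterS (open_nbhs_nbhs (conj oU Ux)). Qed.

Lemma eq_Ck_on (W : normedModType R) k U (f g : V -> W) : open U ->
  (forall x, U x -> f x = g x) -> Ck_on k U f -> Ck_on k U g.
Proof.
move=> oU; elim: k f g => [|k IH] f g fg /=.
  move=> cf x Ux; have fgx := open_near oU Ux fg.
  have cfx : f @ x --> f x := cf x Ux.
  have : g @ x --> f x by apply: cvg_trans cfx; apply: near_eq_cvg.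
  by rewrite fg.
move=> [df Df]; split.
  by move=> x Ux; apply: near_eq_differentiable (open_near oU Ux fg) (df x Ux).
move=> v; apply: IH (Df v) => x Ux; apply: near_eq_derive.
exact: open_near oU Ux fg.
Qed.

Lemma Ck_on_cst (W : normedModType R) k U (c : W) : Ck_on k U (fun=> c).
Proof.
elim: k c => [|k IH] c /=; first by move=> x _; exact: cst_continuous.
split => [x _|v]; first exact: differentiable_cst.
rewrite (_ : 'D_v _ = fun=> 0); first exact: IH.
by apply/funext => x; exact: derive_cst.
Qed.

Lemma Ck_onD (W : normedModType R) k U (f g : V -> W) : open U ->
  Ck_on k U f -> Ck_on k U g -> Ck_on k U (fun x => f x + g x).
Proof.
move=> oU; elim: k f g => [|k IH] f g /=.
  by move=> cf cg x Ux; apply: cvgD; [exact: cf|exact: cg].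
move=> [df Df] [dg Dg]; split.
  by move=> x Ux; apply: differentiableD; [exact: df|exact: dg].
move=> v; apply: eq_Ck_on (IH _ _ (Df v) (Dg v)) => // x Ux.
by rewrite deriveD//; apply: diff_derivable; [exact: df|exact: dg].
Qed.

Lemma Ck_onM k U (f g : V -> R) : open U ->
  Ck_on k U f -> Ck_on k U g -> Ck_on k U (fun x => f x * g x).
Proof.
move=> oU; elim: k f g => [|k IH] f g.
  by move=> /= cf cg x Ux; apply: cvgM; [exact: cf|exact: cg].
move=> fk gk; have [df Df] := fk; have [dg Dg] := gk; split.
  by move=> x Ux; apply: differentiableM; [exact: df|exact: dg].
move=> v; have H := Ck_onD oU (IH _ _ (Ck_onS fk) (Dg v)) (IH _ _ (Ck_onS gk) (Df v)).
apply: eq_Ck_on H => // x Ux.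
by rewrite deriveM//; apply: diff_derivable; [exact: df|exact: dg].
Qed.

Lemma Ck_onV k U (f : V -> R) : open U -> (forall x, U x -> f x != 0) ->
  Ck_on k U f -> Ck_on k U (fun x => (f x)^-1).
Proof.
move=> oU f0; elim: k => [|k IH].
  by move=> /= cf x Ux; apply: cvgV; [exact: f0|exact: cf].
move=> fk; have [df Df] := fk; split.
  by move=> x Ux; apply: differentiableV; [exact: df|exact: f0].
move=> v; have Vk := IH (Ck_onS fk).
have H := Ck_onM oU (Ck_on_cst k U (-1 : R)) (Ck_onM oU (Ck_onM oU Vk Vk) (Df v)).
apply: eq_Ck_on H => // x Ux; rewrite deriveV//; last exact: diff_derivable (df x Ux).
  by rewrite -exprVn expr2 /GRing.scale /=; ring.
exact: f0.
Qed.

Lemma derive_ln (f : V -> R) x v : 0 < f x -> differentiable f x ->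
  differentiable (fun y => ln (f y)) x /\ 'D_v (fun y => ln (f y)) x = 'D_v f x / f x.
Proof.
move=> f0 df; have dl : is_derive (f x) 1 (@ln R) (f x)^-1 by exact: is_derive1_ln.
have dl' : differentiable (@ln R) (f x) by apply/derivable1_diffP.
have dc := differentiable_comp df dl'; split => //.
rewrite deriveE// -[fun y => _]/(@ln R \o f) diff_comp//=.
rewrite -(deriveE v df) -[X in 'd _ _ X]mulr1 -[X in 'd _ _ X]/('D_v f x *: 1).
by rewrite linearZ /= -(deriveE (1 : R^o) dl') derive_val.
Qed.

Lemma Ck_on_ln k U (f : V -> R) : open U -> (forall x, U x -> 0 < f x) ->
  Ck_on k U f -> Ck_on k U (fun x => ln (f x)).
Proof.
move=> oU f0; case: k => [|k] fk.
  move=> x Ux; apply: (@continuous_comp _ _ _ f (@ln R)); first exact: fk.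
  by apply: continuous_ln; exact: f0.
have [df Df] := fk; split.
  by move=> x Ux; have [] := derive_ln 0 (f0 x Ux) (df x Ux).
move=> v; have fn0 x : U x -> f x != 0 by move=> /f0; exact: lt0r_neq0.
have H := Ck_onM oU (Df v) (Ck_onV oU fn0 (Ck_onS fk)).
apply: eq_Ck_on H => // x Ux.
by have [_ ->] := derive_ln v (f0 x Ux) (df x Ux).
Qed.

Lemma Ck_on_linear (W : normedModType R) k U (L : {linear V -> W}) :
  continuous L -> Ck_on k U L.
Proof.
move=> cL; case: k => [|k]; first by move=> x _; exact: cL.
have dL x : differentiable L x by exact: linear_differentiable.
split => // v; rewrite (_ : 'D_v _ = fun=> L v); first exact: Ck_on_cst.
by apply/funext => x; rewrite deriveE// diff_lin.
Qed.

Lemma derive_lin_comp (W W' : normedModType R) (L : {linear W -> W'}) (f : V -> W) x v :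
  continuous L -> differentiable f x ->
  differentiable (fun y => L (f y)) x /\ 'D_v (fun y => L (f y)) x = L ('D_v f x).
Proof.
move=> cL df; have dL : differentiable L (f x) by exact: linear_differentiable.
have dc := differentiable_comp df dL; split => //.
by rewrite deriveE// -[fun y => _]/(L \o f) diff_comp//= diff_lin//= deriveE.
Qed.

Lemma Ck_on_lin_comp (W W' : normedModType R) k U (L : {linear W -> W'}) (f : V -> W) :
  open U -> continuous L -> Ck_on k U f -> Ck_on k U (fun x => L (f x)).
Proof.
move=> oU cL; elim: k f => [|k IH] f.
  by move=> cf x Ux; apply: (@continuous_comp _ _ _ f L); [exact: cf|exact: cL].
move=> [df Df]; split.
  by move=> x Ux; have [] := derive_lin_comp 0 cL (df x Ux).
move=> v; apply: eq_Ck_on (IH _ (Df v)) => // x Ux.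
by have [_ ->] := derive_lin_comp v cL (df x Ux).
Qed.

Lemma Ck_on_fst (W W' : normedModType R) k U (f : V -> W * W') :
  open U -> Ck_on k U f -> Ck_on k U (fun x => (f x).1).
Proof. by move=> oU; apply: (@Ck_on_lin_comp _ _ k U (@fst W W')) => // x; exact: cvg_fst. Qed.

Lemma Ck_on_snd (W W' : normedModType R) k U (f : V -> W * W') :
  open U -> Ck_on k U f -> Ck_on k U (fun x => (f x).2).
Proof. by move=> oU; apply: (@Ck_on_lin_comp _ _ k U (@snd W W')) => // x; exact: cvg_snd. Qed.

Lemma derive_pair (W W' : normedModType R) (f : V -> W) (g : V -> W') x v :
  differentiable f x -> differentiable g x ->
  'D_v (fun y => (f y, g y)) x = ('D_v f x, 'D_v g x).
Proof.
move=> df dg; have dp := differentiable_pair df dg.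
have [_ h1] := @derive_lin_comp (W * W')%type W (@fst W W') _ x v (fun x => @cvg_fst _ _ _ _ _) dp.
have [_ h2] := @derive_lin_comp (W * W')%type W' (@snd W W') _ x v (fun x => @cvg_snd _ _ _ _ _) dp.
by rewrite [LHS]surjective_pairing -[X in (X, _)]h1 -[X in (_, X)]h2.
Qed.

Lemma Ck_on_pair (W W' : normedModType R) k U (f : V -> W) (g : V -> W') :
  open U -> Ck_on k U f -> Ck_on k U g -> Ck_on k U (fun x => (f x, g x)).
Proof.
move=> oU; elim: k f g => [|k IH] f g.
  by move=> cf cg x Ux; apply: cvg_pair; [exact: cf|exact: cg].
move=> [df Df] [dg Dg]; split.
  by move=> x Ux; apply: differentiable_pair; [exact: df|exact: dg].
move=> v; apply: eq_Ck_on (IH _ _ (Df v) (Dg v)) => // x Ux.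
by rewrite derive_pair//; [exact: df|exact: dg].
Qed.

End SmoothOn.

Section Taylor.
Variable R : realType.
Local Notation P := (plane R).

Lemma deriv_dir (f : P -> R) x (h : P) : differentiable f x ->
  'D_h f x = h.1 * 'D_(1, 0) f x + h.2 * 'D_(0, 1) f x.
Proof.
move=> df; rewrite !deriveE//.
have {1}-> : h = h.1 *: (1, 0) + h.2 *: (0, 1) :> P.
  by apply: plane_eq; rewrite /= /GRing.scale /=; ring.
by rewrite linearD !linearZ.
Qed.

Lemma derivable_line (f : P -> R) (x h : P) (t : R) : differentiable f (x + t *: h) ->
  is_derive t 1 (fun s : R => f (x + s *: h)) ('D_h f (x + t *: h)).
Proof.
move=> df; have dv : derivable f (x + t *: h) h by exact: diff_derivable.
have E : (fun s : R => s^-1 *: (((fun s : R => f (x + s *: h)) \o shift t) (s *: (1 : R^o)) - f (x + t *: h))) =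
   (fun s : R => s^-1 *: ((f \o shift (x + t *: h)) (s *: h) - f (x + t *: h))).
  apply/funext => s /=; congr (_ *: (f _ - _)).
  by apply: plane_eq; rewrite /= /GRing.scale /=; ring.
by split; [rewrite /derivable E|rewrite /derive E].
Qed.

Definition jet (f : P -> R) (x : P) (m : R) := exists c, forall e, 0 < e ->
  \forall h \near (0 : P), `|f (x + h) - f x - hquad c h - m * sqmod h| <= e * sqmod h.

(** The mean value theorem is applied first to [k1] and then to [k] minus its quadratic polynomial
    at [0]; the factor [1 / 2] of the sharp bound is given away. *)
Lemma taylor1D (k k1 k2 : R -> R) (A B : R) :
  (forall t : R, 0 <= t <= 1 -> is_derive t 1 k (k1 t)) ->
  (forall t : R, 0 <= t <= 1 -> is_derive t 1 k1 (k2 t)) ->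
  (forall t : R, 0 <= t <= 1 -> `|k2 t - A| <= B) ->
  `|k 1 - k 0 - k1 0 - A / 2| <= B.
Proof.
move=> d1 d2 bB.
have cont (g g1 : R -> R) (t : R) : (forall s : R, 0 <= s <= 1 -> is_derive s 1 g (g1 s)) -> t <= 1 ->
    {within `[0, t], continuous g}.
  move=> dg t1; apply: continuous_in_subspaceT => s /set_mem /= /itvP st.
  have s01 : 0 <= s <= 1 by rewrite st (le_trans _ t1)// st.
  apply: differentiable_continuous; apply/derivable1_diffP.
  by have [] := dg s s01.
have k1b (t : R) : 0 < t <= 1 -> `|k1 t - k1 0 - A * t| <= B.
  move=> /andP[t0 t1].
  have [|c ct ->] := @MVT _ k1 k2 0 t t0 _ (cont _ _ _ d2 t1).
    by move=> s /itvP st; apply: d2; rewrite ltW ?st//= (le_trans _ t1)// ltW ?st.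
  have c01 : 0 <= c <= 1 by rewrite ltW ?(itvP ct)//= (le_trans _ t1)// ltW ?(itvP ct).
  rewrite subr0 -mulrBl normrM [`|t|]gtr0_norm//.
  apply: le_trans (bB c c01); by rewrite ler_piMr.
pose g t : R := k t - (k1 0 * t + A / 2 * t ^+ 2).
have dg (t : R) : 0 <= t <= 1 -> is_derive t 1 g (k1 t - (k1 0 + A * t)).
  move=> t01; have dk := d1 t t01.
  have dq : is_derive t 1 (fun t : R => k1 0 * t + A / 2 * t ^+ 2) (k1 0 + A * t).
    have di : is_derive t (1 : R^o) (id : R -> R) 1 := is_derive_id t (1 : R^o).
    have := is_deriveD (is_deriveZ (k1 0) di) (is_deriveZ (A / 2) (is_deriveM di di)).
    set f := (X in is_derive _ _ X _); set v := (X in is_derive _ _ _ X).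
    have -> : f = (fun t : R => k1 0 * t + A / 2 * t ^+ 2) by apply/funext.
    by have -> : v = k1 0 + A * t by rewrite /v /GRing.scale /=; field.
  exact: (is_deriveB dk dq).
have [|c ct] := @MVT _ g (fun t => k1 t - (k1 0 + A * t)) 0 1 ltr01 _ (cont _ _ _ dg (lexx 1)).
  by move=> s /itvP st; apply: dg; rewrite !ltW ?st.
rewrite subr0 mulr1 /g => E.
have -> : k 1 - k 0 - k1 0 - A / 2 = k1 c - k1 0 - A * c by move: E; lra.
by apply: k1b; rewrite (itvP ct)/= ltW ?(itvP ct).
Qed.

Lemma norm_prod_le_sqmod (h : P) : `|h.1 * h.2| <= sqmod h.
Proof.
rewrite /sqmod ler_norml; have := sqr_ge0 (h.1 - h.2); have := sqr_ge0 (h.1 + h.2).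
have := sqr_ge0 h.1; have := sqr_ge0 h.2.
by move=> ? ? ? ?; apply/andP; split; lra.
Qed.

Lemma norm_sum4 (a b c d z : R) : `|a| <= z -> `|b| <= z -> `|c| <= z -> `|d| <= z ->
  `|a + b + c + d| <= z + z + z + z.
Proof.
move=> ha hb hc hd; apply: le_trans (ler_normD _ _) _; apply: lerD => //.
apply: le_trans (ler_normD _ _) _; apply: lerD => //.
by apply: le_trans (ler_normD _ _) _; exact: lerD.
Qed.

Lemma nbhs_segment (x : P) (Q : P -> Prop) : (\forall y \near x, Q y) ->
  \forall h \near (0 : P), forall t : R, 0 <= t <= 1 -> Q (x + t *: h).
Proof.
move=> /near_sqmod[r r0 rQ]; apply/near0_sqmod; exists r => // h hr t /andP[t0 t1].
apply: rQ; apply: le_lt_trans hr.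
rewrite /sqmod /= /GRing.scale /=; have := sqr_ge0 h.1; have := sqr_ge0 h.2.
have : t ^+ 2 <= 1 by rewrite expr_le1.
by rewrite !exprMn; nra.
Qed.

(** A quarter of the Laplacian, which is [pi * ddc f x], is the coefficient of [|h|^2] once the
    traceless, hence harmonic, part of the second-order term is split off. *)
Lemma taylor2 U (f : P -> R) x : open U -> U x -> smooth_on U f ->
  jet f x (pi * ddc f x).
Proof.
move=> oU Ux sf; pose e1 : P := (1, 0); pose e2 : P := (0, 1).
have d1 : forall y, U y -> differentiable f y by have [] := sf 1%N.
have d2 v : forall y, U y -> differentiable ('D_v f) y.
  by have [_ /(_ v)[]] := sf 2%N.
have c2 v w : forall y, U y -> {for y, continuous ('D_w ('D_v f))}.
  by have [_ /(_ v)[_ /(_ w)]] := sf 2%N.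
pose A i j y := 'D_i ('D_j f) y.
pose Q (h y : P) := h.1 ^+ 2 * A e1 e1 y + h.1 * h.2 * (A e1 e2 y + A e2 e1 y) + h.2 ^+ 2 * A e2 e2 y.
have DD (h y : P) : U y -> 'D_h ('D_h f) y = Q h y.
  move=> Uy; rewrite deriv_dir; last exact: d2.
  have E v : 'D_v ('D_h f) y = h.1 * A v e1 y + h.2 * A v e2 y.
    rewrite (@near_eq_derive _ _ _ _ (fun z => h.1 *: 'D_e1 f z + h.2 *: 'D_e2 f z)); last first.
      by apply: open_near oU Uy _ => z Uz; exact: deriv_dir (d1 z Uz).
    have dd w : derivable ('D_w f) y v by apply: diff_derivable; exact: d2.
    by rewrite deriveD ?deriveZ//; exact: derivableZ.
  rewrite !E /Q; move: (A e1 e1 y) (A e1 e2 y) (A e2 e1 y) (A e2 e2 y) => a b c d.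
  by ring.
have pi0 : (pi : R) != 0 by rewrite gt_eqF// pi_gt0.
exists (('D_e1 f x, 'D_e2 f x), ((A e1 e1 x - A e2 e2 x) / 4, (A e1 e2 x + A e2 e1 x) / 2)).
move=> e e0; pose d := e / 4.
have d0 : 0 < d by rewrite divr_gt0.
have nearA i j : \forall y \near x, `|A i j y - A i j x| <= d.
  have /cvgrPdist_le/(_ _ d0) H := c2 j i x Ux.
  by apply: filterS H => y H'; rewrite distrC; exact: H'.
have nU : \forall y \near x, U y by exact: open_nbhs_nbhs.
have nall : \forall y \near x, U y /\ (`|A e1 e1 y - A e1 e1 x| <= d /\ (`|A e1 e2 y - A e1 e2 x| <= d /\
     (`|A e2 e1 y - A e2 e1 x| <= d /\ `|A e2 e2 y - A e2 e2 x| <= d))).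
  apply: (filterI nU); apply: (filterI (nearA e1 e1)); apply: (filterI (nearA e1 e2)).
  exact: (filterI (nearA e2 e1) (nearA e2 e2)).
apply: filterS (nbhs_segment nall) => h hQ.
have inU (t : R) : 0 <= t <= 1 -> U (x + t *: h) by move=> /hQ[].
have bnd (t : R) : 0 <= t <= 1 -> `|Q h (x + t *: h) - Q h x| <= e * sqmod h.
  move=> /hQ[_ [q1 [q2 [q3 q4]]]].
  have -> : Q h (x + t *: h) - Q h x = h.1 ^+ 2 * (A e1 e1 (x + t *: h) - A e1 e1 x) +
      h.1 * h.2 * (A e1 e2 (x + t *: h) - A e1 e2 x) + h.1 * h.2 * (A e2 e1 (x + t *: h) - A e2 e1 x) +
      h.2 ^+ 2 * (A e2 e2 (x + t *: h) - A e2 e2 x) by rewrite /Q; move: (A e1 e1 _) (A e1 e2 _) (A e2 e1 _) (A e2 e2 _) (A e1 e1 _) (A e1 e2 _) (A e2 e1 _) (A e2 e2 _) => *; ring.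
  have h12 : `|h.1 * h.2| <= sqmod h.
    exact: norm_prod_le_sqmod.
  have h11 : `|h.1 ^+ 2| <= sqmod h by rewrite ger0_norm ?sqr_ge0// lerDl sqr_ge0.
  have h22 : `|h.2 ^+ 2| <= sqmod h by rewrite ger0_norm ?sqr_ge0// lerDr sqr_ge0.
  have st a b : `|a| <= sqmod h -> `|b| <= d -> `|a * b| <= sqmod h * d.
    by move=> ? ?; rewrite normrM ler_pM.
  have := st _ _ h11 q1; have := st _ _ h12 q2; have := st _ _ h12 q3; have := st _ _ h22 q4.
  move=> s4 s3 s2 s1.
  have -> : e * sqmod h = sqmod h * d + sqmod h * d + sqmod h * d + sqmod h * d by rewrite /d; field.
  exact: (norm_sum4 s1 s2 s3 s4).
have := @taylor1D (fun t => f (x + t *: h)) (fun t => 'D_h f (x + t *: h)) (fun t => Q h (x + t *: h)) (Q h x) (e * sqmod h).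
rewrite scale1r scale0r addr0.
move=> T; apply: le_trans (T _ _ bnd).
- rewrite le_eqVlt; apply/orP; left; apply/eqP; congr (`|_|).
  rewrite (@deriv_dir f x h (d1 _ Ux)).
  rewrite /hquad /ddc /Q /sqmod /= -/e1 -/e2 -/(A e1 e1 x) -/(A e2 e2 x).
  move: (A e1 e1 x) (A e1 e2 x) (A e2 e1 x) (A e2 e2 x) ('D_e1 f x) ('D_e2 f x) (f _) (f x) => *.
  by move: pi0; move: (pi : R) => q q0; field.
- by move=> t t01; apply: derivable_line; exact: d1 (inU t t01).
- by move=> t t01; rewrite -DD; [apply: derivable_line; exact: d2 (inU t t01)|exact: inU].
Qed.

End Taylor.

Lemma near_comp (T U : topologicalType) (g : T -> U) (x : T) (Q : U -> Prop) :
  {for x, continuous g} -> (\forall y \near g x, Q y) -> \forall x' \near x, Q (g x').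
Proof. by move=> cg H; exact: (cg _ H). Qed.

(** * Plurisubharmonicity by test functions on complex lines *)

Section LineSubharmonicity.
Variable R : realType.
Local Notation P := (plane R).

Definition usc_at (T : topologicalType) (F : T -> \bar R) (x : T) :=
  forall r : R, (F x < r%:E)%E -> \forall y \near x, (F y < r%:E)%E.

(** Subharmonicity in the viscosity sense; the value [-oo] is allowed and can never be touched. *)
Definition vsh (U : set P) (F : P -> \bar R) := forall x, U x ->
  [/\ (F x < +oo)%E, usc_at F x & ~ touched F x].

Lemma disc_param (h : P) : sqmod h <= 1 ->
  exists s t : R, 0 <= s <= 1 /\ h = cmul (s, 0) (cis t).
Proof.
move=> h1; have [->|h0] := eqVneq h 0.
  by exists 0, 0; split; [rewrite lexx ler01|apply: plane_eq; rewrite cmulE /=; ring].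
pose s := cnorm h.
have s0 : s != 0 by rewrite cnorm_eq0.
have [|t et] := @circle_param R (cmul (s^-1, 0) h).
  have e : sqmod h = s ^+ 2 by rewrite sqr_cnorm.
  by rewrite sqmodM e /sqmod /= expr0n addr0; field.
exists s, t; split; last first.
  by rewrite -et; apply: plane_eq; rewrite !cmulE /=; field.
by rewrite cnorm_ge0 -(@ler_pXn2r _ 2) ?nnegrE ?cnorm_ge0// sqr_cnorm expr1n.
Qed.

(* [L b h] is the vector [h b] of the complex line through [b]. *)
Record cline (V : normedModType R) (rot : R -> V -> V) (L : V -> P -> V) : Prop := {
  cline_cont : forall b, continuous (L b);
  cline0 : forall b, L b 0 = 0;
  cline_rot : forall b (s t : R), s *: rot t b = L b (cmul (s, 0) (cis t));
  cline_scale : forall b (rho : R) h, L (L b (rho, 0)) h = L b (cmul (rho, 0) h) }.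

Lemma cline_rot1 : cline (@rot1 R) (fun b h => cmul h b).
Proof.
split.
- by move=> b h; apply: hol2_continuous; apply: hol2M; [exact: hol2_id|exact: hol2_cst].
- by move=> b; apply: plane_eq; rewrite cmulE /=; ring.
- by move=> b s t; rewrite /rot1 -/(cis t) !cmulE; apply: plane_eq; rewrite /= /GRing.scale /=; ring.
- by move=> b rho h; apply: plane_eq; rewrite !cmulE /=; ring.
Qed.

Lemma cline_rot2 : cline (@rot2 R) (fun b h => (cmul h b.1, cmul h b.2)).
Proof.
have [c1 z1 r1 s1] := cline_rot1; split.
- by move=> b h; exact: (cvg_pair (c1 b.1 h) (c1 b.2 h)).
- by move=> b; rewrite !z1.
- by move=> b s t; rewrite -!r1.
- by move=> b rho h; rewrite /= !s1.
Qed.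

Variables (V : normedModType R) (rot : R -> V -> V) (L : V -> P -> V).
Hypothesis cL : cline rot L.


Lemma usc_at_line (f : V -> \bar R) a b h : usc_at f (a + L b h) ->
  usc_at (fun k => f (a + L b k)) h.
Proof.
move=> uf r /uf H.
have cc : {for h, continuous (fun k => a + L b k)}.
  by apply: cvgD; [exact: cvg_cst|exact: (cline_cont cL)].
exact: (cc _ H).
Qed.

Lemma psh_not_touched (U : set V) (f : V -> \bar R) a b :
  open U -> psh_on rot U f -> U a -> ~ touched (fun h => f (a + L b h)) 0.
Proof.
move=> oU [ff uf mf] Ua.
have : \forall h \near (0 : P), U (a + L b h).
  have cc : {for (0 : P), continuous (fun k => a + L b k)}.
    by apply: cvgD; [exact: cvg_cst|exact: (cline_cont cL)].
  have : nbhs (a + L b 0) U by rewrite (cline0 cL) addr0; exact: open_nbhs_nbhs.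
  by move/cc.
move=> /near0_sqmod[r0 r00 Hr0].
apply: (@mean_not_touched R _ r0) => //.
  by move=> h hr; apply: usc_at_line => r; apply: uf; exact: Hr0.
move=> rho rho0 rhor; pose b' := L b (rho, 0).
have := mf a b'.
have E (s t : R) : s *: rot t b' = L b (cmul (rho * s, 0) (cis t)).
  rewrite (cline_rot cL) /b' (cline_scale cL); congr (L b _).
  by apply: plane_eq; rewrite !cmulE /=; ring.
have E1 t : rot t b' = L b (cmul (rho, 0) (cis t)).
  by rewrite -[LHS]scale1r E mulr1.
rewrite (cline0 cL) addr0 => H.
have -> : (\int[@lebesgue_measure R]_(t in `[0%R, (2 * pi)%R]%classic) f (a + L b (cmul (rho, 0) (cis t)))%R =
    \int[@lebesgue_measure R]_(t in `[0%R, (2 * pi)%R]%classic) f (a + rot t b')%R)%E.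
  by apply: eq_integral => t _; rewrite E1.
apply: H => s t /andP[s0 s1]; rewrite E; apply: Hr0.
rewrite sqmodM sqmod_cis mulr1 /sqmod /= expr0n addr0.
apply: le_lt_trans rhor; rewrite exprMn ler_piMr ?sqr_ge0//.
by rewrite expr_le1.
Qed.

(** The disc in the definition of [psh_on] is the image of the closed unit disc under
    [h |-> a + L b h], where [circle_mean_ge] yields the mean inequality. *)
Lemma psh_intro (U : set V) (f : V -> \bar R) :
  (forall x, U x -> (f x < +oo)%E) -> (forall x, U x -> usc_at f x) ->
  (forall a b, (forall h, sqmod h <= 1 -> U (a + L b h)) -> forall h, sqmod h < 1 ->
     ~ touched (fun k => f (a + L b k)) h) ->
  psh_on rot U f.
Proof.
move=> ff uf nt; split => //; first by move=> x r Ux; exact: uf.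
move=> a b ab.
have Uh h : sqmod h <= 1 -> U (a + L b h).
  by move=> /disc_param[s [t [s01 ->]]]; rewrite -(cline_rot cL); exact: ab.
have -> : (\int[@lebesgue_measure R]_(t in `[0%R, (2 * pi)%R]%classic) f (a + rot t b)%R =
  \int[@lebesgue_measure R]_(t in `[0%R, (2 * pi)%R]%classic) f (a + L b (cis t))%R)%E.
  apply: eq_integral => t _; congr (f (a + _)).
  rewrite -[LHS]scale1r (cline_rot cL); congr (L b _).
  by apply: plane_eq; rewrite cmulE /=; ring.
have := @circle_mean_ge R (fun h => f (a + L b h)); rewrite (cline0 cL) addr0; apply.
- by move=> x /Uh Ux; apply: usc_at_line; exact: uf.
- by move=> x /Uh; exact: ff.
- by move=> x; exact: nt.
Qed.

End LineSubharmonicity.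

Section Psh1.
Variable R : realType.
Local Notation P := (plane R).

Lemma touched_shift (F : P -> \bar R) a : touched F a -> touched (fun h => F (a + h)) 0.
Proof.
move=> [r [c [e [Fr e0 He]]]]; exists r, c, e; rewrite addr0; split => //.
by apply: filterS He => h; rewrite add0r.
Qed.

Lemma psh1_vsh (U : set P) f : open U -> psh_on (@rot1 R) U f -> vsh U f.
Proof.
move=> oU pf; have [ff uf _] := pf; move=> x Ux; split; [exact: ff|by move=> r; exact: uf|].
move=> /touched_shift tx.
apply: (psh_not_touched (b := (1, 0)) (cline_rot1 R) oU pf Ux).
rewrite (_ : (fun h => _) = fun h => f (x + h))//.
by apply/funext => h; congr (f (x + _)); apply: plane_eq; rewrite cmulE /=; ring.
Qed.

(** The two-variable statement is used with a dummy second coordinate, which forces a separate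
    treatment of lines on which the first coordinate is constant. *)
Lemma touched_comp1 (f : P -> \bar R) (g : P -> P) (x0 : P) (W : set P) :
  open W -> W (g x0) -> vsh W f -> (\forall x \near x0, hol2 g x) ->
  ~ touched (f \o g) x0.
Proof.
move=> oW Wg vf hg.
apply: (@touched_comp R (fun p => f p.1) (fun x => (g x, 0)) x0 [set p | W p.1]).
- by move: oW; rewrite !openE => oW p /oW; exact: near_fst.
- exact: Wg.
- move=> p Wp r; have [_ uf _] := vf _ Wp => /uf /near_fst.
  by apply: filterS => q.
- by move=> p /vf[].
- move=> p b Wp; have [ff uf nt] := vf _ Wp => /= tt.
  (* On such a line the function is constant. A harmonic quadratic sums to zero over the four points
     at distance [s] on the axes, so it cannot stay above [e |h|^2]. *)
  have [b0|b0] := eqVneq b.1 0.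
    case: tt => r [c [e [Fr e0 /near0_sqmod[d d0 Hd]]]].
    move: Fr; rewrite b0 => Fr.
    have Fh h : f (p.1 + cmul h 0) = r%:E.
      by rewrite -Fr; congr (f (_ + _)); apply: plane_eq; rewrite !cmulE /=; ring.
    pose s := Num.sqrt (d / 2).
    have ss : s ^+ 2 = d / 2 by rewrite sqr_sqrtr// divr_ge0// ltW.
    have q (h : P) : sqmod h = d / 2 -> 0 <= hquad c h - e * (d / 2).
      move=> hd; have := Hd h; rewrite hd b0 add0r Fh lee_fin => /(_ ltac:(lra)); lra.
    have sq (a b' : R) : a ^+ 2 + b' ^+ 2 = d / 2 -> sqmod (a, b') = d / 2 by [].
    have := q (s, 0) ltac:(by rewrite /sqmod /= expr0n addr0).
    have := q (- s, 0) ltac:(by rewrite /sqmod /= expr0n addr0 sqrrN).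
    have := q (0, s) ltac:(by rewrite /sqmod /= expr0n add0r).
    have := q (0, - s) ltac:(by rewrite /sqmod /= expr0n add0r sqrrN).
    have : 0 < e * (d / 2) by rewrite mulr_gt0// divr_gt0.
    by rewrite /hquad /=; lra.
  pose g2 k := cmul (k - p.1) (cinv b.1).
  (* on the line through [p.1] in the nonzero direction [b.1] the function is [f] *)
  move: tt => [r [c [e [Fr e0 He]]]].
  apply: nt; exists r.
  pose i := cinv b.1.
  pose L1 := c.1; pose L2 := c.2.
  pose c' : P * P := ((L1.1 * i.1 + L1.2 * i.2, - L1.1 * i.2 + L1.2 * i.1),
    (L2.1 * (i.1 ^+ 2 - i.2 ^+ 2) + L2.2 * (i.1 * i.2),
     - 4 * L2.1 * (i.1 * i.2) + L2.2 * (i.1 ^+ 2 - i.2 ^+ 2))).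
  exists c', (e * sqmod i); split.
  + by rewrite -Fr; congr f; apply: plane_eq; rewrite cmulE /=; ring.
  + by rewrite mulr_gt0// sqmod_gt0 cinv_neq0.
  + have ch : {for (0 : P), continuous (fun k : P => cmul k i)}.
      by apply: hol2_continuous; apply: hol2M; [exact: hol2_id|exact: hol2_cst].
    have z : cmul 0 i = 0 :> P by apply: plane_eq; rewrite cmulE /=; ring.
    have He' : \forall h \near cmul 0 i, (f (p.1 + cmul (0 + h) b.1)%R <= (r + hquad c h - e * sqmod h)%:E)%E by rewrite z.
    apply: filterS (near_comp ch He') => k.
    rewrite add0r.
    have -> : cmul (cmul k i) b.1 = k.
      have -> : cmul (cmul k i) b.1 = cmul k (cmul b.1 i) by apply: plane_eq; rewrite !cmulE /=; ring.
      by rewrite cinv_mulV//; apply: plane_eq; rewrite !cmulE /=; ring.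
    rewrite sqmodM => /le_trans; apply; rewrite lee_fin le_eqVlt; apply/orP; left; apply/eqP.
    by rewrite /hquad /c' /L1 /L2 cmulE /=; ring.
- by apply: filterS hg => x hx; split => //; exact: hol2_cst.
Qed.

End Psh1.

(** * The two affine charts of the projective line *)

Section Charts.
Variable R : realType.
Local Notation P := (plane R).

Lemma chart_cinv (x : P) : x != 0 -> chart false (cinv x) = chart true x.
Proof. by move=> x0; rewrite /chart (negPf (cinv_neq0 x0)) cinvK. Qed.

Lemma chart_cinv' (x : P) : x != 0 -> chart true (cinv x) = chart false x.
Proof. by move=> x0; rewrite /chart (negPf x0). Qed.

Lemma near_neq0 (x : P) : x != 0 -> \forall y \near x, y != 0.
Proof.
rewrite -sqmod_gt0 => x0; have := @continuous_sqmod R x => cs.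
have H : \forall y \near x, 0 < sqmod y.
  by have H0 := cs _ (open_nbhs_nbhs (conj (@open_gt R 0) x0)).
by apply: filterS H => y; rewrite -sqmod_gt0.
Qed.

Lemma continuous_cinv (x : P) : x != 0 -> {for x, continuous (@cinv R)}.
Proof. by move=> x0; apply: hol2_continuous; exact: hol2_cinv. Qed.

(** At infinity this says that inversion exchanges complements of compact sets with neighbourhoods
    of [0]; elsewhere it is the continuity of inversion. *)
Lemma near_chart c (x : P) (Q : P1 R -> Prop) :
  (\forall z \near chart c x, Q z) <-> (\forall y \near x, Q (chart c y)).
Proof.
case: c; first by [].
rewrite {1}/chart; have [->|x0] := eqVneq x 0.
  split.
    move=> [C [cC clC] CQ].
    have [B B0 CB] : exists2 B : R, 0 < B & forall x, C x -> sqmod x <= B.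
      have [[k Ck]|Ce] := pselect (C !=set0); last first.
        by exists 1 => // y Cy; exfalso; apply: Ce; exists y.
      have [|m Cm mB] := @compact_EVT_max _ _ (@sqmod R) C (ex_intro _ k Ck) cC.
        by apply: continuous_subspaceT => y; exact: continuous_sqmod.
      exists (1 + sqmod m); first by have := sqmod_ge0 m; lra.
      by move=> y Cy; have := mB y (mem_set Cy); lra.
    apply/near0_sqmod; exists B^-1; first by rewrite invr_gt0.
    move=> h hB; apply: CQ; rewrite /chart; have [h0|h0] := eqVneq h 0; first by right.
    left; exists (cinv h) => // /CB; rewrite sqmod_cinv leNgt => /negP; apply.
    by rewrite -[ltLHS]invrK ltf_pV2// posrE ?invr_gt0// sqmod_gt0.
  move=> /near0_sqmod[r r0 rQ].
  exists (cdisc 0 r^-1); first by split; [exact: compact_cdisc|exact: closed_cdisc].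
  move=> _ [[y ny <-]|->].
    have yr : r^-1 < sqmod y by rewrite ltNge; apply/negP => h; apply: ny; rewrite /cdisc /= subr0.
    have y0 : y != 0 by rewrite -sqmod_gt0; apply: lt_trans yr; rewrite invr_gt0.
    rewrite -[Some y]/(chart true y) -chart_cinv//; apply: rQ.
    by rewrite sqmod_cinv -[ltRHS]invrK ltf_pV2// posrE ?invr_gt0// sqmod_gt0.
  by have := rQ 0; rewrite sqmod0 => /(_ r0); rewrite /chart eqxx.
split => H.
  have H' : \forall y \near cinv x, Q (Some y) by [].
  have := continuous_cinv x0 H'; apply: filterS2 (near_neq0 x0) => y y0 /=.
  by rewrite /chart (negPf y0).
have i0 := cinv_neq0 x0.
have H' : \forall y \near cinv (cinv x), Q (chart false y) by rewrite cinvK.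
have /= := continuous_cinv i0 H'.
suff S : (\forall z \near cinv x, Q (chart false (cinv z))) -> \forall z \near cinv x, Q (Some z) by exact: S.
move=> H2; apply: filterS2 (near_neq0 i0) H2 => y y0.
by rewrite chart_cinv.
Qed.

Lemma chart_inj c : injective (@chart R c).
Proof.
case: c => x y; first by case.
rewrite /chart; have [->|x0] := eqVneq x 0; have [->|y0] := eqVneq y 0 => //.
by move=> E; have E' := @Some_inj _ _ _ E; rewrite -(cinvK x) E' cinvK.
Qed.

Lemma P1_chart_false (z : P1 R) : z <> P1zero R -> exists x, z = chart false x.
Proof.
case: z => [x|] zn0; last by exists 0; rewrite /chart eqxx.
have x0 : x != 0 by apply/eqP => x0; apply: zn0; rewrite x0.
by exists (cinv x); rewrite chart_cinv.
Qed.

Lemma chart_false_neq0 (x : P) : chart false x <> P1zero R.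
Proof.
rewrite /chart /P1zero; case: eqP => // /eqP x0 E; have := cinv_neq0 x0.
by have -> := @Some_inj _ _ _ E; rewrite eqxx.
Qed.

End Charts.

(** * Potentials of the Fubini-Study form *)

Section Potentials.
Variable R : realType.
Local Notation P := (plane R).

Definition pot (x : P) : R := ln (1 + sqmod x).

Lemma Ck_on_coord k (U : set P) : open U ->
  Ck_on k U (fun x : P => x.1) /\ Ck_on k U (fun x : P => x.2).
Proof.
move=> oU; split.
  by apply: (@Ck_on_linear _ _ _ k U (@fst R R)) => x; exact: cvg_fst.
by apply: (@Ck_on_linear _ _ _ k U (@snd R R)) => x; exact: cvg_snd.
Qed.

Lemma Ck_on_sqmod k (U : set P) : open U -> Ck_on k U (@sqmod R).
Proof.
move=> oU; have [c1 c2] := Ck_on_coord k oU.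
exact: (Ck_onD oU (Ck_onM oU c1 c1) (Ck_onM oU c2 c2)).
Qed.

Lemma smooth_pot (U : set P) : open U -> smooth_on U pot.
Proof.
move=> oU k; apply: Ck_on_ln => //.
  by move=> x _; have := sqmod_ge0 x; lra.
by apply: Ck_onD => //; [exact: Ck_on_cst|exact: Ck_on_sqmod].
Qed.

Lemma FS_pot : FS_potential [set: P] pot.
Proof. by split; [apply: smooth_pot; exact: openT|]. Qed.

Lemma pot_ge0 x : 0 <= pot x.
Proof. by apply: ln_ge0; rewrite lerDl sqmod_ge0. Qed.

Lemma continuous_pot : continuous pot.
Proof. by move=> x; have := smooth_pot (@openT _) 0%N; apply. Qed.

Lemma pot_cinv x : x != 0 -> pot (cinv x) = pot x - ln (sqmod x).
Proof.
rewrite -sqmod_gt0 => x0; rewrite /pot sqmod_cinv -ln_div ?posrE//; last first.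
  by have := sqmod_ge0 x; lra.
by congr ln; field; rewrite gt_eqF.
Qed.

Lemma pot_ge_ln x : x != 0 -> ln (sqmod x) <= pot x.
Proof.
by rewrite -sqmod_gt0 => x0; rewrite /pot ler_ln ?posrE//; have := sqmod_ge0 x; lra.
Qed.

Lemma pot_le_ln x : 1 <= sqmod x -> pot x <= ln (sqmod x) + ln 2.
Proof.
move=> x1; rewrite -lnM ?posrE//; last lra.
by rewrite /pot ler_ln ?posrE//; lra.
Qed.

Lemma jetB (f g : P -> R) x m : jet f x m -> jet g x m -> hjet (fun y => f y - g y) x.
Proof.
move=> [c fc] [d gd]; exists (c - d) => e e0.
have e2 : 0 < e / 2 by rewrite divr_gt0.
apply: filterS2 (fc _ e2) (gd _ e2) => h h1 h2.
have -> : f (x + h) - g (x + h) - (f x - g x) - hquad (c - d) h =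
  (f (x + h) - f x - hquad c h - m * sqmod h) - (g (x + h) - g x - hquad d h - m * sqmod h).
  by rewrite /hquad /=; ring.
by apply: le_trans (ler_normB _ _) _; lra.
Qed.

Lemma jetD (f g : P -> R) x m n : jet f x m -> jet g x n -> jet (fun y => f y + g y) x (m + n).
Proof.
move=> [c fc] [d gd]; exists (c + d) => e e0.
have e2 : 0 < e / 2 by rewrite divr_gt0.
apply: filterS2 (fc _ e2) (gd _ e2) => h h1 h2.
have -> : f (x + h) + g (x + h) - (f x + g x) - hquad (c + d) h - (m + n) * sqmod h =
  (f (x + h) - f x - hquad c h - m * sqmod h) + (g (x + h) - g x - hquad d h - n * sqmod h).
  by rewrite /hquad /=; ring.
by apply: le_trans (ler_normD _ _) _; lra.
Qed.

Lemma jet0_hjet (f : P -> R) x : jet f x 0 -> hjet f x.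
Proof.
move=> [c fc]; exists c => e e0; apply: filterS (fc e e0) => h.
by rewrite mul0r subr0.
Qed.

Lemma jet_sqmodB (k : R) (p x : P) : jet (fun y => k * sqmod (y - p)) x k.
Proof.
exists ((2 * k * (x.1 - p.1), 2 * k * (x.2 - p.2)), (0, 0)) => e e0; near=> h.
rewrite (_ : _ - k * sqmod h = 0); last by rewrite /hquad /sqmod /=; ring.
by rewrite normr0 mulr_ge0 ?sqmod_ge0// ltW.
Unshelve. all: by end_near. Qed.

(** The sum over the four points at distance [a] on the axes kills every harmonic quadratic, so
    [m |h|^2] with [m > 0] cannot lie below one of them minus [e |h|^2]. *)
Lemma jet_pos_not_touched (f : P -> R) x m : jet f x m -> 0 < m ->
  ~ touched (fun y => (f y)%:E) x.
Proof.
move=> [c fc] m0 [r [d [e [[fr] e0 He]]]].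
have /near0_sqmod[s s0 Hs] : \forall h \near (0 : P),
    hquad (c - d) h <= - e * sqmod h.
  have H := fc m m0; apply: filterS2 He H => h; rewrite lee_fin ler_norml => h1 /andP[h2 _].
  rewrite (_ : hquad (c - d) h = hquad c h - hquad d h); last by rewrite /hquad /=; ring.
  lra.
pose a := Num.sqrt (s / 2).
have aa : a ^+ 2 = s / 2 by rewrite sqr_sqrtr// divr_ge0// ltW.
have es : 0 < e * (s / 2) by rewrite mulr_gt0// divr_gt0.
have q (h : P) : sqmod h = s / 2 -> hquad (c - d) h <= - (e * (s / 2)).
  by move=> hs; have := Hs h; rewrite hs => /(_ ltac:(lra)); rewrite mulNr.
have := q (a, 0) ltac:(by rewrite /sqmod /= expr0n addr0).
have := q (- a, 0) ltac:(by rewrite /sqmod /= expr0n addr0 sqrrN).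
have := q (0, a) ltac:(by rewrite /sqmod /= expr0n add0r).
have := q (0, - a) ltac:(by rewrite /sqmod /= expr0n add0r sqrrN).
by rewrite /hquad /=; lra.
Qed.

(** Two potentials of the same form differ by a harmonic function, so testing with the global
    potential [pot] suffices. *)
Lemma FS_hjet (U : set P) u x : open U -> U x -> FS_potential U u ->
  hjet (fun y => u y - pot y) x.
Proof.
move=> oU Ux [su du]; have j1 := taylor2 oU Ux su.
have j2 := taylor2 oU Ux (smooth_pot oU).
by apply: jetB j1 _; rewrite (du x Ux).
Qed.

Lemma derive_quad (f : P -> R) (x v : P) a k :
  (forall h : R, f (h *: v + x) = f x + h * a + h ^+ 2 * k) -> 'D_v f x = a.
Proof.
move=> H; rewrite /derive; apply: cvg_lim => //.
have E : {near 0^', (fun h : R => a + h * k) =1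
    (fun h => h^-1 *: ((f \o shift x) (h *: v) - f x))}.
  near=> h.
  have h0 : h != 0 by near: h; exact: nbhs_dnbhs_neq.
  by rewrite /= H /GRing.scale /=; field.
apply: cvg_trans (near_eq_cvg E) _.
have : {for (0 : R), continuous (fun h : R => a + h * k)}.
  by apply: continuousD; [exact: cst_continuous|apply: continuousM => //; exact: cst_continuous].
rewrite /prop_for /continuous_at /= mul0r addr0 => c.
by apply: cvg_trans c; apply: cvg_app; exact: nbhs_dnbhs.
Unshelve. all: by end_near. Qed.

Lemma derive_sqmod (y v : P) : 'D_v (@sqmod R) y = 2 * (v.1 * y.1 + v.2 * y.2).
Proof.
by apply: (@derive_quad _ _ _ _ (sqmod v)) => h; rewrite /sqmod /= /GRing.scale /=; ring.
Qed.

Lemma hjet_ln (x : P) : x != 0 -> hjet (fun y => ln (sqmod y)) x.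
Proof.
move=> x0.
pose U : set P := [set y | 0 < sqmod y].
have oU : open U.
  apply: (@open_comp _ _ (@sqmod R) [set t | 0 < t]); last exact: open_gt.
  by move=> y _; exact: continuous_sqmod.
have Ux : U x by rewrite /U /= sqmod_gt0.
have sl : smooth_on U (fun y => ln (sqmod y)).
  by move=> k; apply: Ck_on_ln => //; exact: Ck_on_sqmod.
have ds y : U y -> differentiable (@sqmod R) y by move=> Uy; have [H _] := Ck_on_sqmod 1 oU; exact: H.
have D1 v y : U y -> 'D_v (fun y => ln (sqmod y)) y = 2 * (v.1 * y.1 + v.2 * y.2) * (sqmod y)^-1.
  by move=> Uy; have [_ ->] := derive_ln v Uy (ds y Uy); rewrite derive_sqmod.
pose l (v y : P) : R := 2 * (v.1 * y.1 + v.2 * y.2).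
have D2 v : 'D_v ('D_v (fun y => ln (sqmod y))) x = 2 * (v.1 ^+ 2 + v.2 ^+ 2) / sqmod x - (l v x) ^+ 2 / sqmod x ^+ 2.
  rewrite (@near_eq_derive _ _ _ _ (fun y => l v y * (sqmod y)^-1)); last first.
    by apply: open_near oU Ux _ => y Uy; exact: D1.
  have [c1 c2] := Ck_on_coord 1%N (@openT P).
  have dl : differentiable (l v) x.
    have C2 := @Ck_on_cst R P R 1 setT.
    have : Ck_on 1 setT (l v).
      exact: (Ck_onM openT (C2 _) (Ck_onD openT (Ck_onM openT (C2 _) c1) (Ck_onM openT (C2 _) c2))).
    by case=> H _; exact: H.
  have dV : differentiable (fun y => (sqmod y)^-1) x.
    by apply: differentiableV; [exact: ds|exact: lt0r_neq0].
  have Dl : 'D_v (l v) x = 2 * (v.1 ^+ 2 + v.2 ^+ 2).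
    by apply: (@derive_quad _ _ _ _ 0) => h; rewrite /l /= /GRing.scale /=; ring.
  rewrite deriveM; [|exact: diff_derivable|exact: diff_derivable].
  rewrite deriveV; [|exact: lt0r_neq0|by apply: diff_derivable; exact: ds].
  rewrite derive_sqmod Dl -/(l v x) /GRing.scale /=.
  have := Ux; rewrite /U /=; move: (l v x) (sqmod x) => q s s0; field; exact: lt0r_neq0.
apply: jet0_hjet; have := taylor2 oU Ux sl.
suff -> : ddc (fun y => ln (sqmod y)) x = 0 by rewrite mulr0.
have s0 : sqmod x != 0 by rewrite sqmod_eq0.
rewrite /ddc !D2 /l /=; move: s0; rewrite /sqmod => s0.
have -> : 2 * (1 ^+ 2 + 0 ^+ 2) / (x.1 ^+ 2 + x.2 ^+ 2) - (2 * (1 * x.1 + 0 * x.2)) ^+ 2 / (x.1 ^+ 2 + x.2 ^+ 2) ^+ 2 +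
   (2 * (0 ^+ 2 + 1 ^+ 2) / (x.1 ^+ 2 + x.2 ^+ 2) - (2 * (0 * x.1 + 1 * x.2)) ^+ 2 / (x.1 ^+ 2 + x.2 ^+ 2) ^+ 2) = 0.
  by field.
by rewrite mul0r.
Qed.

Lemma vsh_psh1 (U : set P) f : open U -> vsh U f -> psh_on (@rot1 R) U f.
Proof.
move=> oU vf; apply: (psh_intro (cline_rot1 R)).
- by move=> x /vf[].
- by move=> x /vf[].
- move=> a b ab h h1.
  apply: (@touched_comp1 R f (fun k => a + cmul k b) h U) => //; first by apply: ab; exact: ltW.
  by near=> k; apply: hol2D; [exact: hol2_cst|apply: hol2M; [exact: hol2_id|exact: hol2_cst]].
Unshelve. all: by end_near. Qed.

Lemma usc_at_addr (T : topologicalType) (F : T -> \bar R) (g : T -> R) x :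
  usc_at F x -> {for x, continuous g} -> usc_at (fun y => F y + (g y)%:E)%E x.
Proof.
move=> uF cg r; rewrite -lteBrDr// => /ereal_between[s Fs sr].
have e0 : 0 < r - g x - s by lra.
have := cg => /cvgrPdist_lt/(_ _ e0) gx.
apply: filterS2 gx (uF s Fs) => y gy Fy; rewrite -lteBrDr//.
apply: lt_trans Fy _; rewrite lte_fin.
by move: gy; rewrite ltr_distl => /andP[]; lra.
Qed.

Lemma near_usc_at (T : topologicalType) (F G : T -> \bar R) x :
  (\forall y \near x, F y = G y) -> usc_at F x -> usc_at G x.
Proof.
move=> FG uF r; rewrite -(nbhs_singleton FG) => /uF H.
by apply: filterS2 FG H => y ->.
Qed.

End Potentials.

Section NearReal.
Variables (R : realType) (T : topologicalType) (k : T -> R) (x : T) (c : R).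

Lemma near_lt : {for x, continuous k} -> k x < c -> \forall y \near x, k y < c.
Proof.
by move=> ck kx; apply: (@near_comp _ _ k x (fun z => z < c) ck); exact: open_nbhs_nbhs (conj (@open_lt R c) kx).
Qed.

Lemma near_gt : {for x, continuous k} -> c < k x -> \forall y \near x, c < k y.
Proof.
by move=> ck kx; apply: (@near_comp _ _ k x (fun z => c < z) ck); exact: open_nbhs_nbhs (conj (@open_gt R c) kx).
Qed.

End NearReal.

(** * The Hele-Shaw envelopes *)

Section HeleShawClass.
Variables (R : realType) (phi : P1 R -> R).
Hypothesis hphi : kahler_potential phi.
Local Notation P := (plane R).

(** The obstacle in the coordinate [w = 1/z] once the potential is added; [hphi] makes it strictly
    subharmonic. *)
Definition phat (x : P) : R := phi (chart false x) + pot x.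

Lemma phatE x : phat x = phi (chart false x) + pot x. Proof. by []. Qed.

(* The candidates for the Hele-Shaw envelope in the coordinate [1 / z], with the
   potential of the Fubini-Study form added; the Lelong number at [z = 0] is the
   growth condition at infinity. *)
Definition HSc (t : R) (u : P -> \bar R) :=
  [/\ vsh setT u, forall x, (u x <= (phat x)%:E)%E &
      forall t', t' < t -> exists C B : R, forall x, B <= sqmod x ->
        (u x <= ((1 - t') * ln (sqmod x) + C)%:E)%E].

Lemma ln_cinv (x : P) : x != 0 -> ln (sqmod (cinv x)) = - ln (sqmod x).
Proof. by rewrite -sqmod_gt0 => x0; rewrite sqmod_cinv lnV// posrE. Qed.

Lemma continuous_phi c : continuous (fun x : P => phi (chart c x)).
Proof. by move=> x; have [/(_ c 0%N) + _] := hphi; apply. Qed.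

Lemma continuous_phat : continuous phat.
Proof. by move=> x; apply: cvgD; [exact: continuous_phi|exact: continuous_pot]. Qed.

Lemma chart_disc (z : P1 R) : exists c x, z = chart c x /\ sqmod x <= 1.
Proof.
case: z => [x|]; last by exists false, 0; rewrite /chart eqxx sqmod0 ler01.
have [x1|x1] := leP (sqmod x) 1; first by exists true, x.
have x0 : x != 0 by rewrite -sqmod_gt0; lra.
exists false, (cinv x); rewrite chart_cinv// sqmod_cinv; split => //.
by rewrite invf_le1//; lra.
Qed.

Lemma phi_bounded : exists2 M, 0 <= M & forall z, `|phi z| <= M.
Proof.
have H c : exists M : R, forall x : P, sqmod x <= 1 -> `|phi (chart c x)| <= M.
  have [||m _ mB] := @compact_EVT_max _ _ (fun x => `|phi (chart c x)|) (cdisc (0 : P) 1) _ (@compact_cdisc R 0 1).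
  - by exists 0; rewrite /cdisc /= subrr sqmod0 ler01.
  - by apply: continuous_subspaceT => y; apply: cvg_norm; exact: continuous_phi.
  - exists `|phi (chart c m)| => x x1; apply: mB; apply/mem_set.
    by rewrite /cdisc /= subr0.
have [M1 H1] := H true; have [M2 H2] := H false.
have M10 : 0 <= M1 by apply: le_trans (H1 0 _) => //; rewrite sqmod0 ler01.
have M20 : 0 <= M2 by apply: le_trans (H2 0 _) => //; rewrite sqmod0 ler01.
exists (M1 + M2); first by rewrite addr_ge0.
by move=> z; have [[] [x [-> x1]]] := chart_disc z; [have := H1 x x1|have := H2 x x1]; lra.
Qed.

(** With [w = 1/z] the bound [s ln |z|^2 + C] becomes [- s ln |w|^2 + C], and [pot] adds at most
    [ln |w|^2 + ln 2]. A smaller [t'] appears because the supremum in the Lelong number need not be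
    attained. *)
Lemma HSc_of_candidate t (psi : P1 R -> \bar R) : omega_psh psi ->
  (forall y, (psi y <= (phi y)%:E)%E) -> (t%:E <= lelong0 psi)%E ->
  HSc t (fun x => psi (chart false x) + (pot x)%:E)%E.
Proof.
move=> [_ pp] ple tl; split.
- exact: psh1_vsh openT (pp false setT _ openT (FS_pot R)).
- by move=> x; rewrite /phat EFinD leeD2r.
- move=> t' tt'.
  have : (t'%:E < lelong0 psi)%E by apply: lt_le_trans tl; rewrite lte_fin.
  move=> /ereal_sup_gt[_ [s [C /near0_sqmod[r r0 HC]] <-]]; rewrite lte_fin => st.
  exists (C + ln 2), (1 + r^-1) => y yB.
  have ri : 0 < r^-1 by rewrite invr_gt0.
  have y0 : 0 < sqmod y by lra.
  have yn : y != 0 by rewrite -sqmod_gt0.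
  have := HC (cinv y); rewrite sqmod_cinv -[in X in X -> _](invrK r) ltf_pV2 ?posrE// => /(_ ltac:(lra)).
  rewrite -sqmod_cinv lne_EFin; last by rewrite sqmod_cinv invr_gt0.
  rewrite chart_cinv'// ln_cinv// => H.
  apply: (@le_trans _ _ ((s * - ln (sqmod y) + C)%:E + (pot y)%:E)%E).
    by apply: leeD2r; exact: H.
  rewrite -EFinD lee_fin.
  have := @pot_le_ln R y ltac:(lra).
  have l0 : 0 <= ln (sqmod y) by apply: ln_ge0; lra.
  have : t' * ln (sqmod y) <= s * ln (sqmod y) by rewrite ler_wpM2r// ltW.
  lra.
Qed.

Section CandidateOf.
Variables (t : R) (u : P -> \bar R).
Hypotheses (t0 : 0 < t) (hu : HSc t u).

(** This moves [u] back to the projective line. The value [-oo] at [z = 0] is the one that a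
    positive Lelong number dictates. *)
Definition psi_of (z : P1 R) : \bar R :=
  if z is Some x then
    if x == 0 then -oo%E else (u (cinv x) - (pot (cinv x))%:E)%E
  else u 0.

Lemma psi_of_false x : psi_of (chart false x) = (u x - (pot x)%:E)%E.
Proof.
rewrite /chart; have [->|x0] := eqVneq x 0.
  by rewrite /psi_of /pot sqmod0 addr0 ln1 sube0.
by rewrite /psi_of (negPf (cinv_neq0 x0)) cinvK.
Qed.

Lemma psi_of_true x : psi_of (chart true x) =
  if x == 0 then -oo%E else (u (cinv x) - (pot (cinv x))%:E)%E.
Proof. by []. Qed.

Lemma psi_of_near0 t' : t' < t -> exists C, \forall x \near (0 : P),
  (psi_of (chart true x) <= t'%:E * lne (sqmod x)%:E + C%:E)%E.
Proof.
move=> tt'; have [_ _ /(_ t' tt')[C [B H]]] := hu.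
exists C; apply/near0_sqmod; exists (1 + `|B|)^-1.
  by rewrite invr_gt0; have := normr_ge0 B; lra.
move=> x xB; rewrite psi_of_true.
have [->|x0] := eqVneq x 0; first by rewrite leNye.
have s0 : 0 < sqmod x by rewrite sqmod_gt0.
have BB : B <= sqmod (cinv x).
  rewrite sqmod_cinv; apply: (@le_trans _ _ (1 + `|B|)); first by have := ler_norm B; lra.
  by rewrite -[leLHS]invrK lef_pV2 ?posrE ?invr_gt0//; have := normr_ge0 B; lra.
rewrite lne_EFin//; have := H _ BB; rewrite ln_cinv// => uB.
rewrite leeBlDr//; apply: le_trans uB _; rewrite -EFinM -!EFinD lee_fin.
have := pot_ge_ln (cinv_neq0 x0); rewrite ln_cinv//.
lra.
Qed.

Lemma psi_of_lelong : (t%:E <= lelong0 psi_of)%E.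
Proof.
apply/lee_subgt0Pr => e e0; rewrite -EFinB.
apply: ereal_sup_ubound; exists (t - e) => //.
by apply: psi_of_near0; lra.
Qed.

Lemma psi_of_le y : (psi_of y <= (phi y)%:E)%E.
Proof.
have [_ ule _] := hu.
have [->|/P1_chart_false[x ->]] := pselect (y = P1zero R).
  by rewrite /psi_of /= eqxx leNye.
by rewrite psi_of_false leeBlDr// -EFinD.
Qed.

(** In the chart [z] the function is [u (1/z) + ln |z|^2] up to a difference of potentials, hence
    untouched away from [0]. At [z = 0] it equals [-oo], which cannot be touched, and the growth
    bound makes it tend to [-oo] there. *)
Lemma psi_of_omega_psh : omega_psh psi_of.
Proof.
have [vu ule gu] := hu.
split; first by move=> z; apply: le_lt_trans (psi_of_le z) _; exact: ltry.
move=> c U v oU [sv dv]; apply: vsh_psh1 => // x Ux.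
have cv : {for x, continuous v} by have := sv 0%N; apply.
split.
- apply: le_lt_trans (_ : ((phi (chart c x))%:E + (v x)%:E)%E < +oo)%E; last exact: ltry.
  by apply: leeD2r; exact: psi_of_le.
- case: c; last first.
    rewrite (_ : (fun x => _) = (fun x => u x + (v x - pot x)%:E)%E); last first.
      by apply/funext => y; rewrite psi_of_false EFinB addeAC -addeA.
    apply: usc_at_addr; first by have [_ + _] := vu x I.
    by apply: continuousB => //; exact: continuous_pot.
  have [x0|x0] := eqVneq x 0; last first.
    apply: usc_at_addr => //.
    apply: (@near_usc_at R _ (fun y => u (cinv y) + (- pot (cinv y))%:E)%E).
      by apply: filterS (near_neq0 x0) => y y0; rewrite psi_of_true (negPf y0) EFinN.
    apply: (@usc_at_addr R _ (fun y => u (cinv y)) (fun y => - pot (cinv y))).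
      by move=> r ur; have [_ /(_ _ ur) H _] := vu (cinv x) I; exact: near_comp (continuous_cinv x0) H.
    apply: continuousN; apply: continuous_comp; first exact: continuous_cinv.
    exact: continuous_pot.
  move: Ux cv; rewrite x0 => Ux cv r _.
  have t2 : t / 2 < t by move: t0; lra.
  have [C HC] := psi_of_near0 t2.
  have Hv : \forall y \near (0 : P), v y < v 0 + 1.
    by apply: near_lt => //; lra.
  pose L := (r - v 0 - 1 - C) / (t / 2).
  have Hs : \forall y \near (0 : P), sqmod y < expR L.
    by apply/near0_sqmod; exists (expR L) => //; exact: expR_gt0.
  apply: filterS3 HC Hv Hs => y h1 h2 h3.
  have [y0|y0] := eqVneq y 0; first by rewrite psi_of_true y0 eqxx ltNyr.
  have s0 : 0 < sqmod y by rewrite sqmod_gt0.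
  apply: le_lt_trans (leeD2r _ h1) _.
  rewrite lne_EFin// -EFinM -!EFinD lte_fin.
  have : ln (sqmod y) < L by rewrite -[ltRHS]expRK ltr_ln ?posrE ?expR_gt0.
  have t20 : 0 < t / 2 by move: t0; lra.
  rewrite /L ltr_pdivlMr//; move: (ln (sqmod y)) => l; lra.
- have hv : hjet (fun y => v y - pot y) x := FS_hjet oU Ux (conj sv dv).
  case: c.
    have [x0|x0] := eqVneq x 0.
      by move=> [r [? [? []]]]; rewrite psi_of_true x0 eqxx.
    move=> T.
    have T1 : touched (fun y => u (cinv y) + (v y - pot y + ln (sqmod y))%:E)%E x.
      apply: near_touched T; apply: filterS (near_neq0 x0) => y y0.
      rewrite psi_of_true (negPf y0) pot_cinv// -EFinN -addeA -EFinD.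
      by congr (_ + _%:E)%E; ring.
    have := hjet_touched (hjetD hv (hjet_ln x0)) T1.
    apply: (@touched_comp1 _ u (@cinv R) x setT openT I) => //.
    by apply: filterS (near_neq0 x0) => y; exact: hol2_cinv.
  rewrite (_ : (fun x => _) = (fun x => u x + (v x - pot x)%:E)%E); last first.
    by apply/funext => y; rewrite psi_of_false EFinB addeAC -addeA.
  by move/(hjet_touched hv); have [] := vu x I.
Qed.

End CandidateOf.

Definition hs (t : R) (x : P) : \bar R := ereal_sup [set u x | u in HSc t].

Lemma HS_envelope_hs t x : 0 < t ->
  HS_envelope phi t (chart false x) = (hs t x - (pot x)%:E)%E.
Proof.
move=> t0; apply/eqP; rewrite eq_le; apply/andP; split.
  apply: ge_ereal_sup => _ [psi [pp ple pl] <-]; rewrite leeBrDr//.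
  apply: ereal_sup_ubound; exists (fun x => psi (chart false x) + (pot x)%:E)%E => //.
  exact: HSc_of_candidate.
rewrite leeBlDr//; apply: ge_ereal_sup => _ [u uc <-].
rewrite -leeBlDr// -psi_of_false; apply: ereal_sup_ubound.
exists (psi_of u) => //; split; [exact: psi_of_omega_psh uc|exact: psi_of_le uc|exact: psi_of_lelong uc].
Qed.

Lemma HS_flowE t x : 0 < t ->
  HS_flow phi t (chart false x) <-> (hs t x < (phat x)%:E)%E.
Proof. by move=> t0; rewrite /HS_flow /= HS_envelope_hs// lteBlDr// -EFinD. Qed.

(** A positive Lelong number makes every candidate [-oo] at this point. *)
Lemma HS_flow0 t : 0 < t -> HS_flow phi t (P1zero R).
Proof.
move=> t0; rewrite /HS_flow /=; apply: (@le_lt_trans _ _ -oo%E); last exact: ltNyr.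
apply: ge_ereal_sup => _ [psi [_ _ tl] <-].
have : (0%:E < lelong0 psi)%E by apply: lt_le_trans tl; rewrite lte_fin.
move=> /ereal_sup_gt[_ [s [C /nbhs_singleton H] <-]]; rewrite lte_fin => s0.
by apply: le_trans H _; rewrite sqmod0 le0_lneNy// gt0_muleNy.
Qed.

Lemma hs_le_phat t x : (hs t x <= (phat x)%:E)%E.
Proof. by apply: ge_ereal_sup => _ [u [_ ule _] <-]. Qed.

Lemma hs_ge t u x : HSc t u -> (u x <= hs t x)%E.
Proof. by move=> uc; apply: ereal_sup_ubound; exists u. Qed.

Lemma phat_jet x : jet phat x (pi * (omegaFS x + ddc (fun y => phi (chart false y)) x)).
Proof.
have [sp _] := hphi.
have j1 := taylor2 openT I (sp false : smooth_on [set: P] _).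
have j2 := taylor2 openT I (smooth_pot (@openT P)).
by have := jetD (j1 x) (j2 x); rewrite addrC -mulrDr.
Qed.

End HeleShawClass.

Section Touched2.
Variable R : realType.
Local Notation P := (plane R).
Implicit Types F G : P -> \bar R.

Lemma touched_translate F x k : touched (fun k => F (x + k)) k -> touched F (x + k).
Proof.
move=> [r [c [e [Fr e0 He]]]]; exists r, c, e; split => //.
by apply: filterS He => h; rewrite addrA.
Qed.

Lemma touched_le F G x : (\forall y \near x, (F y <= G y)%E) -> F x = G x ->
  touched G x -> touched F x.
Proof.
move=> /nearD0 FG E [r [c [e [Gr e0 He]]]]; exists r, c, e; split; rewrite ?E//.
by apply: filterS2 FG He => h; exact: le_trans.
Qed.

Lemma touched_affine F x (a b : R) : 0 < a ->
  touched (fun y => a%:E * F y + b%:E)%E x -> touched F x.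
Proof.
move=> a0 [r [c [e [Fr e0 He]]]].
have [s Fs] : exists s, F x = s%:E.
  move: Fr; case: (F x) => [s||]; first by exists s.
    by rewrite gt0_muley.
  by rewrite gt0_muleNy.
exists s, ((c.1.1 / a, c.1.2 / a), (c.2.1 / a, c.2.2 / a)), (e / a); split => //.
  by rewrite divr_gt0.
have re : a * s + b = r by move: Fr; rewrite Fs -EFinM -EFinD => -[].
rewrite -re in He; apply: filterS He => h; case: (F (x + h)) => [v||].
- rewrite -EFinM -EFinD !lee_fin => H; rewrite -(ler_pM2l a0).
  apply: le_trans (_ : a * s + hquad c h - e * sqmod h <= _); first by move: H; rewrite -subr_ge0; lra.
  rewrite le_eqVlt; apply/orP; left; apply/eqP; rewrite /hquad /=; field.
  exact: lt0r_neq0.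
- by rewrite gt0_muley// addye.
- by rewrite leNye.
Qed.

Lemma usc_at_scale F x (a : R) : 0 < a -> (F x < +oo)%E -> usc_at F x ->
  usc_at (fun y => a%:E * F y)%E x.
Proof.
move=> a0 Fx uF r; rewrite -lte_pdivlMl// -EFinM => /uF.
by apply: filterS => y; rewrite EFinM lte_pdivlMl.
Qed.

Lemma usc_in_at K F : (forall x, K x -> usc_at F x) -> usc_in K F.
Proof. by move=> H x Kx r /(H x Kx); apply: filterS. Qed.

End Touched2.

(** * Growth, regularity, interpolation and comparison for the envelopes *)

Section Envelope.
Variables (R : realType) (phi : P1 R -> R).
Hypothesis hphi : kahler_potential phi.
Local Notation P := (plane R).
Local Notation phat := (phat phi).
Local Notation HSc := (HSc phi).
Local Notation hs := (hs phi).

(** The supremum inherits the growth only if one constant serves all candidates. The maximum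
    principle on an annulus gives it for each [t' < t] with a bound that does not depend on [t'],
    and then [t'] tends to [t]. *)
Lemma HSc_growth t : exists C, forall u, HSc t u -> forall x, 1 <= sqmod x ->
  (u x <= ((1 - t) * ln (sqmod x) + C)%:E)%E.
Proof.
have [M M0 HM] := phi_bounded hphi.
exists (M + ln 2) => u [vu ule gu].
suff H t' x : t' < t -> 1 <= sqmod x -> (u x <= ((1 - t') * ln (sqmod x) + (M + ln 2))%:E)%E.
  move=> x x1; apply/lee_addgt0Pr => e e0.
  have l0 : 0 <= ln (sqmod x) by apply: ln_ge0.
  have l1 : 0 < ln (sqmod x) + 1 by lra.
  have e1 : 0 < e / (ln (sqmod x) + 1) by rewrite divr_gt0.
  apply: le_trans (H (t - e / (ln (sqmod x) + 1)) x ltac:(lra) x1) _.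
  rewrite -EFinD lee_fin.
  have : e / (ln (sqmod x) + 1) * ln (sqmod x) <= e.
    by rewrite mulrAC ler_pdivrMr// ler_pM2l//; lra.
  by move: (e / _) => q; lra.
move=> tt' x1.
(* The candidate has slope [1 - t2] with its own constant [C1]; on the outer circle [|y|^2 = rho]
   the surplus [(t2 - t') ln rho] absorbs that constant. *)
pose t2 := (t + t') / 2.
have t2t : t2 < t by rewrite /t2; lra.
have [C1 [B1 H1]] := gu t2 t2t.
pose L := (C1 + M) / (t2 - t').
have tp : 0 < t2 - t' by rewrite /t2; lra.
pose rho := `|B1| + sqmod x + 1 + expR L.
have eL : 0 < expR L by exact: expR_gt0.
have nB : 0 <= `|B1| by [].
have rho1 : 1 <= rho by rewrite /rho; lra.
have cln y : 0 < sqmod y -> hjet (fun y : P => ln (sqmod y)) y.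
  by rewrite sqmod_gt0 => y0; exact: hjet_ln.
have Krho y : 1 <= sqmod y <= rho -> (u y + (- (1 - t') * ln (sqmod y))%:E <= (M + ln 2)%:E)%E.
  apply: (@max_principle R [set y | 1 <= sqmod y <= rho] [set y | 1 < sqmod y < rho]
    (fun y => u y + (- (1 - t') * ln (sqmod y))%:E)%E) => {y}.
  - apply: (@subclosed_compact _ _ (cdisc 0 rho)); last 2 first.
    + exact: compact_cdisc.
    + by move=> y /andP[_ yr]; rewrite /cdisc /= subr0.
    rewrite (_ : [set y | _] = [set y | 1 <= sqmod y] `&` [set y | sqmod y <= rho]); last first.
      by apply/seteqP; split => y /=; [move/andP|move=> [-> ->]].
    apply: closedI.
      apply: (@closed_comp _ _ (@sqmod R) [set t | 1 <= t]); last exact: closed_ge.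
      by move=> y _; exact: continuous_sqmod.
    apply: (@closed_comp _ _ (@sqmod R) [set t | t <= rho]); last exact: closed_le.
    by move=> y _; exact: continuous_sqmod.
  - rewrite (_ : [set y | _] = [set y | 1 < sqmod y] `&` [set y | sqmod y < rho]); last first.
      by apply/seteqP; split => y /=; [move/andP|move=> [-> ->]].
    apply: openI.
      apply: (@open_comp _ _ (@sqmod R) [set t | 1 < t]); last exact: open_gt.
      by move=> y _; exact: continuous_sqmod.
    apply: (@open_comp _ _ (@sqmod R) [set t | t < rho]); last exact: open_lt.
    by move=> y _; exact: continuous_sqmod.
  - by move=> y /andP[h1 h2]; apply/andP; split; exact: ltW.
  - apply: usc_addr; first by apply: usc_in_at => y _; have [] := vu y I.
    move=> y; rewrite inE => /andP[y1 _].
    by apply: hjet_continuous; apply: hjetZ; apply: cln; lra.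
  - move=> y _; have [uy _ _] := vu y I; exact: lte_add_pinfty (ltry _).
  - move=> y /andP[y1 _]; have [_ _ +] := vu y I => nt T; apply: nt.
    by apply: hjet_touched T; apply: hjetZ; apply: cln; lra.
  - move=> y /andP[y1 y2] nU.
    have [y1'|y1'] := eqVneq (sqmod y) 1.
      rewrite y1' ln1 mulr0 adde0; apply: le_trans (ule y) _.
      rewrite lee_fin /phat /pot y1'; apply: lerD; last by rewrite (_ : 1 + 1 = 2).
      by apply: le_trans (HM (chart false y)); exact: ler_norm.
    have y2' : sqmod y = rho.
      apply/eqP/negPn/negP => y2'; apply: nU.
      by rewrite /= !lt_neqAle y2' y1 y2 eq_sym y1'.
    rewrite y2'; have := H1 y; rewrite y2' => /(_ ltac:(have := ler_norm B1; rewrite /rho; have := sqmod_ge0 x; lra)) uy.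
    apply: le_trans (leeD2r _ uy) _; rewrite -EFinD lee_fin.
    have : L <= ln rho by rewrite -[leLHS]expRK ler_ln ?posrE//; rewrite /rho; have := sqmod_ge0 x; lra.
    rewrite /L ler_pdivrMr//; have : 0 <= ln 2 :> R by apply: ln_ge0; lra.
    move: (ln rho) (ln 2) => l l2; rewrite /t2; lra.
have := Krho x; rewrite x1 /= => /(_ ltac:(rewrite /rho; lra)).
by rewrite mulNr EFinN -leeBrDr// oppeK -EFinD addrC.
Qed.

Lemma HSc_vsh t u x : HSc t u -> [/\ (u x < +oo)%E, usc_at u x & ~ touched u x].
Proof. by move=> [vu _ _]; have := vu x I. Qed.

(** The upper semicontinuous regularization, as an infimum of local upper bounds. *)
Definition ureg (h : P -> \bar R) (x : P) : \bar R :=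
  ereal_inf [set r%:E | r in [set r : R | \forall y \near x, (h y <= r%:E)%E]].

Lemma ureg_ge h x : (h x <= ureg h x)%E.
Proof. by apply: le_ereal_inf_tmp => _ [r hr <-]; exact: nbhs_singleton hr. Qed.

Lemma ureg_le h x r : (\forall y \near x, (h y <= r%:E)%E) -> (ureg h x <= r%:E)%E.
Proof. by move=> H; apply: ereal_inf_lbound; exists r. Qed.

Lemma ureg_lt h x r : (ureg h x < r%:E)%E -> exists2 s, s < r & \forall y \near x, (h y <= s%:E)%E.
Proof. by move/ereal_inf_lt => [_ [s hs <-] sr]; exists s. Qed.

Lemma usc_ureg h x : usc_at (ureg h) x.
Proof.
move=> r /ureg_lt[s sr /nbhs_interior H].
apply: filterS H => y /ureg_le /le_lt_trans; apply.
by rewrite lte_fin.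
Qed.

Lemma ureg_cont h (k : P -> R) x : {for x, continuous k} ->
  (\forall y \near x, (h y <= (k y)%:E)%E) -> (ureg h x <= (k x)%:E)%E.
Proof.
move=> ck H; apply/lee_addgt0Pr => e e0; rewrite -EFinD; apply: ureg_le.
have /(near_lt ck) : k x < k x + e by lra.
apply: filterS2 H => y /le_trans h1 h2; apply: h1.
by rewrite lee_fin ltW.
Qed.

(** If a test function touched the regularization, the maximum principle on a small disc would bound
    all candidates at once by the test function lowered by [e d1]. Near the centre this would push
    the regularization below its own value. *)
Lemma HSc_ureg t : HSc t (ureg (hs t)).
Proof.
have lephat y : (ureg (hs t) y <= (phat y)%:E)%E.
  apply: ureg_cont; first exact: continuous_phat.
  by apply: filterE => z; exact: hs_le_phat.
split => //.
- move=> x _; split; [|exact: usc_ureg|].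
    by apply: le_lt_trans (lephat x) _; exact: ltry.
  move=> [r [c [e [Fr e0 /near0_sqmod[d d0 Hd]]]]].
  pose d1 := d / 2.
  have d10 : 0 < d1 by rewrite divr_gt0.
  have ed : 0 < e * d1 by rewrite mulr_gt0.
  have nbd u : HSc t u -> forall k, sqmod k <= d1 -> (u (x + k)%R <= (r - e * d1 + hquad c k)%:E)%E.
    move=> uc k kd.
    suff : (u (x + k)%R + (-1 * hquad c k)%:E <= (r - e * d1)%:E)%E.
      by rewrite mulN1r EFinN -leeBrDr// oppeK -EFinD.
    apply: (@max_principle R (cdisc 0 d1) [set y | sqmod (y - 0) < d1]
      (fun k => u (x + k)%R + (-1 * hquad c k)%:E)%E).
    + exact: compact_cdisc.
    + exact: open_disc.
    + by move=> y /ltW.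
    + apply: usc_in_at => y _; apply: usc_at_addr.
        move=> s us; have [_ /(_ _ us) H _] := HSc_vsh (x + y) uc.
        have cc : {for y, continuous (fun y => x + y)} by apply: cvgD; [exact: cvg_cst|exact: cvg_id].
        exact: (near_comp cc H).
      by apply: cvgM; [exact: cvg_cst|exact: continuous_hquad].
    + move=> y _; have [uy _ _] := HSc_vsh (x + y) uc; exact: lte_add_pinfty (ltry _).
    + move=> y _ T; have [_ _] := HSc_vsh (x + y) uc; apply.
      apply: touched_translate; apply: hjet_touched T.
      by apply: hjetZ; exact: hjet_hquad.
    + move=> y; rewrite /cdisc /= subr0 => yd /negP; rewrite -leNgt => yd'.
      have H := Hd y ltac:(rewrite /d1 in yd; lra).
      apply: le_trans (leeD2r _ (le_trans (le_trans (hs_ge (x + y) uc) (ureg_ge _ _)) H)) _.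
      rewrite -EFinD lee_fin; have : e * d1 <= e * sqmod y by rewrite ler_pM2l.
      by rewrite mulN1r; lra.
    + by rewrite /cdisc /= subr0.
  have H : \forall y \near x, (hs t y <= (r - e * d1 / 2)%:E)%E.
    apply/nearD0.
    have H0 : \forall k \near (0 : P), hquad c k < e * d1 / 2.
      by apply: near_lt; [exact: continuous_hquad|rewrite hquad0; lra].
    have H1 : \forall k \near (0 : P), sqmod k < d1 by apply/near0_sqmod; exists d1.
    apply: filterS2 H0 H1 => k h0 h1; apply: ge_ereal_sup => _ [u uc <-].
    apply: le_trans (nbd u uc k (ltW h1)) _; rewrite lee_fin; lra.
  by have := ureg_le H; rewrite Fr lee_fin; lra.
- move=> t' tt'; have [C HC] := HSc_growth t.
  exists C, 2 => y y2.
  have y0 : y != 0 by rewrite -sqmod_gt0; lra.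
  apply: (@ureg_cont _ (fun y => (1 - t') * ln (sqmod y) + C)).
    apply: cvgD; last exact: cvg_cst.
    apply: cvgM; first exact: cvg_cst.
    exact: hjet_continuous (hjet_ln y0).
  have H1 : \forall z \near y, 1 < sqmod z by apply: near_gt; [exact: continuous_sqmod|lra].
  apply: filterS H1 => z z1; apply: ge_ereal_sup => _ [u uc <-].
  apply: le_trans (HC u uc z (ltW z1)) _; rewrite lee_fin lerD2r ler_wpM2r//; last by lra.
  by apply: ln_ge0; exact: ltW.
Qed.

Lemma HSc_hs t : HSc t (hs t).
Proof.
have -> : hs t = ureg (hs t); last exact: HSc_ureg.
apply/funext => x; apply/eqP; rewrite eq_le ureg_ge /=.
exact: hs_ge (HSc_ureg t).
Qed.

Lemma hs_lty t x : (hs t x < +oo)%E.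
Proof. by apply: le_lt_trans (hs_le_phat phi t x) _; exact: ltry. Qed.

Lemma pot_le_phat m x : (forall z, m <= phi z) -> m <= phat x.
Proof. by move=> Hm; have := Hm (chart false x); have := pot_ge0 x; rewrite /phat; lra. Qed.

(** Multiplication by [a] scales the growth to [a (1 - t)], and adding [(1 - a) m] keeps the
    function below the obstacle because [m <= phat]. This bounds the envelope at one time from below
    by the envelope at another. *)
Lemma hs_interp t T a m x : 0 < a <= 1 -> a * (1 - t) <= 1 - T -> (forall z, m <= phi z) ->
  (a%:E * hs t x + ((1 - a) * m)%:E <= hs T x)%E.
Proof.
move=> /andP[a0 a1] atT Hm.
apply: (@hs_ge _ _ _ (fun x => a%:E * hs t x + ((1 - a) * m)%:E)%E).
have [C HC] := HSc_growth t.
have [vu ule gu] := HSc_hs t.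
split.
- move=> y _; have [uy usy ny] := vu y I; split.
  + by move: uy; case: (hs t y) => [v||] // _; rewrite ?gt0_muleNy// -EFinM -EFinD ltry.
  + by apply: usc_at_addr; [exact: usc_at_scale|exact: cst_continuous].
  + by move/(touched_affine a0).
- move=> y; apply: (@le_trans _ _ (a%:E * (phat y)%:E + ((1 - a) * m)%:E)%E).
    by apply: leeD2r; apply: lee_wpmul2l; rewrite ?lee_fin ?(ltW a0)//; exact: ule.
  rewrite -EFinM -EFinD lee_fin; have := pot_le_phat y Hm => H.
  have : (1 - a) * m <= (1 - a) * phat y by rewrite ler_wpM2l// subr_ge0.
  by lra.
- move=> T' TT; exists (a * C + (1 - a) * m), 1 => y y1.
  apply: (@le_trans _ _ (a%:E * ((1 - t) * ln (sqmod y) + C)%:E + ((1 - a) * m)%:E)%E).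
    by apply: leeD2r; apply: lee_wpmul2l; rewrite ?lee_fin ?(ltW a0)//; exact: HC (HSc_hs t) _ y1.
  rewrite -EFinM -EFinD lee_fin.
  have l0 : 0 <= ln (sqmod y) by exact: ln_ge0.
  have : a * (1 - t) * ln (sqmod y) <= (1 - T') * ln (sqmod y) by rewrite ler_wpM2r//; lra.
  by lra.
Qed.

Lemma ddc_continuous (f : P -> R) : smooth_on setT f -> continuous (ddc f).
Proof.
move=> sf x.
have H v : {for x, continuous (fun y => 'D_v (fun y => 'D_v f y) y)}.
  have [_ /(_ v)[_ /(_ v) H]] := sf 2%N.
  exact: H.
by apply: cvgM; [apply: cvgD; exact: H|exact: cvg_cst].
Qed.

(** Half of the coefficient of [|h|^2] at [p] may be subtracted near [p], since [k |y - q|^2] has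
    the coefficient [k] whatever its centre [q]. *)
Lemma phat_margin (p : P) : exists2 k : R, 0 < k & \forall x \near p, forall q,
  ~ touched (fun y => (phat y - k * sqmod (y - q))%:E) x.
Proof.
have [sp Kp] := hphi.
pose m x := pi * (omegaFS x + ddc (fun y => phi (chart false y)) x) : R.
have m0 : 0 < m p by rewrite mulr_gt0 ?pi_gt0.
have cm : {for p, continuous m}.
  apply: cvgM; first exact: cvg_cst.
  apply: cvgD; first by apply: ddc_continuous; exact: smooth_pot openT.
  by apply: ddc_continuous; exact: sp.
have jm x : jet phat x (m x) := phat_jet hphi x.
clearbody m.
exists (m p / 2); first by rewrite divr_gt0.
have H : \forall x \near p, m p / 2 < m x by apply: near_gt => //; lra.
apply: filterS H => x mx q; apply: (@jet_pos_not_touched _ _ x (m x - m p / 2)); last by lra.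
have := jetD (jm x) (jet_sqmodB (- (m p / 2)) q x).
rewrite (_ : (fun y => _) = (fun y => phat y - m p / 2 * sqmod (y - q)))//.
by apply/funext => y; rewrite mulNr.
Qed.

Lemma hs0 x : hs 0 x = (phat x)%:E.
Proof.
apply/eqP; rewrite eq_le hs_le_phat/=.
apply: (@hs_ge _ _ _ (fun x => (phat x)%:E)); split => //.
- move=> y _; split; first exact: ltry.
    move=> r; rewrite lte_fin => H.
    apply: filterS (near_lt (continuous_phat hphi (x:=y)) H) => z.
    by rewrite lte_fin.
  have [sp Kp] := hphi.
  by apply: jet_pos_not_touched (phat_jet hphi y) _; rewrite mulr_gt0 ?pi_gt0.
- move=> t' t0; have [M M0 HM] := phi_bounded hphi.
  exists (M + ln 2), 1 => y y1; rewrite lee_fin /phat.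
  have := HM (chart false y); rewrite ler_norml => /andP[_ h].
  have := pot_le_ln y1; have l0 : 0 <= ln (sqmod y) by exact: ln_ge0.
  have : 0 <= - t' * ln (sqmod y) by rewrite mulr_ge0//; lra.
  by lra.
Qed.

(** Gluing: the maximum of [hs T] and [v] on [N], continued by [hs T], is again a candidate. Off [N]
    it equals [hs T] and near there it is at least [hs T], so a function touching it would touch
    [hs T]. *)
Lemma hs_comparison T (N : set P) (v : P -> \bar R) : open N ->
  (exists B, forall x, N x -> sqmod x < B) ->
  (forall x, closure N x -> usc_at v x) ->
  (forall x, N x -> ~ touched v x /\ (v x <= (phat x)%:E)%E) ->
  (forall x, closure N x -> ~ N x -> (v x <= hs T x)%E) ->
  forall x, N x -> (v x <= hs T x)%E.
Proof.
move=> oN [B HB] uv tv bv x Nx.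
pose w y := if y \in N then Order.max (hs T y) (v y) else hs T y.
suff wc : HSc T w.
  apply: le_trans (hs_ge x wc); rewrite /w mem_set//.
  by rewrite le_max lexx orbT.
have wge y : (hs T y <= w y)%E by rewrite /w; case: ifP; rewrite ?le_max lexx.
have [vu ule gu] := HSc_hs T.
have wN y : N y -> w y = Order.max (hs T y) (v y) by move=> Ny; rewrite /w mem_set.
have wnN y : ~ N y -> w y = hs T y by move=> Ny; rewrite /w memNset.
have wphat y : (w y <= (phat y)%:E)%E.
  have [Ny|Ny] := pselect (N y); last by rewrite wnN.
  by rewrite wN// ge_max ule/=; have [] := tv y Ny.
split => //.
- move=> y _; split; first by apply: le_lt_trans (wphat y) _; exact: ltry.
  + move=> r wr.
    have hr : (hs T y < r%:E)%E by apply: le_lt_trans (wge y) wr.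
    have [_ /(_ _ hr) H _] := vu y I.
    have [cy|cy] := pselect (closure N y).
      have vr : (v y < r%:E)%E.
        have [Ny|Ny] := pselect (N y).
          by move: wr; rewrite wN// gt_max => /andP[].
        by apply: le_lt_trans (bv y cy Ny) _.
      apply: filterS2 H (uv y cy _ vr) => z h1 h2.
      have [Nz|Nz] := pselect (N z); last by rewrite wnN.
      by rewrite wN// gt_max h1.
    have H2 : \forall z \near y, ~ N z.
      apply: contrapT => nH; apply: cy => V Vy; apply: contrapT => nV; apply: nH.
      by apply: filterS Vy => z Vz Nz; apply: nV; exists z.
    by apply: filterS2 H H2 => z h1 h2; rewrite wnN.
  + have [Ny|Ny] := pselect (N y); last first.
      move=> T1; have [_ _] := vu y I; apply.
      by apply: touched_le T1; [apply: filterE => z; exact: wge|rewrite wnN].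
    have nN : \forall z \near y, N z by exact: open_nbhs_nbhs.
    have [hv|hv] := leP (v y) (hs T y).
      move=> T1; have [_ _] := vu y I; apply.
      by apply: touched_le T1; [apply: filterE => z; exact: wge|rewrite wN//; apply/esym/max_idPl].
    move=> T1; have [+ _] := tv y Ny; apply; apply: touched_le T1.
      by apply: filterS nN => z Nz; rewrite wN// le_max lexx orbT.
    by rewrite wN//; apply/esym/max_idPr; exact: ltW.
- move=> t' tt'; have [C [B' H]] := gu t' tt'.
  exists C, (`|B'| + `|B|) => y yB; rewrite wnN; first by apply: H; have := ler_norm B'; have := normr_ge0 B; lra.
  by move=> /HB; have := ler_norm B; have := normr_ge0 B'; lra.
Qed.

End Envelope.

(** * The complex exponential and holomorphic substitution in harmonic jets *)

Section ComplexExp.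
Variable R : realType.
Local Notation P := (plane R).

Definition cexp (x : P) : P := cmul (expR x.1, 0) (cis x.2).

Lemma cexpE x : cexp x = (expR x.1 * cos x.2, expR x.1 * sin x.2).
Proof. by rewrite /cexp cmulE /=; congr (_, _); ring. Qed.

Lemma cexpD x y : cexp (x + y) = cmul (cexp x) (cexp y).
Proof.
rewrite /cexp /= expRD -cmul_cis.
by apply: plane_eq; rewrite !cmulE /=; ring.
Qed.

Lemma sqmod_cexp x : sqmod (cexp x) = expR (2 * x.1).
Proof. by rewrite sqmodM sqmod_cis mulr1 /sqmod /= expr0n addr0 mulrC expRM powR_mulrn ?expR_ge0. Qed.

Lemma expR_small (x : R) : `|x| <= 2^-1 -> `|expR x - 1| <= 2 * `|x|.
Proof.
move=> xs; have h1 := expR_ge1Dx x; have h2 := expR_ge1Dx (- x).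
have e : expR x * expR (- x) = 1 by rewrite -expRD subrr expR0.
have e0 := expR_gt0 x.
have xx : `|x| * `|x| <= 2^-1 * `|x| by rewrite ler_wpM2r.
have h3 : expR x * (1 - x) <= 1 by rewrite -[leRHS]e ler_pM2l.
move: xs xx.
have [x0|x0] := lerP 0 x.
  rewrite (ger0_norm x0) ler_norml => xs xx; apply/andP; split; first lra.
  have h4 : expR x * (1 - x) <= (1 + 2 * x) * (1 - x) by lra.
  by move: h4; rewrite ler_pM2r; [lra|lra].
rewrite (ltr0_norm x0) ler_norml => xs xx; apply/andP; split; first lra.
have : expR x <= 1 by rewrite -[leRHS]expR0 ler_expR ltW.
by lra.
Qed.

Lemma cexp_small (h : P) : cnorm h <= 2^-1 ->
  `|(cexp h).1 - 1| <= 4 * cnorm h /\ `|(cexp h).2| <= 4 * cnorm h.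
Proof.
move=> hs; rewrite cexpE /=.
have h1 := norm_fst_le h; have h2 := norm_snd_le h.
have e1 := expR_small (le_trans h1 hs).
have s2 : `|sin h.2| <= `|h.2| := norm_sin_le h.2.
have c2 : `|cos h.2 - 1| <= `|h.2|.
  have -> : cos h.2 = 1 - 2 * sin (h.2 / 2) ^+ 2.
    have {1}-> : h.2 = h.2 / 2 + h.2 / 2 by field.
    by rewrite cosD; have := cos2Dsin2 (h.2 / 2); move: (cos _) (sin _) => x y; lra.
  have := norm_sin_le (h.2 / 2); rewrite normrM (@ger0_norm _ 2^-1)// => H.
  have -> : 1 - 2 * sin (h.2 / 2) ^+ 2 - 1 = - (2 * sin (h.2 / 2) ^+ 2) by ring.
  rewrite normrN normrM normrX (@ger0_norm _ 2)//.
  by have := normr_ge0 (sin (h.2 / 2)); nra.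
have e0 := expR_gt0 h.1.
have e2 : expR h.1 <= 2 by move: e1; rewrite ler_norml => /andP[_]; lra.
have n0 := normr_ge0 h.2.
have E t : `|expR h.1 * t| <= 2 * `|t| by rewrite normrM (ger0_norm (ltW e0)) ler_wpM2r.
split; last by apply: le_trans (E _) _; lra.
have -> : expR h.1 * cos h.2 - 1 = (expR h.1 - 1) + expR h.1 * (cos h.2 - 1) by ring.
apply: le_trans (ler_normD _ _) _.
have := E (cos h.2 - 1).
lra.
Qed.

Lemma cnorm_le_sum (x : P) : cnorm x <= `|x.1| + `|x.2|.
Proof.
have H := sqr_cnorm x; have h0 := cnorm_ge0 x.
rewrite -(@ler_pXn2r _ 2) ?nnegrE ?addr_ge0// H /sqmod sqrrD !real_normK ?num_real//.
by rewrite -addrA lerD2l lerDr mulrn_wge0// mulr_ge0.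
Qed.

Lemma is_derive_ecos (a b t : R) : is_derive t (1 : R) (fun s => expR (s * a) * cos (s * b))
  (a * (expR (t * a) * cos (t * b)) - b * (expR (t * a) * sin (t * b))).
Proof.
have H1 (c : R) : is_derive t (1 : R) (fun s : R => s * c) c.
  refine (is_derive_eq (is_deriveM (is_derive_id t 1) (is_derive_cst c t 1)) _).
  by rewrite scaler0 add0r /GRing.scale /= mulr1.
have H2 : is_derive t (1 : R) (fun s => expR (s * a)) (a * expR (t * a)).
  by refine (is_derive_eq (is_derive1_comp (is_derive_expR _) (H1 a)) _); rewrite mulrC.
have H3 : is_derive t (1 : R) (fun s => cos (s * b)) (b * - sin (t * b)).
  by refine (is_derive_eq (is_derive1_comp (is_derive_cos _) (H1 b)) _); rewrite mulrC.
refine (is_derive_eq (is_deriveM H2 H3) _).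
by rewrite /GRing.scale /=; move: (expR _) (cos _) (sin _) => x y z; ring.
Qed.

Lemma is_derive_esin (a b t : R) : is_derive t (1 : R) (fun s => expR (s * a) * sin (s * b))
  (a * (expR (t * a) * sin (t * b)) + b * (expR (t * a) * cos (t * b))).
Proof.
have H1 (c : R) : is_derive t (1 : R) (fun s : R => s * c) c.
  refine (is_derive_eq (is_deriveM (is_derive_id t 1) (is_derive_cst c t 1)) _).
  by rewrite scaler0 add0r /GRing.scale /= mulr1.
have H2 : is_derive t (1 : R) (fun s => expR (s * a)) (a * expR (t * a)).
  by refine (is_derive_eq (is_derive1_comp (is_derive_expR _) (H1 a)) _); rewrite mulrC.
have H3 : is_derive t (1 : R) (fun s => sin (s * b)) (b * cos (t * b)).
  by refine (is_derive_eq (is_derive1_comp (is_derive_sin _) (H1 b)) _); rewrite mulrC.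
refine (is_derive_eq (is_deriveM H2 H3) _).
by rewrite /GRing.scale /=; move: (expR _) (cos _) (sin _) => x y z; ring.
Qed.

Lemma is_derive_lin2 (f g : R -> R) (a b t df dg : R) : is_derive t (1 : R) f df ->
  is_derive t (1 : R) g dg ->
  is_derive t (1 : R) (fun s => a * f s + b * g s) (a * df + b * dg).
Proof.
move=> hf hg; exact: (is_deriveD (is_deriveZ a hf) (is_deriveZ b hg)).
Qed.

(** Taylor's formula along [t |-> cexp (t h)], whose second derivative is [h^2 cexp (t h)], for the
    real and imaginary parts separately. *)
Lemma cexp_taylor : bigOn 3 (fun h : P => cexp h - ((1, 0) + h + cmul (2^-1, 0) (cmul h h))).
Proof.
exists 16 => //; have := @near0_cnorm_lt R 2^-1 ltac:(by []).
apply: filterS => h hs.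
have n0 := cnorm_ge0 h.
have key (t : R) : 0 <= t <= 1 -> cnorm (cmul (cmul h h) (cexp (t *: h) - (1, 0))) <= 8 * cnorm h ^+ 3.
  move=> /andP[t0 t1]; rewrite !cnormM.
  have th : cnorm (t *: h) <= cnorm h.
    rewrite -(@ler_pXn2r _ 2) ?nnegrE ?cnorm_ge0// !sqr_cnorm.
    have -> : sqmod (t *: h) = t ^+ 2 * sqmod h by rewrite /sqmod /= /GRing.scale /=; ring.
    by rewrite ler_piMl ?sqmod_ge0// expr_le1.
  have [|e1 e2] := @cexp_small (t *: h); first by apply: le_trans th _; exact: ltW.
  have := cnorm_le_sum (cexp (t *: h) - (1, 0)); rewrite /= subr0 => H.
  have H8 : cnorm (cexp (t *: h) - (1, 0)) <= 8 * cnorm h by lra.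
  have -> : 8 * cnorm h ^+ 3 = cnorm h * cnorm h * (8 * cnorm h) by ring.
  by rewrite ler_wpM2l// mulr_ge0.
apply: le_trans (cnorm_le_sum _) _.
have -> : 16 * cnorm h ^+ 3 = 8 * cnorm h ^+ 3 + 8 * cnorm h ^+ 3 by ring.
pose c (t : R) := expR (t * h.1) * cos (t * h.2); pose s (t : R) := expR (t * h.1) * sin (t * h.2).
have dc t : is_derive t (1 : R) c (h.1 * c t + - h.2 * s t) by have := is_derive_ecos h.1 h.2 t; rewrite mulNr.
have ds t : is_derive t (1 : R) s (h.1 * s t + h.2 * c t) := is_derive_esin h.1 h.2 t.
have ce t : cexp (t *: h) = (c t, s t) by rewrite cexpE.
have c0 : c 0 = 1 by rewrite /c !mul0r expR0 cos0 mulr1.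
have s0 : s 0 = 0 by rewrite /s !mul0r expR0 sin0 mulr0.
have ch : cexp h = (c 1, s 1) by rewrite -ce scale1r.
apply: lerD.
- have := @taylor1D R c (fun t => h.1 * c t + - h.2 * s t)
    (fun t => h.1 * (h.1 * c t + - h.2 * s t) + - h.2 * (h.1 * s t + h.2 * c t))
    (h.1 ^+ 2 - h.2 ^+ 2) (8 * cnorm h ^+ 3).
  rewrite ch c0 s0 !cmulE /=.
  have -> : c 1 - (1 + h.1 + (2^-1 * (h.1 * h.1 - h.2 * h.2) - 0 * (h.1 * h.2 + h.2 * h.1))) =
    c 1 - 1 - (h.1 * 1 + - h.2 * 0) - (h.1 ^+ 2 - h.2 ^+ 2) / 2 by field.
  move/(_ (fun t _ => dc t) (fun t _ => is_derive_lin2 _ _ (dc t) (ds t))); apply=> t t01.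
  apply: le_trans (key t t01); apply: le_trans (norm_fst_le _); rewrite ce !cmulE /=.
  by rewrite le_eqVlt; apply/orP; left; apply/eqP; congr `|_|; move: (c t) (s t) => x y; ring.
- have := @taylor1D R s (fun t => h.1 * s t + h.2 * c t)
    (fun t => h.1 * (h.1 * s t + h.2 * c t) + h.2 * (h.1 * c t + - h.2 * s t))
    (2 * (h.1 * h.2)) (8 * cnorm h ^+ 3).
  rewrite ch c0 s0 !cmulE /=.
  have -> : s 1 - (0 + h.2 + (2^-1 * (h.1 * h.2 + h.2 * h.1) + 0 * (h.1 * h.1 - h.2 * h.2))) =
    s 1 - 0 - (h.1 * 0 + h.2 * 1) - (2 * (h.1 * h.2)) / 2 by field.
  move/(_ (fun t _ => ds t) (fun t _ => is_derive_lin2 _ _ (ds t) (dc t))); apply=> t t01.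
  apply: le_trans (key t t01); apply: le_trans (norm_snd_le _); rewrite ce !cmulE /=.
  by rewrite le_eqVlt; apply/orP; left; apply/eqP; congr `|_|; move: (c t) (s t) => x y; ring.
Qed.

Lemma hol2_cexp x : hol2 cexp x.
Proof.
exists (cexp x), (cmul (cexp x) (2^-1, 0)).
apply: eq_bigOn (bigOnM (bigOn_cst (cexp x)) cexp_taylor) => h.
rewrite cexpD; move: (cexp x) (cexp h) => u v.
by apply: plane_eq; rewrite !cmulE /=; ring.
Qed.

End ComplexExp.

Section HarmonicSubstitution.
Variable R : realType.
Local Notation P := (plane R).

Lemma hjet_not_touched (k : P -> R) x : hjet k x -> ~ touched (fun y => (k y)%:E) x.
Proof.
move=> hk.
rewrite (_ : (fun y => _) = fun y => (0%:E + (k y)%:E)%E); last by apply/funext => y; rewrite add0e.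
move/(hjet_touched (F := fun=> 0%:E) hk) => [r [c [e [[r0] e0 He]]]].
have e2 : 0 < e / 2 by rewrite divr_gt0.
apply: (jet_pos_not_touched (jet_sqmodB (e / 2) x x) e2).
exists 0, c, (e / 2); split => //; first by rewrite subrr sqmod0 mulr0.
apply: filterS He => h; rewrite -r0 !lee_fin (_ : x + h - x = h); last by rewrite addrC addKr.
lra.
Qed.

(** A harmonic quadratic is the real part of [A w + B w^2], so inserting a holomorphic [w] gives the
    real part of a holomorphic jet; the remainder stays [o(|h|^2)] by the Lipschitz bound on [g]. *)
Lemma hjet_comp (k : P -> R) (g : P -> P) x : hol2 g x -> hjet k (g x) -> hjet (k \o g) x.
Proof.
move=> hg [c kc].
pose A : P := (c.1.1, - c.1.2); pose B : P := (c.2.1, - c.2.2 / 2).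
pose w y := g y - g x.
have hw : hol2 w x by apply: hol2D => //; exact: hol2_cst.
have H1 : hjet (fun y => hquad c (w y)) x.
  have H := hol2_hjet (hol2D (hol2M (hol2_cst A x) hw) (hol2M (hol2_cst B x) (hol2M hw hw))).
  by apply: eq_hjet H => y; rewrite !cmulE /hquad /A /B /=; field.
have [d Hd] := H1; exists d => e e0.
have [C C0 HC] := hol2_bigO1 hg.
have C1 : 0 < 2 * (C ^+ 2 + 1) by rewrite mulr_gt0// ltr_wpDl// sqr_ge0.
have e2 : 0 < e / 2 by rewrite divr_gt0.
have cg : {for (0 : P), continuous (fun h => g (x + h) - g x)}.
  apply: cvgB; last exact: cvg_cst.
  have cc : {for (0 : P), continuous (fun h : P => x + h)} by apply: cvgD; [exact: cvg_cst|exact: cvg_id].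
  apply: (@continuous_comp _ _ _ (fun h : P => x + h) g) => //.
  by rewrite addr0; exact: hol2_continuous.
have H2 := kc _ (divr_gt0 e0 C1).
have H2' : \forall h \near g (x + 0) - g x, `|k (g x + h) - k (g x) - hquad c h| <= e / (2 * (C ^+ 2 + 1)) * sqmod h.
  by rewrite addr0 subrr.
apply: filterS3 (Hd _ e2) HC (near_comp cg H2') => h h1 h2 h3.
have E : g x + (g (x + h) - g x) = g (x + h) by rewrite addrC subrK.
rewrite E in h3.
have s1 : sqmod (g (x + h) - g x) <= C ^+ 2 * sqmod h.
  rewrite -!sqr_cnorm -exprMn ler_pXn2r ?nnegrE ?cnorm_ge0 ?mulr_ge0 ?cnorm_ge0//.
have s2 : e / (2 * (C ^+ 2 + 1)) * sqmod (g (x + h) - g x) <= e / 2 * sqmod h.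
  apply: (@le_trans _ _ (e / (2 * (C ^+ 2 + 1)) * (C ^+ 2 * sqmod h))).
    by rewrite ler_wpM2l// ltW// divr_gt0.
  have C2 : 0 < C ^+ 2 + 1 by rewrite ltr_wpDl// sqr_ge0.
  have -> : e / (2 * (C ^+ 2 + 1)) * (C ^+ 2 * sqmod h) = (e / 2 * sqmod h) * (C ^+ 2 / (C ^+ 2 + 1)).
    by move: (sqmod h) => q; field; rewrite gt_eqF.
  rewrite ler_piMr ?mulr_ge0 ?sqmod_ge0 ?(ltW e0)//.
  by rewrite ler_pdivrMr// mul1r; lra.
move: h1; rewrite /w subrr hquad0 subr0 => h1.
rewrite /= (_ : _ - _ - hquad d h = (k (g (x + h)) - k (g x) - hquad c (g (x + h) - g x)) +
  (hquad c (g (x + h) - g x) - hquad d h)); last by ring.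
by apply: le_trans (ler_normD _ _) _; lra.
Qed.

Lemma near_chart2 c (x tau : P) (Q : P1 R * P -> Prop) :
  (\forall p \near (chart c x, tau), Q p) <->
  (\forall p \near (x, tau), Q (chart c p.1, p.2)).
Proof.
split=> -[[A B] /= [nA nB] AB].
  exists (chart c @^-1` A, B); first by split => //=; exact/near_chart.
  by move=> [y s] /= [Ay Bs]; exact: (AB (chart c y, s)).
exists ([set z | exists2 y, A y & z = chart c y], B).
  split => //=; apply/(@near_chart R c x (fun z => exists2 y, A y & z = chart c y)).
  by apply: filterS nA => y Ay; exists y.
by move=> [z s] /= [[y Ay ->] Bs]; exact: (AB (y, s)).
Qed.

(** In the coordinate [w = 1/z], multiplication by [tau] is division by [tau]; hence [tau^-1 z] has
    the coordinate [tau w]. *)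
Lemma P1mul_chart (x tau : P) : sqmod tau = 1 ->
  P1mul tau (chart false (cmul tau x)) = chart false x.
Proof.
move=> t1; have t0 : tau != 0 by rewrite -sqmod_gt0 t1.
rewrite /chart; have [->|x0] := eqVneq x 0.
  by rewrite (_ : cmul tau 0 = 0) ?eqxx//; apply: plane_eq; rewrite cmulE /=; ring.
have xt0 : cmul tau x != 0 by rewrite -sqmod_gt0 sqmodM mulr_gt0 ?sqmod_gt0.
rewrite (negPf xt0) /=; congr Some.
move: t1 x0; rewrite -sqmod_eq0 => t1 x0.
have tt : tau.1 ^+ 2 + tau.2 ^+ 2 = 1 := t1.
apply: plane_eq; rewrite !(cmulE, cinvE) /= sqmodM t1 mul1r; move: (sqmod x) => N.
  by rewrite -[RHS]mul1r -tt; ring.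
by rewrite -[RHS]mul1r -tt; ring.
Qed.

End HarmonicSubstitution.

(** * The weak solution along orbits *)

Section Kiselev.
Variables (R : realType) (phi : P1 R -> R).
Hypothesis hphi : kahler_potential phi.
Local Notation P := (plane R).
Local Notation phat := (phat phi).
Variable psi : P1 R * P -> \bar R.
Hypothesis hpsi : HMAE_candidate phi psi.

(** The candidate in the coordinate [1/z], with the potential added; the value [-oo] outside the
    closed disc makes it upper semicontinuous everywhere. *)
Definition hm (p : P * P) : \bar R :=
  if sqmod p.2 <= 1 then (psi (chart false p.1, p.2) + (pot p.1)%:E)%E else -oo%E.

Lemma hm_lty p : (hm p < +oo)%E.
Proof.
rewrite /hm; case: ifP => // p1; have [H _ _ _] := hpsi.
exact: lte_add_pinfty (H _ _ p1) (ltry _).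
Qed.

Lemma usc_hm p : usc_at hm p.
Proof.
have [_ H _ _] := hpsi; move: p => [x tau]; have [p1|p1] := leP (sqmod tau) 1; last first.
  move=> r _; have := near_snd (near_gt (@continuous_sqmod R tau) p1 : \forall y \near (x, tau).2, 1 < sqmod y).
  by apply: filterS => q q1; rewrite /hm leNgt q1 /= ltNyr.
move=> r; rewrite {1}/hm /= p1 -lteBrDr// -EFinB => /ereal_between[s Hs sr].
have /near_chart2 N1 := H (chart false x, tau) s p1 Hs.
have e0 : pot x < r - s by lra.
have := near_fst (near_lt (continuous_pot (x := x)) e0 : \forall y \near (x, tau).1, pot y < r - s).
apply: filterS2 N1 => q q1 q2; rewrite /hm; case: ifP => q3; last exact: ltNyr.
rewrite -lteBrDr// -EFinB; apply: lt_trans (q1 q3) _; rewrite lte_fin; lra.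
Qed.

Lemma hm_line_not_touched (a b : P * P) : sqmod a.2 < 1 ->
  ~ touched (fun h => hm (a.1 + cmul h b.1, a.2 + cmul h b.2)) 0.
Proof.
move=> a1; have [_ _ H _] := hpsi.
have oU : open [set p : P * P | setT p.1 /\ sqmod p.2 < 1].
  rewrite openE => -[p1 p2] /= [_ pp].
  have := near_snd (near_lt (@continuous_sqmod R p2) pp : \forall y \near (p1, p2).2, sqmod y < 1).
  exact: filterS.
have ha := H false setT (@pot R) openT (@FS_pot R).
have := psh_not_touched (b := b) (cline_rot2 R) oU ha (conj I a1 : [set p : P * P | setT p.1 /\ sqmod p.2 < 1] a).
apply: contra_not; apply: near_touched.
have cc : {for (0 : P), continuous (fun h : P => sqmod (a.2 + cmul h b.2))}.
  apply: (@continuous_comp _ _ _ (fun h : P => a.2 + cmul h b.2)); last exact: continuous_sqmod.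
  by apply: hol2_continuous; apply: hol2D; [exact: hol2_cst|apply: hol2M; [exact: hol2_id|exact: hol2_cst]].
have := near_lt cc (c := 1); rewrite (_ : a.2 + cmul 0 b.2 = a.2); last first.
  by apply: plane_eq; rewrite cmulE /=; ring.
move=> /(_ a1); apply: filterS => h h1; rewrite /hm /=.
by rewrite ltW.
Qed.

Lemma hm_bd x tau : sqmod tau = 1 -> (hm (cmul tau x, tau) <= (phat x)%:E)%E.
Proof.
move=> t1; rewrite /hm /= t1 lexx /phat EFinD.
have -> : pot (cmul tau x) = pot x by rewrite /pot sqmodM t1 mul1r.
have [_ _ _ H] := hpsi; apply: leeD2r; have := H (chart false (cmul tau x)) tau t1.
by rewrite P1mul_chart.
Qed.

Section Slice.
Variables (a b : P).
(** With [a = 0] this is the orbit of [b]; with [b = 0] it is the disc over the fixed point [a]. *)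
Let F tau := hm (a + cmul tau b, tau).

Lemma slice_usc tau : usc_at F tau.
Proof.
move=> r /usc_hm H.
have cc : {for tau, continuous (fun s : P => (a + cmul s b, s))}.
  have c1 : {for tau, continuous (fun s : P => a + cmul s b)}.
    by apply: hol2_continuous; apply: hol2D; [exact: hol2_cst|apply: hol2M; [exact: hol2_id|exact: hol2_cst]].
  exact: (cvg_pair c1 cvg_id).
exact: near_comp cc H.
Qed.

Lemma slice_not_touched tau : sqmod tau < 1 -> ~ touched F tau.
Proof.
move=> t1 /touched_shift T; apply: (@hm_line_not_touched (a + cmul tau b, tau) (b, (1, 0)) t1).
rewrite (_ : (fun h => _) = fun h => F (tau + h))//; apply/funext => h.
by rewrite /F /=; congr (hm (_, _)); apply: plane_eq; rewrite !cmulE /=; ring.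
Qed.

Lemma slice_max (C : R) : (forall tau, sqmod tau = 1 -> (F tau <= C%:E)%E) ->
  forall tau, sqmod tau <= 1 -> (F tau <= C%:E)%E.
Proof.
move=> H tau t1.
apply: (@max_principle R (cdisc 0 1) [set y | sqmod (y - 0) < 1] F C).
- exact: compact_cdisc.
- exact: open_disc.
- by move=> y /ltW.
- by apply: usc_in_at => y _; exact: slice_usc.
- by move=> y _; exact: hm_lty.
- by move=> y; rewrite /= subr0; exact: slice_not_touched.
- move=> y; rewrite /cdisc /= subr0 => y1 /negP; rewrite -leNgt => y2.
  by apply: H; apply/eqP; rewrite eq_le y1.
- by rewrite /cdisc /= subr0.
Qed.

End Slice.

Lemma hm_le_phat x tau : sqmod tau <= 1 -> (hm (cmul tau x, tau) <= (phat x)%:E)%E.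
Proof.
move=> t1; rewrite -[cmul tau x]add0r; apply: (@slice_max 0 x) => // s s1.
by rewrite add0r; exact: hm_bd.
Qed.

Lemma hm_le_pot : exists C, forall x tau, sqmod tau <= 1 -> (hm (x, tau) <= (C + pot x)%:E)%E.
Proof.
have [M M0 HM] := phi_bounded hphi; exists M => x tau t1.
have := @slice_max x 0 (M + pot x).
have E s : x + cmul s 0 = x by apply: plane_eq; rewrite cmulE /=; ring.
move=> /(_ _ tau t1); rewrite E; apply => s s1; rewrite E /hm /= s1 lexx EFinD; apply: leeD2r.
have [_ _ _ H] := hpsi; apply: le_trans (H _ _ s1) _; rewrite lee_fin.
by apply: le_trans (HM (P1mul s (chart false x))); exact: ler_norm.
Qed.

(* [A] bounds the candidate over the circle [|tau|^2 = e^-s]. *)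
Definition ubd (x : P) (s A : R) :=
  forall tau, sqmod tau = expR (- s) -> (hm (cmul tau x, tau) <= A%:E)%E.

Lemma ubd_le x s A B : ubd x s A -> A <= B -> ubd x s B.
Proof. by move=> H AB tau /H /le_trans; apply; rewrite lee_fin. Qed.

(** Hadamard's argument: a multiple of the harmonic function [ln |tau|^2] makes the bounds on both
    circles equal, and the maximum principle applies on the annulus. *)
Lemma three_circles x a b A B tau : 0 <= a -> a < b -> ubd x a A -> ubd x b B ->
  expR (- b) <= sqmod tau <= expR (- a) ->
  (hm (cmul tau x, tau) <= (A + (B - A) / (b - a) * (- ln (sqmod tau) - a))%:E)%E.
Proof.
move=> a0 ab uA uB tt.
pose q := (B - A) / (b - a).
have ba : b - a != 0 by rewrite subr_eq0 gt_eqF.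
have eb : 0 < expR (- b) := expR_gt0 _.
suff : (hm ((0 + cmul tau x)%R, tau) + (q * ln (sqmod tau))%:E <= (A - q * a)%:E)%E.
  rewrite add0r -leeBrDr// => /le_trans; apply; rewrite -EFinB lee_fin /q.
  by rewrite le_eqVlt; apply/orP; left; apply/eqP; ring.
apply: (@max_principle R [set y | expR (- b) <= sqmod y <= expR (- a)]
  [set y | expR (- b) < sqmod y < expR (- a)]
  (fun y => hm ((0 + cmul y x)%R, y) + (q * ln (sqmod y))%:E)%E) => //.
- apply: (@subclosed_compact _ _ (cdisc 0 (expR (- a)))); last 2 first.
  + exact: compact_cdisc.
  + by move=> y /andP[_ yr]; rewrite /cdisc /= subr0.
  rewrite (_ : [set y | _] = [set y | expR (- b) <= sqmod y] `&` [set y | sqmod y <= expR (- a)]); last first.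
    by apply/seteqP; split => y /=; [move/andP|move=> [-> ->]].
  apply: closedI.
    apply: (@closed_comp _ _ (@sqmod R) [set t | expR (- b) <= t]); last exact: closed_ge.
    by move=> y _; exact: continuous_sqmod.
  apply: (@closed_comp _ _ (@sqmod R) [set t | t <= expR (- a)]); last exact: closed_le.
  by move=> y _; exact: continuous_sqmod.
- rewrite (_ : [set y | _] = [set y | expR (- b) < sqmod y] `&` [set y | sqmod y < expR (- a)]); last first.
    by apply/seteqP; split => y /=; [move/andP|move=> [-> ->]].
  apply: openI.
    apply: (@open_comp _ _ (@sqmod R) [set t | expR (- b) < t]); last exact: open_gt.
    by move=> y _; exact: continuous_sqmod.
  apply: (@open_comp _ _ (@sqmod R) [set t | t < expR (- a)]); last exact: open_lt.
  by move=> y _; exact: continuous_sqmod.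
- by move=> y /andP[h1 h2]; apply/andP; split; exact: ltW.
- apply: usc_addr; first by apply: usc_in_at => y _; exact: slice_usc.
  move=> y; rewrite inE => /andP[y1 _].
  apply: hjet_continuous; apply: hjetZ; apply: hjet_ln; rewrite -sqmod_gt0.
  exact: lt_le_trans y1.
- by move=> y _; exact: lte_add_pinfty (hm_lty _) (ltry _).
- move=> y /andP[y1 y2] T; apply: (@slice_not_touched 0 x y).
    by apply: lt_le_trans y2 _; rewrite -expR0 ler_expR oppr_le0.
  apply: hjet_touched T; apply: hjetZ; apply: hjet_ln; rewrite -sqmod_gt0.
  exact: lt_trans y1.
- move=> y /andP[y1 y2] nU; rewrite add0r.
  have [ya|ya] := eqVneq (sqmod y) (expR (- a)).
    rewrite -leeBrDr// ya expRK; apply: le_trans (uA y ya) _; rewrite -EFinB lee_fin.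
    by rewrite le_eqVlt; apply/orP; left; apply/eqP; ring.
  have yb : sqmod y = expR (- b).
    apply/eqP/negPn/negP => yb; apply: nU.
    by rewrite /= !lt_neqAle ya y1 y2 eq_sym yb.
  rewrite -leeBrDr// yb expRK; apply: le_trans (uB y yb) _; rewrite -EFinB lee_fin /q.
  by rewrite le_eqVlt; apply/orP; left; apply/eqP; field.
Qed.

Lemma ubd_convex2 x a b A B l : 0 <= a -> 0 <= b -> 0 <= l <= 1 -> ubd x a A -> ubd x b B ->
  ubd x (l * a + (1 - l) * b) (l * A + (1 - l) * B).
Proof.
suff W a' b' A' B' l' : 0 <= a' -> a' < b' -> 0 <= l' <= 1 -> ubd x a' A' -> ubd x b' B' ->
    ubd x (l' * a' + (1 - l') * b') (l' * A' + (1 - l') * B').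
  move=> a0 b0 l01 uA uB; have [ab|ab|ab] := ltgtP a b.
  - exact: W.
  - have l01' : 0 <= 1 - l <= 1 by lra.
    have := @W b a B A (1 - l) b0 ab l01' uB uA.
    by rewrite (_ : 1 - (1 - l) = l) 1?[_ + l * a]addrC 1?[_ + l * A]addrC//; ring.
  - rewrite -ab (_ : l * a + _ = a); last by ring.
    move=> tau ta; have [AB|AB] := leP A B.
      apply: le_trans (uA tau ta) _; rewrite lee_fin.
      have : 0 <= (1 - l) * (B - A) by apply: mulr_ge0; lra.
      lra.
    have tb : sqmod tau = expR (- b) by rewrite -ab.
    apply: le_trans (uB tau tb) _; rewrite lee_fin.
    have : 0 <= l * (A - B) by apply: mulr_ge0; lra.
    lra.
move=> a0 ab /andP[l0 l1] uA uB tau tt.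
have p1 : 0 <= (1 - l') * (b' - a') by apply: mulr_ge0; lra.
have p2 : 0 <= l' * (b' - a') by apply: mulr_ge0; lra.
apply: le_trans (three_circles a0 ab uA uB _) _.
  by rewrite tt !ler_expR; apply/andP; split; lra.
rewrite tt expRK lee_fin le_eqVlt; apply/orP; left; apply/eqP.
by field; rewrite subr_eq0 gt_eqF.
Qed.

(** Jensen's inequality, by induction over partial sums renormalized to total weight one; partial
    sums of weight zero are treated apart. *)
Lemma ubd_convex x n (k s A : 'I_n -> R) : (forall j, 0 <= k j) -> (forall j, 0 <= s j) ->
  (forall j, ubd x (s j) (A j)) -> \sum_j k j = 1 ->
  ubd x (\sum_j k j * s j) (\sum_j k j * A j).
Proof.
move=> k0 s0 u k1.
suff H (r : seq 'I_n) : 0 < \sum_(j <- r) k j -> ubd x ((\sum_(j <- r) k j * s j) / \sum_(j <- r) k j)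
    ((\sum_(j <- r) k j * A j) / \sum_(j <- r) k j).
  by have := H (index_enum 'I_n); rewrite k1 ltr01 !divr1; exact.
elim: r => [|i r IH]; first by rewrite big_nil ltxx.
rewrite !big_cons.
have K0 : 0 <= \sum_(j <- r) k j by exact: sumr_ge0.
have [Kp|Kn] := ltP 0 (\sum_(j <- r) k j); last first.
  have Kz : \sum_(j <- r) k j = 0 by apply/eqP; rewrite eq_le Kn K0.
  have z B : \sum_(j <- r) k j * B j = 0.
    move/eqP: Kz; rewrite psumr_eq0// => /allP Kz; rewrite big_seq big1// => j /Kz /eqP ->.
    by rewrite mul0r.
  rewrite Kz !z !addr0 => ki.
  have E B : k i * B / k i = B by rewrite mulrAC divff ?mul1r// gt_eqF.
  by rewrite !E; exact: u.
have uK := IH Kp; clear IH; move: uK Kp; set S := \sum_(j <- r) k j * s j; set T := \sum_(j <- r) k j * A j.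
have S0 : 0 <= S by apply: sumr_ge0 => j _; exact: mulr_ge0.
clearbody S T; move: (\sum_(j <- r) k j) K0 S0 => K K0 S0 uK Kp Kt.
have l01 : 0 <= k i / (k i + K) <= 1.
  by rewrite divr_ge0 ?(ltW Kt)//= ler_pdivrMr// mul1r lerDl.
have := ubd_convex2 (s0 i) (divr_ge0 S0 K0) l01 (u i) uK.
have n1 : K != 0 by rewrite gt_eqF.
have n2 : k i + K != 0 by rewrite gt_eqF.
rewrite (_ : k i / (k i + K) * s i + _ = (k i * s i + S) / (k i + K)); last by field; rewrite ?n1 ?n2.
by rewrite (_ : k i / (k i + K) * A i + _ = (k i * A i + T) / (k i + K)); last by field; rewrite ?n1 ?n2.
Qed.

End Kiselev.

(** * Kiselev's minimum principle *)

Section MinimumPrinciple.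
Variables (R : realType) (phi : P1 R -> R).
Hypothesis hphi : kahler_potential phi.
Local Notation P := (plane R).
Local Notation phat := (phat phi).
Variable psi : P1 R * P -> \bar R.
Hypothesis hpsi : HMAE_candidate phi psi.
Local Notation hm := (hm psi).
Local Notation ubd := (ubd psi).

Lemma continuous_cmul2 (p : P * P) : {for p, continuous (fun p : P * P => cmul p.1 p.2)}.
Proof.
have c11 : (fun p : P * P => p.1.1) @ p --> p.1.1 by apply: (@cvg_comp_fst _ _ _ (@fst R R)); exact: cvg_fst.
have c12 : (fun p : P * P => p.1.2) @ p --> p.1.2 by apply: (@cvg_comp_fst _ _ _ (@snd R R)); exact: cvg_snd.
have c21 : (fun p : P * P => p.2.1) @ p --> p.2.1 by apply: (@cvg_comp_snd _ _ _ (@fst R R)); exact: cvg_fst.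
have c22 : (fun p : P * P => p.2.2) @ p --> p.2.2 by apply: (@cvg_comp_snd _ _ _ (@snd R R)); exact: cvg_snd.
rewrite /prop_for /continuous_at (_ : (fun p => _) = fun p : P * P =>
  (p.1.1 * p.2.1 - p.1.2 * p.2.2, p.1.1 * p.2.2 + p.1.2 * p.2.1)); last first.
  by apply/funext => q; rewrite cmulE.
rewrite (cmulE p.1 p.2).
exact: (cvg_pair (cvgB (cvgM c11 c21) (cvgM c12 c22)) (cvgD (cvgM c11 c22) (cvgM c12 c21))).
Qed.

Lemma compact_circle (r : R) : compact [set tau : P | sqmod tau = r].
Proof.
apply: (@subclosed_compact _ _ (cdisc 0 r)).
- apply: (@closed_comp _ _ (@sqmod R) [set t | t = r]); last exact: closed_eq.
  by move=> y _; exact: continuous_sqmod.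
- exact: compact_cdisc.
- by move=> y /= yr; rewrite /cdisc /= subr0 yr.
Qed.

(** Upper semicontinuity at each point of the circle, made uniform by compactness. *)
Lemma ubd_near x s A A' : ubd x s A -> A < A' -> \forall y \near x, ubd y s A'.
Proof.
move=> u AA.
have /compact_near_coveringP cK := @compact_circle (expR (- s)).
suff H : \forall y \near x, [set tau : P | sqmod tau = expR (- s)] `<=`
    (fun tau => (hm (cmul tau y, tau) < A'%:E)%E).
  by apply: filterS H => y Hy tau tt; exact: ltW (Hy tau tt).
apply: (cK _ (nbhs x) (fun y tau => (hm (cmul tau y, tau) < A'%:E)%E)) => tau ht.
have hA : (hm (cmul tau x, tau) < A'%:E)%E by apply: le_lt_trans (u tau ht) _; rewrite lte_fin.
have cc : {for (tau, x), continuous (fun p : P * P => (cmul p.1 p.2, p.1))}.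
  exact: (cvg_pair (continuous_cmul2 (p := (tau, x))) cvg_fst).
have [[B C] /= [nB nC] BC] := near_comp cc (usc_hm hpsi hA).
by exists (B, C).
Qed.

Variables (t s1 : R).
Hypotheses (t0 : 0 <= t) (t1 : t <= 1) (s10 : 0 < s1).

(** Kiselev's partial infimum: a Legendre transform, over [s >= s1], of the supremum of the
    candidate on the circle [|tau|^2 = e^-s]. Upper bounds [A] stand for that supremum, which may be
    [-oo]. *)
Definition chi (x : P) : \bar R := ereal_inf [set r%:E | r in [set r : R |
  exists s A, [/\ s1 <= s, ubd x s A & r = A + (1 - t) * (s - s1)]]].

Lemma chi_le x s A : s1 <= s -> ubd x s A -> (chi x <= (A + (1 - t) * (s - s1))%:E)%E.
Proof. by move=> ss u; apply: ereal_inf_lbound; exists (A + (1 - t) * (s - s1)) => //; exists s, A. Qed.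

Lemma chi_lt x r : (chi x < r%:E)%E ->
  exists s A, [/\ s1 <= s, ubd x s A & A + (1 - t) * (s - s1) < r].
Proof. by move/ereal_inf_lt => [_ [_ [s [A [ss u ->]]] <-]]; rewrite lte_fin => h; exists s, A. Qed.

Lemma usc_chi x : usc_at chi x.
Proof.
move=> r /chi_lt[s [A [ss u Ar]]].
have AA : A < A + (r - (A + (1 - t) * (s - s1))) / 2 by rewrite ltrDl divr_gt0// subr_gt0.
apply: filterS (ubd_near u AA) => y uy.
apply: le_lt_trans (chi_le ss uy) _; rewrite lte_fin; lra.
Qed.

Lemma ubd_phat x s : 0 <= s -> ubd x s (phat x).
Proof.
move=> s0 tau tt; apply: (hm_le_phat hpsi); rewrite tt -[leRHS]expR0 ler_expR; lra.
Qed.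

Section Touch.
Variables (x : P) (c : P * P) (r0 e d : R).
Hypotheses (e0 : 0 < e) (d0 : 0 < d).
Hypothesis Hd : forall w, sqmod w = d -> (chi (x + w)%R <= (r0 + hquad c w - e * d)%:E)%E.

(** The gap [e d] is four times [eta]: the selection of radii spends two, the Fejer interpolation
    one, and one is left in the conclusion. *)
Let eta := e * d / 4.

Let eta0 : 0 < eta. Proof. by rewrite /eta divr_gt0// mulr_gt0. Qed.

Let bound h s A := ubd (x + h) s A /\ A + (1 - t) * (s - s1) <= r0 + hquad c h - e * d + 2 * eta.

Lemma chi_select_at w : sqmod w = d -> exists2 s, s1 <= s & \forall h \near w, exists A, bound h s A.
Proof.
move=> wd.
have : (chi (x + w)%R < (r0 + hquad c w - e * d + eta)%:E)%E.
  by apply: le_lt_trans (Hd wd) _; rewrite lte_fin; have := eta0; lra.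
move=> /chi_lt[s [A [ss u Ar]]]; exists s => //.
have AA : A < A + eta / 2 by have := eta0; lra.
have cc : {for w, continuous (fun h : P => x + h)} by apply: cvgD; [exact: cvg_cst|exact: cvg_id].
have ch : hquad c w - eta / 2 < hquad c w by have := eta0; lra.
apply: filterS2 (near_comp cc (ubd_near u AA)) (near_gt (continuous_hquad (c := c) (x:=w)) ch) => h uh hh.
exists (A + eta / 2); split => //; move: Ar hh eta0; lra.
Qed.

(** Compactness of the circle. The single number [N] bounds the selected [s] from above and, through
    its inverse, the squared radius on which a choice remains valid from below. *)
Lemma chi_select : exists N : nat, forall w, sqmod w = d -> exists2 s, s1 <= s <= N.+1%:R &
  forall h, sqmod (h - w) < N.+1%:R^-1 -> exists A, bound h s A.
Proof.
have /compact_near_coveringP cK := @compact_circle d.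
have := cK _ \oo (fun N w => exists2 s, s1 <= s <= N.+1%:R &
  forall h, sqmod (h - w) < N.+1%:R^-1 -> exists A, bound h s A) _.
case=> [w /= wd|N _ HN]; last by exists N; apply: (HN N) => /=.
have [s ss /near_sqmod[rho rho0 Hr]] := chi_select_at wd.
pose N0 := Num.Def.trunc (s + 4 / rho).
have sr : 0 < s + 4 / rho by rewrite addr_gt0 ?divr_gt0//; apply: lt_le_trans ss.
have N0s : s + 4 / rho < N0.+1%:R by exact: truncnS_gt.
have r40 : 0 < 4 / rho by rewrite divr_gt0.
exists ([set w' | sqmod (w' - w) < rho / 4], [set N | (N0 <= N)%N]).
  split => /=; last exact: nbhs_infty_ge.
  apply/near_sqmod; exists (rho / 4); first by rewrite divr_gt0.
  by move=> h; rewrite /= [w + h]addrC addrK.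
move=> [w' N] /= [ww NN].
have NR : s + 4 / rho < N.+1%:R by apply: lt_le_trans N0s _; rewrite ler_nat ltnS.
exists s; first by rewrite ss /=; move: NR r40; lra.
move=> h hw; have : bound h s = bound (w + (h - w)) s by rewrite addrC subrK.
move=> ->; apply: Hr.
have -> : h - w = (h - w') + (w' - w) by rewrite addrA subrK.
apply: le_lt_trans (sqmodD_le _ _) _.
have N1 : N.+1%:R^-1 < rho / 4.
  rewrite -[ltRHS]invrK ltf_pV2 ?posrE ?invr_gt0 ?divr_gt0// invf_div.
  have s0 : 0 < s by apply: lt_le_trans ss.
  by move: NR; lra.
by move: N1 hw ww; move: (N.+1%:R^-1) (sqmod (h - w')) (sqmod (w' - w)) => a1 a2 a3; lra.
Qed.

(* The parameters selected at the nodes are interpolated by a positive harmonic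
   function built from the Fejer kernels; convexity in the radius is Jensen's
   inequality for the interpolation weights. *)
Lemma chi_touch_lt : (chi x <= (r0 - eta)%:E)%E.
Proof.
have [N HN] := chi_select.
have [B HB] : exists B : R, forall h, sqmod h <= d -> phat (x + h) - hquad c h <= B.
  have [||m _ mB] := @compact_EVT_max _ _ (fun h => phat (x + h) - hquad c h) (cdisc (0 : P) d) _ (@compact_cdisc R 0 d).
  - by exists 0; rewrite /cdisc /= subrr sqmod0 ltW.
  - apply: continuous_subspaceT => y; apply: cvgB; last exact: continuous_hquad.
    have cc : {for y, continuous (fun h : P => x + h)} by apply: cvgD; [exact: cvg_cst|exact: cvg_id].
    by apply: (@continuous_comp _ _ _ (fun h : P => x + h) phat) => //; exact: continuous_phat.
  - by exists (phat (x + m) - hquad c m) => h hd; apply: mB; apply/mem_set; rewrite /cdisc /= subr0.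
pose al := r0 - e * d + 2 * eta.
(* At squared distance at least [1 / (N + 1)] from a node the penalty [Cd |h - w j|^2] outweighs all
   other terms, so there the general bound by [phat] already implies the bound by [A j h]. *)
pose Cd := (`|B| + `|al| + N.+1%:R) * N.+1%:R.
have N1 : 0 < N.+1%:R :> R by rewrite ltr0n.
have Cd0 : 0 <= Cd by rewrite mulr_ge0// !addr_ge0.
have [M M0 HM] : exists2 M : nat, (0 < M)%N & Cd * d * (2 / M%:R) <= eta.
  exists (Num.Def.trunc (Cd * d * 2 / eta)).+1 => //.
  have : Cd * d * 2 / eta < (Num.Def.trunc (Cd * d * 2 / eta)).+1%:R by exact: truncnS_gt.
  rewrite mulrA ler_pdivrMr ?ltr0n// ltr_pdivrMr ?eta0// => /ltW.
  by rewrite (mulrC eta).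
pose rr := Num.sqrt d.
have rr2 : rr ^+ 2 = d by rewrite sqr_sqrtr// ltW.
have rr0 : rr != 0 by apply/eqP => rz; move: d0; rewrite -rr2 rz expr0n ltxx.
pose w (j : 'I_M.+1) : P := cmul (rr, 0) (cis (node R M.+1 j)).
have ws (a : P) : sqmod (cmul (rr, 0) a) = d * sqmod a.
  by rewrite sqmodM /sqmod /= expr0n addr0 rr2.
have wd j : sqmod (w j) = d by rewrite ws sqmod_cis mulr1.
have /choice[s Hs] : forall j : 'I_M.+1, exists s, s1 <= s <= N.+1%:R /\
    forall h, sqmod (h - w j) < N.+1%:R^-1 -> exists A, bound h s A.
  by move=> j; have [s h1 h2] := HN (w j) (wd j); exists s.
have s1s j : s1 <= s j by have [/andP[]] := Hs j.
have s0 j : 0 <= s j by apply: le_trans (s1s j); exact: ltW.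
pose A j h := al + hquad c h - (1 - t) * (s j - s1) + Cd * sqmod (h - w j).
have ubdA j h : sqmod h = d -> ubd (x + h) (s j) (A j h).
  move=> hd; have [/andP[_ sN] Hj] := Hs j.
  have t10 : 0 <= 1 - t by rewrite subr_ge0.
  have [near|far] := ltP (sqmod (h - w j)) N.+1%:R^-1.
    have [A' [u' A'le]] := Hj h near; apply: ubd_le u' _.
    have : 0 <= Cd * sqmod (h - w j) by rewrite mulr_ge0// sqmod_ge0.
    rewrite /A; move: A'le; rewrite /al; lra.
  apply: ubd_le (ubd_phat (x + h) (s0 j)) _.
  have hB := HB h; rewrite hd lexx in hB; have {}hB := hB isT.
  have : `|B| + `|al| + N.+1%:R <= Cd * sqmod (h - w j).
    have q1 : 1 <= N.+1%:R * sqmod (h - w j) by rewrite mulrC -ler_pdivrMr// mul1r.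
    by rewrite /Cd -mulrA ler_peMr ?addr_ge0.
  have sle : (1 - t) * (s j - s1) <= N.+1%:R.
    apply: (@le_trans _ _ (s j - s1)); last by apply: le_trans sN; rewrite lerBlDr lerDl ltW.
    by rewrite ler_piMl ?subr_ge0 ?s1s//; move: t0; lra.
  have := ler_norm B; have := ler_norm (- al); rewrite normrN /A.
  move: sle hB; move: (phat _) (hquad _ _) (Cd * _) ((1 - t) * _) => a1 a2 a3 a4; lra.
pose k (j : 'I_M.+1) (h : P) : P := fejer M j (cmul (rr^-1, 0) h).
have hk j y : hol2 (k j) y.
  apply: (@hol2_comp R (@fejer R M j) (fun h => cmul (rr^-1, 0) h)); last exact: hol2_fejer.
  by apply: hol2M; [exact: hol2_cst|exact: hol2_id].
(* A holomorphic function whose real part averages the selected [s j] with the Fejer weights. *)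
pose Q h := \sum_j cmul (s j, 0) (k j h).
have hQ y : hol2 Q y by apply: hol2_sum => j; apply: hol2M; [exact: hol2_cst|exact: hk].
have Q1 h : (Q h).1 = \sum_j (k j h).1 * s j.
  by rewrite fst_sum; apply: eq_bigr => j _; rewrite cmulE /=; ring.
have circ h : sqmod h = d -> exists th, h = cmul (rr, 0) (cis th) /\ cmul (rr^-1, 0) h = cis th.
  move=> hd; have [|th E] := @circle_param R (cmul (rr^-1, 0) h).
    by rewrite sqmodM hd /sqmod /= expr0n addr0 exprVn rr2 mulVf// gt_eqF.
  by exists th; split => //; rewrite -E; apply: plane_eq; rewrite !cmulE /=; field.
have k_ge0 h j : sqmod h = d -> 0 <= (k j h).1.
  by move=> /circ[th [_ E]]; rewrite /k E; exact: fejer_ge0.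
have k_sum h : sqmod h = d -> \sum_j (k j h).1 = 1.
  move=> /circ[th [_ E]]; rewrite -(@fejer_sum1 R M th M0); apply: eq_bigr => j _.
  by rewrite /k E.
have k_conc h : sqmod h = d -> Cd * \sum_j (k j h).1 * sqmod (h - w j) <= eta.
  move=> /circ[th [E1 E]]; apply: le_trans HM; rewrite -mulrA ler_wpM2l//.
  rewrite -(@fejer_conc R M th M0) mulr_sumr ler_sum// => j _.
  rewrite /k E (_ : h - w j = cmul (rr, 0) (cis th - cis (node R M.+1 j))).
    by rewrite ws mulrCA.
  by rewrite {1}E1 /w; apply: plane_eq; rewrite !cmulE /=; ring.
have Q_circle h : sqmod h = d -> s1 <= (Q h).1.
  move=> hd; rewrite Q1 -[leLHS]mul1r -(k_sum h hd) mulr_suml ler_sum// => j _.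
  by rewrite ler_wpM2l ?k_ge0.
have Q_disc h : sqmod h <= d -> s1 <= (Q h).1.
  move=> hd; rewrite -lerN2 -lee_fin.
  apply: (@max_principle R (cdisc 0 d) [set y | sqmod (y - 0) < d] (fun y => (- (Q y).1)%:E)).
  - exact: compact_cdisc.
  - exact: open_disc.
  - by move=> y /ltW.
  - apply: usc_in_at => y _ r; rewrite lte_fin => Hy.
    have cQ : {for y, continuous (fun y => - (Q y).1)}.
      by apply: cvgN; exact: hjet_continuous (hol2_hjet (hQ y)).
    by apply: filterS (near_lt cQ Hy) => z; rewrite lte_fin.
  - by move=> y _; exact: ltry.
  - move=> y _; apply: hjet_not_touched.
    by apply: eq_hjet (hjetZ (-1) (hol2_hjet (hQ y))) => z; rewrite mulN1r.
  - move=> y; rewrite /cdisc /= subr0 => yd /negP; rewrite -leNgt => yd'.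
    by rewrite lee_fin lerN2; apply: Q_circle; apply/eqP; rewrite eq_le yd.
  - by rewrite /cdisc /= subr0.
have ubd0 : ubd x (Q 0).1 (al + eta - (1 - t) * ((Q 0).1 - s1)).
  move=> tau tt.
  (* Since [|tu h|^2 = e^(- Re Q h)], the holomorphic curve [h |-> (tu h (x + h), tu h)] meets each
     orbit at the interpolated radius and passes through the given point at [h = 0]. Along it the
     candidate is subharmonic. *)
  pose tu h := cmul tau (cexp (cmul (- 2^-1, 0) (Q h - Q 0))).
  have htu y : hol2 tu y.
    apply: hol2M; first exact: hol2_cst.
    apply: (@hol2_comp R (@cexp R) (fun h => cmul (- 2^-1, 0) (Q h - Q 0))); last exact: hol2_cexp.
    by apply: hol2M; [exact: hol2_cst|apply: hol2D => //; exact: hol2_cst].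
  have tu0 : tu 0 = tau.
    rewrite /tu subrr (_ : cmul _ 0 = 0); last by apply: plane_eq; rewrite cmulE /=; ring.
    by rewrite cexpE /= expR0 cos0 sin0; apply: plane_eq; rewrite cmulE /=; ring.
  have tus h : sqmod (tu h) = expR (- (Q h).1).
    rewrite sqmodM tt sqmod_cexp -expRD; congr expR.
    by rewrite cmulE /=; field.
  pose g h := (cmul (tu h) (x + h), tu h).
  have hg1 y : hol2 (fun h => (g h).1) y.
    by apply: hol2M => //; apply: hol2D; [exact: hol2_cst|exact: hol2_id].
  have hl y : hjet (fun h => (1 - t) * (Q h).1 + -1 * hquad c h) y.
    by apply: hjetD; apply: hjetZ; [exact: hol2_hjet|exact: hjet_hquad].
  have : (hm (g (0 : P)%R) + ((1 - t) * (Q 0).1 + -1 * hquad c 0)%:E <= (al + eta + (1 - t) * s1)%:E)%E.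
    apply: (@max_principle R (cdisc 0 d) [set y | sqmod (y - 0) < d]
      (fun h => hm (g h) + ((1 - t) * (Q h).1 + -1 * hquad c h)%:E)%E).
    - exact: compact_cdisc.
    - exact: open_disc.
    - by move=> y /ltW.
    - apply: usc_in_at => y _; apply: usc_at_addr; last exact: hjet_continuous (hl y).
      move=> r /(usc_hm hpsi); apply: near_comp.
      exact: (cvg_pair (hol2_continuous (hg1 y)) (hol2_continuous (htu y))).
    - by move=> y _; exact: lte_add_pinfty (hm_lty hpsi _) (ltry _).
    - move=> y; rewrite /= subr0 => yd /(hjet_touched (hl y)).
      apply: (@touched_comp R hm g y [set p | sqmod p.2 < 1]).
      + rewrite openE => -[p1 p2] /= pp.
        have := near_snd (near_lt (@continuous_sqmod R p2) pp : \forall y \near (p1, p2).2, sqmod y < 1).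
        exact: filterS.
      + rewrite /= tus -[ltRHS]expR0 ltr_expR oppr_lt0.
        exact: lt_le_trans s10 (Q_disc y (ltW yd)).
      + by move=> p _ r /(usc_hm hpsi); apply: filterS.
      + by move=> p _; exact: (hm_lty hpsi).
      + by move=> p b pp; exact: (hm_line_not_touched hpsi).
      + by apply: filterE => z; split.
    - move=> h; rewrite /cdisc /= subr0 => hd /negP; rewrite -leNgt => hd'.
      have {hd hd'}hd : sqmod h = d by apply/eqP; rewrite eq_le hd.
      rewrite -leeBrDr// -EFinB.
      have tth : sqmod (tu h) = expR (- \sum_j (k j h).1 * s j) by rewrite tus Q1.
      have := ubd_convex hpsi (fun j => k_ge0 h j hd) s0 (fun j => ubdA j h hd) (k_sum h hd).
      move=> /(_ (tu h) tth) /le_trans; apply; rewrite lee_fin.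
      have -> : \sum_j (k j h).1 * A j h = (al + hquad c h + (1 - t) * s1) * \sum_j (k j h).1
          - (1 - t) * (\sum_j (k j h).1 * s j) + Cd * \sum_j (k j h).1 * sqmod (h - w j).
        rewrite !mulr_sumr -sumrB -big_split; apply: eq_bigr => j _ /=; rewrite /A.
        by move: (k j h).1 (sqmod _) (hquad _ _) => a1 a2 a3; ring.
      have := k_conc h hd; rewrite k_sum// -Q1.
      by move: (\sum_j _) (Q h).1 (hquad c h) => a1 a2 a3; lra.
    - by rewrite /cdisc /= subr0 sqmod0 ltW.
  rewrite /g tu0 addr0 hquad0 mulr0 addr0 -leeBrDr// -EFinB => /le_trans; apply.
  by rewrite lee_fin; lra.
apply: le_trans (chi_le (Q_disc 0 _) ubd0) _; first by rewrite sqmod0 ltW.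
by rewrite lee_fin /al /eta; lra.
Qed.

End Touch.

Lemma chi_not_touched x : ~ touched chi x.
Proof.
move=> [r0 [c [e [Fr e0 /near0_sqmod[d d0 Hd]]]]].
have d20 : 0 < d / 2 by rewrite divr_gt0.
have := @chi_touch_lt x c r0 e (d / 2) e0 d20.
have H w : sqmod w = d / 2 -> (chi (x + w)%R <= (r0 + hquad c w - e * (d / 2))%:E)%E.
  by move=> wd; rewrite -wd; apply: Hd; rewrite wd; lra.
move=> /(_ H); rewrite Fr lee_fin.
have : 0 < e * (d / 2) by rewrite mulr_gt0.
by move: (e * (d / 2)) => q; lra.
Qed.

Lemma HSc_chi : HSc phi t chi.
Proof.
have chi_phat x : (chi x <= (phat x)%:E)%E.
  by apply: le_trans (chi_le (lexx s1) (ubd_phat x (ltW s10))) _; rewrite subrr mulr0 addr0.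
split => //.
- move=> x _; split; last exact: chi_not_touched.
    by apply: le_lt_trans (chi_phat x) _; exact: ltry.
  exact: usc_chi.
- move=> t' tt'; have [C HC] := hm_le_pot hphi hpsi.
  exists (C + ln 2 - (1 - t) * s1), (expR s1 + 1) => x xB.
  have e0 := expR_gt0 s1.
  have x0 : 0 < sqmod x by lra.
  have sl : s1 <= ln (sqmod x) by rewrite -[leLHS]expRK ler_ln ?posrE//; lra.
  (* On [|tau|^2 = 1 / |x|^2] the point [tau x] lies on the unit circle, where [pot] is [ln 2]. *)
  have u : ubd x (ln (sqmod x)) (C + ln 2).
    move=> tau tt; apply: le_trans (HC _ _ _) _.
      rewrite tt -[leRHS]expR0 ler_expR oppr_le0.
      by apply: le_trans sl; exact: ltW.
    rewrite lee_fin lerD2l /pot sqmodM tt expRN lnK ?posrE// mulVf ?gt_eqF//.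
  apply: le_trans (chi_le sl u) _; rewrite lee_fin.
  have l0 : 0 <= ln (sqmod x) by apply: le_trans sl; exact: ltW.
  have : 0 <= (t - t') * ln (sqmod x) by rewrite mulr_ge0//; lra.
  by move: (ln (sqmod x)) => l; lra.
Qed.

End MinimumPrinciple.

Section KiselevBound.
Variables (R : realType) (phi : P1 R -> R).
Hypothesis hphi : kahler_potential phi.
Local Notation P := (plane R).
Local Notation phat := (phat phi).
Variable psi : P1 R * P -> \bar R.
Hypothesis hpsi : HMAE_candidate phi psi.

(** A bound [A] at [s > s1] and the bound [phat x] at [s = 0] control the value at [s1] by three
    circles. If that value exceeds [phat x - (1 - t) s1], then [A] exceeds [phat x - (1 - t) s],
    which is what each term of the infimum [chi] requires. *)
Lemma hs_ge_of_candidate t s1 tau x : 0 <= t <= 1 -> 0 < s1 -> sqmod tau = expR (- s1) ->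
  ((phat x - (1 - t) * s1)%:E < hm psi (cmul tau x, tau))%E ->
  ((phat x - (1 - t) * s1)%:E <= hs phi t x)%E.
Proof.
move=> /andP[t0 t1] s10 tt Hf.
apply: le_trans (hs_ge x (HSc_chi hphi hpsi t0 t1 s10)).
apply: le_ereal_inf_tmp => _ [_ [s [A [ss u ->]]] <-]; rewrite lee_fin.
have [v fv vf] := ereal_between2 Hf.
move: fv; rewrite lte_fin => fv.
have [ss1|ss1] := eqVneq s s1.
  have := le_trans vf (u tau _); rewrite ss1 => /(_ tt); rewrite lee_fin subrr; lra.
have s1s : s1 < s by rewrite lt_neqAle eq_sym ss1.
have s0 : 0 < s by apply: lt_trans s1s.
have u0 := ubd_phat hpsi x (lexx 0).
have := three_circles hpsi (lexx 0) s0 u0 u (tau := tau).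
rewrite tt !ler_expR oppr0 => /(_ ltac:(lra)) /(le_trans vf).
rewrite lee_fin expRK opprK !addr0 => H.
have : - (1 - t) * s1 * s < (A - phat x) / s * s1 * s by rewrite ltr_pM2r//; lra.
have -> : (A - phat x) / s * s1 * s = (A - phat x) * s1 by field; rewrite gt_eqF.
have -> : - (1 - t) * s1 * s = (- (1 - t) * s) * s1 by ring.
by rewrite ltr_pM2r//; lra.
Qed.

End KiselevBound.

(** * Candidates for the Dirichlet problem built from Hele-Shaw envelopes *)

Section HMAEFromHeleShaw.
Variables (R : realType) (phi : P1 R -> R).
Hypothesis hphi : kahler_potential phi.
Local Notation P := (plane R).
Local Notation phat := (phat phi).
Local Notation hs := (hs phi).

(** The coordinate [1/z] in terms of the chart [c]; for the chart [z] itself it is an inversion,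
    singular at [z = 0]. *)
Definition zeta (c : bool) (y : P) : P := if c then cinv y else y.

Lemma hol2_zeta c y : (c ==> (y != 0)) -> hol2 (zeta c) y.
Proof. by case: c => /= y0; [exact: hol2_cinv|exact: hol2_id]. Qed.

Lemma near_zeta c (y : P) : (c ==> (y != 0)) -> \forall z \near y, c ==> (z != 0 :> P).
Proof. by case: c => /= y0; [exact: near_neq0|exact: filterE]. Qed.

Section Candidate.
Variables (t t' : R).
Hypotheses (t0 : 0 < t) (t1 : t <= 1) (tt' : t' < t).

(** The converse construction transports [hs t] along orbits, [x / tau] being the base point of the
    orbit through [(x, tau)]. Taking [t' < t] leaves a spare [(t - t') ln |tau|^2], which sends the
    function to [-oo] at [tau = 0]. *)
Let Psi0 (x tau : P) : \bar R :=
  if tau == 0 then -oo%E else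
    (hs t (cmul x (cinv tau)) + ((1 - t') * ln (sqmod tau) - pot x)%:E)%E.

Let Psi (p : P1 R * P) : \bar R :=
  if p.1 is Some x then if x == 0 then -oo%E else Psi0 (cinv x) p.2 else Psi0 0 p.2.

Let Psi_zeta c y tau : (c ==> (y != 0)) -> Psi (chart c y, tau) = Psi0 (zeta c y) tau.
Proof.
case: c => /= [y0|_]; first by rewrite /Psi /= (negPf y0).
rewrite /chart; have [->//|y0] := eqVneq y 0.
by rewrite /Psi /= (negPf (cinv_neq0 y0)) cinvK.
Qed.

Let Psi_zero c y tau : ~~ (c ==> (y != 0)) -> Psi (chart c y, tau) = -oo%E.
Proof. by case: c => //=; rewrite negbK => /eqP->; rewrite /Psi /= eqxx. Qed.

Let Psi_tau0 z : Psi (z, 0) = -oo%E.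
Proof. by rewrite /Psi /Psi0 /= eqxx; case: z => // x; case: ifP. Qed.

Let Psi_lty p : (Psi p < +oo)%E.
Proof.
have H x tau : (Psi0 x tau < +oo)%E.
  by rewrite /Psi0; case: ifP => // _; exact: lte_add_pinfty (hs_lty _ _ _) (ltry _).
by case: p => [[x|] tau]; rewrite /Psi /=; first case: ifP => // _; exact: H.
Qed.

Lemma hs_le_pot : exists C, forall x, (hs t x <= ((1 - t) * pot x + C)%:E)%E.
Proof.
have [C HC] := HSc_growth hphi t; have [M M0 HM] := phi_bounded hphi.
have t10 : 0 <= 1 - t by rewrite subr_ge0.
have l2 : 0 <= ln 2 :> R by apply: ln_ge0; lra.
exists (`|C| + M + ln 2) => x; have p0 := pot_ge0 x.
have [x1|x1] := leP 1 (sqmod x).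
  apply: le_trans (HC _ (HSc_hs hphi t) x x1) _; rewrite lee_fin.
  have x0 : x != 0 by rewrite -sqmod_gt0; lra.
  have := ler_wpM2l t10 (pot_ge_ln x0); have := ler_norm C.
  by move: ((1 - t) * _) ((1 - t) * _) => a b; lra.
apply: le_trans (hs_le_phat phi t x) _; rewrite lee_fin phatE.
have := le_trans (ler_norm _) (HM (chart false x)).
have : pot x <= ln 2 by rewrite /pot ler_ln ?posrE//; have := sqmod_ge0 x; lra.
have : 0 <= (1 - t) * pot x by rewrite mulr_ge0.
by have := normr_ge0 C; move: ((1 - t) * _) => a; lra.
Qed.

(** From [pot (x / tau) <= pot x - ln |tau|^2] for [|tau| <= 1]. The logarithmic term gives upper
    semicontinuity at [tau = 0], and [- t pot x] gives it at [z = 0], where [pot x] tends to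
    infinity. *)
Let Psi0_le : exists C, forall x tau, tau != 0 -> sqmod tau <= 1 ->
  (Psi0 x tau <= (- t * pot x + (t - t') * ln (sqmod tau) + C)%:E)%E.
Proof.
have [C HC] := hs_le_pot; exists C => x tau tau0 tau1.
rewrite /Psi0 (negPf tau0); apply: le_trans (leeD2r _ (HC _)) _.
have s0 : 0 < sqmod tau by rewrite sqmod_gt0.
rewrite -EFinD lee_fin.
have : pot (cmul x (cinv tau)) <= pot x - ln (sqmod tau).
  have x0 := sqmod_ge0 x.
  rewrite /pot -ln_div ?posrE//; last by lra.
  rewrite sqmodM sqmod_cinv ler_ln ?posrE ?divr_gt0//; last 2 first.
  - by have := mulr_ge0 x0 (ltW (_ : 0 < (sqmod tau)^-1)); rewrite invr_gt0 => /(_ s0); lra.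
  - by lra.
  have -> : (1 + sqmod x) / sqmod tau = (sqmod tau)^-1 + sqmod x / sqmod tau.
    by field; exact: lt0r_neq0.
  by rewrite lerD2r invf_ge1.
have t10 : 0 <= 1 - t by rewrite subr_ge0.
move/(ler_wpM2l t10).
by move: (pot _) (pot _) (ln _) => a b l; lra.
Qed.

Let Psi_le_tau : exists C, forall z tau, tau != 0 -> sqmod tau <= 1 ->
  (Psi (z, tau) <= ((t - t') * ln (sqmod tau) + C)%:E)%E.
Proof.
have [C HC] := Psi0_le; exists C => z tau tau0 tau1.
have [->|/P1_chart_false[x ->]] := pselect (z = P1zero R).
  by rewrite -[P1zero R]/(chart true (0 : P)) Psi_zero ?eqxx// leNye.
rewrite Psi_zeta//; apply: le_trans (HC _ _ tau0 tau1) _; rewrite lee_fin.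
have : 0 <= t * pot x by rewrite mulr_ge0 ?pot_ge0// ltW.
by move: (pot x) (ln _) => a l; lra.
Qed.

Let usc_Psi c (x tau0 : P) r : sqmod tau0 <= 1 -> (Psi (chart c x, tau0) < r%:E)%E ->
  \forall p \near (x, tau0), sqmod p.2 <= 1 -> (Psi (chart c p.1, p.2) < r%:E)%E.
Proof.
move=> tau1 Pr.
have ball L : \forall y \near (0 : P), sqmod y < expR L.
  by apply/near0_sqmod; exists (expR L) => //; exact: expR_gt0.
have [tz|tn] := eqVneq tau0 0.
  have [C HC] := Psi_le_tau.
  have d0 : 0 < t - t' by rewrite subr_gt0.
  have B := ball ((r - C) / (t - t')).
  have N : \forall p \near (x, tau0), sqmod p.2 < expR ((r - C) / (t - t')).
    have {}B : \forall y \near tau0, sqmod y < expR ((r - C) / (t - t')) by rewrite tz.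
    exact: (near_snd (B : \forall y \near (x, tau0).2, _)).
  apply: filterS N => -[y tau] /= ts tau1'.
  have [->|t00] := eqVneq tau 0; first by rewrite Psi_tau0 ltNyr.
  apply: le_lt_trans (HC _ _ t00 tau1') _; rewrite lte_fin.
  have s0 : 0 < sqmod tau by rewrite sqmod_gt0.
  have : ln (sqmod tau) < (r - C) / (t - t') by rewrite -[ltRHS]expRK ltr_ln ?posrE ?expR_gt0.
  by rewrite ltr_pdivlMr// mulrC; move: (_ * ln _) => l; lra.
have [ok|nok] := boolP (c ==> (x != 0)); last first.
  move: nok Pr; case: c => //=; rewrite negbK => /eqP xz _.
  have [C HC] := Psi0_le.
  have N : \forall p \near (x, tau0), sqmod p.1 < expR ((r - C) / t).
    have B : \forall y \near x, sqmod y < expR ((r - C) / t) by rewrite xz; exact: ball.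
    exact: (near_fst (B : \forall y \near (x, tau0).1, _)).
  apply: filterS N => -[y tau] /= ts tau1'.
  have [->|t00] := eqVneq tau 0; first by rewrite Psi_tau0 ltNyr.
  have [->|y0] := eqVneq y 0; first by rewrite -[Some _]/(chart true (0 : P)) Psi_zero ?eqxx// ltNyr.
  rewrite -[Some _]/(chart true y) Psi_zeta// /zeta; apply: le_lt_trans (HC _ _ t00 tau1') _; rewrite lte_fin.
  have s0 : 0 < sqmod tau by rewrite sqmod_gt0.
  have y00 : 0 < sqmod y by rewrite sqmod_gt0.
  have : ln (sqmod y) < (r - C) / t by rewrite -[ltRHS]expRK ltr_ln ?posrE ?expR_gt0.
  rewrite ltr_pdivlMr// mulrC => h1.
  have := ler_wpM2l (ltW t0) (pot_ge_ln (cinv_neq0 y0)); rewrite ln_cinv//.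
  have : (t - t') * ln (sqmod tau) <= 0.
    by apply: mulr_ge0_le0; [rewrite subr_ge0 ltW|rewrite ln_le0].
  by move: h1; move: (pot _) (ln (sqmod y)) (_ * ln (sqmod tau)) => a b l; lra.
have N1 : \forall p \near (x, tau0), c ==> (p.1 != 0) := near_fst (near_zeta ok : \forall y \near (x, tau0).1, _).
have N2 : \forall p \near (x, tau0), p.2 != 0 := near_snd (near_neq0 tn : \forall y \near (x, tau0).2, y != 0).
have cz : {for x, continuous (zeta c)} by apply: hol2_continuous; exact: hol2_zeta.
have cg : {for (x, tau0), continuous (fun p : P * P => cmul (zeta c p.1) (cinv p.2))}.
  have c1 : (fun p : P * P => zeta c p.1) @ (x, tau0) --> zeta c x by exact: (cvg_comp_fst (t := (x, tau0)) cz).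
  have c2 : (fun p : P * P => cinv p.2) @ (x, tau0) --> cinv tau0.
    exact: (cvg_comp_snd (t := (x, tau0)) (continuous_cinv tn)).
  exact: (cvg_comp _ _ (cvg_pair c1 c2) (continuous_cmul2 (p := (zeta c x, cinv tau0)))).
have ck : {for (x, tau0), continuous (fun p : P * P => (1 - t') * ln (sqmod p.2) - pot (zeta c p.1))}.
  apply: cvgB.
    apply: cvgM; first exact: cvg_cst.
    have H := hjet_continuous (hjet_ln tn).
    exact: (cvg_comp_snd (t := (x, tau0)) H).
  have H : {for x, continuous (fun y => pot (zeta c y))} by apply: (@continuous_comp _ _ _ (zeta c)) => //; exact: continuous_pot.
  exact: (cvg_comp_fst (t := (x, tau0)) H).
have uh : usc_at (fun p : P * P => hs t (cmul (zeta c p.1) (cinv p.2))) (x, tau0).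
  by move=> s Hs; have [_ /(_ _ Hs) H _] := HSc_vsh (cmul (zeta c x) (cinv tau0)) (HSc_hs hphi t); exact: near_comp cg H.
move: Pr; rewrite Psi_zeta// /Psi0 (negPf tn) => /(usc_at_addr uh ck) H.
apply: filterS3 N1 N2 H => -[y tau] /= ok' tn' H _.
by rewrite Psi_zeta// /Psi0 (negPf tn').
Qed.

(** Off [tau = 0] and [z = 0] the function is [hs t] after a holomorphic map, plus a harmonic
    function; on these two sets it is [-oo] and cannot be touched. On [|tau| = 1] the boundary
    inequality is [hs t <= phat]. *)
Lemma hs_HMAE_candidate : exists2 psi, HMAE_candidate phi psi & forall x tau, tau != 0 ->
  psi (chart false x, tau) = (hs t (cmul x (cinv tau)) + ((1 - t') * ln (sqmod tau) - pot x)%:E)%E.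
Proof.
exists Psi; last by move=> x tau tn; rewrite Psi_zeta// /Psi0 (negPf tn).
split.
- by move=> z tau _; exact: Psi_lty.
- move=> [z tau] r /= tau1; have [c [x [-> _]]] := chart_disc z => /(usc_Psi tau1) H.
  exact/near_chart2.
- move=> c U v oU [sv dv].
  have cv x : U x -> {for x, continuous v} by move=> Ux; have := sv 0%N; apply.
  apply: (psh_intro (cline_rot2 R)).
  + by move=> p _; exact: lte_add_pinfty (Psi_lty _) (ltry _).
  + move=> [x tau] /= [Ux tau1].
    have ck : {for (x, tau), continuous (fun p : P * P => v p.1)}.
      exact: (cvg_comp_fst (t := (x, tau)) (cv x Ux)).
    apply: (@usc_at_addr R _ (fun p : P * P => Psi (chart c p.1, p.2)) (fun p => v p.1)) => //.
    move=> r /(usc_Psi (ltW tau1)) H.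
    have H2 := near_snd (near_lt (@continuous_sqmod R tau) tau1 : \forall y \near (x, tau).2, sqmod y < 1).
    by apply: filterS2 H H2 => q h1 h2; apply: h1; exact: ltW.
  + move=> a b ab h h1 T.
    pose xx k := a.1 + cmul k b.1; pose ta k := a.2 + cmul k b.2.
    have hxx y : hol2 xx y by apply: hol2D; [exact: hol2_cst|apply: hol2M; [exact: hol2_id|exact: hol2_cst]].
    have hta y : hol2 ta y by apply: hol2D; [exact: hol2_cst|apply: hol2M; [exact: hol2_id|exact: hol2_cst]].
    have {}T : touched (fun k => (Psi (chart c (xx k), ta k) + (v (xx k))%:E)%E) h by exact: T.
    have [Ux _] : U (xx h) /\ _ := ab h (ltW h1).
    have tn : ta h != 0.
      by apply/eqP => tz; move: T => [r [? [? []]]]; rewrite tz Psi_tau0.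
    have ok : c ==> (xx h != 0).
      by apply/negPn/negP => nok; move: T => [r [? [? []]]]; rewrite Psi_zero.
    have hj : hjet (fun y => v y - pot (zeta c y)) (xx h).
      have hv := FS_hjet oU Ux (conj sv dv).
      move: ok; rewrite /zeta; case: (c) => //= x0.
      apply: near_hjet (hjetD hv (hjet_ln x0)).
      by apply: filterS (near_neq0 x0) => y y0; rewrite pot_cinv//; ring.
    have hJ : hjet (fun k => (1 - t') * ln (sqmod (ta k)) + (v (xx k) - pot (zeta c (xx k)))) h.
      apply: hjetD; last exact: (hjet_comp (k := fun y => v y - pot (zeta c y)) (hxx h) hj).
      apply: hjetZ; exact: (hjet_comp (k := fun y => ln (sqmod y)) (hta h) (hjet_ln tn)).
    have N1 : \forall k \near h, c ==> (xx k != 0) := near_comp (hol2_continuous (hxx h)) (near_zeta ok).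
    have N2 : \forall k \near h, ta k != 0 := near_comp (hol2_continuous (hta h)) (near_neq0 tn).
    have : touched (fun k => hs t (cmul (zeta c (xx k)) (cinv (ta k))) +
        ((1 - t') * ln (sqmod (ta k)) + (v (xx k) - pot (zeta c (xx k))))%:E)%E h.
      apply: near_touched T; apply: filterS2 N1 N2 => k ok' tn'.
      rewrite Psi_zeta// /Psi0 (negPf tn') -addeA -EFinD; congr (_ + _%:E)%E; ring.
    move/(hjet_touched hJ).
    have [vu _ _] := HSc_hs hphi t.
    apply: (@touched_comp1 R (hs t) (fun k => cmul (zeta c (xx k)) (cinv (ta k))) h setT openT I) => //.
    apply: filterS2 N1 N2 => k ok' tn'; apply: hol2M.
      by apply: (@hol2_comp R (zeta c) xx) => //; exact: hol2_zeta.
    by apply: (@hol2_comp R (@cinv R) ta) => //; exact: hol2_cinv.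
- move=> z tau tau1; have tn : tau != 0 by rewrite -sqmod_gt0 tau1.
  have [->|/P1_chart_false[x ->]] := pselect (z = P1zero R).
    by rewrite -[P1zero R]/(chart true (0 : P)) Psi_zero ?eqxx// leNye.
  rewrite Psi_zeta// /Psi0 (negPf tn) tau1 ln1 mulr0 sub0r EFinN leeBlDr//.
  apply: le_trans (hs_le_phat _ _ _) _; rewrite phatE lee_fin -(P1mul_chart _ tau1).
  have -> : cmul tau (cmul x (cinv tau)) = x.
    have -> : cmul tau (cmul x (cinv tau)) = cmul x (cmul tau (cinv tau)).
      by apply: plane_eq; rewrite !cmulE /=; ring.
    by rewrite cinv_mulV//; apply: plane_eq; rewrite !cmulE /=; ring.
  by rewrite /pot sqmodM sqmod_cinv tau1 invr1 mulr1.
Qed.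

End Candidate.

(* The weak solution along the orbit [tau |-> tau^-1 z], plus the potential. *)
Definition worb (x tau : P) : \bar R :=
  (weak_solution phi (chart false (cmul tau x), tau) + (pot (cmul tau x))%:E)%E.

Lemma worb_le x tau : sqmod tau <= 1 -> (worb x tau <= (phat x)%:E)%E.
Proof.
move=> tau1; rewrite /worb -leeBrDr//; apply: ge_ereal_sup => _ [psi hpsi <-].
rewrite leeBrDr//; have := hm_le_phat hpsi x tau1.
by rewrite /hm /= tau1.
Qed.

(** The candidates for [t' = t - dl] are used, with [dl] tending to zero for fixed [tau]. *)
Lemma worb_ge t x tau : 0 < t <= 1 -> tau != 0 -> sqmod tau <= 1 ->
  (hs t x + ((1 - t) * ln (sqmod tau))%:E <= worb x tau)%E.
Proof.
move=> /andP[t0 t1] tn tau1.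
apply/lee_addgt0Pr => e e0; rewrite -leeBlDr//.
pose l := ln (sqmod tau).
have l1 : 0 < 1 + `|l| by rewrite ltr_pwDl.
pose dl := e / (1 + `|l|).
have dl0 : 0 < dl by rewrite divr_gt0.
have dle : dl * `|l| <= e by rewrite /dl mulrAC ler_pdivrMr// ler_pM2l//; lra.
have [psi hpsi Epsi] := @hs_HMAE_candidate t (t - dl) t0 t1 ltac:(lra).
have : (psi (chart false (cmul tau x), tau) <= weak_solution phi (chart false (cmul tau x), tau))%E.
  by apply: ereal_sup_ubound; exists psi.
rewrite Epsi// => H; rewrite /worb; apply: le_trans (leeD2r _ H).
have -> : cmul (cmul tau x) (cinv tau) = x.
  have -> : cmul (cmul tau x) (cinv tau) = cmul x (cmul tau (cinv tau)).
    by apply: plane_eq; rewrite !cmulE /=; ring.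
  by rewrite cinv_mulV//; apply: plane_eq; rewrite !cmulE /=; ring.
rewrite -EFinN -!addeA -!EFinD; apply: leeD2l; rewrite lee_fin -/l.
have := ler_norm (- l); rewrite normrN => nl.
have : dl * - l <= dl * `|l| by rewrite ler_pM2l.
move: (pot _) => q; lra.
Qed.

Lemma worb_kiselev t s1 x tau : 0 <= t <= 1 -> 0 < s1 -> sqmod tau = expR (- s1) ->
  ((phat x - (1 - t) * s1)%:E < worb x tau)%E ->
  ((phat x - (1 - t) * s1)%:E <= hs t x)%E.
Proof.
move=> t01 s10 tt; rewrite /worb -lteBlDr// -EFinB => /ereal_sup_gt[_ [psi hpsi <-]] H.
apply: (hs_ge_of_candidate hphi hpsi t01 s10 tt).
rewrite /hm /= tt -[X in _ <= X]expR0 ler_expR oppr_le0 ltW//.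
by rewrite -lteBlDr// -EFinB.
Qed.

(** From below, [hs t] is at least [(1 - t) phat - t M] by interpolation with time [0], and this
    tends to [phat] as [t] tends to [0]. *)
Lemma worb_bd x tau : sqmod tau = 1 -> worb x tau = (phat x)%:E.
Proof.
move=> tau1; apply/eqP; rewrite eq_le worb_le ?tau1//=.
have tn : tau != 0 by rewrite -sqmod_gt0 tau1.
have [M M0 HM] := phi_bounded hphi.
have Hm z : - M <= phi z by have := HM z; rewrite ler_norml => /andP[].
apply/lee_addgt0Pr => e e0; rewrite -leeBlDr// -EFinB.
pose q := 1 + `|phat x| + M.
have q0 : 0 < q by rewrite /q; have := normr_ge0 (phat x); lra.
pose t := e / (e + q).
have eq0 : 0 < e + q by lra.
have t0 : 0 < t by rewrite divr_gt0.
have t1 : t < 1 by rewrite /t ltr_pdivrMr// mul1r; lra.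
have tq : t * q <= e by rewrite /t mulrAC ler_pdivrMr// ler_pM2l//; lra.
have t01 : 0 < t <= 1 by rewrite t0 ltW.
apply: le_trans (worb_ge x t01 tn _); last by rewrite tau1.
rewrite tau1 ln1 mulr0 adde0.
have a01 : 0 < 1 - t <= 1 by lra.
have := @hs_interp _ _ hphi 0 t (1 - t) (- M) x a01 _ Hm; rewrite subr0 mulr1 => /(_ (lexx _)).
apply: le_trans; rewrite hs0// -EFinM -EFinD lee_fin.
have : t * (phat x + M) <= t * q by rewrite ler_pM2l// /q; have := ler_norm (phat x); lra.
by move: (phat x) => a; lra.
Qed.

End HMAEFromHeleShaw.

(** * Differentiability of the contact time *)

Section LinearApprox.
Variable R : realType.
Local Notation P := (plane R).
Implicit Types (f g : P -> R) (p : P).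

Definition lapprox f p := exists l, forall e, 0 < e ->
  \forall h \near (0 : P), `|f (p + h) - f p - cdot l h| <= e * cnorm h.

Lemma sqmod_small e : 0 < e -> \forall h \near (0 : P), sqmod h <= e * cnorm h.
Proof.
move=> e0; apply: filterS (near0_cnorm_lt e0) => h he.
by rewrite -sqr_cnorm expr2 ler_wpM2r ?cnorm_ge0 ?ltW.
Qed.

Lemma norm_hquad2 (c : P * P) (h : P) :
  `|hquad c h - cdot c.1 h| <= (`|c.2.1| + `|c.2.2|) * sqmod h.
Proof.
rewrite /hquad /cdot (_ : _ - _ = c.2.1 * (h.1 ^+ 2 - h.2 ^+ 2) + c.2.2 * (h.1 * h.2)); last by ring.
apply: le_trans (ler_normD _ _) _; rewrite mulrDl !(normrM c.2.1) !(normrM c.2.2); apply: lerD.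
  rewrite ler_wpM2l// ler_norml /sqmod; have := sqr_ge0 h.1; have := sqr_ge0 h.2.
  by move=> a b; apply/andP; split; lra.
by rewrite ler_wpM2l// norm_prod_le_sqmod.
Qed.

Lemma jet_lapprox f p m : jet f p m -> lapprox f p.
Proof.
move=> [c fc]; exists c.1 => e e0.
pose A := `|c.2.1| + `|c.2.2| + `|m| + 1.
have A0 : 0 < A by rewrite /A ltr_wpDl// !addr_ge0.
have eA : 0 < e / A by rewrite divr_gt0.
apply: filterS2 (fc 1 ltr01) (sqmod_small eA) => h h1 h2.
have h3 := norm_hquad2 c h.
have h4 : `|m * sqmod h| <= `|m| * sqmod h by rewrite normrM (ger0_norm (sqmod_ge0 h)).
have -> : f (p + h) - f p - cdot c.1 h = (f (p + h) - f p - hquad c h - m * sqmod h) +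
  (hquad c h - cdot c.1 h) + m * sqmod h by ring.
have : A * sqmod h <= e * cnorm h.
  by move: h2; rewrite mulrAC ler_pdivlMr// mulrC.
apply: le_trans; apply: le_trans (ler_normD _ _) _.
by have := ler_normD (f (p + h) - f p - hquad c h - m * sqmod h) (hquad c h - cdot c.1 h); rewrite /A; lra.
Qed.

Lemma hjet_lapprox f p : hjet f p -> lapprox f p.
Proof.
move=> [c fc]; apply: (@jet_lapprox f p 0); exists c => e e0.
by apply: filterS (fc e e0) => h; rewrite mul0r subr0.
Qed.

Lemma hol2_fst_lapprox (w : P -> P) p : hol2 w p -> lapprox (fun x => (w x).1) p.
Proof. by move=> hw; apply: hjet_lapprox; exact: hol2_hjet. Qed.

Lemma hol2_snd_lapprox (w : P -> P) p : hol2 w p -> lapprox (fun x => (w x).2) p.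
Proof.
move=> hw; apply: hjet_lapprox; have := hol2_hjet (hol2M (hol2_cst (0, -1) p) hw).
by apply: eq_hjet => x; rewrite cmulE /=; ring.
Qed.

Lemma lapprox_cst (a : R) p : lapprox (fun=> a) p.
Proof. by apply: hjet_lapprox; exact: hjet_cst. Qed.

Lemma lapproxD f g p : lapprox f p -> lapprox g p -> lapprox (fun x => f x + g x) p.
Proof.
move=> [l fl] [k gk]; exists (l + k) => e e0.
have e2 : 0 < e / 2 by rewrite divr_gt0.
apply: filterS2 (fl _ e2) (gk _ e2) => h h1 h2.
have -> : f (p + h) + g (p + h) - (f p + g p) - cdot (l + k) h =
  (f (p + h) - f p - cdot l h) + (g (p + h) - g p - cdot k h) by rewrite /cdot /=; ring.
by apply: le_trans (ler_normD _ _) _; lra.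
Qed.

Lemma lapprox_lip f p : lapprox f p -> exists2 C, 0 <= C & \forall h \near (0 : P), `|f (p + h) - f p| <= C * cnorm h.
Proof.
move=> [l fl]; exists (cnorm l + 1); first by have := cnorm_ge0 l; lra.
apply: filterS (fl 1 ltr01) => h h1; have h2 := cdot_le l h.
have -> : f (p + h) - f p = (f (p + h) - f p - cdot l h) + cdot l h by ring.
by apply: le_trans (ler_normD _ _) _; lra.
Qed.

Lemma lapproxM f g p : lapprox f p -> lapprox g p -> lapprox (fun x => f x * g x) p.
Proof.
move=> lf lg; have [C C0 fC] := lapprox_lip lf; have [D D0 gD] := lapprox_lip lg.
have [l fl] := lf; have [k gk] := lg.
exists ((f p * k.1 + g p * l.1, f p * k.2 + g p * l.2)) => e e0.
pose A := `|f p| + `|g p| + C * D + 1.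
have A0 : 0 < A by rewrite /A ltr_wpDl// !addr_ge0// mulr_ge0.
have eA : 0 < e / A by rewrite divr_gt0.
near=> h.
have h1 : `|f (p + h) - f p - cdot l h| <= e / A * cnorm h by near: h; exact: fl.
have h2 : `|g (p + h) - g p - cdot k h| <= e / A * cnorm h by near: h; exact: gk.
have h3 : `|f (p + h) - f p| <= C * cnorm h by near: h.
have h4 : `|g (p + h) - g p| <= D * cnorm h by near: h.
have h5 : sqmod h <= e / A * cnorm h by near: h; exact: sqmod_small.
have n0 := cnorm_ge0 h.
have -> : f (p + h) * g (p + h) - f p * g p - cdot (f p * k.1 + g p * l.1, f p * k.2 + g p * l.2) h =
  f p * (g (p + h) - g p - cdot k h) + g p * (f (p + h) - f p - cdot l h) +
  (f (p + h) - f p) * (g (p + h) - g p) by rewrite /cdot /=; ring.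
have q1 : `|f p * (g (p + h) - g p - cdot k h)| <= `|f p| * (e / A * cnorm h) by rewrite normrM ler_wpM2l.
have q2 : `|g p * (f (p + h) - f p - cdot l h)| <= `|g p| * (e / A * cnorm h) by rewrite normrM ler_wpM2l.
have q3 : `|(f (p + h) - f p) * (g (p + h) - g p)| <= C * D * (e / A * cnorm h).
  rewrite normrM; apply: (@le_trans _ _ (C * cnorm h * (D * cnorm h))); first exact: ler_pM.
  rewrite (_ : _ * _ = C * D * sqmod h); last by rewrite -sqr_cnorm; ring.
  by rewrite ler_wpM2l// mulr_ge0.
have q4 : e * cnorm h = A * (e / A * cnorm h) by field; rewrite gt_eqF.
have q5 : 0 <= e / A * cnorm h by rewrite mulr_ge0// ltW.
rewrite q4 /A -/A; move: (e / A * cnorm h) q1 q2 q3 q5 => q q1 q2 q3 q5.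
apply: le_trans (ler_normD _ _) _.
apply: le_trans (lerD (ler_normD _ _) (lexx _)) _.
by rewrite /A; lra.
Unshelve. all: by end_near. Qed.

Lemma has_diff_within_comp (D : set (P * P)) (B : P * P -> R) (w : P -> P) p (tau : P)
    (L : {linear (P * P)%type -> R}) : hol2 w p -> (forall x, D (w x, tau)) ->
  has_diff_within D B (w p, tau) L -> lapprox (fun x => B (w x, tau)) p.
Proof.
move=> hw Dw HB.
pose a := L ((1, 0), 0); pose b := L ((0, 1), 0).
have Lab (u : P) : L (u, 0) = u.1 * a + u.2 * b.
  have -> : (u, 0) = u.1 *: (((1, 0), 0) : P * P) + u.2 *: (((0, 1), 0) : P * P).
    by apply/pair_equal_spec; split; apply: plane_eq; rewrite /= /GRing.scale /=; ring.
  by rewrite linearD !linearZ.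
have := lapproxD (lapproxM (hol2_fst_lapprox hw) (lapprox_cst a p))
  (lapproxM (hol2_snd_lapprox hw) (lapprox_cst b p)).
move=> [l Hl]; exists l => e e0.
have [C C0 HC] := hol2_bigO1 hw.
have C1 : 0 < 2 * (C + 1) by lra.
have e2 : 0 < e / 2 by rewrite divr_gt0.
have eC : 0 < e / (2 * (C + 1)) by rewrite divr_gt0.
have cw : {for (0 : P), continuous (fun h : P => (w (p + h), tau))}.
  have cc : {for (0 : P), continuous (fun h : P => p + h)} by apply: cvgD; [exact: cvg_cst|exact: cvg_id].
  have c1 : {for (0 : P), continuous (fun h : P => w (p + h))}.
    apply: (@continuous_comp _ _ _ (fun h : P => p + h) w) => //.
    by rewrite addr0; exact: hol2_continuous.
  exact: (cvg_pair c1 (cvg_cst tau)).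
have HB' : \forall y \near (w (p + 0), tau), D y -> `|B y - B (w p, tau) - L (y - (w p, tau))| <= e / (2 * (C + 1)) * `|y - (w p, tau)|.
  by rewrite addr0; exact: HB.
apply: filterS3 (Hl _ e2) HC (near_comp cw HB') => h h1 h2 /(_ (Dw _)).
have -> : (w (p + h), tau) - (w p, tau) = (w (p + h) - w p, 0).
  by apply/pair_equal_spec; rewrite /= subrr.
rewrite Lab /= => h3.
have h4 : `|(w (p + h) - w p, 0 : P)| <= C * cnorm h.
  apply: le_trans h2; rewrite prod_normE /= normr0.
  rewrite ge_max cnorm_ge0 andbT -(@ler_pXn2r _ 2) ?nnegrE ?cnorm_ge0//.
  by rewrite sqr_cnorm norm_le_sqmod.
have h5 : e / (2 * (C + 1)) * `|(w (p + h) - w p, 0 : P)| <= e / 2 * cnorm h.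
  apply: (@le_trans _ _ (e / (2 * (C + 1)) * (C * cnorm h))); first by rewrite ler_wpM2l// ltW.
  have -> : e / (2 * (C + 1)) * (C * cnorm h) = (e / 2 * cnorm h) * (C / (C + 1)).
    by move: (cnorm h) => q; field; lra.
  rewrite ler_piMr ?mulr_ge0 ?cnorm_ge0 ?(ltW e0)//.
  by rewrite ler_pdivrMr ?mul1r; lra.
have -> : B (w (p + h), tau) - B (w p, tau) - cdot l h =
  (B (w (p + h), tau) - B (w p, tau) - ((w (p + h) - w p).1 * a + (w (p + h) - w p).2 * b)) +
  ((w (p + h)).1 * a + (w (p + h)).2 * b - ((w p).1 * a + (w p).2 * b) - cdot l h) by rewrite /=; ring.
by apply: le_trans (ler_normD _ _) _; move: h1 h3 h5; rewrite /=; lra.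
Qed.

End LinearApprox.

Section Slope.
Variables (R : realType) (phi : P1 R -> R).
Hypothesis hphi : kahler_potential phi.
Local Notation P := (plane R).
Local Notation phat := (phat phi).
Local Notation hs := (hs phi).

Lemma small_pos (a b c d : R) : 0 < a -> 0 < b -> 0 < c -> 0 < d ->
  exists s, [/\ 0 < s, s < a, s < b, s < c & s < d].
Proof.
move=> a0 b0 c0 d0; pose m := Num.min (Num.min a b) (Num.min c d).
have m0 : 0 < m by rewrite !lt_min a0 b0 c0 d0.
have [ma mb mc md] : [/\ m <= a, m <= b, m <= c & m <= d].
  by split; rewrite !ge_min lexx ?orbT.
by exists (m / 2); split; lra.
Qed.

Lemma ln1p_bound (u : R) : `|u| <= 2^-1 -> `|ln (1 + u) - u| <= 2 * u ^+ 2.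
Proof.
move=> us; move: (us); rewrite ler_norml => /andP[u1 u2].
have h1 : ln (1 + u) <= u by apply: le_ln1Dx; lra.
have h2 : u - 2 * u ^+ 2 <= ln (1 + u).
  have i0 : 0 < 1 + u by lra.
  have E : ln (1 + u) = - ln (1 + - (u / (1 + u))).
    have -> : 1 + - (u / (1 + u)) = (1 + u)^-1 by field; lra.
    by rewrite lnV ?posrE// opprK.
  have q1 : - (u / (1 + u)) > -1.
    have -> : - (u / (1 + u)) = -1 + (1 + u)^-1 by field; lra.
    by rewrite ltrDl invr_gt0.
  have := le_ln1Dx q1; rewrite E.
  have : u - 2 * u ^+ 2 <= u / (1 + u).
    rewrite ler_pdivlMr//; have := sqr_ge0 u; rewrite expr2; nra.
  by move: (ln _) => a; move: (u / _) => b; lra.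
by rewrite ler_norml; have := sqr_ge0 u; move: (ln (1 + u)) h1 h2 => a; lra.
Qed.

Section Ray.
Variables (x tau0 : P) (d : R).
Hypothesis t01 : sqmod tau0 = 1.
Hypothesis slope : forall e, 0 < e -> exists2 s0 : R, 0 < s0 & forall s, 0 < s < s0 ->
  exists2 r, worb phi x (cmul (1 - s, 0) tau0) = r%:E & `|r - phat x - d * s| <= e * s.

Let tau (s : R) := cmul (1 - s, 0) tau0.

Let sqmod_tau s : sqmod (tau s) = (1 - s) ^+ 2.
Proof. by rewrite sqmodM t01 mulr1 /sqmod /= expr0n addr0. Qed.

Let ln_tau (s : R) : 0 < s <= 2^-1 -> `|ln (sqmod (tau s)) + 2 * s| <= 4 * s ^+ 2.
Proof.
move=> s01; rewrite sqmod_tau lnXn; last by lra.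
have := @ln1p_bound (- s); rewrite normrN ger0_norm; last by lra.
move=> /(_ ltac:(lra)); rewrite sqrrN opprK mulr2n => H.
have -> : ln (1 - s) + ln (1 - s) + 2 * s = 2 * (ln (1 - s) + s) by ring.
by rewrite normrM ger0_norm//; lra.
Qed.

(** Contact at time [t] puts [phat + (1 - t) ln |tau|^2] below the solution, and the logarithm is
    [- 2 s] to first order on the ray; hence [d >= - 2 (1 - t)]. *)
Lemma slope_lower t : 0 < t <= 1 -> hs t x = (phat x)%:E -> t <= 1 + d / 2.
Proof.
move=> t1 ht.
rewrite -subr_ge0; apply/ler_addgt0Pl => e e0.
have [s0 s00 Hs] := slope e0.
have [s [sp ss0 /ltW sh /ltW se _]] : exists s, [/\ 0 < s, s < s0, s < 2^-1, s < e / 4 & s < 1].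
  by apply: small_pos => //; rewrite divr_gt0.
have [r Er] := Hs s ltac:(by rewrite sp ss0).
have {}Er : worb phi x (tau s) = r%:E := Er.
have st : sqmod (tau s) <= 1 by rewrite sqmod_tau expr_le1//; lra.
have tn : tau s != 0.
  by rewrite -sqmod_gt0 sqmod_tau exprn_gt0//; lra.
have := worb_ge hphi x t1 tn st; rewrite ht Er -EFinD lee_fin.
have := @ln_tau s ltac:(by rewrite sp sh); rewrite !ler_norml => /andP[l1 l2] H /andP[_ r2].
have : (1 - t) * (- 2 * s - 4 * s ^+ 2) <= (1 - t) * ln (sqmod (tau s)) by rewrite ler_wpM2l; lra.
have : (1 - t) * (4 * s ^+ 2) <= e * s.
  apply: (@le_trans _ _ (4 * s ^+ 2)).
    by rewrite ler_piMl ?mulr_ge0 ?sqr_ge0//; lra.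
  by rewrite expr2 mulrA ler_wpM2r ?(ltW sp)//; lra.
move: H r2; move: (ln _) => l H r2 q1 q2.
have : 0 <= (e + (1 + d / 2 - t)) * s by lra.
by rewrite pmulr_lge0.
Qed.

(** For [t] below [1 + d / 2] the solution exceeds [phat - (1 - t) s1] when [s1 = - ln |tau|^2] is
    small. Kiselev's bound turns this into [hs t >= phat - (1 - t) s1], and then [s1] tends to
    [0]. *)
Lemma slope_upper t : 0 <= t <= 1 -> t < 1 + d / 2 -> hs t x = (phat x)%:E.
Proof.
move=> t1 td; apply/eqP; rewrite eq_le hs_le_phat/=.
apply/lee_addgt0Pr => e e0; rewrite -leeBlDr// -EFinB.
pose e1 := d / 2 + 1 - t.
have e10 : 0 < e1 by rewrite /e1; lra.
have dE : d = 2 * e1 - 2 * (1 - t) by rewrite /e1; field.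
clearbody e1.
have [s0 s00 Hs] := slope e10.
have [s [sp ss0 /ltW sh /ltW se /ltW se1]] : exists s, [/\ 0 < s, s < s0, s < 2^-1, s < e / 4 & s < e1 / 8].
  by apply: small_pos => //; rewrite divr_gt0.
have [r Er] := Hs s ltac:(by rewrite sp ss0).
have {}Er : worb phi x (tau s) = r%:E := Er.
have := @ln_tau s ltac:(by rewrite sp sh); rewrite !ler_norml => /andP[l1 l2] /andP[r1 _].
have tp : 0 < sqmod (tau s) by rewrite sqmod_tau exprn_gt0//; lra.
have ss : s ^+ 2 <= 2^-1 * s by rewrite expr2 ler_wpM2r// ltW.
have ss2 : s ^+ 2 <= e1 / 8 * s by rewrite expr2 ler_wpM2r// ltW.
have lneg : ln (sqmod (tau s)) < 0.
  by apply: ln_lt0; rewrite tp sqmod_tau expr_lt1//; lra.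
pose s1 := - ln (sqmod (tau s)).
have s10 : 0 < s1 by rewrite /s1 oppr_gt0.
have tt : sqmod (tau s) = expR (- s1) by rewrite /s1 opprK lnK.
have m1 : (1 - t) * s1 <= s1 by rewrite ler_piMl ?(ltW s10)//; lra.
have m2 : (1 - t) * (2 * s - 4 * s ^+ 2) <= (1 - t) * s1.
  by rewrite ler_wpM2l//; [lra|rewrite /s1; move: (ln _) l2 => l; lra].
have m3 : (1 - t) * (4 * s ^+ 2) <= 4 * s ^+ 2 by rewrite ler_piMl ?mulr_ge0 ?sqr_ge0//; lra.
have := worb_kiselev hphi (x := x) t1 s10 tt; rewrite Er lte_fin.
have : phat x - (1 - t) * s1 < r.
  have : (e1 / 2) * s < e1 * s by rewrite ltr_pM2r//; lra.
  move: r1 m2 m3 ss2; rewrite dE; move: ((1 - t) * s1) (phat x) => f g.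
  by move: sp e10; clear; move=> *; lra.
move=> /[swap] /[apply]; apply: le_trans; rewrite lee_fin.
have : s1 <= e by rewrite /s1; move: (ln _) l1 l2 => l; lra.
by move: m1; lra.
Qed.

End Ray.

Lemma pot_ray (w : P) (e : R) : 0 < e -> exists2 s0 : R, 0 < s0 & forall s, 0 < s < s0 ->
  `|pot (cmul (1 - s, 0) w) - pot w - (- 2 + 2 * (1 + sqmod w)^-1) * s| <= e * s.
Proof.
move=> e0; exists (Num.min (4^-1) (e / 9)); first by rewrite lt_min invr_gt0 ltr0n divr_gt0.
move=> s /andP[s0]; rewrite lt_min => /andP[s1 s2].
have q0 := sqmod_ge0 w.
pose k := sqmod w / (1 + sqmod w).
have k01 : 0 <= k <= 1.
  by rewrite /k divr_ge0//=; [rewrite ler_pdivrMr; lra|lra].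
have kE : - 2 + 2 * (1 + sqmod w)^-1 = - 2 * k by rewrite /k; field; lra.
pose u := (- 2 * s + s ^+ 2) * k.
have ss : s ^+ 2 <= 4^-1 * s by rewrite expr2 ler_wpM2r//; lra.
have ss2 : s ^+ 2 <= e / 9 * s by rewrite expr2 ler_wpM2r//; lra.
have s20 := sqr_ge0 s.
have ku : `|u| <= 2 * s.
  rewrite /u normrM ler0_norm; last by lra.
  rewrite (@ger0_norm _ k); last by case/andP: k01.
  by apply: (@le_trans _ _ (- (- 2 * s + s ^+ 2))); [rewrite ler_piMr//; lra|lra].
have := @ln1p_bound u ltac:(lra).
have -> : ln (1 + u) = pot (cmul (1 - s, 0) w) - pot w.
  rewrite /pot -ln_div ?posrE; [|by have := sqmod_ge0 (cmul (1 - s, 0) w); lra|lra].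
  congr ln; rewrite sqmodM (_ : sqmod (1 - s, 0) = (1 - s) ^+ 2); last by rewrite /sqmod /= expr0n addr0.
  by rewrite /u /k; field; lra.
have u2 : u ^+ 2 <= 4 * s ^+ 2.
  by rewrite -(real_normK (num_real u)) (_ : 4 * s ^+ 2 = (2 * s) ^+ 2) ?ler_pXn2r ?nnegrE//; [lra|ring].
have k2 : `|k * s ^+ 2| <= s ^+ 2.
  by case/andP: k01 => k0 k1; rewrite normrM (ger0_norm k0) (ger0_norm s20) ler_piMl.
rewrite kE => H.
have -> : pot (cmul (1 - s, 0) w) - pot w - - 2 * k * s =
  (pot (cmul (1 - s, 0) w) - pot w - u) + k * s ^+ 2 by rewrite /u; ring.
by apply: le_trans (ler_normD _ _) _; move: `|_| `|_| H k2 => n1 n2; lra.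
Qed.

Lemma chart_zeta c (y : P) : (c ==> (y != 0)) -> chart c (zeta c y) = chart false y.
Proof. by case: c => [/= y0|//]; exact: chart_cinv'. Qed.

(** [D] is [1 + d / 2], where [d] is the inward derivative of solution plus potential along the
    orbit. The part of [d] from the solution is [df] applied to a vector depending smoothly on the
    base point, so differentiability of [df] at the base point makes [D] differentiable at [p]. *)
Lemma slope_of_twice_diff p tau0 : sqmod tau0 = 1 ->
  twice_differentiable_at (weak_solution phi) (P1mul (cinv tau0) (chart false p)) tau0 ->
  exists2 D : P -> R, lapprox D p &
    \forall x \near p, (forall t, 0 < t <= 1 -> hs t x = (phat x)%:E -> t <= D x) /\
      (forall t, 0 <= t <= 1 -> t < D x -> hs t x = (phat x)%:E).
Proof.
move=> t01 [c [a [F [ca NF [df [Ndf hdf]]]]]].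
have tn : tau0 != 0 by rewrite -sqmod_gt0 t01.
have ti1 : sqmod (cinv tau0) = 1 by rewrite sqmod_cinv t01 invr1.
have caE : chart c a = chart false (cmul tau0 p).
  rewrite ca -(P1mul_chart (cmul tau0 p) ti1); congr (P1mul _ (chart false _)).
  have -> : cmul (cinv tau0) (cmul tau0 p) = cmul p (cmul tau0 (cinv tau0)).
    by apply: plane_eq; rewrite !cmulE /=; ring.
  by rewrite cinv_mulV//; apply: plane_eq; rewrite !cmulE /=; ring.
have ok : c ==> (cmul tau0 p != 0).
  by move: caE; case: (c) => //= caE; apply/eqP => w0; move: caE; rewrite w0 /chart eqxx.
pose w x := zeta c (cmul tau0 x).
have aw : a = w p by apply: (@chart_inj R c); rewrite caE /w chart_zeta.
have hw x : c ==> (cmul tau0 x != 0) -> hol2 w x.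
  move=> okx; apply: (@hol2_comp R (zeta c) (cmul tau0)); last exact: hol2_zeta.
  by apply: hol2M; [exact: hol2_cst|exact: hol2_id].
rewrite aw in NF Ndf hdf.
set Dm := [set q : P * P | sqmod q.2 <= 1] in Ndf hdf.
have Dw x : Dm (w x, tau0) by rewrite /Dm /= t01.
(* Along the ray [tau = (1 - s) tau0] the coordinate [1/z] is multiplied by [1 - s] and the
   coordinate [z] by [(1 - s)^-1]; hence the opposite signs of the velocities. *)
pose eps : R := if c then 1 else - 1.
pose d1 x := df (w x, tau0) (eps *: w x, - tau0).
pose dp x := - 2 + 2 * (1 + sqmod (cmul tau0 x))^-1.
exists (fun x => 1 + (d1 x + dp x) * 2^-1).
- apply: lapproxD; first exact: lapprox_cst.
  apply: lapproxM; last exact: lapprox_cst.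
  apply: lapproxD; last first.
    rewrite (_ : dp = fun x => - 2 + 2 * (1 + sqmod x)^-1); last first.
      by apply/funext => x; rewrite /dp sqmodM t01 mul1r.
    apply: lapproxD; first exact: lapprox_cst.
    apply: lapproxM; first exact: lapprox_cst.
    have sm : smooth_on setT (fun x : P => (1 + sqmod x)^-1).
      move=> k; apply: Ck_onV; first exact: openT.
        by move=> x _; apply: lt0r_neq0; have := sqmod_ge0 x; lra.
      by apply: Ck_onD; [exact: openT|exact: Ck_on_cst|exact: Ck_on_sqmod openT].
    exact: jet_lapprox (taylor2 openT (I : setT p) sm).
  rewrite (_ : d1 = fun x => eps * (w x).1 * df (w x, tau0) ((1, 0), 0) +
     eps * (w x).2 * df (w x, tau0) ((0, 1), 0) + df (w x, tau0) (0, - tau0)); last first.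
    apply/funext => x; rewrite /d1.
    have -> : (eps *: w x, - tau0) = (eps * (w x).1) *: (((1, 0), 0) : P * P) +
        (eps * (w x).2) *: (((0, 1), 0) : P * P) + (0, - tau0).
      by apply/pair_equal_spec; split; apply: plane_eq; rewrite /= /GRing.scale /=; ring.
    by rewrite !linearD !linearZ.
  have L v : lapprox (fun x => df (w x, tau0) v) p.
    have [L HL] := hdf v.
    exact: (has_diff_within_comp (B := fun y => df y v) (hw p ok) Dw HL).
  have lw1 := hol2_fst_lapprox (hw p ok); have lw2 := hol2_snd_lapprox (hw p ok).
  apply: lapproxD => //; apply: lapproxD; apply: lapproxM => //; apply: lapproxM => //; exact: lapprox_cst.
- have cw : {for p, continuous (fun x => (w x, tau0))}.
    exact: (cvg_pair (hol2_continuous (hw p ok)) (cvg_cst tau0)).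
  have ct : {for p, continuous (cmul tau0)}.
    by apply: hol2_continuous; apply: hol2M; [exact: hol2_cst|exact: hol2_id].
  have N1 := near_comp cw (nbhs_interior NF).
  have N2 := near_comp cw Ndf.
  have N3 := near_comp ct (near_zeta ok).
  apply: filterS3 N1 N2 N3 => x N1 N2 okx.
  pose W := cmul tau0 x.
  have hdx := N2 (Dw x).
  pose v : P * P := (eps *: w x, - tau0).
  pose kk : R := if c then 1 else 0.
  pose y s : P * P := (zeta c (cmul (1 - s, 0) W), cmul (1 - s, 0) tau0).
  (* In the chart [1/z] the ray is straight; in the chart [z] it deviates from its tangent by a
     multiple [s^2 / (1 - s)], which [kk] switches on. *)
  have yE s : s < 1 -> y s - (w x, tau0) = s *: v + (kk * (s ^+ 2 / (1 - s))) *: ((w x, 0) : P * P).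
    move=> s1; apply/pair_equal_spec; split; last first.
      rewrite /y /v /=; apply: plane_eq; rewrite cmulE /= /GRing.scale /=; ring.
    rewrite /y /v /w /eps /kk -/W /=; move: okx; rewrite -/W; case: (c) => /= W0; last first.
      by apply: plane_eq; rewrite cmulE /= /GRing.scale /=; ring.
    have s0 : sqmod W != 0 by rewrite sqmod_eq0.
    have s1' : 1 - s != 0 by rewrite gt_eqF// subr_gt0.
    have E : cinv (cmul (1 - s, 0) W) = ((1 - s)^-1 *: cinv W).
      rewrite !cinvE sqmodM (_ : sqmod (1 - s, 0) = (1 - s) ^+ 2); last by rewrite /sqmod /= expr0n addr0.
      by apply: plane_eq; rewrite !cmulE /= /GRing.scale /=; move: (sqmod W) s0 => q s0; field; do ?[apply/andP; split].
    rewrite E; move: (cinv W) => u.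
    by apply: plane_eq; rewrite /= /GRing.scale /=; field.
  pose L := df (w x, tau0).
  pose B := `|L (w x, 0)|.
  pose Nm := `|v| + `|(w x, 0 : P)|.
  have Nm0 : 0 <= Nm by rewrite addr_ge0.
  have B0 : 0 <= B := normr_ge0 _.
  have wor0 : F (w x, tau0) + pot W = phat x.
    have := worb_bd hphi x t01; rewrite /worb -/W.
    have := nbhs_singleton N1 (Dw x); rewrite /= /w chart_zeta// -/W => ->.
    by rewrite -EFinD => -[].
  have slope e : 0 < e -> exists2 s0 : R, 0 < s0 & forall s, 0 < s < s0 ->
      exists2 r, worb phi x (cmul (1 - s, 0) tau0) = r%:E & `|r - phat x - (d1 x + dp x) * s| <= e * s.
    move=> e0.
    have e3 : 0 < e / 3 by rewrite divr_gt0.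
    have [sp sp0 Hsp] := pot_ray W e3.
    have e1 : 0 < e / (3 * (Nm + 1)) by rewrite divr_gt0// mulr_gt0//; lra.
    have /nbhs_normP[r1 /= r10 Hr1] := hdx _ e1.
    have /nbhs_normP[r2 /= r20 Hr2] := N1.
    clear NF Ndf hdf N1 N2 hdx cw ct hw aw caE ca Dw ok.
    pose s0 := Num.min (Num.min sp 2^-1) (Num.min (Num.min (r1 / (Nm + 1)) (r2 / (Nm + 1))) (e / (6 * (B + 1)))).
    exists s0.
      have p1 : 0 < r1 / (Nm + 1) by rewrite divr_gt0//; lra.
      have p2 : 0 < r2 / (Nm + 1) by rewrite divr_gt0//; lra.
      have p3 : 0 < e / (6 * (B + 1)) by rewrite divr_gt0// mulr_gt0//; lra.
      by rewrite !lt_min sp0 invr_gt0 ltr0n p1 p2 p3.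
    move=> s /andP[sg]; rewrite !lt_min => /andP[/andP[ssp sh] /andP[/andP[sr1 sr2] sB]].
    have s1 : s < 1 by lra.
    have sq : s ^+ 2 / (1 - s) <= 2 * s ^+ 2.
      by rewrite ler_pdivrMr; [rewrite expr2; nra|lra].
    have sq0 : 0 <= s ^+ 2 / (1 - s) by rewrite divr_ge0 ?sqr_ge0//; lra.
    have ss : 2 * s ^+ 2 <= s by rewrite expr2; nra.
    have kk01 : 0 <= kk <= 1 by rewrite /kk; case: ifP; rewrite ?lexx ?ler01.
    have kq : 0 <= kk * (s ^+ 2 / (1 - s)) <= 2 * s ^+ 2.
      case/andP: kk01 => k0 k1; rewrite mulr_ge0//=.
      by apply: le_trans sq; rewrite ler_piMl.
    have ny : `|y s - (w x, tau0)| <= s * Nm.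
      rewrite yE//; apply: le_trans (ler_normD _ _) _; rewrite normrZ [X in _ + X]normrZ mulrDr.
      case/andP: kq => k0 k1; rewrite (gtr0_norm sg) (ger0_norm k0); apply: lerD => //.
      by rewrite ler_wpM2r//; lra.
    have snm r : s < r / (Nm + 1) -> `|(w x, tau0) - y s| < r.
      rewrite ltr_pdivlMr; last by lra.
      by rewrite distrC; apply: le_lt_trans; apply: le_trans ny _; lra.
    have Dy : Dm (y s).
      rewrite /Dm /= sqmodM t01 mulr1 (_ : sqmod (1 - s, 0) = (1 - s) ^+ 2) ?expr_le1//; [lra|lra|].
      by rewrite /sqmod /= expr0n addr0.
    have Fy := Hr2 (y s) (snm _ sr2) Dy.
    have Hy := Hr1 (y s) (snm _ sr1) Dy.
    have okW : c ==> (cmul (1 - s, 0) W != 0).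
      move: okx; case: (c) => //= W0; rewrite -sqmod_gt0 sqmodM mulr_gt0//; last by rewrite sqmod_gt0.
      by rewrite /sqmod /= expr0n addr0 exprn_gt0//; lra.
    exists (F (y s) + pot (cmul (1 - s, 0) W)).
      rewrite /worb (_ : cmul (cmul (1 - s, 0) tau0) x = cmul (1 - s, 0) W); last first.
        by apply: plane_eq; rewrite !cmulE /=; ring.
      by rewrite -(chart_zeta okW) Fy.
    have Hp := Hsp s ltac:(by rewrite sg ssp).
    have LE : L (y s - (w x, tau0)) = s * d1 x + kk * (s ^+ 2 / (1 - s)) * L (w x, 0).
      by rewrite yE// linearD !linearZ.
    rewrite LE in Hy.
    have b1 : e / (3 * (Nm + 1)) * `|y s - (w x, tau0)| <= e / 3 * s.
      apply: (@le_trans _ _ (e / (3 * (Nm + 1)) * (s * Nm))); first by rewrite ler_wpM2l// ltW.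
      have -> : e / (3 * (Nm + 1)) * (s * Nm) = (e / 3 * s) * (Nm / (Nm + 1)).
        by move: (Nm) Nm0 => q q0; field; lra.
      rewrite ler_piMr//; first by rewrite mulr_ge0// ltW.
      by rewrite ler_pdivrMr; lra.
    have b2 : `|kk * (s ^+ 2 / (1 - s)) * L (w x, 0)| <= e / 3 * s.
      case/andP: kq => k0 k1; rewrite normrM (ger0_norm k0).
      apply: (@le_trans _ _ (2 * s ^+ 2 * B)); first by rewrite ler_wpM2r.
      move: sB; rewrite ltr_pdivlMr; last by lra.
      have : 0 < s * (B + 1) by rewrite mulr_gt0//; lra.
      by rewrite expr2; move: (B) B0 => b b0; nra.
    have b3 : `|pot (cmul (1 - s, 0) W) - pot W - dp x * s| <= e / 3 * s by exact: Hp.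
    rewrite -wor0.
    have -> : F (y s) + pot (cmul (1 - s, 0) W) - (F (w x, tau0) + pot W) - (d1 x + dp x) * s =
      (F (y s) - F (w x, tau0) - (s * d1 x + kk * (s ^+ 2 / (1 - s)) * L (w x, 0))) +
      kk * (s ^+ 2 / (1 - s)) * L (w x, 0) + (pot (cmul (1 - s, 0) W) - pot W - dp x * s) by ring.
    apply: le_trans (ler_normD _ _) _; apply: le_trans (lerD (ler_normD _ _) (lexx _)) _.
    by move: (le_trans Hy b1) b2 b3; move: `|_| `|_| `|_| => n1 n2 n3; lra.
  split => t tt; first exact: slope_lower slope t tt.
  exact: slope_upper slope t tt.
Qed.

End Slope.

(** * Contact along graphs *)

Section Obstacle.
Variable R : realType.
Local Notation P := (plane R).

(** What the local analysis uses of [phat] and [hs T], in a form invariant under rigid motions;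
    [obs_comparison] expresses the maximality of the envelope. *)
Record obstacle (ph : P -> R) (U : P -> \bar R) : Prop := {
  obs_le : forall q, (U q <= (ph q)%:E)%E;
  obs_cont : continuous ph;
  obs_open : open [set q | (U q < (ph q)%:E)%E];
  obs_bound : exists2 B : R, 0 <= B & forall q, sqmod q <= 1 -> ((ph q - B)%:E <= U q)%E;
  obs_comparison : forall (N : set P) (v : P -> \bar R), open N ->
    (exists B, forall x, N x -> sqmod x < B) -> (forall x, closure N x -> usc_at v x) ->
    (forall x, N x -> ~ touched v x /\ (v x <= (ph x)%:E)%E) ->
    (forall x, closure N x -> ~ N x -> (v x <= U x)%E) ->
    forall x, N x -> (v x <= U x)%E;
  obs_margin : exists2 k : R, 0 < k & \forall x \near (0 : P), forall q,
    ~ touched (fun y => (ph y - k * sqmod (y - q))%:E) x }.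

Lemma touched_cmul (F : P -> \bar R) (a b x : P) : b != 0 ->
  touched (fun x => F (a + cmul b x)) x -> touched F (a + cmul b x).
Proof.
move=> b0 [r [c [e [Fr e0 He]]]]; exists r.
pose i := cinv b.
pose c' : P * P := ((c.1.1 * i.1 + c.1.2 * i.2, - c.1.1 * i.2 + c.1.2 * i.1),
  (c.2.1 * (i.1 ^+ 2 - i.2 ^+ 2) + c.2.2 * (i.1 * i.2),
   - 4 * c.2.1 * (i.1 * i.2) + c.2.2 * (i.1 ^+ 2 - i.2 ^+ 2))).
exists c', (e * sqmod i); split => //.
  by rewrite mulr_gt0// sqmod_gt0 cinv_neq0.
have ch : {for (0 : P), continuous (fun k : P => cmul k i)}.
  by apply: hol2_continuous; apply: hol2M; [exact: hol2_id|exact: hol2_cst].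
have z : cmul 0 i = 0 :> P by apply: plane_eq; rewrite cmulE /=; ring.
have He' : \forall h \near cmul 0 i, (F (a + cmul b (x + h))%R <= (r + hquad c h - e * sqmod h)%:E)%E by rewrite z.
apply: filterS (near_comp ch He') => k.
have -> : a + cmul b (x + cmul k i) = a + cmul b x + k.
  have -> : cmul b (x + cmul k i) = cmul b x + cmul k (cmul b i) by apply: plane_eq; rewrite !cmulE /=; ring.
  by rewrite cinv_mulV// addrA; congr (_ + _); apply: plane_eq; rewrite !cmulE /=; ring.
rewrite sqmodM => /le_trans; apply; rewrite lee_fin le_eqVlt; apply/orP; left; apply/eqP.
by rewrite /hquad /c' cmulE /=; ring.
Qed.

Lemma closure_near (N : set P) q (Q : P -> Prop) : closure N q -> (\forall x \near q, Q x) ->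
  exists2 x, N x & Q x.
Proof. by move=> cN HQ; have [x [Nx Qx]] := cN _ HQ; exists x. Qed.

Lemma usc_at_fin (v : P -> R) x : {for x, continuous v} -> usc_at (fun y => (v y)%:E) x.
Proof.
move=> cv r; rewrite lte_fin => vr; apply: filterS (near_lt cv vr) => y.
by rewrite lte_fin.
Qed.

Lemma touched_sub_sqmod (ph : P -> R) x (k : R) : 0 <= k ->
  touched (fun y => (ph y)%:E) x -> touched (fun y => (ph y - k * sqmod (y - x))%:E) x.
Proof.
move=> k0; apply: touched_le; last by rewrite subrr sqmod0 mulr0 subr0.
by apply: filterE => y; rewrite lee_fin gerBl mulr_ge0 ?sqmod_ge0.
Qed.

Lemma ler_sqr_norm (a b : R) : `|a| <= b -> a ^+ 2 <= b ^+ 2.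
Proof.
move=> ab; rewrite -(real_normK (num_real a)) ler_pXn2r ?nnegrE//.
exact: le_trans ab.
Qed.

Lemma near_above (f : R -> R) (q : P) : {for q.1, continuous f} -> f q.1 < q.2 ->
  \forall z \near q, f z.1 < z.2.
Proof.
move=> cf fq.
have c : {for q, continuous (fun z : P => z.2 - f z.1)}.
  by apply: cvgB; [exact: cvg_snd|exact: cvg_comp_fst].
have : 0 < q.2 - f q.1 by rewrite subr_gt0.
by move=> /(near_gt c); apply: filterS => z; rewrite subr_gt0.
Qed.

Lemma near_below (f : R -> R) (q : P) : {for q.1, continuous f} -> q.2 < f q.1 ->
  \forall z \near q, z.2 < f z.1.
Proof.
move=> cf fq.
have c : {for q, continuous (fun z : P => f z.1 - z.2)}.
  by apply: cvgB; [exact: cvg_comp_fst|exact: cvg_snd].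
have : 0 < f q.1 - q.2 by rewrite subr_gt0.
by move=> /(near_gt c); apply: filterS => z; rewrite subr_gt0.
Qed.

Section Sliver.
Variables (ph : P -> R) (U : P -> \bar R).
Hypothesis ob : obstacle ph U.
Local Notation O := [set q : P | (U q < (ph q)%:E)%E].

Lemma contact q : ~ O q -> (U q = (ph q)%:E).
Proof. by move=> /negP; rewrite -leNgt => H; apply/eqP; rewrite eq_le (obs_le ob). Qed.

Section Graphs.
Variables (r K : R) (g h : R -> R).
Hypotheses (K0 : 0 <= K) (r0 : 0 < r).
Hypothesis Hg : forall x, `|x| < r -> [/\ {for x, continuous g}, ~ O (x, g x) & `|g x| <= K * x ^+ 2].
Hypothesis Hh : forall x, `|x| < r -> [/\ {for x, continuous h}, ~ O (x, h x) & `|h x| <= K * x ^+ 2].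

(** The comparison set is the fluid between the graphs over [|x - x1| < |x1| / 2], a window away
    from the tangency at [0]. At contact points of its boundary [U] equals [ph], so a bound by [U]
    is required on the two vertical sides only. *)
Lemma sliver_comparison (x1 y1 : R) (v : P -> R) : `|x1| * 2 < r -> continuous v ->
  (forall x y, `|x - x1| < `|x1| / 2 -> g x < y < h x -> ~ touched (fun q => (v q)%:E) (x, y)) ->
  (forall x y, `|x - x1| <= `|x1| / 2 -> g x <= y <= h x -> v (x, y) <= ph (x, y)) ->
  (forall x y, `|x - x1| = `|x1| / 2 -> g x < y < h x -> ((v (x, y))%:E <= U (x, y))%E) ->
  g x1 < y1 < h x1 -> ((v (x1, y1))%:E <= U (x1, y1))%E.
Proof.
move=> x1r cv tv vph bv gyh.
have xr x : `|x - x1| <= `|x1| / 2 -> `|x| < r.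
  move=> xx; have := ler_normD (x - x1) x1; rewrite subrK; have := normr_ge0 x1.
  by move: xx x1r; move: `|_| `|_| `|_| => a b c; lra.
have x1n : x1 != 0.
  apply/eqP => x10; have [_ _ g0] := Hg (xr x1 ltac:(by rewrite subrr normr0 divr_ge0)).
  have [_ _ h0] := Hh (xr x1 ltac:(by rewrite subrr normr0 divr_ge0)).
  move: g0 h0 gyh; rewrite x10 expr0n /= mulr0 !normr_le0 => /eqP-> /eqP->.
  by case/andP => /lt_trans/[apply]; rewrite ltxx.
have x1p : 0 < `|x1| by rewrite normr_gt0.
have [Oq|/contact ->] := pselect (O (x1, y1)); last first.
  rewrite lee_fin; apply: vph; first by rewrite subrr normr0 divr_ge0.
  by case/andP: gyh => /ltW -> /ltW ->.
pose N : set P := [set q | [/\ `|q.1 - x1| < `|x1| / 2, g q.1 < q.2, q.2 < h q.1 & O q]].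
have clN q : closure N q -> `|q.1 - x1| <= `|x1| / 2 /\ g q.1 <= q.2 <= h q.1.
  move=> cq.
  have c1 : {for q, continuous (fun z : P => `|z.1 - x1|)}.
    by apply: cvg_norm; apply: cvgB; [exact: cvg_fst|exact: cvg_cst].
  have h1 : `|q.1 - x1| <= `|x1| / 2.
    rewrite leNgt; apply/negP => /(near_gt c1)/(closure_near cq)[z [z1 _ _ _] /=].
    by move=> /(lt_trans z1); rewrite ltxx.
  have [cg _ _] := Hg (xr _ h1); have [ch _ _] := Hh (xr _ h1).
  split => //; apply/andP; split; rewrite leNgt; apply/negP.
    move=> /(near_below cg)/(closure_near cq)[z [_ z2 _ _]].
    by move=> /(lt_trans z2); rewrite ltxx.
  move=> /(near_above ch)/(closure_near cq)[z [_ _ z2 _]].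
  by move=> /(lt_trans z2); rewrite ltxx.
apply: (obs_comparison ob (N := N) (v := fun q => (v q)%:E)).
- rewrite openE => q [q1 q2 q3 q4].
  have c1 : {for q, continuous (fun z : P => `|z.1 - x1|)}.
    by apply: cvg_norm; apply: cvgB; [exact: cvg_fst|exact: cvg_cst].
  have [cg _ _] := Hg (xr _ (ltW q1)); have [ch _ _] := Hh (xr _ (ltW q1)).
  have H4 : \forall z \near q, O z by exact: open_nbhs_nbhs (conj (obs_open ob) q4).
  have H23 : \forall z \near q, g z.1 < z.2 /\ z.2 < h z.1.
    by apply: filterS2 (near_above cg q2) (near_below ch q3) => z.
  by apply: filterS3 (near_lt c1 q1) H23 H4 => z a [b c] d; split.
- exists (r ^+ 2 + (K * r ^+ 2) ^+ 2) => q [q1 q2 q3 _].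
  have qr := xr _ (ltW q1).
  have [_ _ bg] := Hg qr; have [_ _ bh] := Hh qr.
  have q1r : q.1 ^+ 2 < r ^+ 2 by rewrite -(real_normK (num_real q.1)) ltr_pXn2r ?nnegrE// ltW.
  have q2r : `|q.2| <= K * r ^+ 2.
    have Kr : K * q.1 ^+ 2 <= K * r ^+ 2 by rewrite ler_wpM2l// ltW.
    by move: bg bh; rewrite !ler_norml => /andP[b1 b2] /andP[b3 b4]; apply/andP; split; lra.
  rewrite /sqmod -(real_normK (num_real q.2)) ltr_leD// ler_pXn2r ?nnegrE//.
  by rewrite mulr_ge0 ?sqr_ge0.
- by move=> q _; apply: usc_at_fin; exact: cv.
- move=> [x y] [q1 q2 q3 _]; split; first by apply: tv => //; rewrite q2 q3.
  by rewrite lee_fin; apply: vph; [exact: ltW|rewrite (ltW q2) (ltW q3)].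
- move=> [x y] cq nN; have [/= q1 q2] := clN _ cq.
  have [Oxy|/contact ->] := pselect (O (x, y)); last by rewrite lee_fin; exact: vph.
  have [cg ng _] := Hg (xr _ q1); have [ch nh _] := Hh (xr _ q1).
  have gy : g x < y.
    by rewrite lt_neqAle; case/andP: q2 => -> _; rewrite andbT; apply/eqP => E; apply: ng; rewrite E.
  have yh : y < h x.
    by rewrite lt_neqAle; case/andP: q2 => _ ->; rewrite andbT; apply/eqP => E; apply: nh; rewrite -E.
  apply: bv; last by rewrite gy yh.
  by apply/eqP; rewrite eq_le q1/= leNgt; apply/negP => lt; apply: nN; split.
- split => //=; [by rewrite subrr normr0 divr_gt0|by case/andP: gyh|by case/andP: gyh].
Qed.

(** The barrier subtracts the harmonic function [al ((x - x1)^2 - y^2 + d^2)], where [d] bounds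
    [|y|] on the window. On the vertical sides it is at least [al x1^2 / 4], which covers the old
    gap; over [x1] it is at most [al d^2]. As [d] is of order [x1^2], the gap gains a factor of
    order [x1^2]. The powers of [9 / 4] come from [|x| <= (3 / 2) |x1|]. *)
Lemma sliver_step (rho b : R) (k : nat) : 0 <= b -> rho <= r -> rho <= 1 ->
  (forall x y, `|x| < rho -> g x <= y <= h x -> ~ touched (fun q => (ph q)%:E) (x, y)) ->
  (forall x y, `|x| < rho -> g x < y < h x -> ((ph (x, y) - b * (x ^+ 2) ^+ k)%:E <= U (x, y))%E) ->
  forall x y, `|x| < rho / 2 -> g x < y < h x ->
   ((ph (x, y) - b * (9 / 4) ^+ k * (81 / 4) * K ^+ 2 * (x ^+ 2) ^+ k.+1)%:E <= U (x, y))%E.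
Proof.
move=> b0 rr r1 nt Hb x1 y1 x1r gyh.
have [x10|x1n] := eqVneq x1 0.
  have [|_ _ g0] := Hg (x := x1); first by rewrite x10 normr0.
  have [|_ _ h0] := Hh (x := x1); first by rewrite x10 normr0.
  move: g0 h0 gyh; rewrite x10 expr0n /= mulr0 !normr_le0 => /eqP-> /eqP->.
  by case/andP => /lt_trans/[apply]; rewrite ltxx.
have x1p : 0 < `|x1| by rewrite normr_gt0.
have x12 : 0 < x1 ^+ 2 by rewrite -(real_normK (num_real x1)) exprn_gt0.
pose bb := b * (9 / 4) ^+ k * (x1 ^+ 2) ^+ k.
pose al := bb / (x1 ^+ 2 / 4).
pose d := K * (9 / 4) * x1 ^+ 2.
have bb0 : 0 <= bb.
  apply: mulr_ge0; last by apply: exprn_ge0; exact: sqr_ge0.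
  by apply: mulr_ge0 => //; apply: exprn_ge0; lra.
have al0 : 0 <= al by rewrite divr_ge0// divr_ge0// ltW.
have d0 : 0 <= d by apply: mulr_ge0; [apply: mulr_ge0 => //; lra|exact: ltW].
have near2 x : `|x - x1| <= `|x1| / 2 -> `|x| < rho /\ x ^+ 2 <= 9 / 4 * x1 ^+ 2.
  move=> xx; have := ler_normD (x - x1) x1; rewrite subrK => H.
  have h1 : `|x| <= 3 / 2 * `|x1| by move: H xx; move: `|x| `|x - x1| `|x1| => a c e; lra.
  split; first by move: h1 x1r x1p; move: `|x| `|x1| => a c; lra.
  rewrite -(real_normK (num_real x)) -(real_normK (num_real x1)).
  have -> : 9 / 4 * `|x1| ^+ 2 = (3 / 2 * `|x1|) ^+ 2 by field.
  by rewrite ler_pXn2r ?nnegrE// mulr_ge0// divr_ge0.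
have yd x y : `|x - x1| <= `|x1| / 2 -> g x <= y <= h x -> y ^+ 2 <= d ^+ 2.
  move=> /near2[xr x2] /andP[gy yh].
  have [_ _ bg] := Hg (lt_le_trans xr rr); have [_ _ bh] := Hh (lt_le_trans xr rr).
  have Kd : K * x ^+ 2 <= d by rewrite /d -mulrA ler_wpM2l.
  have : `|y| <= d by move: bg bh; rewrite !ler_norml => /andP[b1 b2] /andP[b3 b4]; apply/andP; split; lra.
  exact: ler_sqr_norm.
pose v (q : P) := ph q + (hquad ((2 * al * x1, 0), (- al, 0)) q - al * (x1 ^+ 2 + d ^+ 2)).
have vE x y : v (x, y) = ph (x, y) - al * ((x - x1) ^+ 2 + d ^+ 2 - y ^+ 2).
  by rewrite /v /hquad /=; ring.
have := @sliver_comparison x1 y1 v.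
have H1 : `|x1| * 2 < r by move: x1r rr; move: `|x1| => a; lra.
move=> /(_ H1) H.
have cv : continuous v.
  move=> q; apply: cvgD; first exact: (obs_cont ob).
  by apply: cvgB; [exact: continuous_hquad|exact: cvg_cst].
apply: (@le_trans _ _ (v (x1, y1))%:E).
  rewrite lee_fin vE subrr expr0n /= add0r lerD2l lerN2 /al /bb /d.
  apply: (@le_trans _ _ (al * d ^+ 2)); first by rewrite ler_wpM2l// gerBl sqr_ge0.
  rewrite le_eqVlt; apply/orP; left; apply/eqP; rewrite /al /bb /d [(x1 ^+ 2) ^+ k.+1]exprS.
  move: (x1 ^+ 2) x12 => q q0; move: ((9 / 4) ^+ k) (q ^+ k) => a c; field.
  exact: lt0r_neq0.
apply: H => //.
- move=> x y xx gy T.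
  have [xr x2] := near2 x (ltW xx).
  apply: (nt x y xr); first by case/andP: gy => /ltW -> /ltW ->.
  have hj : hjet (fun q : P => hquad ((2 * al * x1, 0), (- al, 0)) q - al * (x1 ^+ 2 + d ^+ 2)) (x, y).
    by apply: hjetD; [exact: hjet_hquad|exact: hjet_cst].
  by apply: (hjet_touched hj); move: T; rewrite /v.
- move=> x y xx gy; rewrite vE gerBl mulr_ge0//.
  by have := yd x y xx gy; have := sqr_ge0 (x - x1); lra.
- move=> x y xx gy; have [xr x2] := near2 x ltac:(by rewrite xx).
  have gy' : g x <= y <= h x by case/andP: gy => /ltW -> /ltW ->.
  have y2 := yd x y ltac:(by rewrite xx) gy'.
  apply: le_trans (Hb x y xr gy); rewrite lee_fin vE lerD2l lerN2.
  apply: (@le_trans _ _ bb).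
    rewrite /bb -mulrA ler_wpM2l// -exprMn lerXn2r// nnegrE ?sqr_ge0//.
    by rewrite mulr_ge0// ?sqr_ge0// divr_ge0.
  have -> : bb = al * (x1 ^+ 2 / 4) by rewrite /al; field.
  rewrite ler_wpM2l// -(real_normK (num_real (x - x1))) xx exprMn real_normK ?num_real//.
  by move: (x1 ^+ 2) (d ^+ 2) (y ^+ 2) y2 => a c e; lra.
Qed.

End Graphs.

(* Between two contact graphs that are tangent at the origin the obstacle gap
   would have to decay faster than any power of the distance to the origin,
   which the strict subharmonicity of the obstacle excludes. *)
Lemma sliver (K R0 : R) : 0 <= K -> 0 < R0 -> exists r, [/\ 0 < r, r <= R0 & forall g h : R -> R,
  (forall x, `|x| < r -> [/\ {for x, continuous g}, ~ O (x, g x) & `|g x| <= K * x ^+ 2]) ->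
  (forall x, `|x| < r -> [/\ {for x, continuous h}, ~ O (x, h x) & `|h x| <= K * x ^+ 2]) ->
  forall x y, `|x| < r / 8 -> g x < y < h x -> ~ O (x, y)].
Proof.
move=> K0 R00; have [B B0 HB] := obs_bound ob; have [k k0 /near0_sqmod[s s0 Hk]] := obs_margin ob.
have K1 : 0 < 1 + K by lra.
(* The constant after two rounds of [sliver_step], starting from the crude gap [B]: the gap is then
   at most [b2 x^4]. *)
pose b2 := B * (9 / 4) ^+ 0 * (81 / 4) * K ^+ 2 * (9 / 4) ^+ 1 * (81 / 4) * K ^+ 2.
have b10 : 0 <= B * (9 / 4) ^+ 0 * (81 / 4) * K ^+ 2.
  apply: mulr_ge0; last exact: sqr_ge0.
  by apply: mulr_ge0; [rewrite expr0 mulr1|lra].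
have b20 : 0 <= b2.
  apply: mulr_ge0; last exact: sqr_ge0.
  by apply: mulr_ge0; [apply: mulr_ge0 => //; rewrite expr1|]; lra.
have q0 : 0 < k / (9 * b2 + 9) by rewrite divr_gt0//; lra.
have [r [r0 rm rs rK rk]] : exists r, [/\ 0 < r, r < Num.min 2^-1 R0, r < Num.sqrt s / (1 + K), r < (1 + K)^-1 & r < Num.sqrt (k / (9 * b2 + 9))].
  by apply: small_pos; rewrite ?lt_min ?R00 ?andbT ?divr_gt0 ?sqrtr_gt0 ?invr_gt0//; lra.
have [r1 rR] : r < 2^-1 /\ r < R0 by move: rm; rewrite lt_min => /andP.
have Kr0 : 0 <= r * (1 + K) by rewrite mulr_ge0 ?(ltW r0) ?(ltW K1).
have rs2 : (r * (1 + K)) ^+ 2 < s.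
  rewrite ltr_pdivlMr// in rs.
  by rewrite -[ltRHS](sqr_sqrtr (ltW s0)) ltr_pXn2r ?nnegrE ?sqrtr_ge0.
have rK2 : (r * (1 + K)) ^+ 2 <= 1.
  by rewrite expr_le1//; move: rK; rewrite -[ltRHS]mul1r ltr_pdivlMr// => /ltW.
have rk2 : r ^+ 2 * (9 * b2 + 9) <= k.
  have : r ^+ 2 <= k / (9 * b2 + 9).
    by rewrite -[leRHS](sqr_sqrtr (ltW q0)); apply: ler_sqr_norm; rewrite gtr0_norm// ltW.
  by rewrite ler_pdivlMr//; lra.
exists r; split => // [|g h Hg Hh]; first exact: ltW.
have yb x y : `|x| < r -> g x <= y <= h x -> sqmod (x, y) <= (r * (1 + K)) ^+ 2.
  move=> xr /andP[gy yh]; have [_ _ bg] := Hg x xr; have [_ _ bh] := Hh x xr.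
  have x2 : x ^+ 2 <= r ^+ 2 by apply: ler_sqr_norm; exact: ltW.
  have rr2 : r ^+ 2 <= 1 * r by rewrite expr2 ler_wpM2r ?(ltW r0)//; lra.
  have y1 : `|y| <= K * r.
    have : K * x ^+ 2 <= K * r by rewrite ler_wpM2l//; lra.
    by move: bg bh; rewrite !ler_norml => /andP[b1 b'2] /andP[b3 b4] h1; apply/andP; split; lra.
  have y2 := ler_sqr_norm y1; rewrite /sqmod /=.
  have -> : (r * (1 + K)) ^+ 2 = r ^+ 2 + (K * r) ^+ 2 + 2 * (r * (K * r)) by ring.
  have : 0 <= r * (K * r) by rewrite !mulr_ge0 ?(ltW r0).
  by move: x2 y2; move: (x ^+ 2) (y ^+ 2) ((K * r) ^+ 2) (r * (K * r)) => a c e f; lra.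
have nt x y : `|x| < r -> g x <= y <= h x -> ~ touched (fun q => (ph q)%:E) (x, y).
  move=> xr gy T; apply: (Hk (x, y) (le_lt_trans (yb x y xr gy) rs2) (x, y)).
  exact: touched_sub_sqmod (ltW k0) T.
have L0 x y : `|x| < r -> g x < y < h x -> ((ph (x, y) - B * (x ^+ 2) ^+ 0)%:E <= U (x, y))%E.
  move=> xr /andP[gy yh]; rewrite expr0 mulr1; apply: HB; apply: le_trans rK2; apply: yb => //.
  by rewrite (ltW gy) (ltW yh).
have r2 : r / 2 <= r by lra.
have r20 : 0 <= r / 2 by lra.
have L1 := sliver_step K0 r0 Hg Hh B0 (lexx r) ltac:(lra) nt L0.
have L2 := sliver_step K0 r0 Hg Hh b10 r2 ltac:(lra) (fun x y xr => nt x y (lt_le_trans xr r2)) L1.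
move=> x1 y1 x1r gyh Oxy.
suff : ((ph (x1, y1) - k * sqmod ((x1, y1) - (x1, y1)))%:E <= U (x1, y1))%E.
  by rewrite subrr sqmod0 mulr0 subr0 leNgt Oxy.
(* The function [ph - k |q - (x1, y1)|^2] is untouched. On the vertical sides it has dropped by at
   least [k x1^2 / 4], which outweighs the gap [b2 x^4] for the chosen [r]; at its centre the
   comparison gives contact. *)
apply: (sliver_comparison K0 r0 Hg Hh (v := fun q => ph q - k * sqmod (q - (x1, y1))) (x1 := x1)) => //.
- by move: x1r r0; move: `|x1| => a; lra.
- move=> q; apply: cvgB; first exact: (obs_cont ob).
  by apply: cvgM; [exact: cvg_cst|exact: continuous_sqmodB].
- move=> x y xx gy; apply: Hk; apply: le_lt_trans rs2; apply: yb.
    have := ler_normD (x - x1) x1; rewrite subrK.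
    by move: xx x1r r0; move: `|x| `|x1| `|x - x1| => a c e; lra.
  by case/andP: gy => /ltW -> /ltW ->.
- by move=> x y xx gy; rewrite gerBl mulr_ge0 ?sqmod_ge0// ltW.
- move=> x y xx gy.
  have := ler_normD (x - x1) x1; rewrite subrK xx => x32.
  have xr : `|x| < r / 2 / 2 by move: x32 x1r; have := normr_ge0 x1; move: `|x| `|x1| => a c; lra.
  apply: le_trans (L2 x y xr gy); rewrite -/b2 lee_fin lerD2l lerN2.
  have x2 : x ^+ 2 <= 9 / 4 * x1 ^+ 2.
    rewrite -(real_normK (num_real x1)).
    have -> : 9 / 4 * `|x1| ^+ 2 = (3 / 2 * `|x1|) ^+ 2 by field.
    by apply: ler_sqr_norm; move: x32; move: `|x| `|x1| => a c; lra.
  have x2r : x ^+ 2 <= r ^+ 2.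
    by apply: ler_sqr_norm; move: xr r0; move: `|x| => a; lra.
  have -> : (x ^+ 2) ^+ 2 = x ^+ 2 * x ^+ 2 by rewrite expr2.
  apply: (@le_trans _ _ (k * (x1 ^+ 2 / 4))); last first.
    rewrite ler_wpM2l ?(ltW k0)// /sqmod /= -(real_normK (num_real (x - x1))) xx.
    rewrite exprMn real_normK ?num_real//; have := sqr_ge0 (y - y1).
    by move: (x1 ^+ 2) ((y - y1) ^+ 2) => a c; lra.
  have q1 : b2 * (x ^+ 2 * x ^+ 2) <= b2 * (r ^+ 2 * (9 / 4 * x1 ^+ 2)).
    by rewrite ler_wpM2l// ler_pM ?sqr_ge0.
  apply: le_trans q1 _.
  have : r ^+ 2 * (9 * b2 + 9) * (x1 ^+ 2 / 4) <= k * (x1 ^+ 2 / 4) by rewrite ler_wpM2r// divr_ge0 ?sqr_ge0.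
  have : 0 <= r ^+ 2 * (x1 ^+ 2 / 4) by rewrite mulr_ge0 ?divr_ge0 ?sqr_ge0.
  by move: (k * _) => kk; move: (x1 ^+ 2) (r ^+ 2) => a c; lra.
Qed.

End Sliver.
End Obstacle.

(** * Rigid motions of the plane *)

Section Frames.
Variable R : realType.
Local Notation P := (plane R).

(** For [|e| = 1], [fr] and [co] are inverse rigid motions, with origin [p] and first axis in the
    direction [e]. *)
Definition fr (p e q : P) : P := p + cmul e q.
Definition co (p e w : P) : P := cmul (e.1, - e.2) (w - p).

Variables (p e : P).
Hypothesis e1 : sqmod e = 1.

Let ee : e.1 ^+ 2 + e.2 ^+ 2 = 1. Proof. exact: e1. Qed.

Lemma conj_cmul q : cmul (e.1, - e.2) (cmul e q) = q.
Proof. by apply: plane_eq; rewrite !cmulE /=; [rewrite -[RHS]mul1r -ee|rewrite -[RHS]mul1r -ee]; ring. Qed.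

Lemma cmul_conj q : cmul e (cmul (e.1, - e.2) q) = q.
Proof. by apply: plane_eq; rewrite !cmulE /=; [rewrite -[RHS]mul1r -ee|rewrite -[RHS]mul1r -ee]; ring. Qed.

Lemma frK q : co p e (fr p e q) = q.
Proof. by rewrite /co /fr addrC addKr conj_cmul. Qed.

Lemma coK w : fr p e (co p e w) = w.
Proof. by rewrite /co /fr cmul_conj addrC subrK. Qed.

Lemma fr_isom q q' : sqmod (fr p e q - fr p e q') = sqmod (q - q').
Proof.
have -> : fr p e q - fr p e q' = cmul e (q - q') by apply: plane_eq; rewrite /fr !cmulE /=; ring.
by rewrite sqmodM e1 mul1r.
Qed.

Lemma hol2_fr q : hol2 (fr p e) q.
Proof. by apply: hol2D; [exact: hol2_cst|apply: hol2M; [exact: hol2_cst|exact: hol2_id]]. Qed.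

Lemma hol2_co w : hol2 (co p e) w.
Proof.
apply: hol2M; first exact: hol2_cst.
by apply: hol2D; [exact: hol2_id|exact: hol2_cst].
Qed.

Lemma fr0 : fr p e 0 = p.
Proof. by apply: plane_eq; rewrite /fr cmulE /=; ring. Qed.

Lemma touched_fr (F : P -> \bar R) q : touched (F \o fr p e) q -> touched F (fr p e q).
Proof. by move=> T; apply: touched_cmul => //; rewrite -sqmod_gt0 e1. Qed.

Lemma touched_co (F : P -> \bar R) w : touched (F \o co p e) w -> touched F (co p e w).
Proof.
pose b : P := (e.1, - e.2); pose a := - cmul b p.
have E x : co p e x = a + cmul b x by apply: plane_eq; rewrite /co /a !cmulE /=; ring.
have -> : F \o co p e = fun x => F (a + cmul b x) by apply/funext => x; rewrite /= E.
rewrite E; apply: touched_cmul; rewrite -sqmod_gt0 /sqmod /= sqrrN ee.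
by [].
Qed.

Section FrameObstacle.
Variable phi : P1 R -> R.
Hypothesis hphi : kahler_potential phi.

(** Each property is carried through the rigid motion. The lower bound [obs_bound] comes from
    interpolation with time [0], where the envelope is the obstacle. *)
Lemma obstacle_frame T : 0 < T < 1 ->
  obstacle (fun q => phat phi (fr p e q)) (fun q => hs phi T (fr p e q)).
Proof.
move=> /andP[T0 T1].
have cfr : continuous (fr p e) by move=> q; exact: hol2_continuous (hol2_fr q).
split.
- by move=> q; exact: hs_le_phat.
- move=> q; apply: (@continuous_comp _ _ _ (fr p e)) => //; first exact: cfr.
  exact: continuous_phat.
- rewrite openE => q /= hq.
  have [_ uh _] := HSc_vsh (fr p e q) (HSc_hs hphi T).
  have := usc_at_addr uh (_ : {for fr p e q, continuous (fun w => - phat phi w)}).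
  move=> /(_ (cvgN (continuous_phat hphi (x:=_)))) /(_ 0).
  rewrite -lteBrDr// -EFinB sub0r opprK => /(_ hq) H.
  apply: filterS (near_comp (cfr q) H) => z /=.
  by rewrite -lteBrDr// -EFinB sub0r opprK.
- have [M M0 HM] := phi_bounded hphi.
  have s0 := sqmod_ge0 p.
  have l0 : 0 <= ln (3 + 2 * sqmod p) by apply: ln_ge0; lra.
  exists (2 * M + ln (3 + 2 * sqmod p)); first by rewrite addr_ge0 ?mulr_ge0.
  move=> q q1; set w := fr p e q.
  have Hm z : - M <= phi z by have := HM z; rewrite ler_norml => /andP[].
  have a01 : 0 < 1 - T <= 1 by lra.
  have := @hs_interp _ _ hphi 0 T (1 - T) (- M) w a01 _ Hm; rewrite subr0 mulr1 => /(_ (lexx _)).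
  apply: le_trans; rewrite hs0// -EFinM -EFinD lee_fin.
  have pw : pot w <= ln (3 + 2 * sqmod p).
    rewrite /pot ler_ln ?posrE; [|by have := sqmod_ge0 w; lra|lra].
    have := sqmodD_le p (cmul e q); rewrite sqmodM e1 mul1r -/(fr p e q) -/w; lra.
  have pw2 : phat phi w <= M + ln (3 + 2 * sqmod p).
    by rewrite /phat; have := HM (chart false w); rewrite ler_norml => /andP[_]; lra.
  have : T * (phat phi w + M) <= phat phi w + M.
    by rewrite ler_piMl ?(ltW T1)//; have := pot_le_phat w Hm; lra.
  by move: pw2; move: (phat phi w) (ln _) => a c; lra.
- move=> N v oN [B HB] uv tv bv q Nq.
  pose N0 : set P := [set w | N (co p e w)].
  have cco : continuous (co p e) by move=> w; exact: hol2_continuous (hol2_co w).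
  have cl w : closure N0 w -> closure N (co p e w).
    move=> cw V /(cco w) HV; have [x [Nx Vx]] := cw _ HV.
    by exists (co p e x).
  have := @hs_comparison _ _ hphi T N0 (v \o co p e).
  move=> /(_ _ _ _ _ _ (fr p e q)); rewrite /N0 /= frK; apply => //.
  + by apply: open_comp oN => w _; exact: cco.
  + exists (2 * `|B| + 2 * sqmod p) => w Nw.
    have := HB _ Nw; rewrite sqmodM (_ : sqmod (e.1, - e.2) = 1) ?mul1r; last by rewrite /sqmod /= sqrrN.
    move=> h1; have := sqmodD_le (w - p) p; rewrite subrK; have := ler_norm B; lra.
  + by move=> w /cl /uv H r /H; exact: near_comp (cco w).
  + move=> w Nw; have [h1 h2] := tv _ Nw; split; first by move/touched_co.
    by rewrite /= (le_trans h2)// coK.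
  + by move=> w /cl cw nN; have := bv _ cw nN; rewrite coK.
- have [k k0 Hk] := phat_margin hphi p; exists k => //.
  have Hk0 : \forall x \near fr p e 0, forall q, ~ touched (fun y => (phat phi y - k * sqmod (y - q))%:E) x by rewrite fr0.
  apply: filterS (near_comp (cfr 0) Hk0) => x Hx q T0'; apply: (Hx (fr p e q)).
  apply: touched_fr; apply: near_touched T0'; apply: filterE => y /=.
  by rewrite fr_isom.
Qed.

End FrameObstacle.
End Frames.

(** For points within [ep / 2] of [(0, ep)] in each coordinate the graph stays below [ep / 4] and
    the height is at least [ep / 2]. *)
Lemma small_disc_bounds (R : realType) (ep x y g K r : R) : 0 < ep -> 0 < K -> K * ep <= 1 ->
  3 / 2 * ep < r -> `|x| <= ep / 2 -> `|y - ep| <= ep / 2 -> `|g| <= K * x ^+ 2 ->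
  [/\ 0 < y, `|y| <= 3 / 2 * ep, K * x ^+ 2 <= ep / 4, cnorm (x, y) <= 2 * ep & g < y < r].
Proof.
move=> ep0 K0 Kep er xe; rewrite ler_norml => /andP[q3 q4]; rewrite ler_norml => /andP[_ g2].
have x2 : x ^+ 2 <= ep / 2 * (ep / 2) by rewrite -expr2; exact: ler_sqr_norm.
have Kx : K * x ^+ 2 <= ep / 4.
  have : K * x ^+ 2 <= K * (ep / 2 * (ep / 2)) by rewrite ler_wpM2l// ltW.
  have : K * ep * ep <= 1 * ep by rewrite ler_wpM2r// ltW.
  by move: (x ^+ 2) => q; lra.
have yn : `|y| <= 3 / 2 * ep by rewrite ler_norml; apply/andP; split; lra.
split => //; first lra.
  by apply: le_trans (cnorm_le_sum _) _; rewrite /=; lra.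
by apply/andP; split; lra.
Qed.

(** * A differentiable contact time excludes fluid above a tangent contact graph *)

Section FinalSide.
Variable R : realType.
Local Notation P := (plane R).
Variables (ph : P -> R) (V : R -> P -> \bar R) (T m : R).
Hypothesis T01 : 0 < T < 1.
Hypothesis ob : obstacle ph (V T).
Hypothesis mph : forall q, m <= ph q.
Hypothesis hV : forall t q, [/\ usc_at (V t) q, ~ touched (V t) q & (V t q <= (ph q)%:E)%E].
Hypothesis hVT : forall t q, 0 < t < T ->
  (((1 - T) / (1 - t))%:E * V t q + ((1 - (1 - T) / (1 - t)) * m)%:E <= V T q)%E.
Variables (D : P -> R) (l : P).
Hypothesis hl : forall e, 0 < e -> \forall h \near (0 : P), `|D h - D 0 - cdot l h| <= e * cnorm h.
Hypothesis l2 : 0 <= l.2.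
Hypothesis hD : \forall q \near (0 : P), (forall t, 0 < t <= 1 -> V t q = (ph q)%:E -> t <= D q) /\
  (forall t, 0 <= t <= 1 -> t < D q -> V t q = (ph q)%:E).
Variables (r K : R) (g : R -> R).
Hypotheses (r0 : 0 < r) (K1 : 1 <= K).
Hypothesis hg : forall x, `|x| < r ->
  [/\ {for x, continuous g}, V T (x, g x) = (ph (x, g x))%:E & `|g x| <= K * x ^+ 2].
Hypothesis fluid : forall e, 0 < e -> exists2 y, 0 < y < e & (V T (0%R, y) < (ph (0%R, y))%:E)%E.

Lemma vertical_near (Q : P -> Prop) : (\forall q \near (0 : P), Q q) ->
  exists2 e : R, 0 < e & forall x y, `|x| < e -> `|y| < e -> Q (x, y).
Proof.
move=> /nbhs_normP[e /= e0 He]; exists e => // x y xe ye; apply: He => /=.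
by rewrite sub0r normrN prod_normE /= gt_max xe ye.
Qed.

(** Contact on the graph gives [T <= D 0]. Strict inequality would persist near [0] and force
    contact there, against [fluid]. *)
Lemma final_D0 : D 0 = T.
Proof.
have g0 : g 0 = 0.
  have [|_ _] := hg (x := 0); first by rewrite normr0.
  by rewrite expr0n mulr0 normr_le0 => /eqP.
have [|_ V0 _] := hg (x := 0); first by rewrite normr0.
rewrite g0 in V0.
have [T0 T1] : 0 < T /\ T < 1 by case/andP: T01.
have [hD1 hD2] := nbhs_singleton hD.
have D0 : T <= D 0 by apply: hD1 => //; lra.
apply/eqP; rewrite eq_le D0 andbT leNgt; apply/negP => TD.
have cD : \forall h \near (0 : P), T < D h.
  have e0 : 0 < (D 0 - T) / (cnorm l + 2).
    by rewrite divr_gt0 ?subr_gt0//; have := cnorm_ge0 l; lra.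
  apply: filterS2 (hl ltr01) (near0_cnorm_lt e0) => h h1 h2.
  have h3 := cdot_le l h; move: h2; rewrite ltr_pdivlMr; last by have := cnorm_ge0 l; lra.
  move: h1 h3; rewrite !ler_norml => /andP[h1 _] /andP[h3 _] h2.
  have := cnorm_ge0 h; lra.
have [d d0 Hd] := vertical_near (filterI cD hD).
have [y /andP[y0 yd]] := fluid d0.
have [|| TDy [_ H]] := Hd 0 y; rewrite ?normr0 ?(gtr0_norm y0)//.
by rewrite (H T) ?ltxx//; lra.
Qed.

(** Along the graph [D >= T = D 0], in both horizontal directions, and the height of the graph is of
    second order. *)
Lemma final_l1 : l.1 = 0.
Proof.
have [T0 T1] : 0 < T /\ T < 1 by case/andP: T01.
have Kp := K1.
apply/eqP/negPn/negP => l1n.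
have l1p : 0 < `|l.1| by rewrite normr_gt0.
pose e := `|l.1| / 4.
have e0 : 0 < e by rewrite divr_gt0.
have [d d0 Hd] := vertical_near (filterI (hl e0) hD).
have l20 : 0 <= `|l.2| by [].
have [s [s0 sd sr s1 sK]] : exists s, [/\ 0 < s, s < d, s < r, s < K^-1 & s < e / (K * (`|l.2| + 1))].
  by apply: small_pos => //; rewrite ?invr_gt0 ?divr_gt0// ?mulr_gt0//; lra.
(* The direction in which a nonzero [l.1] would make [D] fall below [T]. *)
pose x := - (Num.sg l.1 * s).
have xs : `|x| = s by rewrite normrN normrM normr_sg l1n mul1r gtr0_norm.
have [_ Vx gx] := hg (x := x) ltac:(by rewrite xs).
have Ks1 : K * s <= 1.
  by move: s1; rewrite -[ltRHS]mul1r ltr_pdivlMr 1?mulrC; [move/ltW|lra].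
have x2 : x ^+ 2 = s ^+ 2 by rewrite -(real_normK (num_real x)) xs.
have gs : `|g x| <= s.
  by apply: le_trans gx _; rewrite x2 expr2 mulrA; rewrite -[leRHS]mul1r ler_wpM2r// ltW.
have [||h1 [h2 _]] := Hd x (g x); [by rewrite xs|exact: le_lt_trans gs sd|].
have TD := h2 T ltac:(lra) Vx.
have cx : cnorm (x, g x) <= 2 * s.
  by apply: le_trans (cnorm_le_sum _) _; rewrite /= xs; lra.
move: h1; rewrite final_D0 ler_norml => /andP[_].
have -> : cdot l (x, g x) = - (`|l.1| * s) + l.2 * g x.
  by rewrite /cdot /= /x [`|l.1|]normrEsg; ring.
have b1 : `|l.2 * g x| <= e * s.
  rewrite normrM; apply: (@le_trans _ _ (`|l.2| * (K * s ^+ 2))); first by rewrite -x2 ler_wpM2l.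
  move: sK; rewrite ltr_pdivlMr ?mulr_gt0//; last by lra.
  move=> sK; have -> : `|l.2| * (K * s ^+ 2) = (s * (K * `|l.2|)) * s by ring.
  rewrite ler_wpM2r ?(ltW s0)//; apply: le_trans (ltW sK).
  by rewrite ler_wpM2l ?(ltW s0)// ler_wpM2l; lra.
have b2 : e * cnorm (x, g x) <= e * (2 * s) by rewrite ler_wpM2l// ltW.
have b3 : 4 * (e * s) = `|l.1| * s by rewrite /e; field.
have es : 0 < e * s by rewrite mulr_gt0.
move: b1; rewrite ler_norml => /andP[_ b1].
move: TD b1 b2 b3 es; move: (D _) (l.2 * g x) (cnorm _) (`|l.1| * s) => a b c f.
by move: (e) => e'; lra.
Qed.

Lemma final_side : False.
Proof.
have [T0 T1] : 0 < T /\ T < 1 by case/andP: T01.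
have Kp := K1; have K0 : 0 < K by lra.
have [B B0 HB] : exists2 B, 0 < B & forall q : P, sqmod q <= 2 -> ph q - m <= B.
  have [||c _ cB] := @compact_EVT_max _ _ ph (cdisc (0 : P) 2) _ (@compact_cdisc R 0 2).
  - by exists 0; rewrite /cdisc /= subrr sqmod0.
  - by apply: continuous_subspaceT => y; exact: (obs_cont ob).
  - exists (ph c - m + 1); first by have := mph c; lra.
    by move=> q q2; have := cB q (mem_set (_ : cdisc 0 2 q)); rewrite /cdisc /= subr0 => /(_ q2); lra.
have [k k0 Hk] := obs_margin ob.
have [d d0 Hd] := vertical_near (filterI Hk hD).
have [r' [r'0 r'r r'K r'd r'1]] : exists r', [/\ 0 < r', r' < r, r' < (4 * K)^-1, r' < d & r' < 1].
  by apply: small_pos; rewrite ?invr_gt0//; lra.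
have r'K2 : r' * (4 * K) < 1 by move: r'K; rewrite -[ltRHS]mul1r ltr_pdivlMr//; lra.
(* [A] is scaled so that [b] reaches [B / (1 - T)] on the vertical sides and on the top of the
   box. *)
have [A A0 AB] : exists2 A, 0 < A & forall u, B / (1 - T) * u = A * (r' ^+ 2 / 2) * u.
  exists (2 * B / ((1 - T) * r' ^+ 2)); last by move=> u; field; rewrite gt_eqF//= gt_eqF//; lra.
  by rewrite divr_gt0 ?mulr_gt0 ?exprn_gt0//; lra.
(* Points above the graph may have negative height, down to [- K x^2]; the term [2 K x^2]
   compensates for it, so that the harmonic [b] is nonnegative there. *)
pose b (q : P) := A * (q.2 + 2 * K * (q.1 ^+ 2 - q.2 ^+ 2)).
have blow x y : `|x| <= r' -> g x <= y <= r' -> [/\ 0 <= b (x, y),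
    `|x| = r' -> B / (1 - T) <= b (x, y) & y = r' -> B / (1 - T) <= b (x, y)].
  move=> xr /andP[gy yr].
  have [_ _ gx] := hg (le_lt_trans xr r'r).
  have x2 : x ^+ 2 <= r' ^+ 2 := ler_sqr_norm xr.
  have x20 := sqr_ge0 x.
  pose w := y + 2 * K * (x ^+ 2 - y ^+ 2).
  have Kr : K * r' <= 4^-1 by lra.
  have [w1 w2] : [/\ K * x ^+ 2 / 2 <= w & 0 <= y -> y / 2 <= w].
    have [y0|y0] := leP 0 y.
      have : K * y ^+ 2 <= K * (r' * y) by rewrite ler_wpM2l ?(ltW K0)// expr2 ler_wpM2r.
      have : K * (r' * y) <= 4^-1 * y by rewrite mulrA ler_wpM2r.
      have : 0 <= K * x ^+ 2 by rewrite mulr_ge0 // ltW.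
      by rewrite /w; split; lra.
    have yK : `|y| <= K * x ^+ 2.
      by rewrite ltr0_norm//; move: gx; rewrite ler_norml; lra.
    have : y ^+ 2 <= (K * x ^+ 2) ^+ 2 by exact: ler_sqr_norm.
    have -> : (K * x ^+ 2) ^+ 2 = K ^+ 2 * (x ^+ 2 * x ^+ 2) by ring.
    have : K ^+ 2 * (x ^+ 2 * x ^+ 2) <= K ^+ 2 * (r' ^+ 2 * x ^+ 2).
      by rewrite ler_wpM2l ?sqr_ge0// ler_wpM2r.
    have : K ^+ 2 * (r' ^+ 2 * x ^+ 2) <= 4^-1 ^+ 2 * x ^+ 2.
      rewrite mulrA ler_wpM2r// -exprMn; apply: ler_sqr_norm.
      by rewrite ger0_norm//; apply: mulr_ge0; exact: ltW.
    move=> q1 q2 q3; have q4 : y ^+ 2 <= 4^-1 ^+ 2 * x ^+ 2 := le_trans q3 (le_trans q2 q1).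
    have : K * y ^+ 2 <= K * (4^-1 ^+ 2 * x ^+ 2) by rewrite ler_wpM2l// ltW.
    have : 0 <= K * x ^+ 2 by rewrite mulr_ge0 // ltW.
    rewrite (_ : K * (4^-1 ^+ 2 * x ^+ 2) = 16^-1 * (K * x ^+ 2)); last by field.
    move: gx; rewrite ler_norml => /andP[g1 _].
    rewrite /w; split; last by lra.
    by move: g1 gy; move: (g x) => gg; lra.
  have w0 : 0 <= w by apply: le_trans w1; rewrite divr_ge0// mulr_ge0// ltW.
  rewrite -[B / (1 - T)]mulr1 (AB 1) mulr1; split; first by rewrite mulr_ge0 // ltW.
    move=> xe; rewrite ler_pM2l//; apply: le_trans w1.
    have -> : x ^+ 2 = r' ^+ 2 by rewrite -xe real_normK ?num_real.
    by have := sqr_ge0 r'; move: (r' ^+ 2) => q; nra.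
  move=> ye; rewrite ler_pM2l//; rewrite /b /= -/w; apply: le_trans (w2 _); rewrite ye; last exact: ltW.
  by rewrite expr2; nra.
(* [T - t] will be [3 eta ep] and [b <= 2 A ep] on the disc, so the loss [(T - t) b] is at most
   [k ep^2 / 8], half of the strict margin [k (ep / 2)^2] available on its circle. *)
have [eta eta0 etaE] : exists2 eta, 0 < eta & forall e, 3 * eta * e * (A * (2 * e)) = k * e ^+ 2 / 8.
  exists (k / (48 * A)); first by rewrite divr_gt0// mulr_gt0.
  by move=> e; field; rewrite gt_eqF.
have [d2 d20 Hd2] := vertical_near (hl eta0).
have [y0 [y00 y0d y0d2 y0r y0T]] : exists y0, [/\ 0 < y0, y0 < d / 2, y0 < d2 / 2, y0 < r' / 4 & y0 < T / (4 * eta + 1)].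
  by apply: small_pos; rewrite ?divr_gt0//; lra.
have [ep /andP[ep0 epy] fl] := fluid y00.
have [t tE] : exists t, t = T - 3 * eta * ep by exists (T - 3 * eta * ep).
have ee0 : 0 < eta * ep by rewrite mulr_gt0.
have tT : 0 < t < T.
  have : ep * (4 * eta + 1) < T by rewrite -ltr_pdivlMr; [exact: lt_trans y0T|lra].
  by rewrite tE; lra.
have cb : continuous b.
  by move=> q; have := @continuous_hquad R ((0, A), (2 * K * A, 0)) q; congr continuous_at; apply/funext => z; rewrite /b /hquad /=; ring.
(* Comparison of two times. On the graph [V T] equals [ph]; on the other sides the interpolation
   [hVT] loses at most [(T - t) B / (1 - T)], which [(T - t) b] covers. *)
have comp1 x y : `|x| < r' -> g x < y < r' -> (V t (x, y) + (- ((T - t) * b (x, y)))%:E <= V T (x, y))%E.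
  have [t0 tT'] : 0 < t /\ t < T by case/andP: tT.
  have Tt0 : 0 <= T - t by rewrite subr_ge0 ltW.
  pose N : set P := [set q | [/\ `|q.1| < r', g q.1 < q.2 & q.2 < r']].
  have c1 (q : P) : {for q, continuous (fun z : P => `|z.1|)} by apply: cvg_norm; exact: cvg_fst.
  have c2 (q : P) : {for q, continuous (fun z : P => z.2)} by exact: cvg_snd.
  have clN q : closure N q -> `|q.1| <= r' /\ g q.1 <= q.2 <= r'.
    move=> cq.
    have h1 : `|q.1| <= r'.
      rewrite leNgt; apply/negP => /(near_gt (c1 q))/(closure_near cq)[z [z1 _ _] /=].
      by move=> /(lt_trans z1); rewrite ltxx.
    have [cg _ _] := hg (le_lt_trans h1 r'r).
    split => //; apply/andP; split; rewrite leNgt; apply/negP.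
      move=> /(near_below cg)/(closure_near cq)[z [_ z2 _]].
      by move=> /(lt_trans z2); rewrite ltxx.
    move=> /(near_gt (c2 q))/(closure_near cq)[z [_ _ z2]].
    by move=> /(lt_trans z2); rewrite ltxx.
  have small q : closure N q -> sqmod q <= 2.
    move=> /clN[q1 /andP[q2 q3]].
    have [_ _ gx] := hg (le_lt_trans q1 r'r).
    have x2 := ler_sqr_norm q1.
    have rr1 : r' ^+ 2 <= 1 by rewrite expr_le1 ?ltW.
    have yr : `|q.2| <= 1.
      have : K * q.1 ^+ 2 <= K * r' ^+ 2 by rewrite ler_wpM2l ?(ltW K0).
      have : K * r' ^+ 2 <= 1 by rewrite expr2; nra.
      by move: gx; rewrite !ler_norml => /andP[g1 g2] k1 k2; apply/andP; split; lra.
    have := ler_sqr_norm yr; rewrite expr1n /sqmod; lra.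
  move=> xr /andP[gy yr].
  apply: (obs_comparison ob (N := N) (v := fun q => V t q + (- ((T - t) * b q))%:E)%E) => //.
  - rewrite openE => q [q1 q2 q3]; have [cg _ _] := hg (lt_trans q1 r'r).
    by apply: filterS3 (near_lt (c1 q) q1) (near_above cg q2) (near_lt (c2 q) q3) => z a c f; split.
  - by exists 3 => q Nq; have := small q (subset_closure Nq); lra.
  - move=> q _; apply: usc_at_addr; first by have [] := hV t q.
    by apply: cvgN; apply: cvgM; [exact: cvg_cst|exact: cb].
  - move=> [x' y'] [q1 q2 q3]; have [_ nt le] := hV t (x', y'); split.
      have hj : hjet (fun q => - ((T - t) * b q)) (x', y').
        apply: eq_hjet (hjetZ (- (T - t)) (hjet_hquad ((0, A), (2 * K * A, 0)) (x', y'))) => z.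
        by rewrite /b /hquad /=; ring.
      by move/(hjet_touched hj).
    have [b0 _ _] := blow x' y' (ltW q1) ltac:(by rewrite /= in q2 q3; rewrite (ltW q2) (ltW q3)).
    rewrite -[leRHS]adde0; by apply: leeD => //; rewrite lee_fin oppr_le0 mulr_ge0.
  - move=> [x' y'] cq nN; have [/= q1 q2] := clN _ cq.
    have [b0 b1 b2] := blow x' y' q1 q2.
    have sq := small _ cq.
    have [_ _ le] := hV t (x', y').
    have Tb0 : 0 <= (T - t) * b (x', y') by rewrite mulr_ge0.
    have [ye|yn] := eqVneq y' (g x').
      have [_ ct _] := hg (le_lt_trans q1 r'r).
      rewrite ye ct -[leRHS]adde0; apply: leeD; first by rewrite -ye.
      by rewrite lee_fin oppr_le0 -ye.
    have bB : B / (1 - T) <= b (x', y').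
      have [xe|xn] := eqVneq `|x'| r'; first exact: b1.
      apply: b2; apply/eqP/negPn/negP => yn'; apply: nN; split => /=.
      + by rewrite lt_neqAle xn.
      + by rewrite lt_neqAle eq_sym yn; case/andP: q2.
      + by rewrite lt_neqAle yn'; case/andP: q2.
    apply: le_trans (hVT (x', y') tT).
    move: le; case: (V t (x', y')) => [w||] // le; last by rewrite addNye leNye.
    rewrite -EFinM -!EFinD lee_fin; move: le; rewrite lee_fin => le.
    have HBq := HB _ sq.
    have t1 : 0 < 1 - t by rewrite subr_gt0 (lt_trans tT').
    have T1' : 0 < 1 - T by rewrite subr_gt0.
    have h1 : (T - t) * (w - m) <= (T - t) * ((1 - T) * b (x', y')).
      rewrite ler_wpM2l//; move: bB; rewrite ler_pdivrMr// mulrC; apply: le_trans.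
      by apply: le_trans HBq; rewrite lerD2r.
    have h2 : (T - t) * ((1 - T) * b (x', y')) <= (T - t) * ((1 - t) * b (x', y')).
      by rewrite ler_wpM2l// ler_wpM2r// lerD2l lerN2 ltW.
    rewrite -(ler_pM2l t1).
    have -> : (1 - t) * ((1 - T) / (1 - t) * w + (1 - (1 - T) / (1 - t)) * m) = (1 - T) * w + (T - t) * m.
      by field; rewrite gt_eqF.
    rewrite -subr_ge0; move: h1 h2; rewrite -subr_ge0 => h1; rewrite -subr_ge0 => h2.
    by have := addr_ge0 h1 h2; congr (0 <= _); ring.
suff : ((ph (0, ep) - k * sqmod ((0, ep) - (0, ep) : P))%:E <= V T (0%R, ep))%E.
  by rewrite subrr sqmod0 mulr0 subr0 leNgt fl.
have epr : ep < r' / 4 by exact: lt_trans y0r.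
have epd : ep < d / 2 by exact: lt_trans y0d.
have epd2 : ep < d2 / 2 by exact: lt_trans y0d2.
have DT := final_D0; have l10 := final_l1.
clear y00 y0d y0d2 y0r y0T epy blow AB HB hVT r'K r'd r'1 B0 T01 mph cb Hk hD hl hV fluid.
have eh : ep / 2 <= 3 / 2 * ep by lra.
have er : 3 / 2 * ep < r' by lra.
have ed : 3 / 2 * ep < d by lra.
have ed2 : 3 / 2 * ep < d2 by lra.
have Kep : K * ep <= 1.
  have : K * ep <= K * r' by rewrite ler_pM2l//; lra.
  by lra.
pose pe : P := (0, ep).
have inball (q : P) : sqmod (q - pe) <= (ep / 2) ^+ 2 -> `|q.1| <= ep / 2 /\ `|q.2 - ep| <= ep / 2.
  rewrite /sqmod /= subr0 => H; have e2 : 0 <= ep / 2 by lra.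
  have := sqr_ge0 q.1; have := sqr_ge0 (q.2 - ep) => s1 s2.
  by split; rewrite -(@ler_pXn2r _ 2) ?nnegrE// real_normK ?num_real//; lra.
(* [ph - k |q - pe|^2] is untouched, and on the circle it lies below [V T] because contact at time
   [t] holds there. At the centre it equals [ph], in contradiction with fluid at [(0, ep)]. *)
apply: (obs_comparison ob (N := [set q | sqmod (q - pe) < (ep / 2) ^+ 2]) (v := fun q => (ph q - k * sqmod (q - pe))%:E)).
- exact: open_disc.
- exists (2 * (ep / 2) ^+ 2 + 2 * sqmod pe) => q /= qd.
  by have := sqmodD_le (q - pe) pe; rewrite subrK; lra.
- move=> q _; apply: usc_at_fin; apply: cvgB; first exact: (obs_cont ob).
  by apply: cvgM; [exact: cvg_cst|exact: continuous_sqmodB].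
- move=> [x y] qd; have [/= q1 q2] := inball _ (ltW qd).
  split; last by rewrite lee_fin gerBl mulr_ge0 ?sqmod_ge0// ltW.
  have [_ yn _ _ _] := small_disc_bounds (g := 0) ep0 K0 Kep er q1 q2 ltac:(by rewrite normr0 mulr_ge0 ?sqr_ge0 ?(ltW K0)).
  by have [] := Hd x y (le_lt_trans (le_trans q1 eh) ed) (le_lt_trans yn ed).
- move=> [x y] cq nN.
  have qd : sqmod ((x, y) - pe) <= (ep / 2) ^+ 2.
    rewrite leNgt; apply/negP => /(near_gt (@continuous_sqmodB R pe _))/(closure_near cq)[z z1 z2].
    by move: (lt_trans z1 z2); rewrite ltxx.
  have qe : sqmod ((x, y) - pe) = (ep / 2) ^+ 2.
    by apply/eqP; rewrite eq_le qd/= leNgt; apply/negP => lt; apply: nN.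
  have [/= q1 q2] := inball _ qd.
  move: (q2); rewrite ler_norml => /andP[q3 q4].
  have xr' : `|x| < r' := le_lt_trans (le_trans q1 eh) er.
  have [_ _ gx] := hg (lt_trans xr' r'r).
  have [yp yn Kx cn gyr] := small_disc_bounds ep0 K0 Kep er q1 q2 gx.
  have [_ [_ HV]] := Hd x y (le_lt_trans (le_trans q1 eh) ed) (le_lt_trans yn ed).
  have HD := Hd2 x y (le_lt_trans (le_trans q1 eh) ed2) (le_lt_trans yn ed2).
  have tD : t < D (x, y).
    have : eta * cnorm (x, y) <= eta * (2 * ep) by rewrite ler_wpM2l// ltW.
    move: HD; rewrite DT ler_norml => /andP[HD _].
    have ly : 0 <= l.2 * y by rewrite mulr_ge0// ltW.
    move: HD; rewrite /cdot l10 mul0r add0r /= tE.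
    by move: (D _) (l.2 * y) ly (cnorm _) => a c c0 f; lra.
  have Vt : V t (x, y) = (ph (x, y))%:E by apply: HV => //; lra.
  apply: le_trans (comp1 x y xr' gyr); rewrite Vt -EFinD lee_fin qe lerD2l lerN2.
  have b1 : b (x, y) <= A * (2 * ep).
    rewrite /b ler_pM2l//=; have := sqr_ge0 y => yy.
    have : 0 <= K * y ^+ 2 by rewrite mulr_ge0 ?(ltW K0).
    by move: Kx q4; move: (x ^+ 2) (y ^+ 2) => a c; lra.
  have h1 : (T - t) * b (x, y) <= (3 * eta * ep) * (A * (2 * ep)).
    have -> : T - t = 3 * eta * ep by rewrite tE; ring.
    by rewrite ler_wpM2l// !mulr_ge0// ltW.
  apply: le_trans h1 _.
  rewrite etaE.
  have : 0 < k * ep ^+ 2 by rewrite mulr_gt0// exprn_gt0.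
  have -> : k * (ep / 2) ^+ 2 = k * ep ^+ 2 / 4 by field.
  by move: (k * _) => q; lra.
- by rewrite /= subrr sqmod0 exprn_gt0//; lra.
Qed.

End FinalSide.

(** * The boundary curve *)

Section Lifts.
Variable R : realType.
Local Notation P := (plane R).

Lemma ball_open (s r : R) : open [set x : R | `|x - s| < r].
Proof.
apply: (@open_comp _ _ (fun x : R => `|x - s|) [set t | t < r]); last exact: open_lt.
by move=> x _; apply: cvg_norm; apply: cvgB; [exact: cvg_id|exact: cvg_cst].
Qed.

Lemma near_ball (s : R) (Q : R -> Prop) : (\forall x \near s, Q x) <->
  exists2 r : R, 0 < r & forall x, `|x - s| < r -> Q x.
Proof.
split=> [/nbhs_normP[r /= r0 H]|[r r0 H]].
  by exists r => // x xr; apply: H; rewrite /= distrC.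
by apply/nbhs_normP; exists r => //= x; rewrite /= distrC => /H.
Qed.

Lemma Ck_on_cinv k (U : set R) (g : R -> P) : open U -> (forall x, U x -> g x != 0) ->
  Ck_on k U g -> Ck_on k U (fun x => cinv (g x)).
Proof.
move=> oU g0 cg; have c1 := Ck_on_fst oU cg; have c2 := Ck_on_snd oU cg.
have cs : Ck_on k U (fun x => (sqmod (g x))^-1).
  apply: Ck_onV => //; first by move=> x /g0; rewrite sqmod_eq0.
  exact: (Ck_onD oU (Ck_onM oU c1 c1) (Ck_onM oU c2 c2)).
have cN : Ck_on k U (fun x => -1 * (g x).2) by apply: Ck_onM => //; exact: Ck_on_cst.
apply: (@eq_Ck_on _ _ _ _ U (fun x => ((g x).1 * (sqmod (g x))^-1, (-1 * (g x).2) * (sqmod (g x))^-1))) => //.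
  by move=> x _; rewrite cinvE; congr (_, _); rewrite mulN1r.
by apply: Ck_on_pair => //; exact: Ck_onM.
Qed.

(** A bound on the second derivative near [s] gives one constant for all pairs of points, not only
    for expansions at [s]; this prepares uniform estimates along the whole curve. *)
Lemma taylor_uniform (U : set R) (k : R -> R) s : open U -> U s -> smooth_on U k ->
  exists d C : R, [/\ 0 < d, 0 <= C & forall t u, `|t - s| < d -> `|u - s| < d ->
    `|k t - k u - (t - u) * 'D_1 k u| <= C * (t - u) ^+ 2].
Proof.
move=> oU Us sk.
have [dk /(_ 1) [dk1 /(_ 1) ck2]] := sk 2%N.
have nU : \forall x \near s, U x by exact: open_nbhs_nbhs.
pose k2 : R -> R := 'D_1 ('D_1 k).
have c2 : {for s, continuous (fun x => `|k2 x|)} by apply: cvg_norm; exact: ck2.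
have b2 : `|k2 s| < `|k2 s| + 1 by rewrite ltrDl.
have H0 : \forall x \near s, U x /\ `|k2 x| < `|k2 s| + 1 by exact: filterI nU (near_lt c2 b2).
have /near_ball[d d0 Hd] := H0.
exists d, (`|k2 s| + 1); split => //.
move=> t u td ud.
have seg (v : R) : 0 <= v <= 1 -> `|u + v * (t - u) - s| < d.
  move=> /andP[v0 v1]; move: td ud; rewrite !ltr_norml => /andP[a1 a2] /andP[b1 b2'].
  have -> : u + v * (t - u) - s = (1 - v) * (u - s) + v * (t - s) by ring.
  have w0 : 0 <= 1 - v by lra.
  have d1 : d = (1 - v) * d + v * d by ring.
  have e1 : (1 - v) * (u - s) <= (1 - v) * d by rewrite ler_wpM2l// ltW.
  have e2 : v * (t - s) <= v * d by rewrite ler_wpM2l// ltW.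
  have e3 : (1 - v) * (- d) <= (1 - v) * (u - s) by rewrite ler_wpM2l// ltW.
  have e4 : v * (- d) <= v * (t - s) by rewrite ler_wpM2l// ltW.
  have [vz|vn] := eqVneq v 0; first by rewrite vz; apply/andP; split; lra.
  have v00 : 0 < v by rewrite lt_neqAle eq_sym vn.
  have e5 : v * (t - s) < v * d by rewrite ltr_pM2l.
  have e6 : v * (- d) < v * (t - s) by rewrite ltr_pM2l.
  by apply/andP; split; lra.
have lin v : is_derive v (1 : R) (fun w : R => u + w * (t - u)) (t - u).
  refine (is_derive_eq (is_deriveD (is_derive_cst u v 1) (is_deriveM (is_derive_id v 1) (is_derive_cst (t - u) v 1))) _).
  by rewrite scaler0 !add0r /GRing.scale /= mulr1.
have comp (f : R -> R) v : differentiable f (u + v * (t - u)) ->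
    is_derive v (1 : R) (fun w : R => f (u + w * (t - u))) ((t - u) * 'D_1 f (u + v * (t - u))).
  move=> df; have H : is_derive (u + v * (t - u)) (1 : R) f ('D_1 f (u + v * (t - u))).
    by apply: derivableP; exact: diff_derivable.
  by refine (is_derive_eq (is_derive1_comp (g := fun w : R => u + w * (t - u)) H (lin v)) _); rewrite mulrC.
have := @taylor1D R (fun v => k (u + v * (t - u))) (fun v => (t - u) * 'D_1 k (u + v * (t - u)))
  (fun v => (t - u) * ((t - u) * k2 (u + v * (t - u)))) 0 ((`|k2 s| + 1) * (t - u) ^+ 2).
rewrite mul1r mul0r addr0 mul0r subr0 addrCA subrr addr0; apply.
- by move=> v /seg /Hd[Uv _]; apply: comp; exact: dk.
- move=> v /seg /Hd[Uv _].
  have H := comp ('D_1 k) v (dk1 _ Uv).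
  exact: (is_deriveZ (t - u) H).
- move=> v /seg /Hd[_ /= kv]; rewrite subr0 mulrA normrM -expr2 mulrC.
  by rewrite (ger0_norm (sqr_ge0 _)); apply: ler_wpM2r; [exact: sqr_ge0|exact: ltW kv].
Qed.

Lemma derive_fst_snd (g : R -> P) s : differentiable g s ->
  'D_1 (fun x => (g x).1) s = ('D_1 g s).1 /\ 'D_1 (fun x => (g x).2) s = ('D_1 g s).2.
Proof.
move=> dg; split.
  by have [_ H] := @derive_lin_comp _ _ _ _ (@fst R R) g s 1 (fun x => cvg_fst) dg.
by have [_ H] := @derive_lin_comp _ _ _ _ (@snd R R) g s 1 (fun x => cvg_snd) dg.
Qed.

Lemma curve_uniform (U : set R) (g : R -> P) s : open U -> U s -> smooth_on U g ->
  exists d C : R, [/\ 0 < d, 0 <= C & forall t u, `|t - s| < d -> `|u - s| < d ->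
    cnorm (g t - g u - (t - u) *: 'D_1 g u) <= C * (t - u) ^+ 2].
Proof.
move=> oU Us sg.
have [d1 [C1 [d10 C10 H1]]] := taylor_uniform oU Us (fun k => Ck_on_fst oU (sg k)).
have [d2 [C2 [d20 C20 H2]]] := taylor_uniform oU Us (fun k => Ck_on_snd oU (sg k)).
have nU : \forall x \near s, U x by exact: open_nbhs_nbhs.
have /near_ball[d3 d30 H3] := nU.
have [d [d0 dd1 dd2 dd3 _]] := small_pos d10 d20 d30 (@ltr01 R).
exists d, (C1 + C2); split => //; first by rewrite addr_ge0.
move=> t u td ud; have [dg _] := sg 1%N.
have [E1 E2] := derive_fst_snd (dg u (H3 u (lt_trans ud dd3))).
apply: le_trans (cnorm_le_sum _) _; rewrite mulrDl; apply: lerD.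
  have := H1 t u (lt_trans td dd1) (lt_trans ud dd1); rewrite E1.
  by apply: le_trans; rewrite le_eqVlt; apply/orP; left; apply/eqP; congr `|_|.
have := H2 t u (lt_trans td dd2) (lt_trans ud dd2); rewrite E2.
by apply: le_trans; rewrite le_eqVlt; apply/orP; left; apply/eqP; congr `|_|.
Qed.

Lemma cnormZ (a : R) (x : P) : cnorm (a *: x) = `|a| * cnorm x.
Proof.
apply/eqP; rewrite -(@eqrXn2 _ 2) ?cnorm_ge0 ?mulr_ge0 ?cnorm_ge0//.
rewrite exprMn !sqr_cnorm real_normK ?num_real// /sqmod /= /GRing.scale /=.
by apply/eqP; ring.
Qed.

Lemma derive_eq0 (g : R -> P) s (C : R) : differentiable g s ->
  (\forall t \near s, cnorm (g t - g s) <= C * (t - s) ^+ 2) -> 'D_1 g s = 0.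
Proof.
move=> dg H.
have D h : 'd g s h = h *: 'D_1 g s.
  by rewrite deriveE// -linearZ /= /GRing.scale /= mulr1.
apply/eqP; rewrite -cnorm_eq0; apply/eqP/le_anti; rewrite cnorm_ge0 andbT.
apply/ler_addgt0Pr => e e0; rewrite add0r.
have e4 : 0 < e / 4 by rewrite divr_gt0.
have C0 : 0 < `|C| + 1 by rewrite ltr_wpDl.
have /near_ball[d d0 Hd] := H.
have /near_ball[d' d'0 Hd'] := diff_eps dg e4.
have [h [h0 hd hd' hC _]] := small_pos d0 d'0 (divr_gt0 e4 C0) (@ltr01 R).
have sh : s + h - s = h by rewrite addrC addKr.
have h1 : cnorm (g (s + h) - g s) <= C * h ^+ 2.
  by have := Hd (s + h); rewrite sh; apply; rewrite gtr0_norm.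
have h2 := Hd' h ltac:(by rewrite subr0 gtr0_norm).
rewrite D (gtr0_norm h0) in h2.
have n2 : cnorm (g (s + h) - g s - h *: 'D_1 g s) <= 2 * (e / 4 * h).
  have E : cnorm (g (s + h) - g s - h *: 'D_1 g s) ^+ 2 <= (2 * (e / 4 * h)) ^+ 2.
    rewrite sqr_cnorm; apply: le_trans (sqmod_le_norm _) _.
    have eh0 : 0 <= e / 4 * h by apply: mulr_ge0; exact: ltW.
    have E1 : `|g (s + h) - g s - h *: 'D_1 g s| ^+ 2 <= (e / 4 * h) ^+ 2.
      by rewrite ler_pXn2r ?nnegrE.
    rewrite [(2 * _) ^+ 2]exprMn; have := sqr_ge0 (e / 4 * h).
    by move: E1; move: (`|_| ^+ 2) ((e / 4 * h) ^+ 2) => a b; lra.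
  have eh0 : 0 <= 2 * (e / 4 * h) by apply: mulr_ge0 => //; apply: mulr_ge0; exact: ltW.
  by rewrite ler_pXn2r ?nnegrE ?cnorm_ge0 in E.
have n3 : cnorm (h *: 'D_1 g s) <= C * h ^+ 2 + 2 * (e / 4 * h).
  have E : h *: 'D_1 g s = (g (s + h) - g s) + - (g (s + h) - g s - h *: 'D_1 g s) by rewrite opprB addrCA subrr addr0.
  rewrite E.
  by apply: le_trans (cnormD _ _) _; rewrite cnormN; apply: lerD.
rewrite -(ler_pM2l h0); move: n3; rewrite cnormZ (gtr0_norm h0) => /le_trans; apply.
have n4 : C * h ^+ 2 <= e / 4 * h.
  apply: (@le_trans _ _ ((`|C| + 1) * h ^+ 2)); first by rewrite ler_wpM2r ?sqr_ge0//; have := ler_norm C; lra.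
  by rewrite expr2 mulrA ler_wpM2r ?(ltW h0)//; move: hC; rewrite ltr_pdivlMr// mulrC; exact: ltW.
have : 0 < e * h by rewrite mulr_gt0.
move: n4; have -> : e / 4 * h = e * h / 4 by field.
by rewrite [h * e]mulrC; move: (e * h) (C * _) => a b; lra.
Qed.

(** The immersion may be given in the chart [z]. If the derivative vanished after inversion, the
    inverted curve would move by [O((t - s)^2)], and so would the original one, since inversion is
    Lipschitz near the point. *)
Lemma lift_chart_false (gam : R -> P1 R) s : immersed_at gam s -> gam s <> P1zero R ->
  exists2 g, smooth_lift gam s false g & derive1 g s != 0.
Proof.
move=> [c [g [[r r0 [sg Hg]] dg]]] gs.
case: c Hg => Hg; last by exists g => //; exists r.
have rr : `|s - s| < r by rewrite subrr normr0.
have g0 : g s != 0.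
  by apply/eqP => g0; apply: gs; rewrite -Hg// g0.
have cg : {for s, continuous g} by have := sg 0%N; apply.
have /near_ball[r' r'0 Hr'] := near_comp cg (near_neq0 g0).
have [d [d0 dr dr' _ _]] := small_pos r0 r'0 (@ltr01 R) (@ltr01 R).
have g0' x : `|x - s| < d -> g x != 0 by move=> xd; apply: Hr'; exact: lt_trans dr'.
have sg' : smooth_on [set x | `|x - s| < d] g.
  by move=> k; apply: sub_Ck_on (sg k) => x /= xd; exact: lt_trans dr.
have sc : smooth_on [set x | `|x - s| < d] (fun x => cinv (g x)).
  by move=> k; apply: Ck_on_cinv => //; exact: ball_open.
have ss : `|s - s| < d by rewrite subrr normr0.
exists (fun x => cinv (g x)).
  exists d => //; split => // x xd; rewrite chart_cinv ?g0'//.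
  by apply: Hg; exact: lt_trans dr.
apply: contra dg => /eqP D0; rewrite derive1E; apply/eqP.
have [dgs _] := sg' 1%N; have [dgc _] := sc 1%N.
have [d2 [C [d20 C0 HC]]] := curve_uniform (@ball_open s d) ss sc.
rewrite derive1E in D0.
have ci0 := cinv_neq0 g0.
have [C' C'0 HC'] := hol2_bigO1 (hol2_cinv ci0).
have cgi : {for s, continuous (fun x => cinv (g x) - cinv (g s))}.
  apply: cvgB; last exact: cvg_cst.
  by have := sc 0%N; apply.
have HC2 : \forall h \near cinv (g s) - cinv (g s), cnorm (cinv (cinv (g s) + h) - cinv (cinv (g s))) <= C' * cnorm h ^+ 1 by rewrite subrr.
apply: (@derive_eq0 g s (C' * C)); first exact: dgs.
have Nd : \forall t \near s, `|t - s| < d2 by apply/near_ball; exists d2.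
apply: filterS2 Nd (near_comp cgi HC2) => t td.
rewrite addrCA subrr addr0 !cinvK expr1 => /le_trans; apply.
rewrite -mulrA ler_wpM2l//; have := HC t s td ltac:(by rewrite subrr normr0).
by rewrite D0 scaler0 subr0.
Qed.

End Lifts.

Section Branches.
Variable R : realType.
Local Notation P := (plane R).

Definition eqZ (s t : R) := exists k : int, s - t = k%:~R.

Lemma eqZ_sym s t : eqZ s t -> eqZ t s.
Proof. by move=> [k H]; exists (- k); rewrite mulrNz -H opprB. Qed.

Lemma periodZ (T : Type) (f : R -> T) (k : int) s : (forall s, f (s + 1) = f s) -> f (s + k%:~R) = f s.
Proof.
move=> pf; have N (n : nat) u : f (u + n%:R) = f u.
  by elim: n u => [|n IH] u; rewrite ?addr0// -natr1 addrA pf.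
case: k => n; first exact: N.
by rewrite NegzE mulrNz -(N n.+1) subrK.
Qed.

Lemma eqZ_period (T : Type) (f : R -> T) s t : (forall s, f (s + 1) = f s) -> eqZ s t -> f s = f t.
Proof. by move=> pf [k H]; rewrite -(subrK t s) addrC H periodZ. Qed.

Lemma eqZ_unit (s : R) : exists2 t, 0 <= t <= 1 & eqZ s t.
Proof.
exists (s - (Num.floor s)%:~R); last by exists (Num.floor s); rewrite opprB addrC subrK.
have /andP[f1 f2] := floor_itv s; rewrite subr_ge0 f1 /=.
by move: f2; rewrite rmorphD /= => f2; move: (_%:~R) f2 => a; lra.
Qed.

(** Connectedness of the segment: at the supremum of the parameters reached inside [O] the point
    lies in the closure, hence in [O], so this supremum is [1]. *)
Lemma segment_avoid (O : set P) (q q' : P) : open O ->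
  (forall v : R, 0 <= v <= 1 -> closure O (q + v *: (q' - q)) -> O (q + v *: (q' - q))) ->
  O q -> O q'.
Proof.
move=> oO Hc Oq; pose h (v : R) := q + v *: (q' - q).
have ch : continuous h.
  move=> v; apply: cvgD; first exact: cvg_cst.
  by apply: cvgZl; exact: cvg_id.
pose A := [set v : R | 0 <= v <= 1 /\ O (h v)].
have A0 : A 0 by split; rewrite ?lexx ?ler01// /h scale0r addr0.
have hs : has_sup A.
  by split; [exists 0|exists 1 => v [/andP[]]].
have s01 : 0 <= sup A <= 1.
  apply/andP; split; first by apply: ub_le_sup => //; case: hs.
  by apply: ge_sup; [exists 0|move=> v [/andP[]]].
have Os : O (h (sup A)).
  apply: Hc => // B /(ch (sup A)) /nbhs_normP[e /= e0 He].
  have [v [v01 Ov] sv] := sup_adherent e0 hs.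
  exists (h v); split => //; apply: He => /=.
  have vs : v <= sup A by apply: ub_le_sup => //; case: hs.
  by rewrite ger0_norm ?subr_ge0//; lra.
have [s1|s1] := eqVneq (sup A) 1; first by move: Os; rewrite s1 /h scale1r addrC subrK.
have [s0 sl] : 0 <= sup A /\ sup A < 1 by move/andP: s01 => [? ?]; split => //; rewrite lt_neqAle s1.
have /near_ball[e e0 He] : \forall v \near sup A, O (h v).
  by apply: near_comp (ch (sup A)) _; exact: open_nbhs_nbhs.
have [d [d0 de d1 _ _]] := @small_pos R e (1 - sup A) 1 1 e0 ltac:(by rewrite subr_gt0) ltr01 ltr01.
have : A (sup A + d).
  split; first by apply/andP; split; lra.
  by apply: He; rewrite addrC addKr gtr0_norm.
by move/(ub_le_sup (proj2 hs)); lra.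
Qed.

Definition cross (x y : P) : R := x.1 * y.2 - x.2 * y.1.

(** [F] is a closed immersed curve with velocity [A]; it may touch itself, and its image is the
    boundary of [O]. The single constant [c] serves as lower bound for the speed, as scale of the
    Taylor estimate and as inverse of its constant. *)
Record jordan_arc (O : set P) (F A : R -> P) (c : R) : Prop := {
  jo_open : open O;
  jo_c0 : 0 < c;
  jo_c1 : c <= 1;
  jo_per : forall s, F (s + 1) = F s;
  jo_perA : forall s, A (s + 1) = A s;
  jo_taylor : forall t u, `|t - u| < c -> cnorm (F t - F u - (t - u) *: A u) <= c^-1 * (t - u) ^+ 2;
  jo_imm : forall u, c <= cnorm (A u);
  jo_tan : forall s s', ~ eqZ s s' -> F s = F s' -> exists k : R, A s' = k *: A s;
  jo_range : forall q, (exists s, F s = q) <-> closure O q /\ ~ O q }.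

Section Local.
Variables (O : set P) (F A : R -> P) (c : R).
Hypothesis jo : jordan_arc O F A c.

Let c0 := jo_c0 jo.
Let c1 := jo_c1 jo.
Let ci : 1 <= c^-1. Proof. by rewrite invf_ge1// c1. Qed.

Lemma jo_cont : continuous F.
Proof.
move=> s; have c0' := c0; have ci' := ci.
have H : \forall t \near s, `|F t - F s| <= (c^-1 + cnorm (A s)) * `|t - s|.
  apply/near_ball; exists c => // t ts.
  have tc := jo_taylor jo ts.
  apply: (@le_trans _ _ (cnorm (F t - F s))).
    have := norm_le_sqmod (F t - F s); rewrite -sqr_cnorm.
    by rewrite ler_pXn2r ?nnegrE ?cnorm_ge0.
  have -> : F t - F s = (F t - F s - (t - s) *: A s) + (t - s) *: A s by rewrite subrK.
  apply: le_trans (cnormD _ _) _; rewrite mulrDl cnormZ [cnorm _ * `|_|]mulrC lerD2r.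
  apply: le_trans tc _; rewrite -(real_normK (num_real (t - s))) expr2.
  rewrite ler_wpM2l ?(ltW (lt_le_trans ltr01 ci'))//.
  by rewrite ler_piMl//; apply: le_trans (ltW ts) c1.
pose L := c^-1 + cnorm (A s); have L0 : 0 < L by rewrite /L; have := cnorm_ge0 (A s); lra.
apply/cvgrPdist_lt => e e0; rewrite -/L in H.
have He : \forall t \near s, `|t - s| < e / L by apply/near_ball; exists (e / L) => //; rewrite divr_gt0.
apply: filterS2 H He => t h1; rewrite ltr_pdivlMr// mulrC => h2.
by rewrite distrC; exact: le_lt_trans h1 h2.
Qed.

(** Adding the Taylor estimates from [u] to [t] and from [t] to [u] cancels the positions and leaves
    the difference of the velocities. *)
Lemma jo_lipA t u : `|t - u| < c -> cnorm (A t - A u) <= 2 * c^-1 * `|t - u|.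
Proof.
move=> tu; have [->|tun] := eqVneq t u; first by rewrite !subrr cnorm0 normr0 mulr0.
have n0 : 0 < `|t - u| by rewrite normr_gt0 subr_eq0.
have h1 := jo_taylor jo tu; have h2 := @jo_taylor _ _ _ _ jo u t ltac:(by rewrite distrC).
rewrite -(ler_pM2l n0) -cnormZ.
have -> : (t - u) *: (A t - A u) = (F t - F u - (t - u) *: A u) + (F u - F t - (u - t) *: A t).
  by move: (A t) (A u) (F t) (F u) => [a1 a2] [b1 b2] [d1 d2] [e1 e2]; apply: plane_eq; rewrite /GRing.scale /= /GRing.scale /=; ring.
apply: le_trans (cnormD _ _) _.
have -> : `|t - u| * (2 * c^-1 * `|t - u|) = c^-1 * (t - u) ^+ 2 + c^-1 * (u - t) ^+ 2.
  by rewrite -(sqrrN (u - t)) opprB -(real_normK (num_real (t - u))); ring.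
exact: lerD.
Qed.

Lemma jo_inj t u : `|t - u| < c ^+ 2 -> F t = F u -> t = u.
Proof.
move=> tu FE; apply/eqP; rewrite -subr_eq0 -normr_eq0; apply/eqP/le_anti; rewrite normr_ge0 andbT leNgt.
apply/negP => n0; have c0' := c0.
have tc : `|t - u| < c by apply: lt_le_trans tu _; rewrite expr2 ler_piMl ?(ltW c0)// c1.
have := jo_taylor jo tc; rewrite FE subrr sub0r cnormN cnormZ -(real_normK (num_real (t - u))).
have : `|t - u| * c <= `|t - u| * cnorm (A u) by rewrite ler_pM2l// (jo_imm jo).
move=> h1 /(le_trans h1); rewrite expr2 mulrCA ler_pM2l// => h2.
have : c * c <= c * (c^-1 * `|t - u|) by rewrite ler_pM2l.
by rewrite mulVKf ?gt_eqF// -expr2 leNgt tu.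
Qed.

End Local.
End Branches.

(** * Branches through a point as graphs over the common tangent *)

Section LocalBranches.
Variable R : realType.
Local Notation P := (plane R).
Variables (O : set P) (F A : R -> P) (c : R).
Hypothesis jo : jordan_arc O F A c.
Variable s0 : R.
Hypotheses (Fs0 : F s0 = 0) (As0 : (A s0).2 = 0).

Let c0 : 0 < c. Proof. exact: jo_c0 jo. Qed.
Let c1 : c <= 1. Proof. exact: jo_c1 jo. Qed.

(** Within this parameter distance the velocity varies by at most [c / 8], and the Taylor remainder
    is at most [c / 8] per unit of parameter; together they leave [3 c / 4] of the speed. *)
Definition halfwidth := c ^+ 2 / 16.
Local Notation d1 := halfwidth.
(** From [|t - s| <= 4 |x| / (3 c)] and the Taylor constant [1 / c], heights are at most
    [(16 / 9) x^2 / c^3]. *)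
Definition curvature := 2 / c ^+ 3.
Local Notation K := curvature.

Lemma halfwidth_bounds : [/\ 0 < d1, d1 < c / 8, 2 * d1 < c ^+ 2, 2 * d1 < c & c^-1 * d1 = c / 16].
Proof.
have cp := c0; have cq := c1.
have c2 : c ^+ 2 <= c by rewrite expr2 ler_piMl// ltW.
have c20 : 0 < c ^+ 2 by rewrite exprn_gt0.
have E : c^-1 * (c ^+ 2 / 16) = c / 16 by field; rewrite gt_eqF.
by rewrite /halfwidth; move: (c ^+ 2) E c2 c20 => a E c2 c20; split; lra.
Qed.

Lemma curvature_ge1 : 1 <= K.
Proof.
have cp := c0; rewrite /curvature ler_pdivlMr ?exprn_gt0// mul1r.
have : c ^+ 3 <= 1 by rewrite exprn_ile1 ?(ltW cp)// c1.
lra.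
Qed.

(** By the tangency condition all branches through the origin share the horizontal tangent at
    [s0]. *)
Lemma horizontal s : F s = 0 -> (A s).2 = 0 /\ c <= `|(A s).1|.
Proof.
move=> Fs; have A2 : (A s).2 = 0.
  have [/(eqZ_period (jo_perA jo)) <- //|ns] := pselect (eqZ s0 s).
  have [k ->] := jo_tan jo ns (etrans Fs0 (esym Fs)).
  by rewrite /= As0 scaler0.
split => //; apply: le_trans (jo_imm jo s) _.
by apply: le_trans (cnorm_le_sum _) _; rewrite A2 normr0 addr0.
Qed.

Lemma branch_bilip s t u : F s = 0 -> `|t - s| <= d1 -> `|u - s| <= d1 ->
  `|(F t).1 - (F u).1 - (t - u) * (A s).1| <= c / 4 * `|t - u| /\
  `|(F t).2 - (F u).2| <= c / 4 * `|t - u|.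
Proof.
move=> Fs ts us; have [d0 dc dc2 d2c cd] := halfwidth_bounds; have cp := c0.
have tu2 : `|t - u| <= 2 * d1.
  have := ler_distD s t u; rewrite (distrC s u); move: ts us; lra.
have tc : `|t - u| < c by lra.
have usc : `|u - s| < c by lra.
have h : cnorm (F t - F u - (t - u) *: A s) <= c / 4 * `|t - u|.
  have -> : F t - F u - (t - u) *: A s = (F t - F u - (t - u) *: A u) + (t - u) *: (A u - A s).
    by rewrite scalerBr addrA subrK.
  apply: le_trans (cnormD _ _) _; rewrite cnormZ.
  have h1 := jo_taylor jo tc; have h2 := jo_lipA jo usc.
  have n0 : 0 <= `|t - u| by [].
  have ci0 : 0 <= c^-1 by rewrite invr_ge0 ltW.
  have h3 : c^-1 * (t - u) ^+ 2 <= c / 8 * `|t - u|.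
    rewrite -(real_normK (num_real (t - u))) expr2 mulrA ler_wpM2r//.
    have : c^-1 * `|t - u| <= c^-1 * (2 * d1) by rewrite ler_wpM2l.
    rewrite mulrCA cd; lra.
  have h4 : `|t - u| * cnorm (A u - A s) <= c / 8 * `|t - u|.
    rewrite mulrC ler_wpM2r//; apply: le_trans h2 _.
    have : c^-1 * `|u - s| <= c^-1 * d1 by rewrite ler_wpM2l.
    by rewrite -mulrA cd; lra.
  by move: h1 h3 h4; move: (cnorm _) (_ * _ ^+ 2) (`|t - u|) => a b e; lra.
have [A2 _] := horizontal Fs.
split.
  by apply: le_trans h; have := norm_fst_le (F t - F u - (t - u) *: A s).
apply: le_trans h; have := norm_snd_le (F t - F u - (t - u) *: A s).
by rewrite /= /GRing.scale /= A2 mulr0 subr0.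
Qed.

Lemma branch_expand s t u : F s = 0 -> `|t - s| <= d1 -> `|u - s| <= d1 ->
  3 * c / 4 * `|t - u| <= `|(F t).1 - (F u).1|.
Proof.
move=> Fs ts us; have [h _] := branch_bilip Fs ts us; have [_ A1] := horizontal Fs.
have : c * `|t - u| <= `|(t - u) * (A s).1| by rewrite normrM mulrC ler_wpM2l.
have := ler_normB ((F t).1 - (F u).1) ((F t).1 - (F u).1 - (t - u) * (A s).1).
rewrite opprB addrCA subrr addr0; move: h.
by move: (`|(t - u) * (A s).1|) (`|(F t).1 - (F u).1 - (t - u) * (A s).1|) (`|(F t).1 - (F u).1|) (`|t - u|) => a b e f; lra.
Qed.

(** Inverse of the first coordinate along the branch through parameter [s]; the default [0] is not
    taken when [F s = 0] and [|x| < width]. *)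
Definition param s x := xget 0 [set t | `|t - s| < d1 /\ (F t).1 = x].
Definition graph s x := (F (param s x)).2.
Definition width := 3 * c / 4 * d1.
Local Notation r := width.

Lemma width_gt0 : 0 < r.
Proof. by have [d0 _ _ _ _] := halfwidth_bounds; have cp := c0; rewrite mulr_gt0//; lra. Qed.

Lemma param_exists s x : F s = 0 -> `|x| < r -> exists t, `|t - s| < d1 /\ (F t).1 = x.
Proof.
move=> Fs xr; have [d0 _ _ _ _] := halfwidth_bounds.
have cX : continuous (fun t => (F t).1).
  by move=> t; apply: (@continuous_comp _ _ _ F fst); [exact: jo_cont jo t|exact: cvg_fst].
have [_ A1] := horizontal Fs.
have sd : `|s - s| <= d1 by rewrite subrr normr0 ltW.
have pd : `|s + d1 - s| <= d1 by rewrite addrC addKr gtr0_norm.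
have md : `|s - d1 - s| <= d1 by rewrite addrC addKr normrN gtr0_norm.
have [hp _] := branch_bilip Fs pd sd; have [hm _] := branch_bilip Fs md sd.
have ep : s + d1 - s = d1 by rewrite addrC addKr.
have em : s - d1 - s = - d1 by rewrite addrC addKr.
rewrite ep Fs subr0 (gtr0_norm d0) in hp; rewrite em Fs subr0 normrN (gtr0_norm d0) mulNr opprK in hm.
have lt : s - d1 <= s + d1 by lra.
have [t t1 tx] : exists2 t, t \in `[s - d1, s + d1] & (F t).1 = x.
  apply: IVT => //; first by apply: continuous_subspaceT.
  have Ad : c * d1 <= `|d1 * (A s).1| by rewrite normrM (gtr0_norm d0) mulrC ler_wpM2l// ltW.
  move: hp hm xr Ad; rewrite /width !ler_norml ltr_norml.
  rewrite ge_min le_max; move: (d1 * (A s).1) (F (s + d1)).1 (F (s - d1)).1 => a b e.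
  move=> /andP[h1 h2] /andP[h3 h4] /andP[h5 h6].
  have [a0|a0] := leP 0 a; [rewrite (ger0_norm a0)|rewrite (ltr0_norm a0)] => h7.
    by apply/andP; split; apply/orP; [left|right]; lra.
  by apply/andP; split; apply/orP; [right|left]; lra.
have td : `|t - s| <= d1 by move: t1; rewrite in_itv /= ler_norml => /andP[a b]; apply/andP; split; lra.
exists t; split => //; rewrite lt_neqAle td andbT; apply/eqP => tE.
have := branch_expand Fs td sd; rewrite Fs /= subr0 tx tE; move: xr; rewrite /width; lra.
Qed.

Lemma paramP s x : F s = 0 -> `|x| < r -> `|param s x - s| < d1 /\ F (param s x) = (x, graph s x).
Proof.
move=> Fs xr; have [h1 h2] := xgetPex 0 (param_exists Fs xr).
by split => //; rewrite /graph -{2}h2; case: (F (param s x)).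
Qed.

Lemma param_unique s t : F s = 0 -> `|t - s| < d1 -> `|(F t).1| < r -> t = param s (F t).1.
Proof.
move=> Fs ts xr; have [h1 h2] := paramP Fs xr.
have := branch_expand Fs (ltW ts) (ltW h1); rewrite h2 subrr normr0 => h.
apply/eqP; rewrite -subr_eq0 -normr_eq0; apply/eqP/le_anti; rewrite normr_ge0 andbT.
by move: h; rewrite pmulr_rle0//; have := c0; lra.
Qed.

Lemma graph_bound s x : F s = 0 -> `|x| < r -> `|graph s x| <= K * x ^+ 2.
Proof.
move=> Fs xr; have [h1 h2] := paramP Fs xr; have cp := c0; have cq := c1.
have [d0 dc dc2 d2c cd] := halfwidth_bounds.
have sd : `|s - s| <= d1 by rewrite subrr normr0 ltW.
have tc : `|param s x - s| < c by lra.
have := branch_expand Fs (ltW h1) sd; rewrite Fs h2 /= subr0.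
have := jo_taylor jo tc; rewrite Fs subr0 h2 => h3 h4.
have [A2 _] := horizontal Fs.
have := norm_snd_le ((x, graph s x) - (param s x - s) *: A s).
rewrite /= /GRing.scale /= A2 mulr0 subr0 => /le_trans; apply; apply: le_trans h3 _.
have ci0 : 0 < c^-1 by rewrite invr_gt0.
have -> : K * x ^+ 2 = c^-1 * (2 / c ^+ 2 * x ^+ 2) by rewrite /curvature; field; rewrite gt_eqF.
rewrite ler_pM2l// -(real_normK (num_real x)) -(real_normK (num_real (param s x - s))).
have h5 : `|param s x - s| <= 4 / (3 * c) * `|x|.
  have -> : 4 / (3 * c) * `|x| = `|x| / (3 * c / 4) by field; rewrite gt_eqF.
  by rewrite ler_pdivlMr; [rewrite mulrC|lra].
apply: (@le_trans _ _ ((4 / (3 * c) * `|x|) ^+ 2)).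
  by rewrite ler_pXn2r ?nnegrE// mulr_ge0// divr_ge0//; lra.
have -> : (4 / (3 * c) * `|x|) ^+ 2 = 8 / 9 * (2 / c ^+ 2 * `|x| ^+ 2) by field; rewrite gt_eqF.
rewrite ler_piMl ?mulr_ge0 ?exprn_ge0 ?invr_ge0 ?(ltW cp)//; lra.
Qed.

Lemma param_slope_neq0 s x : F s = 0 -> `|x| < r -> (A (param s x)).1 != 0.
Proof.
move=> Fs xr; have [h1 h2] := paramP Fs xr; have cp := c0.
have [d0 dc dc2 d2c cd] := halfwidth_bounds.
have tc : `|param s x - s| < c by lra.
have h := jo_lipA jo tc; have [_ A1] := horizontal Fs.
have h3 := le_trans (norm_fst_le _) h; apply/eqP => z; move: h3; rewrite /= z sub0r normrN => h3.
have : c^-1 * `|param s x - s| <= c^-1 * d1 by rewrite ler_wpM2l ?invr_ge0 ?ltW.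
by rewrite cd; move: h3; rewrite -mulrA; move: (c^-1 * _) => q; lra.
Qed.

Lemma graph_slope s x : F s = 0 -> `|x| < r -> forall e, 0 < e ->
  \forall k \near (0 : R), `|graph s (x + k) - graph s x - k * ((A (param s x)).2 / (A (param s x)).1)| <= e * `|k|.
Proof.
move=> Fs xr e e0; have [h1 h2] := paramP Fs xr; have cp := c0.
have [d0 dc dc2 d2c cd] := halfwidth_bounds.
have a0 := param_slope_neq0 Fs xr; set u := param s x in h1 h2 a0 *; set a := (A u).1 in a0 *; set b := (A u).2.
pose L := c^-1 * (1 + `|b / a|) * (4 / (3 * c)) ^+ 2.
have ci0 : 0 < c^-1 by rewrite invr_gt0.
have L0 : 0 < L.
  rewrite /L mulr_gt0//; first by rewrite mulr_gt0// ltr_wpDr.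
  by rewrite exprn_gt0// divr_gt0//; lra.
have Nk : \forall k \near (0 : R), `|k| < Num.min (r - `|x|) (e / L).
  have m0 : 0 < Num.min (r - `|x|) (e / L) by rewrite lt_min subr_gt0 xr divr_gt0.
  by apply/near_ball; exists (Num.min (r - `|x|) (e / L)) => // k; rewrite subr0.
apply: filterS Nk => k; rewrite lt_min => /andP[k1 k2].
have xkr : `|x + k| < r by have := ler_normD x k; lra.
have [h3 h4] := paramP Fs xkr; set t := param s (x + k) in h3 h4.
have tuc : `|t - u| < c.
  by have := ler_distD s t u; rewrite (distrC s u); move: h1 h3; lra.
have h5 := branch_expand Fs (ltW h3) (ltW h1); rewrite h4 h2 /= [x + k]addrC addrK in h5.
have h6 := jo_taylor jo tuc; rewrite h4 h2 in h6.
have h7 := le_trans (norm_fst_le _) h6; have h8 := le_trans (norm_snd_le _) h6.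
rewrite /= -/u -/t /GRing.scale /= -/a -/b in h7 h8.
rewrite [x + k]addrC addrK in h7.
have -> : graph s (x + k) - graph s x - k * (b / a) =
    (graph s (x + k) - graph s x - (t - u) * b) - (k - (t - u) * a) * (b / a) by field.
have h9 : `|t - u| <= 4 / (3 * c) * `|k|.
  have -> : 4 / (3 * c) * `|k| = `|k| / (3 * c / 4) by field; rewrite gt_eqF.
  by rewrite ler_pdivlMr; [rewrite mulrC|lra].
apply: le_trans (ler_normB _ _) _; rewrite normrM.
have h10 : c^-1 * (t - u) ^+ 2 <= c^-1 * (4 / (3 * c)) ^+ 2 * `|k| ^+ 2.
  rewrite -mulrA ler_pM2l// -exprMn -(real_normK (num_real (t - u))).
  by rewrite ler_pXn2r ?nnegrE// mulr_ge0// divr_ge0//; lra.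
apply: (@le_trans _ _ (L * `|k| ^+ 2)); last first.
  by rewrite expr2 mulrA ler_wpM2r//; move: k2; rewrite ltr_pdivlMr// mulrC => /ltW.
have -> : L * `|k| ^+ 2 = c^-1 * (4 / (3 * c)) ^+ 2 * `|k| ^+ 2 + c^-1 * (4 / (3 * c)) ^+ 2 * `|k| ^+ 2 * `|b / a|.
  by rewrite /L; move: (c^-1) (4 / _) `|b / a| => q1 q2 q3; ring.
apply: lerD; first exact: le_trans h8 h10.
by rewrite ler_wpM2r//; exact: le_trans h7 h10.
Qed.

Lemma graph_cont s x : F s = 0 -> `|x| < r -> {for x, continuous (graph s)}.
Proof.
move=> Fs xr; set b := (A (param s x)).2 / (A (param s x)).1.
have H := graph_slope Fs xr ltr01.
apply/cvgrPdist_lt => e e0.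
have L0 : 0 < 1 + `|b| by rewrite ltr_wpDr.
have H2 : \forall k \near (0 : R), `|graph s (x + k) - graph s x| < e.
  have Nk : \forall k \near (0 : R), `|k| < e / (1 + `|b|).
    by apply/near_ball; exists (e / (1 + `|b|)); rewrite ?divr_gt0// => k; rewrite subr0.
  apply: filterS2 H Nk => k h1; rewrite ltr_pdivlMr// => h2.
  have := ler_normD (graph s (x + k) - graph s x - k * b) (k * b); rewrite subrK normrM -/b in h1 *.
  move: h1 h2; rewrite mulrDr mulr1 mul1r; lra.
have : \forall y \near x, `|graph s (x + (y - x)) - graph s x| < e.
  apply: (near_comp (g := fun y => y - x) (Q := fun k => `|graph s (x + k) - graph s x| < e)).
    by apply: cvgB; [exact: cvg_id|exact: cvg_cst].
  by rewrite subrr.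
by apply: filterS => y; rewrite addrCA subrr addr0 distrC.
Qed.

Lemma graph_contact s x : F s = 0 -> `|x| < r ->
  [/\ {for x, continuous (graph s)}, ~ O (x, graph s x), closure O (x, graph s x) &
      `|graph s x| <= K * x ^+ 2].
Proof.
move=> Fs xr; have [h1 h2] := paramP Fs xr.
have [cO nO] : closure O (x, graph s x) /\ ~ O (x, graph s x) by apply/(jo_range jo); exists (param s x).
by split; [exact: graph_cont|exact: nO|exact: cO|exact: graph_bound].
Qed.

Lemma param_eqZ s s' x : F s = 0 -> F s' = 0 -> `|x| < r ->
  eqZ (param s x) (param s' x) <-> eqZ s s'.
Proof.
move=> Fs Fs' xr; have [h1 h2] := paramP Fs xr; have [h3 h4] := paramP Fs' xr.
have [d0 dc dc2 d2c cd] := halfwidth_bounds.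
split=> -[k kE]; exists k.
  have E : s = s' + k%:~R; last by rewrite E addrC addKr.
  apply: (jo_inj jo); last by rewrite (periodZ k s' (jo_per jo)) Fs Fs'.
  move: kE h1 h3; rewrite !ltr_norml; move: (k%:~R) (param s x) (param s' x) => q p1 p2 E /andP[a1 a2] /andP[b1 b2].
  by apply/andP; split; lra.
have E : s = s' + k%:~R by rewrite -kE addrC subrK.
have Fx : F (param s' x + k%:~R) = (x, graph s' x) by rewrite (periodZ k _ (jo_per jo)).
have : param s' x + k%:~R = param s (F (param s' x + k%:~R)).1.
  apply: param_unique => //; last by rewrite Fx.
  by rewrite E opprD addrACA subrr addr0.
by rewrite Fx /= => <-; rewrite addrC addKr.
Qed.

Lemma graph_eqZ s s' x : F s = 0 -> F s' = 0 -> `|x| < r -> eqZ s s' -> graph s x = graph s' x.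
Proof.
move=> Fs Fs' xr /(param_eqZ Fs Fs' xr) e; have [_ h1] := paramP Fs xr; have [_ h2] := paramP Fs' xr.
by have := eqZ_period (jo_per jo) e; rewrite h1 h2 => -[].
Qed.

(** Compactness of one period: every parameter either is close to a zero of [F] or keeps the curve
    away from the origin. Near the origin the curve therefore consists of the graphs alone. *)
Lemma local_params : exists rho, [/\ 0 < rho, rho <= r & forall t, `|(F t).1| < rho -> `|(F t).2| < rho ->
  exists2 s, F s = 0 & t = param s (F t).1].
Proof.
have [d0 dc dc2 d2c cd] := halfwidth_bounds; have rp := width_gt0.
have H0 : \forall q \near (0 : R)^'+, forall t, `[0, 1]%classic t -> `|(F t).1| < q -> `|(F t).2| < q ->
    exists2 s, F s = 0 & `|t - s| < d1.
  have /compact_near_coveringP cK := @segment_compact R 0 1.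
  apply: (cK _ _ (fun q t => `|(F t).1| < q -> `|(F t).2| < q -> exists2 s, F s = 0 & `|t - s| < d1)) => t _.
  have [Ft|Ft] := eqVneq (F t) 0.
    have N1 : \forall t' \near t, `|t' - t| < d1 by apply/near_ball; exists d1.
    exists ([set t' | `|t' - t| < d1], setT); first by split => //; exact: filterT.
    by move=> [t' q] /= [tt _] _ _; exists t.
  have F0 : 0 < `|F t| by rewrite normr_gt0.
  have cF : {for t, continuous (fun t => `|F t|)} by apply: cvg_norm; exact: jo_cont jo t.
  have F2 : `|F t| / 2 < `|F t| by lra.
  have N1 := near_gt cF F2.
  have N2 : \forall q \near (0 : R)^'+, q < `|F t| / 2 by apply: nbhs_right_lt; rewrite divr_gt0.
  exists ([set t' | `|F t| / 2 < `|F t'|], [set q | q < `|F t| / 2]) => //= -[t' q] /= [h1 h2] h3 h4.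
  by exfalso; move: h1; rewrite prod_normE lt_max => /orP[] h1; [have := lt_trans (lt_trans h1 h3) h2|have := lt_trans (lt_trans h1 h4) h2]; rewrite ltxx.
have N : \forall q \near (0 : R)^'+, 0 < q <= r.
  have n1 : \forall q \near (0 : R)^'+, 0 < q by exact: nbhs_right_gt.
  have n2 : \forall q \near (0 : R)^'+, q < r by exact: nbhs_right_lt.
  by apply: filterS2 n1 n2 => q -> /ltW.
have H1 : \forall q \near (0 : R)^'+, 0 < q <= r /\ forall t : R, `[0, 1]%classic t -> `|(F t).1| < q -> `|(F t).2| < q ->
    exists2 s, F s = 0 & `|t - s| < d1 by apply: filterS2 N H0.
have [q [/andP[q0 qr] Hq]] := filter_ex H1.
exists q; split => // t t1 t2.
have [t' t'01 tt'] := eqZ_unit t.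
have FE := eqZ_period (jo_per jo) tt'.
have [s Fs sd] : exists2 s, F s = 0 & `|t' - s| < d1 by apply: Hq; rewrite -?FE//= in_itv.
have [k kE] := tt'; exists (s + k%:~R); first by rewrite (periodZ _ _ (jo_per jo)).
apply: param_unique; [by rewrite (periodZ _ _ (jo_per jo))| |exact: lt_le_trans qr].
by rewrite -kE (_ : t - (s + (t - t')) = t' - s)//; ring.
Qed.

End LocalBranches.

(** * Propagation of overlaps along the tangent direction *)

Section Overlap.
Variable R : realType.
Local Notation P := (plane R).

(** Dryness is tested on one transversal segment; [transverse_side] turns this into a dry point
    beyond all branches. *)
Definition one_sided (O : set P) (v q : P) := exists2 d : P, cross v d != 0 &
  exists2 e0 : R, 0 < e0 & forall e, 0 < e < e0 -> ~ O (q + e *: d).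

(* A double point that is not a plain tangency of two strands with fluid on
   both sides. *)
Definition overlap (O : set P) (F A : R -> P) (q : P) := exists u1 u2,
  [/\ F u1 = q, F u2 = q, ~ eqZ u1 u2 &
      one_sided O (A u1) q \/ exists u3, [/\ F u3 = q, ~ eqZ u3 u1 & ~ eqZ u3 u2]].

Lemma conv_lt (a a' M v : R) : a < M -> a' < M -> 0 <= v <= 1 -> a + v * (a' - a) < M.
Proof.
move=> aM aM' /andP[v0 v1]; have [le|lt] := leP a a'.
  have : v * (a' - a) <= a' - a by rewrite ler_piMl// subr_ge0.
  lra.
have : v * (a' - a) <= 0 by rewrite mulr_ge0_le0// subr_le0 ltW.
lra.
Qed.

Lemma conv_norm_lt (a a' M v : R) : `|a| < M -> `|a'| < M -> 0 <= v <= 1 -> `|a + v * (a' - a)| < M.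
Proof.
rewrite !ltr_norml => /andP[a1 a2] /andP[b1 b2] v01; apply/andP; split; last exact: conv_lt.
have := @conv_lt (- a) (- a') M v; rewrite opprK ltrNl => /(_ ltac:(lra) ltac:(lra) v01).
have -> : - a + v * (- a' + a) = - (a + v * (a' - a)) by ring.
by rewrite ltrNl.
Qed.

Section Box.
Variables (O : set P) (F A : R -> P) (c : R).
Hypothesis jo : jordan_arc O F A c.
Variable s0 : R.
Hypotheses (Fs0 : F s0 = 0) (As0 : (A s0).2 = 0).
Local Notation param := (param F c).
Local Notation graph := (graph F c).
Local Notation K := (curvature c).
Variables rho r0 : R.
Hypotheses (rho0 : 0 < rho) (r00 : 0 < r0) (r0w : r0 <= width c) (r0rho : r0 <= rho) (Kr0 : K * r0 ^+ 2 < rho / 2).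
Hypothesis par : forall t, `|(F t).1| < rho -> `|(F t).2| < rho -> exists2 s, F s = 0 & t = param s (F t).1.
Hypothesis slv : forall s s' x y, F s = 0 -> F s' = 0 -> `|x| < r0 -> graph s x < y < graph s' x -> ~ O (x, y).

Lemma box_contact s x : F s = 0 -> `|x| < r0 ->
  [/\ {for x, continuous (graph s)}, ~ O (x, graph s x), closure O (x, graph s x) &
      `|graph s x| <= K * x ^+ 2].
Proof. by move=> Fs xr; apply: (graph_contact jo Fs0 As0) => //; exact: lt_le_trans r0w. Qed.

Lemma box_graph s x : F s = 0 -> `|x| < r0 -> `|graph s x| < rho / 2.
Proof.
move=> Fs xr; have [_ _ _ h] := box_contact Fs xr; apply: le_lt_trans h (le_lt_trans _ Kr0).
have K1 := curvature_ge1 jo; rewrite ler_wpM2l//; first lra.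
by apply: ler_sqr_norm; exact: ltW.
Qed.

Lemma box_graph_lt s x : F s = 0 -> `|x| < r0 -> `|graph s x| < rho.
Proof. by move=> Fs xr; have := box_graph Fs xr; have := rho0; lra. Qed.

Lemma box_param s x : F s = 0 -> `|x| < r0 -> F (param s x) = (x, graph s x).
Proof. by move=> Fs xr; have [] := paramP jo Fs0 As0 Fs (lt_le_trans xr r0w). Qed.

Lemma box_eqZ s s' x : F s = 0 -> F s' = 0 -> `|x| < r0 -> eqZ (param s x) (param s' x) <-> eqZ s s'.
Proof. by move=> Fs Fs' xr; apply: (param_eqZ jo Fs0 As0 Fs Fs' (lt_le_trans xr r0w)). Qed.

Lemma box_slope s x : F s = 0 -> `|x| < r0 -> (A (param s x)).1 != 0.
Proof. by move=> Fs xr; exact: (param_slope_neq0 jo Fs0 As0 Fs (lt_le_trans xr r0w)). Qed.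

Lemma near_box (q : P) : `|q.1| < r0 -> `|q.2| < rho -> \forall z \near q, `|z.1| < r0 /\ `|z.2| < rho.
Proof.
move=> q1 q2.
have c1 : {for q, continuous (fun z : P => `|z.1|)} by apply: cvg_norm; exact: cvg_fst.
have c2 : {for q, continuous (fun z : P => `|z.2|)} by apply: cvg_norm; exact: cvg_snd.
by apply: filterS2 (near_lt c1 q1) (near_lt c2 q2).
Qed.

(** A branch strictly between two others would lie in a dry sliver, while boundary points are limits
    of fluid. *)
Lemma column_middle s s' s'' x : F s = 0 -> F s' = 0 -> F s'' = 0 -> `|x| < r0 ->
  ~ (graph s x < graph s' x < graph s'' x).
Proof.
move=> Fs Fs' Fs'' xr /andP[h1 h2].
have [cg _ _ _] := box_contact Fs xr; have [_ _ cO _] := box_contact Fs' xr.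
have [cg'' _ _ _] := box_contact Fs'' xr.
have xr2 := box_graph_lt Fs' xr.
have n1 := near_box (q := (x, graph s' x)) xr xr2.
have n2 := near_above (q := (x, graph s' x)) cg h1.
have n3 := near_below (q := (x, graph s' x)) cg'' h2.
have N : \forall z \near (x, graph s' x), ~ O z.
  apply: filterS3 n1 n2 n3 => -[a b] /= [a1 _] h3 h4; apply: (slv Fs Fs'' a1).
  by rewrite h3 h4.
by have [z Oz nOz] := closure_near cO N.
Qed.

(** The position of the third branch decides: if it passes above or below, the sliver in between
    gives a dry side; if it passes through the point, there is a triple point. *)
Lemma pair_overlap s s' s'' x : F s = 0 -> F s' = 0 -> F s'' = 0 -> `|x| < r0 ->
  ~ eqZ s s' -> ~ eqZ s'' s -> ~ eqZ s'' s' -> graph s x = graph s' x -> overlap O F A (x, graph s x).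
Proof.
move=> Fs Fs' Fs'' xr n1 n2 n3 gg; exists (param s x), (param s' x).
have cr b : b != 0 -> cross (A (param s x)) (0, b) != 0.
  by move=> b0; rewrite /cross /= mulr0 subr0 mulf_neq0// box_slope.
split; rewrite ?box_param// ?gg//; first by move=> H; apply: n1; apply/(box_eqZ Fs Fs' xr).
have [g1|g1|g1] := ltgtP (graph s x) (graph s'' x).
- left; exists (0, 1); first exact/cr/oner_neq0.
  exists (graph s'' x - graph s x); first by rewrite subr_gt0.
  move=> e /andP[e0 e1]; rewrite -gg.
  have -> : (x, graph s x) + e *: (0, 1) = (x, graph s x + e) :> P.
    by apply: plane_eq; rewrite /= /GRing.scale /=; ring.
  by apply: (slv Fs Fs'' xr); apply/andP; split; lra.
- left; exists (0, -1); first by apply/cr; rewrite oppr_eq0 oner_neq0.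
  exists (graph s x - graph s'' x); first by rewrite subr_gt0.
  move=> e /andP[e0 e1]; rewrite -gg.
  have -> : (x, graph s x) + e *: (0, -1) = (x, graph s x - e) :> P.
    by apply: plane_eq; rewrite /= /GRing.scale /=; ring.
  by apply: (slv Fs'' Fs xr); apply/andP; split; lra.
- right; exists (param s'' x); rewrite box_param// -gg g1.
  by split => // H; [apply: n2; apply/(box_eqZ Fs'' Fs xr)|apply: n3; apply/(box_eqZ Fs'' Fs' xr)].
Qed.

(** By [column_middle] three branches cannot take three different values over [x], so two of them
    meet there. *)
Lemma triple_overlap s1 s2 s3 x : F s1 = 0 -> F s2 = 0 -> F s3 = 0 -> `|x| < r0 ->
  ~ eqZ s1 s2 -> ~ eqZ s3 s1 -> ~ eqZ s3 s2 -> exists2 y, overlap O F A (x, y) & `|y| <= K * x ^+ 2.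
Proof.
move=> F1 F2 F3 xr n1 n2 n3.
have n1' : ~ eqZ s2 s1 by move/eqZ_sym.
have n2' : ~ eqZ s1 s3 by move/eqZ_sym.
have n3' : ~ eqZ s2 s3 by move/eqZ_sym.
have [_ _ _ b1] := box_contact F1 xr; have [_ _ _ b2] := box_contact F2 xr.
have [h|h|h] := ltgtP (graph s1 x) (graph s2 x); last 1 first.
- by exists (graph s1 x) => //; apply: (pair_overlap F1 F2 F3).
- have [k|k|k] := ltgtP (graph s2 x) (graph s3 x).
  + by exfalso; apply: (column_middle F1 F2 F3 xr); rewrite h k.
  + have [l|l|l] := ltgtP (graph s1 x) (graph s3 x).
    * by exfalso; apply: (column_middle F1 F3 F2 xr); rewrite l k.
    * by exfalso; apply: (column_middle F3 F1 F2 xr); rewrite l h.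
    * by exists (graph s1 x) => //; apply: (pair_overlap F1 F3 F2).
  + by exists (graph s2 x) => //; apply: (pair_overlap F2 F3 F1).
- have [k|k|k] := ltgtP (graph s1 x) (graph s3 x).
  + by exfalso; apply: (column_middle F2 F1 F3 xr); rewrite h k.
  + have [l|l|l] := ltgtP (graph s2 x) (graph s3 x).
    * by exfalso; apply: (column_middle F2 F3 F1 xr); rewrite l k.
    * by exfalso; apply: (column_middle F3 F2 F1 xr); rewrite l h.
    * by exists (graph s2 x) => //; apply: (pair_overlap F2 F3 F1).
  + by exists (graph s1 x) => //; apply: (pair_overlap F1 F3 F2).
Qed.

(** The sign [b] selects the side: [1] is above all branches, [-1] below. *)
Definition beyond b (z : P) := [/\ `|z.1| < r0, `|z.2| < rho & forall s, F s = 0 -> b * graph s z.1 < b * z.2].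

Lemma beyond_segment b (q q' : P) : (forall v : R, 0 <= v <= 1 -> beyond b (q + v *: (q' - q))) ->
  O q -> O q'.
Proof.
move=> H; apply: segment_avoid (jo_open jo) _ => v v01 cO.
have [b1 b2 b3] := H v v01; apply: contrapT => nO.
have [t Ft] : exists t, F t = q + v *: (q' - q) by apply/(jo_range jo).
rewrite -Ft in b1 b2 b3; have [s Fs ts] := par (lt_le_trans b1 r0rho) b2.
by have := b3 s Fs; rewrite {2}ts box_param//= ltxx.
Qed.

(** Every branch has height below [rho / 2], so two points of the region are joined through the
    level [b rho / 2]: vertically, horizontally, vertically. *)
Lemma beyond_connected b w w' : b = 1 \/ b = -1 -> beyond b w -> beyond b w' -> O w -> O w'.
Proof.
move=> b1; case: w w' => [x y] [x' y'] [/= w1 w2 w3] [/= w1' w2' w3'].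
pose h := b * (rho / 2).
have bh : b * h = rho / 2 by rewrite /h; case: b1 => ->; ring.
have hr : `|h| < rho.
  have nb : `|b| = 1 by case: b1 => ->; rewrite ?normrN normr1.
  by have rh := rho0; rewrite /h normrM nb mul1r gtr0_norm; lra.
have hg s a : F s = 0 -> `|a| < r0 -> b * graph s a < b * h.
  move=> Fs ar; rewrite bh; have := box_graph Fs ar; rewrite ltr_norml => /andP[g1 g2].
  by case: b1 => ->; lra.
have E (a a' v : R) : forall f f', (a, f) + v *: ((a', f') - (a, f)) = (a + v * (a' - a), f + v * (f' - f)) :> P.
  by move=> f f'; apply: plane_eq; rewrite /= /GRing.scale.
have vert a f f' : beyond b (a, f) -> beyond b (a, f') -> O (a, f) -> O (a, f').
  move=> [/= a1 a2 a3] [/= _ a2' a3']; apply: (@beyond_segment b) => v v01.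
  rewrite E subrr mulr0 addr0; split => //=; first exact: conv_norm_lt.
  move=> s Fs; have := @conv_lt (- (b * f)) (- (b * f')) (- (b * graph s a)) v.
  rewrite !ltrN2 => /(_ (a3 _ Fs) (a3' _ Fs) v01); rewrite ltrNr; congr (_ < _); ring.
have bx a : `|a| < r0 -> beyond b (a, h) by move=> ar; split => //= s Fs; exact: hg.
move=> Ow.
have O1 : O (x, h) by apply: vert Ow => //; exact: bx.
have O2 : O (x', h).
  move: O1; apply: (@beyond_segment b) => v v01; rewrite E subrr mulr0 addr0.
  by apply: bx; exact: conv_norm_lt.
by apply: vert O2 => //; exact: bx.
Qed.

Section Double.
Variables s1 s2 : R.
Hypotheses (F1 : F s1 = 0) (F2 : F s2 = 0).
Hypothesis two : forall s, F s = 0 -> eqZ s s1 \/ eqZ s s2.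

Lemma beyondP b z : `|z.1| < r0 -> `|z.2| < rho -> b * graph s1 z.1 < b * z.2 -> b * graph s2 z.1 < b * z.2 ->
  beyond b z.
Proof.
move=> z1 z2 g1 g2; split => // s Fs.
have gE := graph_eqZ jo Fs0 As0 Fs _ (lt_le_trans z1 r0w).
by have [/(gE s1 F1) ->|/(gE s2 F2) ->] := two Fs.
Qed.
End Double.

(** The outer of two separated branches would have the dry side beyond it and a dry sliver behind
    it, so it could not be a limit of fluid. *)
Lemma side_strict b s1 s2 x : b = 1 \/ b = -1 -> F s1 = 0 -> F s2 = 0 ->
  (forall s, F s = 0 -> eqZ s s1 \/ eqZ s s2) -> (forall z, beyond b z -> ~ O z) ->
  `|x| < r0 -> ~ (b * graph s1 x < b * graph s2 x).
Proof.
move=> b1 F1 F2 two side xr lt.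
have [cg _ _ _] := box_contact F1 xr; have [cg2 _ cO _] := box_contact F2 xr.
have xr2 := box_graph_lt F2 xr.
have n1 := near_box (q := (x, graph s2 x)) xr xr2.
have n2 : \forall z \near (x, graph s2 x), b * graph s1 z.1 < b * z.2.
  have cc : {for (x, graph s2 x), continuous (fun z : P => b * z.2 - b * graph s1 z.1)}.
    apply: cvgB; apply: cvgM; [exact: cvg_cst|exact: cvg_snd|exact: cvg_cst|exact: cvg_comp_fst].
  have : 0 < b * graph s2 x - b * graph s1 x by rewrite subr_gt0.
  by move=> /(near_gt cc); apply: filterS => z; rewrite subr_gt0.
have N : \forall z \near (x, graph s2 x), ~ O z.
  apply: filterS2 n1 n2 => -[a y] /= [a1 a2] h1.
  have [h2|h2|h2] := ltgtP (b * y) (b * graph s2 a).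
  - case: b1 => bE; rewrite bE ?mul1r ?mulN1r ?ltrN2 in h1 h2.
      by apply: (slv F1 F2 a1); rewrite h1 h2.
    by apply: (slv F2 F1 a1); rewrite h1 h2.
  - by apply: side; exact: (beyondP F1 F2).
  - have -> : y = graph s2 a by case: b1 h2 => ->; lra.
    by have [] := box_contact F2 a1.
by have [z Oz nOz] := closure_near cO N.
Qed.

(** One dry point beyond the branches makes that whole side dry, which forces the two branches to
    coincide over every [x]; each common point then has a dry vertical segment. *)
Lemma side_merge b s1 s2 w x : b = 1 \/ b = -1 -> F s1 = 0 -> F s2 = 0 -> ~ eqZ s1 s2 ->
  (forall s, F s = 0 -> eqZ s s1 \/ eqZ s s2) -> beyond b w -> ~ O w -> `|x| < r0 ->
  overlap O F A (x, graph s1 x).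
Proof.
move=> b1 F1 F2 ns two bw nOw xr.
have side z : beyond b z -> ~ O z by move=> bz /(beyond_connected b1 bz bw).
have two' s : F s = 0 -> eqZ s s2 \/ eqZ s s1 by move=> /two[]; [right|left].
have gg : graph s1 x = graph s2 x.
  have h1 := side_strict b1 F1 F2 two side xr; have h2 := side_strict b1 F2 F1 two' side xr.
  move: h1 h2 => /negP; rewrite -leNgt => h1 /negP; rewrite -leNgt => h2.
  by case: b1 h1 h2 => ->; lra.
exists (param s1 x), (param s2 x).
split; rewrite ?box_param// ?gg//; first by move=> H; apply: ns; apply/(box_eqZ F1 F2 xr).
left; exists (0, b).
  rewrite /cross /= mulr0 subr0 mulf_neq0// ?box_slope//.
  by case: b1 => ->; rewrite ?oppr_eq0 oner_neq0.
have rh := rho0; exists (rho / 2); first lra.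
move=> e /andP[e0 e1]; apply: side.
have -> : (x, graph s2 x) + e *: (0, b) = (x, graph s2 x + e * b) :> P.
  by apply: plane_eq; rewrite /= /GRing.scale /= ?mulr0 ?addr0.
have bb : b * b = 1 by case: b1 => ->; ring.
have bg : b * (graph s2 x + e * b) = b * graph s2 x + e by rewrite mulrDr mulrCA bb mulr1.
apply: (beyondP F1 F2) => //=; rewrite ?bg ?gg; try lra.
have : `|e * b| < rho / 2 by rewrite normrM (gtr0_norm e0); case: b1 => ->; rewrite ?normrN normr1 mulr1.
by have := box_graph F2 xr; have := ler_normD (graph s2 x) (e * b); lra.
Qed.

(** Both branches have the same slope [beta] at [x], and [d] leaves it with vertical excess [th],
    which is nonzero. The sign of [th] is the side [b], and a short step along [d] gets beyond both
    graphs. *)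
Lemma transverse_side s1 s2 x : F s1 = 0 -> F s2 = 0 -> `|x| < r0 -> graph s1 x = graph s2 x ->
  (forall s, F s = 0 -> eqZ s s1 \/ eqZ s s2) ->
  (exists k : R, A (param s2 x) = k *: A (param s1 x)) -> one_sided O (A (param s1 x)) (x, graph s1 x) ->
  exists b w, [/\ b = 1 \/ b = -1, beyond b w & ~ O w].
Proof.
move=> F1 F2 xr gg two [k kE] [d cd [e0 e00 He]].
have xw := lt_le_trans xr r0w.
have a1 := box_slope F1 xr; have a2 := box_slope F2 xr.
pose beta := (A (param s1 x)).2 / (A (param s1 x)).1.
have beta2 : (A (param s2 x)).2 / (A (param s2 x)).1 = beta.
  have k0 : k != 0 by apply/eqP => k0; move: a2; rewrite kE k0 scale0r eqxx.
  by rewrite kE /beta /= /GRing.scale /=; field; rewrite a1 k0.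
pose th := d.2 - d.1 * beta.
have th0 : th != 0.
  apply: contra cd => /eqP th0; apply/eqP; rewrite /cross.
  have -> : d.2 = d.1 * beta by move: th0; rewrite /th; lra.
  by rewrite /beta; field.
have M0 : 0 < `|d.1| + `|d.2| + 1 by rewrite ltr_wpDl// addr_ge0.
have ep0 : 0 < `|th| / (2 * (`|d.1| + 1)).
  by rewrite divr_gt0 ?normr_gt0// mulr_gt0// ltr_wpDl.
have /near_ball[q1 q10 H1] := graph_slope jo Fs0 As0 F1 xw ep0.
have /near_ball[q2 q20 H2] := graph_slope jo Fs0 As0 F2 xw ep0.
have /near_ball[q3 q30 H3] : \forall e \near (0 : R), `|x + e * d.1| < r0 /\ `|graph s1 x + e * d.2| < rho.
  have g1 := box_graph_lt F1 xr.
  have ce (u v : R) : {for (0 : R), continuous (fun e : R => `|u + e * v|)}.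
    by apply: cvg_norm; apply: cvgD; [exact: cvg_cst|apply: cvgMl; exact: cvg_id].
  have e1 : `|x + 0 * d.1| < r0 by rewrite mul0r addr0.
  have e2 : `|graph s1 x + 0 * d.2| < rho by rewrite mul0r addr0.
  by apply: filterS2 (near_lt (ce x d.1) e1) (near_lt (ce (graph s1 x) d.2) e2).
have [e [ep e1 e2 e3 e4]] := small_pos e00 (divr_gt0 q10 M0) (divr_gt0 q20 M0) q30.
have nb (q : R) : e < q / (`|d.1| + `|d.2| + 1) -> `|e * d.1 - 0| < q.
  rewrite ltr_pdivlMr// subr0 normrM (gtr0_norm ep); apply: le_lt_trans.
  by rewrite ler_pM2l//; have := normr_ge0 d.2; lra.
have {}H1 := H1 _ (nb _ e2); have {}H2 := H2 _ (nb _ e3).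
have [x1 y1] := H3 e ltac:(by rewrite subr0 gtr0_norm).
have err : `|th| / (2 * (`|d.1| + 1)) * `|e * d.1| <= e * `|th| / 2.
  rewrite normrM (gtr0_norm ep).
  have -> : `|th| / (2 * (`|d.1| + 1)) * (e * `|d.1|) = e * `|th| / 2 * (`|d.1| / (`|d.1| + 1)).
    by have : `|d.1| + 1 != 0 by [rewrite gt_eqF// ltr_wpDl]; move: (`|d.1|) (`|th|) => u v uv; field.
  rewrite ler_piMr//; first by rewrite divr_ge0// mulr_ge0// ltW.
  by rewrite ler_pdivrMr ?ltr_wpDl// mul1r; lra.
have eth : 0 < e * `|th| by rewrite mulr_gt0// normr_gt0.
rewrite beta2 -gg in H2; rewrite -/beta in H1.
have fin b (g : R) : b = 1 \/ b = -1 -> b * th = `|th| ->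
    `|g - graph s1 x - e * d.1 * beta| <= `|th| / (2 * (`|d.1| + 1)) * `|e * d.1| ->
    b * g < b * (graph s1 x + e * d.2).
  move=> b1 bth /le_trans/(_ err); rewrite ler_norml => /andP[h1 h2].
  have E : e * d.2 = e * th + e * d.1 * beta by rewrite /th; ring.
  have E2 : b * (e * th) = e * `|th| by rewrite mulrCA bth.
  rewrite E; move: h1 h2 eth E2; move: (e * th) (e * `|th|) (e * d.1 * beta) => u v w h1 h2 v0.
  by case: b1 => ->; lra.
have [b [b1 bth]] : exists b, (b = 1 \/ b = -1) /\ b * th = `|th|.
  have [t0|t0] := leP 0 th; first by exists 1; split; [left|rewrite mul1r ger0_norm].
  by exists (-1); split; [right|rewrite mulN1r ltr0_norm].
exists b, (x + e * d.1, graph s1 x + e * d.2); split => //.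
  by apply: (beyondP F1 F2 two) => //=; apply: fin.
have := He e ltac:(by rewrite ep e1).
by congr (~ O _).
Qed.

(** Three branches give an overlap in every column by [triple_overlap]. With only two, the dry
    segment gives a dry side, hence coincidence in every column. *)
Lemma box_overlap q x : overlap O F A q -> `|q.1| < r0 -> `|q.2| < r0 -> `|x| < r0 ->
  exists2 y, overlap O F A (x, y) & `|y| <= K * x ^+ 2.
Proof.
case: q => [xq yq] [u1 [u2 [Fu1 Fu2 nu bad]]] /= xqr yqr xr.
have pr (u : R) : F u = (xq, yq) -> exists2 s, F s = 0 & u = param s xq /\ yq = graph s xq.
  move=> Fu; have [||s Fs us] := par (t := u); rewrite ?Fu/= ?(lt_le_trans _ r0rho)//.
  exists s => //; rewrite Fu /= in us; split => //.
  by have := box_param Fs xqr; rewrite -us Fu => -[].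
have [s1 F1 [u1E y1]] := pr _ Fu1; have [s2 F2 [u2E y2]] := pr _ Fu2.
have n12 : ~ eqZ s1 s2 by move=> H; apply: nu; rewrite u1E u2E; apply/box_eqZ.
have [[s3 [F3 n31 n32]]|n3] := pselect (exists s3, [/\ F s3 = 0, ~ eqZ s3 s1 & ~ eqZ s3 s2]).
  exact: (triple_overlap F1 F2 F3).
have two s : F s = 0 -> eqZ s s1 \/ eqZ s s2.
  move=> Fs; apply: contrapT => H; apply: n3; exists s; split => // h; apply: H; [left|right] => //.
case: bad => [os|[u3 [Fu3 n31 n32]]]; last first.
  have [s3 F3 [u3E _]] := pr _ Fu3.
  by exfalso; have [H|H] := two s3 F3; [apply: n31; rewrite u3E u1E|apply: n32; rewrite u3E u2E]; apply/box_eqZ.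
have [||b [w [b1 bw nOw]]] := transverse_side F1 F2 xqr (etrans (esym y1) y2) two.
- by have := jo_tan jo nu (etrans Fu1 (esym Fu2)); rewrite u1E u2E.
- by rewrite -u1E -y1.
exists (graph s1 x); first exact: (side_merge b1 F1 F2 n12 two bw nOw).
by have [] := box_contact F1 xr.
Qed.

End Box.

Lemma local_overlap (ph : P -> R) (U : P -> \bar R) (F A : R -> P) (c s0 : R) : obstacle ph U ->
  jordan_arc [set q | (U q < (ph q)%:E)%E] F A c -> F s0 = 0 -> (A s0).2 = 0 ->
  exists2 r, 0 < r & forall q x, overlap [set q | (U q < (ph q)%:E)%E] F A q ->
    `|q.1| < r -> `|q.2| < r -> `|x| < r ->
    exists2 y, overlap [set q | (U q < (ph q)%:E)%E] F A (x, y) & `|y| <= curvature c * x ^+ 2.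
Proof.
move=> ob jo Fs0 As0; have K1 := curvature_ge1 jo; have w0 := width_gt0 jo.
have [rho [rho0 rhow par]] := local_params jo Fs0 As0.
have K0 : 0 <= curvature c by lra.
have [rs [rs0 rsw slv]] := sliver ob K0 w0.
have rK : 0 < rho / (2 * curvature c + 1) by rewrite divr_gt0//; lra.
have rs8 : 0 < rs / 8 by lra.
have [r [r0 r1 r2 r3 r4]] := small_pos rs8 rho0 rK (@ltr01 R).
have Kr : curvature c * r ^+ 2 < rho / 2.
  rewrite ltr_pdivlMr in r3; last lra.
  have : r ^+ 2 <= r by rewrite expr2 ler_piMl// ltW.
  move=> h; have : curvature c * r ^+ 2 <= curvature c * r by rewrite ler_wpM2l.
  by rewrite mulrC in r3; move: r3; rewrite mulrDl mul1r -mulrA; move: (curvature c * r) (curvature c * r ^+ 2) => u v; lra.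
exists r => // q x ov q1 q2 xr.
have rw : r <= width c by apply: le_trans rhow; exact: ltW.
apply: (box_overlap jo Fs0 As0 rho0 rw (ltW r2) Kr par _ ov) => // s s' x' y Fs Fs' xr' gy.
apply: (slv (graph F c s) (graph F c s')) gy => [z zr|z zr|]; last exact: lt_trans r1.
  by have [] := graph_contact jo Fs0 As0 Fs (lt_le_trans zr rsw).
by have [] := graph_contact jo Fs0 As0 Fs' (lt_le_trans zr rsw).
Qed.

End Overlap.

(** * The boundary of the flow as a curve with uniform estimates *)

Section Boundary.
Variable R : realType.
Local Notation P := (plane R).

Lemma closureN (T : topologicalType) (B : set T) p : closure B p <-> ~ (\forall y \near p, ~ B y).
Proof.
split=> [cB H|nH V HV]; first by have [x [Bx nBx]] := cB _ H.
by apply: contrapT => H; apply: nH; apply: filterS HV => y Vy By; apply: H; exists y.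
Qed.

Lemma norm_le_cnorm (x : P) : `|x| <= cnorm x.
Proof. by have := norm_le_sqmod x; rewrite -sqr_cnorm ler_pXn2r ?nnegrE ?cnorm_ge0. Qed.

Lemma derive1_period (G : R -> P) s : (forall s, G (s + 1) = G s) ->
  derive1 G (s + 1) = derive1 G s.
Proof.
move=> pG; rewrite !derive1E !/derive.
have -> : (fun h : R => h^-1 *: (G (h *: (1 : R) + (s + 1)) - G (s + 1))) =
  (fun h : R => h^-1 *: (G (h *: (1 : R) + s) - G s)); last by [].
by apply/funext => h; rewrite addrA !pG.
Qed.

Section Flow.
Variables (phi : P1 R -> R) (T : R).
Hypotheses (hphi : kahler_potential phi) (T01 : 0 < T < 1).
Local Notation O := [set x : P | (hs phi T x < (phat phi x)%:E)%E].

Let T0 : 0 < T. Proof. by case/andP: T01. Qed.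

(** With [w = 1/z], the envelope grows at most like [(1 - T) ln |w|^2] near [z = 0] and the obstacle
    like [ln |w|^2], so a full neighbourhood is fluid. *)
Lemma bd_neq0 : ~ bd (HS_flow phi T) (P1zero R).
Proof.
move=> [_]; apply; rewrite /interior.
suff : \forall z \near chart true (0 : P), HS_flow phi T z by [].
have [C HC] := HSc_growth hphi T; have [M M0 HM] := phi_bounded hphi.
apply/near_chart/near0_sqmod.
have [r [r0 r1 r2 _ _]] := small_pos ltr01 (expR_gt0 (- ((C + M) / T))) (@ltr01 R) (@ltr01 R).
exists r => // x xr; have [->|x0] := eqVneq x 0; first exact: HS_flow0.
rewrite -chart_cinv//; apply/HS_flowE => //.
have sx : 0 < sqmod x by rewrite sqmod_gt0.
have sc1 : 1 <= sqmod (cinv x).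
  by rewrite sqmod_cinv invf_ge1//; apply: ltW; exact: lt_trans r1.
have h := HC _ (HSc_hs hphi T) (cinv x) sc1.
apply: le_lt_trans h _; rewrite lte_fin ln_cinv//.
have l1 : ln (sqmod x) < - ((C + M) / T).
  by rewrite -[ltRHS]expRK ltr_ln ?posrE ?expR_gt0//; exact: lt_trans r2.
have l2 : C + M < T * - ln (sqmod x).
  by move: l1; rewrite ltrNr ltr_pdivrMr// mulrC.
have p1 : - ln (sqmod x) <= pot (cinv x).
  rewrite -ln_cinv// /pot ler_ln ?posrE; [by rewrite lerDr| |].
    by rewrite sqmod_gt0 cinv_neq0.
  by have := sqmod_ge0 (cinv x); lra.
have p2 : - M <= phi (chart false (cinv x)) by have := HM (chart false (cinv x)); rewrite ler_norml => /andP[].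
rewrite /phat mulrBl mul1r; move: l2 p1 p2; move: (ln _) (pot _) (phi _) => a b f; lra.
Qed.

Lemma open_fluid : open O.
Proof.
have := obs_open (obstacle_frame 0 (_ : sqmod ((1, 0) : P) = 1) hphi T01).
rewrite /sqmod /= expr1n expr0n addr0 => /(_ erefl); congr open; apply/funext => q.
by rewrite /= (_ : fr 0 (1, 0) q = q)//; apply: plane_eq; rewrite /fr cmulE /=; ring.
Qed.

Lemma bd_fluid x : bd (HS_flow phi T) (chart false x) <-> closure O x /\ ~ O x.
Proof.
have E y : HS_flow phi T (chart false y) <-> O y by apply: HS_flowE.
have c1 : closure (HS_flow phi T) (chart false x) <-> closure O x.
  split=> /closureN H; apply/closureN => H2; apply: H.
    by apply/near_chart; apply: filterS H2 => y nO /E.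
  by move/near_chart: H2; apply: filterS => y nO /E.
have i1 : interior (HS_flow phi T) (chart false x) <-> O x.
  split=> [/interior_subset/E //|Ox]; rewrite /interior; apply/near_chart.
  have : \forall y \near x, O y by exact: open_nbhs_nbhs (conj open_fluid Ox).
  by apply: filterS => y /E.
by split=> -[/c1 h1 h2]; split => // /i1.
Qed.

Section Curve.
Variables (gam : R -> P1 R) (S : set (P1 R)).
Hypotheses (rg : range gam = bd (HS_flow phi T)) (stc : self_tangent_curve gam S).

Lemma gam_neq0 s : gam s <> P1zero R.
Proof. by move=> g0; apply: bd_neq0; rewrite -rg; exists s. Qed.

Section Coordinates.
Variable G : R -> P.
Hypothesis gG : forall s, gam s = chart false (G s).

Lemma curve_smooth s : exists2 r, 0 < r & smooth_on [set x | `|x - s| < r] G /\ derive1 G s != 0.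
Proof.
have [_ imm _ _] := stc.
have [g [r r0 [sg Hg]] dg] := lift_chart_false (imm s) (@gam_neq0 s).
have gE x : `|x - s| < r -> g x = G x by move=> xr; apply: (@chart_inj _ false); rewrite Hg// gG.
exists r; first exact: r0.
split; first by move=> k; exact: (eq_Ck_on (@ball_open _ s r) gE (sg k)).
rewrite derive1E -(near_eq_derive (f := g)) -?derive1E//.
by apply/near_ball; exists r.
Qed.

Lemma curve_lift s : smooth_lift gam s false G.
Proof. by have [r r0 [sG _]] := curve_smooth s; exists r => //; split => // x _; rewrite gG. Qed.

Lemma curve_period s : G (s + 1) = G s.
Proof. by have [per _ _ _] := stc; apply: (@chart_inj _ false); rewrite -!gG. Qed.

(** All constants are expressed by the scale [q], so that compactness of a period yields a single
    one. *)
Let good (q s : R) := (forall t u, `|t - s| < q -> `|u - s| < q ->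
    cnorm (G t - G u - (t - u) *: derive1 G u) <= q^-1 * (t - u) ^+ 2) /\
  forall u, `|u - s| < q -> q <= cnorm (derive1 G u).

Lemma good_local s : exists2 eta : R, 0 < eta & forall q s', 0 < q < eta -> `|s' - s| < eta -> good q s'.
Proof.
have [r r0 [sG dG]] := curve_smooth s.
have rr : `|s - s| < r by rewrite subrr normr0.
have [d [C [d0 C0 HC]]] := curve_uniform (@ball_open _ s r) rr sG.
have cV : {for s, continuous (fun u => `|derive1 G u|)}.
  have -> : (fun u => `|derive1 G u|) = (fun u => `|'D_1 G u|) by apply/funext => u; rewrite derive1E.
  by apply: cvg_norm; have [_ /(_ 1)] := sG 1%N; apply.
have V0 : 0 < `|derive1 G s| by rewrite normr_gt0.
have V2 : `|derive1 G s| / 2 < `|derive1 G s| by lra.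
have /near_ball[n n0 Hn] := near_gt cV V2.
have d20 : 0 < d / 2 by lra.
have n20 : 0 < n / 2 by lra.
have v20 : 0 < `|derive1 G s| / 2 by lra.
have C10 : 0 < (C + 1)^-1 by rewrite invr_gt0; lra.
have [eta [e0 e1 e2 e3 e4]] := small_pos d20 n20 v20 C10.
exists eta => // q s' /andP[q0 qe] ss.
have tri u : `|u - s'| < q -> `|u - s| < 2 * eta by have := ler_distD s' u s; lra.
split=> [t u /tri ts /tri us|u /tri us].
  have := HC t u ltac:(lra) ltac:(lra); rewrite derive1E => /le_trans; apply.
  rewrite ler_wpM2r ?sqr_ge0//; apply: (@le_trans _ _ (C + 1)); first lra.
  by rewrite -[leLHS]invrK lef_pV2 ?posrE ?invr_gt0//; lra.
have b := Hn u ltac:(lra); have a := norm_le_cnorm (derive1 G u).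
exact: ltW (lt_le_trans (lt_trans (lt_trans qe e3) b) a).
Qed.

Lemma good_global : exists c, 0 < c <= 1 /\ forall s, good c s.
Proof.
have H0 : \forall q \near (0 : R)^'+, forall s, `[0, 1]%classic s -> good q s.
  have /compact_near_coveringP cK := @segment_compact R 0 1.
  apply: (cK _ _ good) => s _; have [eta e0 He] := good_local s.
  exists ([set s' | `|s' - s| < eta], [set q | 0 < q < eta]).
    split => /=; first by apply/near_ball; exists eta.
    have n1 : \forall q \near (0 : R)^'+, 0 < q by exact: nbhs_right_gt.
    have n2 : \forall q \near (0 : R)^'+, q < eta by exact: nbhs_right_lt.
    by apply: filterS2 n1 n2 => q /= h1 h2; rewrite h1 h2.
  by move=> [s' q] /= [h1 h2]; apply: He.
have N : \forall q \near (0 : R)^'+, 0 < q <= 1.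
  have n1 : \forall q \near (0 : R)^'+, 0 < q by exact: nbhs_right_gt.
  have n2 : \forall q \near (0 : R)^'+, q < 1 by exact: nbhs_right_lt.
  by apply: filterS2 n1 n2 => q -> /ltW.
have H1 : \forall q \near (0 : R)^'+, 0 < q <= 1 /\ forall s : R, `[0, 1]%classic s -> good q s by apply: filterS2 N H0.
have [q [q01 Hq]] := filter_ex H1.
exists q; split => // s; have [s' s'01 [k kE]] := eqZ_unit s.
have [h1 h2] := Hq s' ltac:(by rewrite /= in_itv).
have pV u : derive1 G (u + 1) = derive1 G u := derive1_period u curve_period.
have sh u : u - s = u - k%:~R - s' by rewrite -kE; ring.
have per u : G u = G (u - k%:~R) by rewrite -{1}(subrK k%:~R u) (periodZ k _ curve_period).
have perV u : derive1 G u = derive1 G (u - k%:~R) by rewrite -{1}(subrK k%:~R u) (periodZ k _ pV).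
split=> [t u|u]; rewrite !sh.
  move=> ts us; have := h1 _ _ ts us; rewrite -!per -perV (_ : t - k%:~R - (u - k%:~R) = t - u)//.
  by move: (k%:~R) => z; ring.
by move=> us; rewrite perV; exact: h2.
Qed.

Lemma curve_jordan_arc : exists c, jordan_arc O G (derive1 G) c.
Proof.
have [c [/andP[c0 c1] Hc]] := good_global; exists c; split.
- exact: open_fluid.
- exact: c0.
- exact: c1.
- exact: curve_period.
- by move=> s; exact: derive1_period curve_period.
- by move=> t u tu; have [h _] := Hc u; apply: h; rewrite // subrr normr0.
- by move=> u; have [_ h] := Hc u; apply: h; rewrite subrr normr0.
- move=> s s' ns GE; have [_ _ _ tan] := stc.
  apply: (tan s s' _ _ false G G); [|by rewrite !gG GE|exact: curve_lift|exact: curve_lift].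
  by move=> k kE; apply: ns; exists k.
- move=> q; rewrite -bd_fluid -rg; split=> [[s Gs]|[s _ gs]].
    by exists s => //; rewrite gG Gs.
  by exists s; apply: (@chart_inj _ false); rewrite -gG.
Qed.

Lemma double_points q : S (chart false q) <-> exists s s', [/\ ~ eqZ s s', G s = q & G s' = q].
Proof.
have [_ _ dp _] := stc; rewrite dp; split=> -[s [s' [ns h1 h2]]]; exists s, s'.
  split; [by move=> [k kE]; apply: (ns k)|apply: (@chart_inj _ false); rewrite -gG//..].
by split; [move=> k kE; apply: ns; exists k|rewrite gG ?h1 ?h2..].
Qed.

End Coordinates.

Lemma curve_coordinates : exists G : R -> P, forall s, gam s = chart false (G s).
Proof.
have H s : exists x, gam s = chart false x by apply: P1_chart_false; exact: gam_neq0.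
by have [G HG] := choice H; exists G.
Qed.

End Curve.
End Flow.

Section Rotation.
Variables (p e : P).
Hypothesis e1 : sqmod e = 1.
Local Notation ce := ((e.1, - e.2) : P).

Let ce1 : sqmod ce = 1. Proof. by rewrite /sqmod /= sqrrN. Qed.

Lemma continuous_fr : continuous (fr p e).
Proof. by move=> q; exact: hol2_continuous (hol2_fr p e q). Qed.

Lemma continuous_co : continuous (co p e).
Proof. by move=> q; exact: hol2_continuous (hol2_co p e q). Qed.

Lemma closure_fr (O : set P) q : closure (O \o fr p e) q <-> closure O (fr p e q).
Proof.
split=> /closureN H; apply/closureN => H2; apply: H.
  exact: near_comp (continuous_fr (x:=q)) H2.
have H3 : \forall y \near co p e (fr p e q), ~ (O \o fr p e) y by rewrite frK.
by apply: filterS (near_comp (continuous_co (x:=_)) H3) => w; rewrite /= coK.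
Qed.

Lemma jordan_arc_co (O : set P) (G V : R -> P) c : jordan_arc O G V c ->
  jordan_arc (O \o fr p e) (co p e \o G) (cmul ce \o V) c.
Proof.
move=> jo; have cn : cnorm ce = 1 by rewrite /cnorm ce1 sqrtr1.
have coI : injective (co p e) by move=> x y /(congr1 (fr p e)); rewrite !coK.
split.
- by apply: open_comp (jo_open jo) => w _; exact: continuous_fr.
- exact: jo_c0 jo.
- exact: jo_c1 jo.
- by move=> s; rewrite /= (jo_per jo).
- by move=> s; rewrite /= (jo_perA jo).
- move=> t u tu; apply: le_trans (jo_taylor jo tu).
  rewrite le_eqVlt -(mul1r (cnorm (G t - _ - _))) -cn -cnormM; apply/orP; left; apply/eqP; congr cnorm.
  by rewrite /co /=; move: (G t) (G u) (V u) => x y z; apply: plane_eq; rewrite !cmulE /= /GRing.scale /=; ring.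
- by move=> u; rewrite /= cnormM cn mul1r (jo_imm jo).
- move=> s s' ns /coI /(jo_tan jo ns)[k kE]; exists k.
  by rewrite /= kE; move: (V s) => z; apply: plane_eq; rewrite !cmulE /= /GRing.scale /=; ring.
- move=> q; split=> [[s <-]|[/closure_fr cO nO]].
    have [h1 h2] : closure O (G s) /\ ~ O (G s) by apply/(jo_range jo); exists s.
    by split; [apply/closure_fr|]; rewrite /= coK.
  have /(jo_range jo)[s Gs] : closure O (fr p e q) /\ ~ O (fr p e q) by [].
  by exists s; rewrite /= Gs frK.
Qed.

Lemma overlap_co (O : set P) (G V : R -> P) q :
  overlap O G V (fr p e q) <-> overlap (O \o fr p e) (co p e \o G) (cmul ce \o V) q.
Proof.
have E u : G u = fr p e q <-> co p e (G u) = q by split=> [->|<-]; rewrite ?frK ?coK.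
have X v d : cross (cmul ce v) (cmul ce d) = cross v d.
  rewrite -[RHS]mul1r -ce1 /sqmod /cross !cmulE /=; ring.
have os v : one_sided O v (fr p e q) <-> one_sided (O \o fr p e) (cmul ce v) q.
  split=> -[d cd [e0 e00 He]].
    exists (cmul ce d); first by rewrite X.
    exists e0 => // r re /=; have := He r re; congr (~ O _).
    rewrite /fr -addrA -[r *: d](cmul_conj e1); congr (_ + _).
    by move: (e) => f; apply: plane_eq; rewrite !cmulE /= /GRing.scale /=; ring.
  exists (cmul e d); first by rewrite -X conj_cmul.
  exists e0 => // r re /=; have := He r re; congr (~ O _).
  by rewrite /= /fr -addrA; congr (_ + _); apply: plane_eq; rewrite !cmulE /= /GRing.scale /=; ring.
split=> -[u1 [u2 [/E h1 /E h2 n H]]]; exists u1, u2; split => //.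
  case: H => [/os H|[u3 [/E h3 n1 n2]]]; [by left|by right; exists u3].
by case: H => [/os H|[u3 [/E h3 n1 n2]]]; [left|right; exists u3].
Qed.

End Rotation.
End Boundary.

(** The first axis follows the tangent [v]; reversing it if necessary turns the second axis to the
    side where [l] has a nonnegative component. *)
Lemma upward_frame (R : realType) (v l : plane R) : 0 < cnorm v -> exists e,
  [/\ sqmod e = 1, (cmul ((e.1, - e.2) : plane R) v).2 = 0 & 0 <= (cmul ((e.1, - e.2) : plane R) l).2].
Proof.
move=> V0.
have vv : v.1 ^+ 2 + v.2 ^+ 2 = cnorm v ^+ 2 by rewrite sqr_cnorm.
pose w : plane R := (v.1 / cnorm v, v.2 / cnorm v).
have e1 : sqmod w = 1.
  by rewrite /sqmod /= !expr_div_n -mulrDl vv divff// expf_neq0// gt_eqF.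
have w2 : (cmul ((w.1, - w.2) : plane R) v).2 = 0 by rewrite cmulE /=; ring.
have [l2|l2] := leP 0 (cmul ((w.1, - w.2) : plane R) l).2; first by exists w.
exists (- w); split; first by rewrite sqmodN.
  by move: w2; rewrite !cmulE /= => w2; rewrite -[RHS]oppr0 -w2; ring.
by move: l2; rewrite !cmulE /=; lra.
Qed.

(** * Overlaps cannot end, hence do not exist *)

Section NoOverlap.
Variable R : realType.
Local Notation P := (plane R).
Variables (phi : P1 R -> R) (T : R).
Hypotheses (hphi : kahler_potential phi) (T01 : 0 < T < 1).
Local Notation O := [set x : P | (hs phi T x < (phat phi x)%:E)%E].
Variables (S : set (P1 R)) (G : R -> P) (c : R).
Hypothesis jo : jordan_arc O G (derive1 G) c.
Hypothesis dbl : forall q, S (chart false q) <-> exists s s', [/\ ~ eqZ s s', G s = q & G s' = q].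
Hypothesis S0 : ~ S (P1zero R).

Local Notation ov := (overlap O G (derive1 G)).

Lemma ov_S q : ov q -> S (chart false q).
Proof. by move=> [u1 [u2 [h1 h2 n _]]]; apply/dbl; exists u1, u2. Qed.

Lemma overlap_column s : exists e r K, [/\ sqmod e = 1, 0 < r, 0 <= K & forall q x, ov q ->
  `|(co (G s) e q).1| < r -> `|(co (G s) e q).2| < r -> `|x| < r ->
  exists2 y, ov (fr (G s) e (x, y)) & `|y| <= K * x ^+ 2].
Proof.
have V0 : 0 < cnorm (derive1 G s) by apply: lt_le_trans (jo_c0 jo) (jo_imm jo s).
have [e [e1 e2 _]] := upward_frame 0 V0.
have jo' := jordan_arc_co (G s) e1 jo.
have ob := obstacle_frame (G s) e1 hphi T01.
have F0 : (co (G s) e \o G) s = 0 by rewrite /= /co subrr; apply: plane_eq; rewrite cmulE /=; ring.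
have [r r0 Hr] := local_overlap ob jo' F0 e2.
have K1 := curvature_ge1 jo.
exists e, r, (curvature c); split => //; first by lra.
move=> q x ovq q1 q2 xr.
have ovq' : overlap (O \o fr (G s) e) (co (G s) e \o G) (cmul ((e.1, - e.2) : P) \o derive1 G) (co (G s) e q).
  by apply/overlap_co => //; rewrite coK.
have [y ovy yK] := Hr _ _ ovq' q1 q2 xr.
by exists y => //; apply/overlap_co.
Qed.

(** Overlaps are boundary points, and the boundary of an open set is closed. *)
Lemma curve_of_closure p : (forall e : R, 0 < e -> exists2 q, ov q & cnorm (q - p) < e) -> exists s, G s = p.
Proof.
move=> H; apply/(jo_range jo).
have H2 (B : set P) : nbhs p B -> exists2 q, ov q & B q.
  move=> /near_cnorm[e e0 He]; have [q oq qe] := H e e0.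
  by exists q => //; have := He (q - p) qe; rewrite addrCA subrr addr0.
split.
  move=> B /nbhs_interior /H2[q [u1 [_ [<- _ _ _]]] Bq].
  have [cO _] : closure O (G u1) /\ ~ O (G u1) by apply/(jo_range jo); exists u1.
  have [z [Oz Bz]] := cO _ Bq.
  by exists z.
move=> Op; have : nbhs p O by exact: open_nbhs_nbhs (conj (jo_open jo) Op).
move=> /H2[q [u1 [_ [<- _ _ _]]] Oq].
by have [_] : closure O (G u1) /\ ~ O (G u1) by apply/(jo_range jo); exists u1.
Qed.

Variables (F : set (P1 R)) (m : nat) (sigma : 'I_m -> R -> P1 R).
Hypothesis finF : finite_set F.
Hypothesis imm : forall i s, 0 <= s <= 1 -> immersed_at (sigma i) s.
Hypothesis emb : forall i j s s', 0 <= s <= 1 -> 0 <= s' <= 1 -> sigma i s = sigma j s' -> i = j /\ s = s'.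
Hypothesis SE : S = F `|` \bigcup_i (sigma i @` `[0, 1]%classic).

Lemma near_finite p : \forall y \near p, F (chart false y) -> y = p.
Proof.
have /finite_seqP[l Fl] := finF.
have H : \forall y \near p, forall z, z \in l -> z = chart false y -> y = p.
  elim: {Fl} l => [|z l IH]; first by apply: filterE.
  have Hz : \forall y \near p, z = chart false y -> y = p.
    have [zp|zp] := pselect (z = chart false p).
      by apply: filterE => y; rewrite zp => /chart_inj.
    have [zz|/P1_chart_false[w zw]] := pselect (z = P1zero R).
      by apply: filterE => y; rewrite zz => /esym H; case: (chart_false_neq0 H).
    have : \forall y \near p, y - w != 0.
      have cc : {for p, continuous (fun y : P => y - w)} by apply: cvgB; [exact: cvg_id|exact: cvg_cst].
      have H0 : \forall z \near p - w, z != 0.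
        by apply: near_neq0; rewrite subr_eq0; apply/eqP => pw; apply: zp; rewrite zw pw.
      exact: near_comp cc H0.
    by apply: filterS => y yw; rewrite zw => /chart_inj wy; move: yw; rewrite wy subrr eqxx.
  apply: filterS2 IH Hz => y h1 h2 z'; rewrite in_cons => /orP[/eqP -> //|]; exact: h1.
by apply: filterS H => y h Fy; apply: (h (chart false y)) => //; move: Fy; rewrite Fl.
Qed.

Lemma arc_lift i s : 0 <= s <= 1 -> exists g r W C, [/\ 0 < r, W != 0, 0 <= C,
  (forall t, `|t - s| < r -> chart false (g t) = sigma i t) &
  forall t, `|t - s| < r -> cnorm (g t - g s - (t - s) *: W) <= C * (t - s) ^+ 2].
Proof.
move=> s01; have sn : sigma i s <> P1zero R.
  by move=> sz; apply: S0; rewrite SE -sz; right; exists i => //; exists s => //; rewrite /= in_itv.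
have [g [r r0 [sg Hg]] dg] := lift_chart_false (imm i s01) sn.
have rr : `|s - s| < r by rewrite subrr normr0.
have [d [C [d0 C0 HC]]] := curve_uniform (@ball_open _ s r) rr sg.
have [e [e0 er ed _ _]] := small_pos r0 d0 (@ltr01 R) (@ltr01 R).
exists g, e, (derive1 g s), C; split => //.
- by move=> t te; apply: Hg; exact: lt_trans er.
- move=> t te; rewrite derive1E; apply: HC; last by rewrite subrr normr0.
  exact: lt_trans ed.
Qed.

Lemma lift_near (g : R -> P) s r W C : 0 < r -> 0 <= C ->
  (forall t, `|t - s| < r -> cnorm (g t - g s - (t - s) *: W) <= C * (t - s) ^+ 2) ->
  forall e, 0 < e -> exists2 d, 0 < d & forall t, `|t - s| < d -> cnorm (g t - g s) < e.
Proof.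
move=> r0 C0 H e e0; have L0 : 0 < C + cnorm W + 1 by have := cnorm_ge0 W; lra.
have [d [d0 dr d1 de _]] := small_pos r0 (@ltr01 R) (divr_gt0 e0 L0) (@ltr01 R).
exists d => // t td; have h := H t (lt_trans td dr).
rewrite ltr_pdivlMr// in de.
have -> : g t - g s = (g t - g s - (t - s) *: W) + (t - s) *: W by rewrite subrK.
apply: le_lt_trans (cnormD _ _) _; rewrite cnormZ.
have h2 : (t - s) ^+ 2 <= `|t - s|.
  rewrite -(real_normK (num_real (t - s))) expr2 ler_piMl//; lra.
have h3 : C * (t - s) ^+ 2 <= C * d by rewrite ler_wpM2l//; lra.
have h4 : `|t - s| * cnorm W <= d * cnorm W by rewrite ler_wpM2r ?cnorm_ge0// ltW.
rewrite !mulrDr mulr1 mulrC [d * cnorm _]mulrC in de; move: h h3 h4 de; rewrite [d * cnorm _]mulrC.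
move: (cnorm (_ - _ - _)) (C * d) (cnorm W * d) (C * _ ^+ 2) (_ * cnorm W) => a1 a2 a3 a4 a5; lra.
Qed.

(** Disjointness and injectivity of the arcs, with compactness of the parameter interval: near [p]
    only parameters near [s] on the same arc occur, and only [p] itself can belong to [F]. *)
Lemma near_arcs i s eta p : 0 <= s <= 1 -> 0 < eta -> sigma i s = chart false p ->
  \forall w \near p, S (chart false w) -> w = p \/
    exists t, [/\ 0 <= t <= 1, `|t - s| < eta & sigma i t = chart false w].
Proof.
move=> s01 eta0 sp.
have H j : \forall w \near p, forall t, `[0, 1]%classic t -> sigma j t = chart false w -> j = i /\ `|t - s| < eta.
  have /compact_near_coveringP cK := @segment_compact R 0 1.
  apply: (cK _ (nbhs p) (fun w t => sigma j t = chart false w -> j = i /\ `|t - s| < eta)) => t.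
  rewrite /= in_itv /= => t01.
  have [sE|sn] := pselect (sigma j t = sigma i s).
    have [ji ts] := emb t01 s01 sE.
    exists ([set t' | `|t' - t| < eta], setT).
      by split; [apply/near_ball; exists eta|exact: filterT].
    by move=> [t' w] /= [tt _] _; rewrite -ts.
  have [g [r [W [C [r0 W0 C0 Hg HC]]]]] := arc_lift j t01.
  have gp : 0 < cnorm (g t - p).
    rewrite lt_neqAle eq_sym cnorm_ge0 andbT cnorm_eq0 subr_eq0; apply/eqP => gp.
    by apply: sn; rewrite sp -gp Hg// subrr normr0.
  have gp2 : 0 < cnorm (g t - p) / 2 by lra.
  have [d d0 Hd] := lift_near r0 C0 HC gp2.
  have [d' [d'0 d'r d'd _ _]] := small_pos r0 d0 (@ltr01 R) (@ltr01 R).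
  exists ([set t' | `|t' - t| < d'], [set w | cnorm (w - p) < cnorm (g t - p) / 2]).
    split => /=; first by apply/near_ball; exists d'.
    apply/near_cnorm; exists (cnorm (g t - p) / 2) => // h.
    by rewrite /= [p + h]addrC addrK.
  move=> [t' w] /= [tt wp] E; exfalso.
  have gw : g t' = w by apply: (@chart_inj _ false); rewrite Hg//; exact: lt_trans d'r.
  have := Hd t' (lt_trans tt d'd); rewrite gw.
  have : cnorm (g t - p) <= cnorm (w - p) + cnorm (w - g t).
    have -> : g t - p = (w - p) + - (w - g t) by rewrite opprB [RHS]addrC addrA subrK.
    by apply: le_trans (cnormD _ _) _; rewrite cnormN.
  by move: wp; move: (cnorm _) (cnorm (w - p)) (cnorm _) => a1 a2 a3; lra.
have H2 : \forall w \near p, forall j t, `[0, 1]%classic t -> sigma j t = chart false w -> j = i /\ `|t - s| < eta.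
  apply: (@filter_forall _ _ (fun j w => forall t, `[0, 1]%classic t -> sigma j t = chart false w -> j = i /\ `|t - s| < eta) (nbhs p)) => j.
  exact: H.
apply: filterS2 (near_finite p) H2 => w h1 h2; rewrite SE => -[/h1|[j _ [t t01 tw]]]; first by left.
have [ji ts] := h2 j t t01 tw; by right; exists t; rewrite -ji; split => //; move: t01; rewrite /= in_itv.
Qed.

Lemma column_small (p e : P) K d : sqmod e = 1 -> 0 <= K -> 0 < d -> exists2 b : R, 0 < b &
  forall x y, `|x| < b -> `|y| <= K * x ^+ 2 -> cnorm (fr p e (x, y) - p) < d.
Proof.
move=> e1 K0 d0; have L0 : 0 < K + 1 by lra.
have [b [b0 b1 b2 _ _]] := small_pos ltr01 (divr_gt0 d0 L0) (@ltr01 R) (@ltr01 R).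
exists b => // x y xb yK.
have -> : fr p e (x, y) - p = cmul e (x, y) by rewrite /fr addrC addKr.
rewrite cnormM {1}/cnorm e1 sqrtr1 mul1r; apply: le_lt_trans (cnorm_le_sum _) _; rewrite /=.
rewrite ltr_pdivlMr// in b2.
have x2 : x ^+ 2 <= `|x| by rewrite -(real_normK (num_real x)) expr2 ler_piMl//; lra.
have : K * x ^+ 2 <= K * `|x| by rewrite ler_wpM2l.
have : K * `|x| <= K * b by rewrite ler_wpM2l// ltW.
move: b2 xb yK; rewrite mulrDr mulr1 mulrC; move: `|x| (K * _ ^+ 2) (K * b) (K * `|x|) => a1 a2 a3 a4; lra.
Qed.

(** The columns next to an overlap contain further overlaps, at points different from it. Close
    enough to it these are not in the finite set [F], so they lie on an arc. *)
Lemma overlap_on_arc q : ov q -> exists i s q', [/\ 0 <= s <= 1, ov q' & sigma i s = chart false q'].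
Proof.
move=> ovq; have [u1 [_ [Gu _ _ _]]] := ovq.
have [e [r [K [e1 r0 K0 Hcol]]]] := overlap_column u1; rewrite Gu in Hcol.
have /near_cnorm[d d0 Hd] := near_finite q.
have [b b0 Hb] := column_small q e1 K0 d0.
have [x [x0 xb xr _ _]] := small_pos b0 r0 (@ltr01 R) (@ltr01 R).
have c0 : co q e q = 0 by rewrite /co subrr; apply: plane_eq; rewrite cmulE /=; ring.
have [||| y oy yK] := Hcol q x ovq; rewrite ?c0 ?normr0 ?(gtr0_norm x0)//.
have wd := Hb x y ltac:(by rewrite gtr0_norm) yK.
have nF : ~ F (chart false (fr q e (x, y))).
  move=> Fw; have := Hd _ wd; rewrite addrCA subrr addr0 => /(_ Fw) E.
  have := @frK R q e e1 (x, y) : co q e (fr q e (x, y)) = (x, y).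
  by rewrite E c0 => -[x00 _]; move: x0; rewrite -x00 ltxx.
have := ov_S oy; rewrite SE => -[//|[i _ [s s01 sE]]].
by exists i, s, (fr q e (x, y)); split => //; move: s01; rewrite /= in_itv.
Qed.

(** [s] is the supremum of the parameters of overlaps on arc [i]. Columns on both sides of [g s]
    contain overlaps, which belong to [S] and hence to the arc near [s], with parameter at most [s].
    For the column ahead of the arc this is impossible. *)
Theorem no_overlap q : ~ ov q.
Proof.
move=> /overlap_on_arc[i [sb [q' [sb01 ovq' sbE]]]].
pose B := [set s : R | 0 <= s <= 1 /\ exists2 w, ov w & sigma i s = chart false w].
have B0 : B sb by split => //; exists q'.
have hB : has_sup B by split; [exists sb|exists 1 => s [/andP[]]].
pose s := sup B.
have sub t : B t -> t <= s by move=> Bt; apply: ub_le_sup => //; case: hB.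
have s01 : 0 <= s <= 1.
  apply/andP; split; first by apply: le_trans (sub _ B0); case/andP: sb01.
  by apply: ge_sup; [exists sb|move=> t [/andP[]]].
have [g [r [W [C [r0 W0 C0 Hg HC]]]]] := arc_lift i s01.
have acc e : 0 < e -> exists2 w, ov w & cnorm (w - g s) < e.
  move=> e0; have [d d0 Hd] := lift_near r0 C0 HC e0.
  have [d' [d'0 d'r d'd _ _]] := small_pos r0 d0 (@ltr01 R) (@ltr01 R).
  have [t Bt ts] := sup_adherent d'0 hB.
  have tsd : `|t - s| < d' by rewrite distrC ger0_norm ?subr_ge0 ?sub// -/s; move: ts; rewrite -/s; lra.
  have [_ [w ow wE]] := Bt; exists w => //.
  have -> : w = g t by apply: (@chart_inj _ false); rewrite -wE Hg//; exact: lt_trans d'r.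
  exact: Hd (lt_trans tsd d'd).
have [u Gu] := curve_of_closure acc.
have [e [rc [K [e1 rc0 K0 Hcol]]]] := overlap_column u; rewrite Gu in Hcol.
have cn (v : P) : cnorm (cmul ((e.1, - e.2) : P) v) = cnorm v.
  by rewrite cnormM {1}/cnorm (_ : sqmod _ = 1) ?sqrtr1 ?mul1r// /sqmod /= sqrrN.
have {}Hcol x : `|x| < rc -> exists2 y, ov (fr (g s) e (x, y)) & `|y| <= K * x ^+ 2.
  move=> xr; have [w ow wr] := acc rc rc0; rewrite -cn -/(co (g s) e w) in wr.
  by apply: (Hcol w) => //; [apply: le_lt_trans (norm_fst_le _) wr|apply: le_lt_trans (norm_snd_le _) wr].
have [v vE] : exists v, v = cmul ((e.1, - e.2) : P) W by exists (cmul ((e.1, - e.2) : P) W).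
have v0 : 0 < `|v.1| \/ v.1 = 0 /\ 0 < `|v.2|.
  have : 0 < cnorm v by rewrite vE cn lt_neqAle eq_sym cnorm_eq0 W0 cnorm_ge0.
  have [v1|v1] := eqVneq v.1 0; last by rewrite normr_gt0 v1; left.
  by move=> cv; right; split => //; apply: lt_le_trans cv _; apply: le_trans (cnorm_le_sum _) _; rewrite v1 normr0 add0r.
pose L := C + K * C ^+ 2 + 1.
have L0 : 0 < L by have := mulr_ge0 K0 (sqr_ge0 C); rewrite /L; lra.
(* [v] is the velocity of the arc in the frame of the boundary curve. The angle between the two is
   arbitrary here, so the vertical case [v.1 = 0] is kept apart. *)
pose mu := if v.1 == 0 then `|v.2| else `|v.1|.
have mu0 : 0 < mu.
  rewrite /mu; case: v0 => [v1|[-> v2]]; last by rewrite eqxx.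
  by rewrite ifN// -normr_gt0.
have [eta [eta0 eta1 etar etaL _]] := small_pos (@ltr01 R) r0 (divr_gt0 mu0 L0) (@ltr01 R).
rewrite ltr_pdivlMr// in etaL.
have sp : sigma i s = chart false (g s) by rewrite Hg// subrr normr0.
have /near_cnorm[d d0 Hd] := near_arcs s01 eta0 sp.
have [b b0 Hb] := column_small (g s) e1 K0 d0.
have [x1 [x10 x1b x1r _ _]] := small_pos b0 rc0 (@ltr01 R) (@ltr01 R).
(* The column is taken on the side towards which the arc moves as its parameter increases. *)
have [x [xn xp xm]] : exists x, [/\ `|x| = x1, 0 <= v.1 -> x = x1 & v.1 < 0 -> x = - x1].
  exists (if 0 <= v.1 then x1 else - x1).
  by case: leP => _; split; rewrite ?normrN ?gtr0_norm.
have [y oy yK] := Hcol x ltac:(by rewrite xn).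
have wd := Hb x y ltac:(by rewrite xn) yK.
have := Hd _ wd; rewrite addrCA subrr addr0 => /(_ (ov_S oy)) [E|[t [t01 ts tE]]].
  have := @frK R (g s) e e1 (x, y); rewrite E /co subrr (_ : cmul _ 0 = 0); last by apply: plane_eq; rewrite cmulE /=; ring.
  by move=> [x00 _]; move: x10; rewrite -xn -x00 normr0 ltxx.
have t_s : t <= s by apply: sub; split => //; exists (fr (g s) e (x, y)).
have tr := lt_trans ts etar.
have gE : g t = fr (g s) e (x, y) by apply: (@chart_inj _ false); rewrite Hg.
have := HC t tr; rewrite gE -cn.
have -> : cmul ((e.1, - e.2) : P) (fr (g s) e (x, y) - g s - (t - s) *: W) = (x, y) - (t - s) *: v.
  rewrite -[in RHS](@frK R (g s) e e1 (x, y)) /co vE.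
  by move: (fr _ _ _ - g s) (W) => z1 z2; apply: plane_eq; rewrite !cmulE /= /GRing.scale /=; ring.
move=> h; have h1 := le_trans (norm_fst_le _) h; have h2 := le_trans (norm_snd_le _) h.
rewrite /= /GRing.scale /= in h1 h2.
pose k := s - t.
have k0 : 0 <= k by rewrite subr_ge0.
have kE : t - s = - k by rewrite opprB.
have ke : k < eta by move: ts; rewrite kE normrN ger0_norm.
rewrite kE sqrrN mulNr opprK in h1; rewrite kE sqrrN mulNr opprK in h2.
have kk : 0 < k.
  rewrite lt_neqAle eq_sym k0 andbT; apply/eqP => kz.
  by move: h1; rewrite kz mul0r addr0 expr0n mulr0 xn leNgt x10.
clear - K0 C0 mu0 eta0 eta1 etaL x10 xn xp xm yK h1 h2 k0 kk ke.
have Ck : C * k ^+ 2 < mu * k.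
  rewrite expr2 mulrA ltr_pM2r//; apply: le_lt_trans etaL.
  rewrite mulrC ler_pM ?(ltW ke)// /L; have := mulr_ge0 K0 (sqr_ge0 C); lra.
(* If the arc is not vertical, a parameter below [s] puts its point behind [g s], on the wrong side
   for the column. *)
have [vz|vn] := eqVneq v.1 0; last first.
  have mE : mu = `|v.1| by rewrite /mu (negPf vn).
  move: h1 Ck; rewrite mE ler_norml [`|_| * k]mulrC => /andP[h3 h4].
  have [vs|vs] := leP 0 v.1.
    rewrite (ger0_norm vs); rewrite (xp vs) in h3 h4.
    by move: h3 h4 x10; move: (C * k ^+ 2) (k * v.1) => a1 a2; lra.
  rewrite (ltr0_norm vs) mulrN; rewrite (xm vs) in h3 h4.
  by move: h3 h4 x10; move: (C * k ^+ 2) (k * v.1) => a1 a2; lra.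
(* A vertical arc has height of first order in [k] and abscissa of second order, whereas overlaps in
   the column satisfy [|y| <= K x^2]. *)
have mE : mu = `|v.2| by rewrite /mu vz eqxx.
rewrite vz mulr0 addr0 xn in h1.
have x2 : x ^+ 2 <= (C * k ^+ 2) ^+ 2 by apply: ler_sqr_norm; rewrite xn.
have y2 : `|y| <= K * (C * k ^+ 2) ^+ 2 by apply: le_trans yK _; rewrite ler_wpM2l.
have h3 : k * mu <= `|y| + C * k ^+ 2.
  have := ler_normB (y + k * v.2) y; rewrite addrAC subrr add0r normrM (gtr0_norm kk) mE.
  by move: h2; move: (C * k ^+ 2) `|y + k * v.2| => a1 a2; lra.
have k4 : K * (C * k ^+ 2) ^+ 2 <= K * C ^+ 2 * (k * eta).
  rewrite exprMn mulrA ler_wpM2l ?mulr_ge0 ?sqr_ge0//.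
  rewrite expr2 expr2 -mulrA ler_wpM2l ?(ltW kk)//.
  have h5 : k * (k * k) <= 1 * k.
    by rewrite mulrA ler_wpM2r// -[1]mulr1; apply: ler_pM => //; lra.
  by apply: le_trans h5 _; rewrite mul1r ltW.
have k5 : C * k ^+ 2 <= C * (k * eta) by rewrite ler_wpM2l// expr2 ler_wpM2l// ltW.
have k6 : (C + K * C ^+ 2) * (k * eta) < k * mu.
  rewrite mulrCA ltr_pM2l//; apply: le_lt_trans etaL; rewrite mulrC ler_wpM2l ?(ltW eta0)// /L; lra.
move: k6; rewrite mulrDl; move: h3 y2 k4 k5.
by move: (K * (C * k ^+ 2) ^+ 2) (K * C ^+ 2 * (k * eta)) (C * (k * eta)) (C * k ^+ 2) (`|y|) (k * mu) => a1 a2 a3 a4 a5 a6; lra.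
Qed.

End NoOverlap.

Theorem theoremB (R : realType) (S : set (P1 R)) (phi : P1 R -> R)
    (hS : points_and_segments S) (hS0 : ~ S (P1zero R))
    (hphi : kahler_potential phi) (htan : develops_tangency phi S) :
  forall (z : P1 R) (tau : plane R), S z -> sqmod tau = 1 ->
    ~ twice_differentiable_at (weak_solution phi) (P1mul (cinv tau) z) tau.
Proof.
move=> z tau Sz tau1.
have [T T01 [_ _ _ [gam rg stc]]] := htan.
have /P1_chart_false[p zp] : z <> P1zero R by move=> z0; apply: hS0; rewrite -z0.
rewrite zp => /(slope_of_twice_diff hphi tau1)[D [l0 hl0] hD].
have [G gG] := curve_coordinates hphi T01 rg.
have [c jo] := curve_jordan_arc hphi T01 rg stc gG.
have dbl := double_points stc gG.
have [F [n [sigma [fF imm emb SE]]]] := hS.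
have nov := no_overlap hphi T01 jo dbl hS0 fF imm emb SE.
move: Sz; rewrite zp => /dbl[s [s' [ns Gs Gs']]].
have V0 : 0 < cnorm (derive1 G s) by apply: lt_le_trans (jo_c0 jo) (jo_imm jo s).
have [e [e1 e2 l2]] := upward_frame l0 V0.
have jo' := jordan_arc_co p e1 jo.
have ob := obstacle_frame p e1 hphi T01.
have Fs u : G u = p -> (co p e \o G) u = 0.
  by move=> Gu; rewrite /= Gu /co subrr; apply: plane_eq; rewrite cmulE /=; ring.
have [_ A1] := horizontal jo' (Fs s Gs) e2 (Fs s Gs).
(* A dry vertical segment at the double point would make it an overlap, which [no_overlap]
   excludes. *)
have two_sided (d : plane R) : d.1 = 0 -> d.2 != 0 -> forall r, 0 < r ->
    exists2 y, 0 < y < r & (hs phi T (fr p e (y *: d)) < (phat phi (fr p e (y *: d)))%:E)%E.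
  move=> d1 d2 r r0; apply: contrapT => H; apply: (nov (fr p e 0)); apply/(overlap_co p e1).
  exists s, s'; split; [exact: Fs|exact: Fs|exact: ns|left].
  exists d.
    rewrite /cross d1 mulr0 subr0 mulf_neq0// -normr_gt0.
    exact: lt_le_trans (jo_c0 jo) A1.
  exists r => // y yr Oy; apply: H; exists y => //.
  by move: Oy; rewrite /= add0r.
have [M M0 HM] := phi_bounded hphi.
have Hm z' : - M <= phi z' by have := HM z'; rewrite ler_norml => /andP[].
have [T0 T1] : 0 < T /\ T < 1 by case/andP: T01.
have fr_0 : fr p e 0 = p by exact: fr0.
have cfr := @continuous_fr R p e.
(* The frame makes the vertical derivative of [D] nonnegative, so the fluid above the branch through
   [s] is the one that leads to the contradiction. *)
apply: (@final_side R (fun q => phat phi (fr p e q)) (fun t q => hs phi t (fr p e q)) T (- M)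
  T01 ob _ _ _ (fun q => D (fr p e q)) (cmul ((e.1, - e.2) : plane R) l0) _ l2 _
  (width c) (curvature c) (graph (co p e \o G) c s) (width_gt0 jo) (curvature_ge1 jo)).
- by move=> q; exact: pot_le_phat.
- move=> t q; have [_ uh th] := HSc_vsh (fr p e q) (HSc_hs hphi t); split; last exact: hs_le_phat.
    by move=> r /uh; exact: near_comp (cfr q).
  by move=> th'; apply: th; exact: touched_fr.
- move=> t q /andP[t0 tT]; apply: hs_interp => //.
    by rewrite ler_pdivrMr ?divr_gt0 /=; lra.
  by rewrite mulfVK// gt_eqF//; lra.
- move=> r r0; rewrite fr_0.
  have cc : {for (0 : plane R), continuous (fun h : plane R => cmul e h)}.
    by apply: hol2_continuous; apply: hol2M; [exact: hol2_cst|exact: hol2_id].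
  have e0 : cmul e 0 = 0 :> plane R by apply: plane_eq; rewrite cmulE /=; ring.
  have H : \forall h \near cmul e 0, `|D (p + h) - D p - cdot l0 h| <= r * cnorm h by rewrite e0; exact: hl0.
  apply: filterS (near_comp cc H) => h; rewrite cnormM {1}/cnorm e1 sqrtr1 mul1r.
  by rewrite (_ : cdot (cmul _ l0) h = cdot l0 (cmul e h))// /cdot !cmulE /=; ring.
- have hD' : \forall x \near fr p e 0, (forall t, 0 < t <= 1 -> hs phi t x = (phat phi x)%:E -> t <= D x) /\
      (forall t, 0 <= t <= 1 -> t < D x -> hs phi t x = (phat phi x)%:E) by rewrite fr_0.
  exact: near_comp (cfr 0) hD'.
- move=> x xr; have [cg nO _ bg] := graph_contact jo' (Fs s Gs) e2 (Fs s Gs) xr.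
  have U := @contact R _ _ ob (x, graph (co p e \o G) c s x) nO.
  by split; [exact: cg|exact: U|exact: bg].
- move=> r r0; have [y yr Oy] := two_sided (0, 1) erefl (oner_neq0 R) r r0.
  exists y => //; move: Oy; rewrite (_ : y *: ((0, 1) : plane R) = (0, y))//.
  by apply: plane_eq; rewrite /= /GRing.scale /= ?mulr0 ?mulr1.
Qed.
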